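(* Let $a=\partial\Omega_1$ and $b=\partial\Omega_2$ be the boundaries of nested convex compact domains $\Omega_1\Subset\Omega_2\Subset\mathbb R^2$, both being piecewise $C^4$-smooth Jordan curves, and suppose the billiard transformations of $\Omega_1$ and $\Omega_2$ commute. Then $a$ and $b$ are confocal ellipses.
   Context: For a convex compact domain $\Omega\subset\mathbb R^2$ with piecewise smooth boundary, the billiard transformation acts on the space of oriented lines in $\mathbb R^2$: it fixes every oriented line disjoint from $\Omega$, and sends an oriented line $l$ intersecting $\Omega$ to the line obtained by reflecting $l$ from the tangent line to $\partial\Omega$ at the last intersection point $x$ of $l$ with $\partial\Omega$ (in the sense of the orientation of $l$, so the orienting arrow at $x$ points out of $\Omega$), the reflected line being oriented by a tangent vector at $x$ pointing into $\Omega$. *)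

(* Defs.v *)
From Stdlib Require Import Reals Lra.
From Coquelicot Require Import Coquelicot.
Open Scope R_scope.

Definition pt : Type := (R * R)%type.

Definition padd (p q : pt) : pt := (fst p + fst q, snd p + snd q).
Definition psub (p q : pt) : pt := (fst p - fst q, snd p - snd q).
Definition pscale (c : R) (p : pt) : pt := (c * fst p, c * snd p).
Definition dot (p q : pt) : R := fst p * fst q + snd p * snd q.
Definition cross (p q : pt) : R := fst p * snd q - snd p * fst q.
Definition norm2 (p : pt) : R := sqrt (dot p p).
Definition dist2 (p q : pt) : R := norm2 (psub p q).

Definition interior (A : pt -> Prop) (p : pt) : Prop :=
  exists eps, 0 < eps /\ forall q, dist2 p q < eps -> A q.
Definition closure (A : pt -> Prop) (p : pt) : Prop :=
  forall eps, 0 < eps -> exists q, A q /\ dist2 p q < eps.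
Definition boundary (A : pt -> Prop) (p : pt) : Prop :=
  closure A p /\ ~ interior A p.
Definition is_closed (A : pt -> Prop) : Prop :=
  forall p, closure A p -> A p.
Definition is_bounded (A : pt -> Prop) : Prop :=
  exists M, forall p, A p -> norm2 p <= M.
Definition is_convex (A : pt -> Prop) : Prop :=
  forall p q t, A p -> A q -> 0 <= t <= 1 ->
    A (padd (pscale (1 - t) p) (pscale t q)).

Definition convex_compact_domain (A : pt -> Prop) : Prop :=
  is_convex A /\ is_closed A /\ is_bounded A /\ exists p, interior A p.

Definition compactly_contained (A B : pt -> Prop) : Prop :=
  forall p, closure A p -> interior B p.

Definition C4 (f : R -> R) : Prop :=
  (forall (k : nat) (t : R), (k <= 4)%nat -> ex_derive_n f k t) /\
  (forall t, continuous (Derive_n f 4) t).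

Definition pw_C4_jordan_curve (C : pt -> Prop) : Prop :=
  exists (g1 g2 : R -> R) (n : nat) (s : nat -> R),
    (0 < n)%nat /\ s O = 0 /\ s n = 1 /\
    (forall k, (k < n)%nat -> s k < s (S k)) /\
    (forall k, (k < n)%nat -> exists f1 f2 : R -> R,
        C4 f1 /\ C4 f2 /\
        forall t, s k <= t <= s (S k) ->
          f1 t = g1 t /\ f2 t = g2 t /\ (Derive f1 t <> 0 \/ Derive f2 t <> 0)) /\
    g1 0 = g1 1 /\ g2 0 = g2 1 /\
    (forall t t', 0 <= t < 1 -> 0 <= t' < 1 ->
        g1 t = g1 t' -> g2 t = g2 t' -> t = t') /\
    (forall x, C x <-> exists t, 0 <= t <= 1 /\ x = (g1 t, g2 t)).

(** Oriented lines: a point [p] and a nonzero direction vector [v];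
    the line is {p + t v} oriented by [v]. *)
Definition oline : Type := (pt * pt)%type.
Definition on_line (l : oline) (t : R) : pt := padd (fst l) (pscale t (snd l)).
Definition valid_oline (l : oline) : Prop := snd l <> (0, 0).

Definition same_oline (l l' : oline) : Prop :=
  valid_oline l /\ valid_oline l' /\
  cross (psub (fst l') (fst l)) (snd l) = 0 /\
  exists c, 0 < c /\ snd l' = pscale c (snd l).

(** [u] (nonzero) spans the tangent line to the curve [C] at [x]: secant
    lines through [x] and nearby points [y] of [C] converge to the line
    through [x] of direction [u]. *)
Definition tangent_dir (C : pt -> Prop) (x u : pt) : Prop :=
  u <> (0, 0) /\
  forall eps, 0 < eps -> exists delta, 0 < delta /\
    forall y, C y -> 0 < dist2 y x < delta ->
      Rabs (cross u (psub y x)) < eps * norm2 u * dist2 y x.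

Definition reflect (u v : pt) : pt :=
  psub (pscale (2 * dot v u / dot u u) u) v.

(** The billiard transformation of a domain [O], as a relation between an
    oriented line and its image (a partial map; it is defined on lines
    disjoint from [O], which are fixed, and on lines crossing the interior of
    [O] whose last intersection point with the boundary has a tangent line). *)
Definition billiard (O : pt -> Prop) (l l' : oline) : Prop :=
  valid_oline l /\
  ( ((forall t, ~ O (on_line l t)) /\ same_oline l l')
  \/ ((exists t, interior O (on_line l t)) /\
      exists t1 u w,
        boundary O (on_line l t1) /\
        (forall t, t1 < t -> ~ boundary O (on_line l t)) /\
        tangent_dir (boundary O) (on_line l t1) u /\
        (w = reflect u (snd l) \/ w = pscale (-1) (reflect u (snd l))) /\
        (exists s0, 0 < s0 /\ forall s, 0 < s < s0 ->
           O (padd (on_line l t1) (pscale s w))) /\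
        same_oline (on_line l t1, w) l')).

Definition billiards_commute (O1 O2 : pt -> Prop) : Prop :=
  forall l l1 l12 l2 l21 : oline,
    billiard O1 l l1 -> billiard O2 l1 l12 ->
    billiard O2 l l2 -> billiard O1 l2 l21 ->
    same_oline l12 l21.

(** The ellipse with foci [f1], [f2] and major semi-axis [A]
    (nondegenerate: 2A > |f1 f2|; circles when f1 = f2). *)
Definition ellipse (f1 f2 : pt) (A : R) (x : pt) : Prop :=
  dist2 x f1 + dist2 x f2 = 2 * A.

Definition confocal_ellipses (C1 C2 : pt -> Prop) : Prop :=
  exists (f1 f2 : pt) (A B : R),
    dist2 f1 f2 < 2 * A /\ dist2 f1 f2 < 2 * B /\
    (forall x, C1 x <-> ellipse f1 f2 A x) /\
    (forall x, C2 x <-> ellipse f1 f2 B x).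

(* Main.v *)
From Stdlib Require Import Reals Lra Lia Psatz List Classical ClassicalEpsilon.
From Coquelicot Require Import Coquelicot.
Require Import Defs.
Open Scope R_scope.

(** If the billiard of [O1] moves a line while the billiard of [O2] sends it to a line missing [O1],
    the two compositions differ; hence at every boundary point [B] of [O2] the two tangent rays to [O1]
    are exchanged by the reflection at [B]. Their bisector is then the only normal at [B], so [O2] has no corner
    and its normal is Lipschitz.

    Let a line leave [O1] at [A]. Following it and its reflection at [A] to the boundary of [O2], at [B] and [C],
    and reflecting there, commutation makes the two reflected lines meet at a point [D] of [O1], where they are again
    symmetric. The excess AB + BD - AC - CD of such a quadrilateral is critical at each of its vertices, so it does not
    change when the line turns around [A], and it is zero because it vanishes when the line becomes tangent to [O1].
    Zero excess says that the support lines at [A], [B], [C], [D] are concurrent. A corner of [O1]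
    would be joined by quadrilaterals to infinitely many other corners, so [O1] is smooth too.

    Read from a point [P] outside [O2], concurrency says that the tangent lines from [P] to [O1] and to [O2] have common
    bisectors. Let [P] run over a circle of large radius [r] about an interior point of [O1], and let [h1], [h2] be the support
    functions. The tangents from [P] have normals at the angles [t] with [t + acos (h t / r)] or [t - acos (h t / r)] equal to the angle
    of [P], and Young's formula for inverse functions turns the bisector relation into
    the equality of the integrals of [cos (n t - c) * cos (n * acos (h t / r))] for [h = h1] and [h = h2].
    Expanding the Chebyshev polynomials in [1 / r] up to order four, the Fourier coefficients of [h1 ^ j - h2 ^ j] vanish at all frequencies
    [n > j - 2] of the parity of [j], for [j <= 4]. Consequently [h1] and [h2] have the same odd part, which is
    [P cos t + Q sin t], and the squares of their even parts are [K1 + k cos 2t + l sin 2t] and [K2 + k cos 2t + l sin 2t]: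
    these are the support functions of confocal ellipses. *)

(** * Vectors of the plane *)

(** The obstacle is regularity. [billiard] is undefined at corners, so commutation can only be
    applied to lines that avoid them. Each consequence is first obtained for lines rotated by small
    angles, which avoid the finitely many corners, and then carried over by compactness;
    configurations are therefore described by closed conditions. No derivative of a normal, of a
    tangent angle or of a support function is ever taken. For the excess it is enough that [B] and
    [C] are Lipschitz and [D] continuous in the direction of the line, because vertices enter to
    second order; Young's formula works for continuous monotone maps and their inverses.

    Each radius gives one identity per frequency, and letting the radius vary separates the powers
    of [1 / r]. Powers up to four suffice: the first makes the odd parts equal, the second makes the
    difference of the squared even parts constant, and this constant is nonzero because [h1 < h2].
    Dividing by it, the third power yields the odd part itself and the fourth the sum of the squared
    even parts. *)

Definition perp (v : pt) : pt := (- snd v, fst v).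
Definition rot (t : R) (v : pt) : pt := padd (pscale (cos t) v) (pscale (sin t) (perp v)).
(** For unit [n], the reflection in the line orthogonal to [n]: the billiard reflection written with
    a normal, where [reflect] takes a tangent direction. *)
Definition refl (n v : pt) : pt := psub v (pscale (2 * dot v n) n).

Lemma pt_ext (a b : pt) : fst a = fst b -> snd a = snd b -> a = b.
Proof. destruct a, b; cbn; congruence. Qed.

Ltac pt_unfold :=
  unfold rot, refl, perp, cross, dot, psub, padd, pscale in *; cbn [fst snd] in *.
Ltac pt_eq :=
  try (apply pt_ext); unfold rot, refl, perp, cross, dot, psub, padd, pscale; cbn [fst snd]; try ring.

Lemma dot_self_ge0 a : 0 <= dot a a.
Proof. destruct a; pt_unfold; nra. Qed.

Lemma norm2_ge0 a : 0 <= norm2 a.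
Proof. apply sqrt_pos. Qed.

Lemma norm2_sq a : norm2 a * norm2 a = dot a a.
Proof. apply sqrt_sqrt, dot_self_ge0. Qed.

Lemma norm2_le a c : 0 <= c -> dot a a <= c * c -> norm2 a <= c.
Proof.
  intros Hc H. unfold norm2. rewrite <- (sqrt_square c) by easy. now apply sqrt_le_1_alt.
Qed.

Lemma norm2_unit a : dot a a = 1 -> norm2 a = 1.
Proof. intros H; unfold norm2; rewrite H; apply sqrt_1. Qed.

Lemma norm2_eq0 a : norm2 a = 0 -> a = (0, 0).
Proof.
  intros H. assert (E := norm2_sq a). rewrite H in E.
  destruct a as [x y]; pt_unfold. assert (x = 0) by nra. assert (y = 0) by nra. now subst.
Qed.

Lemma norm2_pos a : a <> (0, 0) -> 0 < norm2 a.
Proof.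
  intros H. destruct (norm2_ge0 a) as [|E]; auto. now symmetry in E; apply norm2_eq0 in E.
Qed.

Lemma cauchy_schwarz a b : Rabs (dot a b) <= norm2 a * norm2 b.
Proof.
  assert (Ha := norm2_ge0 a). assert (Hb := norm2_ge0 b).
  assert (Sa := norm2_sq a). assert (Sb := norm2_sq b).

  assert (H : dot a b * dot a b <= (norm2 a * norm2 b) * (norm2 a * norm2 b)).
  { replace ((norm2 a * norm2 b) * (norm2 a * norm2 b)) with ((norm2 a * norm2 a) * (norm2 b * norm2 b)) by ring.
    rewrite Sa, Sb. clear. assert (H : dot a a * dot b b - dot a b * dot a b = cross a b * cross a b) by pt_eq.
    assert (0 <= cross a b * cross a b) by apply Rle_0_sqr. lra. }
  assert (0 <= norm2 a * norm2 b) by nra.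
  apply Rabs_le; split; nra.
Qed.

Lemma dot_le a b : dot a b <= norm2 a * norm2 b.
Proof. eapply Rle_trans; [apply Rle_abs | apply cauchy_schwarz]. Qed.

Lemma cross_le a b : Rabs (cross a b) <= norm2 a * norm2 b.
Proof.
  replace (cross a b) with (dot a (psub (0,0) (perp b))) by (pt_eq).
  replace (norm2 b) with (norm2 (psub (0,0) (perp b))) by (unfold norm2; f_equal; pt_eq).
  apply cauchy_schwarz.
Qed.

Lemma norm2_add a b : norm2 (padd a b) <= norm2 a + norm2 b.
Proof.
  assert (Ha := norm2_ge0 a). assert (Hb := norm2_ge0 b).
  apply norm2_le; [lra|].
  replace (dot (padd a b) (padd a b)) with (dot a a + dot b b + 2 * dot a b) by pt_eq.
  rewrite <- !norm2_sq. assert (H := dot_le a b). nra.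
Qed.

Lemma norm2_scale c a : norm2 (pscale c a) = Rabs c * norm2 a.
Proof.
  unfold norm2. replace (dot (pscale c a) (pscale c a)) with (Rsqr c * dot a a) by (unfold Rsqr; pt_eq).
  rewrite sqrt_mult by (apply Rle_0_sqr || apply dot_self_ge0). now rewrite sqrt_Rsqr_abs.
Qed.

Lemma norm2_sub_sym a b : norm2 (psub a b) = norm2 (psub b a).
Proof. unfold norm2; f_equal; pt_eq. Qed.

Lemma norm2_sub a b : norm2 (psub a b) <= norm2 a + norm2 b.
Proof.
  replace (psub a b) with (padd a (pscale (-1) b)) by pt_eq.
  eapply Rle_trans; [apply norm2_add|]. rewrite norm2_scale, (Rabs_left (-1)) by lra. lra.
Qed.

Lemma abs_fst_le a : Rabs (fst a) <= norm2 a.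
Proof.
  replace (fst a) with (dot a (1, 0)) by pt_eq. eapply Rle_trans; [apply cauchy_schwarz|].
  rewrite (norm2_unit (1, 0)) by (pt_unfold; ring). lra.
Qed.

Lemma abs_snd_le a : Rabs (snd a) <= norm2 a.
Proof.
  replace (snd a) with (dot a (0, 1)) by pt_eq. eapply Rle_trans; [apply cauchy_schwarz|].
  rewrite (norm2_unit (0, 1)) by (pt_unfold; ring). lra.
Qed.

Lemma dist2_tri a b c : dist2 a c <= dist2 a b + dist2 b c.
Proof.
  unfold dist2. replace (psub a c) with (padd (psub a b) (psub b c)) by pt_eq. apply norm2_add.
Qed.

Lemma dist2_sym a b : dist2 a b = dist2 b a.
Proof. apply norm2_sub_sym. Qed.

Lemma dist2_eq0 a b : dist2 a b = 0 -> a = b.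
Proof.
  intros H. apply norm2_eq0 in H. destruct a, b; pt_unfold. injection H; intros. f_equal; lra.
Qed.

Lemma dist2_refl a : dist2 a a = 0.
Proof. unfold dist2, norm2. replace (dot _ _) with 0 by pt_eq. apply sqrt_0. Qed.

Definition unit_pt (a : pt) := dot a a = 1.

Lemma unit_nz a : unit_pt a -> a <> (0, 0).
Proof. intros H E; subst; unfold unit_pt in H; pt_unfold; lra. Qed.

Lemma normalize a : a <> (0, 0) -> exists u, unit_pt u /\ a = pscale (norm2 a) u.
Proof.
  intros H. assert (P := norm2_pos a H). assert (S := norm2_sq a).
  exists (pscale (/ norm2 a) a). unfold unit_pt. split.
  - replace (dot (pscale (/ norm2 a) a) (pscale (/ norm2 a) a)) with (/ norm2 a * / norm2 a * dot a a) by pt_eq.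
    rewrite <- S. field. lra.
  - destruct a as [x y]; pt_unfold. f_equal; field; lra.
Qed.

Lemma refl_unit n v : unit_pt n -> unit_pt v -> unit_pt (refl n v).
Proof.
  unfold unit_pt; intros Hn Hv.
  replace (dot (refl n v) (refl n v)) with (dot v v + 4 * dot v n * dot v n * (dot n n - 1)) by pt_eq.
  rewrite Hn, Hv; ring.
Qed.

Lemma refl_dot n v : unit_pt n -> dot (refl n v) n = - dot v n.
Proof.
  unfold unit_pt; intros Hn.
  replace (dot (refl n v) n) with (dot v n - 2 * dot v n * dot n n) by pt_eq.
  rewrite Hn; ring.
Qed.

Lemma refl_invol n v : unit_pt n -> refl n (refl n v) = v.
Proof.
  intros Hn. unfold refl at 1. rewrite refl_dot by easy. pt_eq.
Qed.

Lemma rot_unit t v : unit_pt v -> unit_pt (rot t v).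
Proof.
  unfold unit_pt; intros Hv.
  replace (dot (rot t v) (rot t v)) with ((Rsqr (sin t) + Rsqr (cos t)) * dot v v) by (unfold Rsqr; pt_eq).
  rewrite sin2_cos2, Hv; ring.
Qed.

(** * Sequences of points *)

Definition pconv (u : nat -> pt) (p : pt) : Prop :=
  is_lim_seq (fun k => fst (u k)) (fst p) /\ is_lim_seq (fun k => snd (u k)) (snd p).

Definition inc (phi : nat -> nat) : Prop := forall i j, (i < j)%nat -> (phi i < phi j)%nat.

Lemma inc_ge phi : inc phi -> forall n, (n <= phi n)%nat.
Proof.
  intros H n; induction n; [lia|]. assert (phi n < phi (S n))%nat by (apply H; lia). lia.
Qed.

Lemma inc_filterlim phi : inc phi -> filterlim phi eventually eventually.
Proof.
  intros H P [N HN]. exists N. intros n Hn. apply HN. assert (E := inc_ge phi H n). lia.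
Qed.

Lemma inc_comp phi psi : inc phi -> inc psi -> inc (fun n => phi (psi n)).
Proof. intros H1 H2 i j Hij. now apply H1, H2. Qed.

Lemma pconv_sub u p phi : inc phi -> pconv u p -> pconv (fun k => u (phi k)) p.
Proof.
  intros Hi [H1 H2]; split.
  - apply (is_lim_seq_subseq (fun k => fst (u k))); auto. now apply inc_filterlim.
  - apply (is_lim_seq_subseq (fun k => snd (u k))); auto. now apply inc_filterlim.
Qed.

Lemma pconv_const p : pconv (fun _ => p) p.
Proof. split; apply is_lim_seq_const. Qed.

Lemma lim_dot u v p q : pconv u p -> pconv v q -> is_lim_seq (fun k => dot (u k) (v k)) (dot p q).
Proof.
  intros [A B] [C D]. unfold dot.
  apply is_lim_seq_plus'; apply is_lim_seq_mult'; auto.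
Qed.

Lemma lim_cross u v p q : pconv u p -> pconv v q -> is_lim_seq (fun k => cross (u k) (v k)) (cross p q).
Proof.
  intros [A B] [C D]. unfold cross.
  apply is_lim_seq_minus'; apply is_lim_seq_mult'; auto.
Qed.

Lemma pconv_sub2 u v p q : pconv u p -> pconv v q -> pconv (fun k => psub (u k) (v k)) (psub p q).
Proof.
  intros [A B] [C D]. split; cbn; apply is_lim_seq_minus'; auto.
Qed.

Lemma pconv_add u v p q : pconv u p -> pconv v q -> pconv (fun k => padd (u k) (v k)) (padd p q).
Proof.
  intros [A B] [C D]. split; cbn; apply is_lim_seq_plus'; auto.
Qed.

Lemma pconv_scale (c : nat -> R) (l : R) v q :
  is_lim_seq c l -> pconv v q -> pconv (fun k => pscale (c k) (v k)) (pscale l q).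
Proof.
  intros A [C D]. split; cbn; apply is_lim_seq_mult'; auto.
Qed.

Lemma pconv_refl u v p q : pconv u p -> pconv v q -> pconv (fun k => refl (u k) (v k)) (refl p q).
Proof.
  intros A B. apply pconv_sub2; auto. apply pconv_scale; auto.
  apply is_lim_seq_mult'; [apply is_lim_seq_const | now apply lim_dot].
Qed.

Lemma lim_norm2 u p : pconv u p -> is_lim_seq (fun k => norm2 (u k)) (norm2 p).
Proof.
  intros A. unfold norm2. apply (is_lim_seq_continuous sqrt (fun k => dot (u k) (u k))).
  - apply continuity_pt_filterlim; apply continuous_sqrt.
  - now apply lim_dot.
Qed.

Lemma lim_dist2 u v p q : pconv u p -> pconv v q -> is_lim_seq (fun k => dist2 (u k) (v k)) (dist2 p q).
Proof. intros A B. apply lim_norm2. now apply pconv_sub2. Qed.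

Lemma lim_le_const (u : nat -> R) (l c : R) : is_lim_seq u l -> (forall k, u k <= c) -> l <= c.
Proof.
  intros H Hk. apply (is_lim_seq_le u (fun _ => c) l c Hk H (is_lim_seq_const c)).
Qed.

Lemma lim_ge_const (u : nat -> R) (l c : R) : is_lim_seq u l -> (forall k, c <= u k) -> c <= l.
Proof.
  intros H Hk. apply (is_lim_seq_le (fun _ => c) u c l Hk (is_lim_seq_const c) H).
Qed.

Lemma lim_eq (u : nat -> R) (l c : R) : is_lim_seq u l -> (forall k, u k = c) -> l = c.
Proof.
  intros H Hk. apply Rle_antisym; [eapply lim_le_const | eapply lim_ge_const]; eauto; intros; rewrite Hk; lra.
Qed.

Lemma lim_uniq (u : nat -> R) (l l' : R) : is_lim_seq u l -> is_lim_seq u l' -> l = l'.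
Proof.
  intros H H'. apply is_lim_seq_unique in H. apply is_lim_seq_unique in H'. congruence.
Qed.

Lemma pconv_uniq u p q : pconv u p -> pconv u q -> p = q.
Proof.
  intros [A B] [C D]. destruct p, q; cbn in *. f_equal; eapply lim_uniq; eauto.
Qed.

Lemma pconv_dist u p : pconv u p <-> is_lim_seq (fun k => dist2 (u k) p) 0.
Proof.
  split.
  - intros H. rewrite <- (dist2_refl p). apply lim_dist2; auto. apply pconv_const.
  - intros H. split; apply is_lim_seq_spec; intros eps; apply is_lim_seq_spec in H;
    destruct (H eps) as [N HN]; exists N; intros n Hn; specialize (HN n Hn);
    rewrite Rminus_0_r, Rabs_pos_eq in HN by apply norm2_ge0;
    (eapply Rle_lt_trans; [|apply HN]).
    + apply (abs_fst_le (psub (u n) p)).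
    + apply (abs_snd_le (psub (u n) p)).
Qed.

Lemma pconv_squeeze u p (e : nat -> R) :
  is_lim_seq e 0 -> (forall k, dist2 (u k) p <= e k) -> pconv u p.
Proof.
  intros He H. apply pconv_dist. apply (is_lim_seq_le_le (fun _ => 0) _ e); auto.
  - intros k; split; auto. apply norm2_ge0.
  - apply is_lim_seq_const.
Qed.

Lemma pconv_eventually u p eps : pconv u p -> 0 < eps -> exists N, forall k, (N <= k)%nat -> dist2 (u k) p < eps.
Proof.
  intros H He. apply pconv_dist in H. apply is_lim_seq_spec in H. destruct (H (mkposreal eps He)) as [N HN].
  exists N; intros k Hk. specialize (HN k Hk). cbn in HN.
  rewrite Rminus_0_r, Rabs_pos_eq in HN by apply norm2_ge0. easy.
Qed.

Lemma lim_eventually (u : nat -> R) (l eps : R) : is_lim_seq u l -> 0 < eps ->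
  exists N, forall k, (N <= k)%nat -> Rabs (u k - l) < eps.
Proof.
  intros H He. apply is_lim_seq_spec in H. destruct (H (mkposreal eps He)) as [N HN].
  exists N; intros k Hk. apply (HN k Hk).
Qed.

Lemma lim_eventually_gt (u : nat -> R) (l c : R) : is_lim_seq u l -> c < l ->
  exists N, forall k, (N <= k)%nat -> c < u k.
Proof.
  intros H Hc. destruct (lim_eventually u l (l - c) H) as [N HN]; [lra|].
  exists N; intros k Hk. specialize (HN k Hk). apply Rabs_def2 in HN. lra.
Qed.

(** Serves both as a null sequence and as a sequence of rotation angles: the values are distinct and
    lie in (0, 1], so two rotated copies of a line are never parallel. *)
Definition tk (k : nat) : R := / (INR k + 1).

Lemma tk_pos k : 0 < tk k.
Proof. unfold tk. apply Rinv_0_lt_compat. assert (H := pos_INR k). lra. Qed.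

Lemma tk_le1 k : tk k <= 1.
Proof.
  unfold tk. rewrite <- Rinv_1. apply Rinv_le_contravar; [lra|]. assert (H := pos_INR k). lra.
Qed.

Lemma tk_lim : is_lim_seq tk 0.
Proof.
  unfold tk. replace (Finite 0) with (Rbar_inv p_infty) by easy.
  apply is_lim_seq_inv; [|easy].
  eapply is_lim_seq_plus; [apply is_lim_seq_INR | apply is_lim_seq_const | easy].
Qed.

Lemma tk_inj i j : tk i = tk j -> i = j.
Proof.
  unfold tk. intros H. apply (f_equal Rinv) in H. rewrite !Rinv_inv in H.
  apply INR_eq. lra.
Qed.

Lemma tk_small eps : 0 < eps -> exists N, forall k, (N <= k)%nat -> tk k < eps.
Proof.
  intros He. destruct (lim_eventually tk 0 eps tk_lim He) as [N HN]. exists N. intros k Hk.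
  specialize (HN k Hk). rewrite Rminus_0_r in HN. apply Rabs_def2 in HN. lra.
Qed.

Lemma pconv_rot (t : nat -> R) v : is_lim_seq t 0 -> pconv (fun k => rot (t k) v) v.
Proof.
  intros Ht. assert (E : rot 0 v = v) by (unfold rot; rewrite cos_0, sin_0; pt_eq).
  enough (H : pconv (fun k => rot (t k) v) (rot 0 v)) by now rewrite E in H.
  unfold rot. apply pconv_add; apply pconv_scale; try apply pconv_const.
  - apply (is_lim_seq_continuous cos t 0); auto. apply continuity_cos.
  - apply (is_lim_seq_continuous sin t 0); auto. apply continuity_sin.
Qed.

Lemma choice_seq {T : Type} (P : nat -> T -> Prop) :
  (forall k, exists x, P k x) -> exists f : nat -> T, forall k, P k (f k).
Proof.
  intros H. exists (fun k => proj1_sig (constructive_indefinite_description _ (H k))).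
  intros k. apply (proj2_sig (constructive_indefinite_description _ (H k))).
Qed.

(** [Bolzano_Weierstrass] only provides a cluster value [l]; the subsequence is built greedily, each
    index exceeding the previous one and bringing the term within [tk k] of [l]. *)
Lemma BW1 (u : nat -> R) M : (forall k, Rabs (u k) <= M) ->
  exists phi l, inc phi /\ is_lim_seq (fun k => u (phi k)) (Finite l).
Proof.
  intros HM.
  destruct (Bolzano_Weierstrass u (fun c => - M <= c <= M) (compact_P3 (- M) M)) as [l Hl].
  { intros n. specialize (HM n). now apply Rabs_le_between in HM. }
  assert (S : forall N k, exists p, (N <= p)%nat /\ Rabs (u p - l) < tk k).
  { intros N k. destruct (Hl (fun x => Rabs (x - l) < tk k) N) as [p [Hp1 Hp2]].
    - exists (mkposreal (tk k) (tk_pos k)). intros x Hx. apply Hx.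
    - now exists p. }
  set (nxt := fun N k => proj1_sig (constructive_indefinite_description _ (S N k))).
  assert (Hn : forall N k, (N <= nxt N k)%nat /\ Rabs (u (nxt N k) - l) < tk k).
  { intros N k. unfold nxt. apply (proj2_sig (constructive_indefinite_description _ (S N k))). }
  set (phi := fix f k := match k with O => nxt O O | Datatypes.S j => nxt (Datatypes.S (f j)) k end).
  exists phi, l. split.
  - intros i j Hij. induction Hij.
    + cbn. destruct (Hn (Datatypes.S (phi i)) (Datatypes.S i)) as [A _]. exact A.
    + eapply Nat.lt_trans; [exact IHHij|]. cbn. destruct (Hn (Datatypes.S (phi m)) (Datatypes.S m)) as [A _]. exact A.
  - apply is_lim_seq_spec. intros eps. destruct (tk_small eps (cond_pos eps)) as [N HN].
    exists N. intros k Hk. eapply Rlt_trans; [|apply HN, Hk].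
    destruct k; cbn; apply Hn.
Qed.

Lemma BW2 (u : nat -> pt) M : (forall k, norm2 (u k) <= M) ->
  exists phi p, inc phi /\ pconv (fun k => u (phi k)) p.
Proof.
  intros HM.
  assert (F : forall k, Rabs (fst (u k)) <= M /\ Rabs (snd (u k)) <= M).
  { intros k. specialize (HM k). split; (eapply Rle_trans; [|apply HM]); [apply abs_fst_le | apply abs_snd_le]. }
  destruct (BW1 (fun k => fst (u k)) M) as (phi & l1 & Hp & H1). { intros k; apply F. }
  destruct (BW1 (fun k => snd (u (phi k))) M) as (psi & l2 & Hq & H2). { intros k; apply F. }
  exists (fun k => phi (psi k)), (l1, l2). split; [now apply inc_comp|]. split; cbn; auto.
  apply (is_lim_seq_subseq (fun k => fst (u (phi k)))); auto. now apply inc_filterlim.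
Qed.

Lemma BWu (u : nat -> pt) : (forall k, unit_pt (u k)) ->
  exists phi p, inc phi /\ pconv (fun k => u (phi k)) p /\ unit_pt p.
Proof.
  intros HM. destruct (BW2 u 1) as (phi & p & Hp & H).
  { intros k. rewrite norm2_unit; [lra | apply HM]. }
  exists phi, p; repeat split; auto; try apply H.
  apply (lim_eq _ _ _ (lim_dot _ _ _ _ H H)). intros k; apply HM.
Qed.

(** * Normals and exit points of a convex domain *)

(** [n] may be non-normalized or zero; quadrilaterals use this with a difference of two
    directions. *)
Definition supp (O : pt -> Prop) (X n : pt) : Prop := forall Y, O Y -> dot n (psub Y X) <= 0.
Definition nrm (O : pt -> Prop) (X n : pt) : Prop := O X /\ unit_pt n /\ supp O X n.
(** At points without any normal it holds vacuously. *)
Definition smooth (O : pt -> Prop) (X : pt) : Prop := forall n n', nrm O X n -> nrm O X n' -> n = n'.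
(** The strict sign says that the line directed by [v] leaves [O] transversally at [X]; at a corner
    several [n] may fit. *)
Definition exitp (O : pt -> Prop) (X n v : pt) : Prop := nrm O X n /\ 0 < dot n v.
(** The parameter [s] may have either sign: the whole line counts, not only a ray. *)
Definition crosses (O : pt -> Prop) (B v : pt) : Prop :=
  exists s, interior O (padd B (pscale s v)).

Lemma dot_sym a b : dot a b = dot b a.
Proof. pt_eq. Qed.

Lemma interior_ball O c : interior O c -> exists r, 0 < r /\ forall q, dist2 c q <= r -> O q.
Proof.
  intros (e & He & H). exists (e / 2). split; [lra|]. intros q Hq. apply H. lra.
Qed.

Lemma ball_interior (O : pt -> Prop) c r : 0 < r -> (forall q, dist2 c q <= r -> O q) -> interior O c.
Proof. intros Hr H. exists r; split; auto. intros; apply H; lra. Qed.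

Lemma interior_in O c : interior O c -> O c.
Proof. intros (e & He & H). apply H. now rewrite dist2_refl. Qed.

Lemma interior_open O c : interior O c -> exists r, 0 < r /\ forall q, dist2 c q <= r -> interior O q.
Proof.
  intros (e & He & H). exists (e / 2). split; [lra|]. intros q Hq. exists (e / 2). split; [lra|].
  intros q' Hq'. apply H. assert (T := dist2_tri c q q'). lra.
Qed.

Lemma supp_ball (O : pt -> Prop) c r X n : unit_pt n -> supp O X n -> 0 <= r -> (forall q, dist2 c q <= r -> O q) ->
  dot n (psub c X) <= - r.
Proof.
  intros Hn Hs Hr H. assert (H1 := Hs (padd c (pscale r n))). rewrite <- (Rmult_1_r r) at 1. rewrite <- Hn.
  replace (dot n (psub (padd c (pscale r n)) X)) with (dot n (psub c X) + r * dot n n) in H1 by pt_eq.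
  enough (dot n (psub c X) + r * dot n n <= 0) by lra. apply H1. apply H. unfold dist2.
  replace (psub c (padd c (pscale r n))) with (pscale (- r) n) by pt_eq.
  rewrite norm2_scale, (norm2_unit n Hn), Rabs_Ropp, Rabs_pos_eq; lra.
Qed.

Lemma supp_int O c X n : interior O c -> unit_pt n -> supp O X n -> dot n (psub c X) < 0.
Proof.
  intros H Hn Hs. destruct (interior_ball O c H) as (r & Hr & Hb).
  assert (E := supp_ball O c r X n Hn Hs ltac:(lra) Hb). lra.
Qed.

Lemma supp_not_interior O X n : unit_pt n -> supp O X n -> ~ interior O X.
Proof.
  intros Hn Hs Hi. assert (E := supp_int O X X n Hi Hn Hs).
  replace (dot n (psub X X)) with 0 in E by pt_eq. lra.
Qed.

Lemma unit_eq_or a b : unit_pt a -> unit_pt b -> cross a b = 0 -> a = b \/ a = pscale (-1) b.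
Proof.
  unfold unit_pt. intros Ha Hb Hc.
  assert (E : (dot a b - 1) * (dot a b + 1) = 0).
  { replace ((dot a b - 1) * (dot a b + 1)) with (dot a a * dot b b - cross a b * cross a b - 1) by pt_eq.
    rewrite Ha, Hb, Hc; ring. }
  apply Rmult_integral in E. destruct E as [E|E].
  - left. apply dist2_eq0. unfold dist2, norm2.
    replace (dot (psub a b) (psub a b)) with (dot a a + dot b b - 2 * dot a b) by pt_eq.
    replace (dot a a + dot b b - 2 * dot a b) with 0 by lra. apply sqrt_0.
  - right. apply dist2_eq0. unfold dist2, norm2.
    replace (dot (psub a (pscale (-1) b)) (psub a (pscale (-1) b))) with (dot a a + dot b b + 2 * dot a b) by pt_eq.
    replace (dot a a + dot b b + 2 * dot a b) with 0 by lra. apply sqrt_0.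
Qed.

Lemma decomp n d : unit_pt n -> d = padd (pscale (dot n d) n) (pscale (cross n d) (perp n)).
Proof.
  unfold unit_pt. intros Hn. destruct n as [x y], d as [a b]; pt_unfold.
  assert (a * (x * x + y * y) = a /\ b * (x * x + y * y) = b) as [E1 E2] by (rewrite Hn; lra).
  f_equal; lra.
Qed.

Lemma perp_unit n : unit_pt n -> unit_pt (perp n).
Proof. unfold unit_pt; intros H; rewrite <- H; pt_eq. Qed.

Section Convex.
Variable O : pt -> Prop.
Hypothesis HO : convex_compact_domain O.

Lemma dom_conv : is_convex O. Proof. apply HO. Qed.

Lemma dom_bound : exists M, 0 < M /\ forall p, O p -> norm2 p <= M.
Proof.
  destruct HO as (_ & _ & (M & HM) & _). exists (Rabs M + 1). split.
  - assert (H := Rabs_pos M). lra.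
  - intros p Hp. specialize (HM p Hp). assert (H := Rle_abs M). lra.
Qed.

Lemma dom_seq_closed u p : pconv u p -> (forall k, O (u k)) -> O p.
Proof.
  intros H Hk. destruct HO as (_ & Hc & _). apply Hc. intros eps He.
  destruct (pconv_eventually u p eps H He) as [N HN]. exists (u N). split; auto.
  rewrite dist2_sym. now apply HN.
Qed.

Lemma dom_int : exists c, interior O c. Proof. apply HO. Qed.

Lemma dom_BW u : (forall k, O (u k)) -> exists phi p, inc phi /\ pconv (fun k => u (phi k)) p /\ O p.
Proof.
  intros H. destruct dom_bound as (M & _ & HM). destruct (BW2 u M) as (phi & p & Hp & Hc); auto.
  exists phi, p. repeat split; auto; try apply Hc. apply (dom_seq_closed (fun k => u (phi k))); auto.
Qed.

Lemma compact_min (f : pt -> R) :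
  (forall u p, pconv u p -> (forall k, O (u k)) -> O p -> is_lim_seq (fun k => f (u k)) (f p)) ->
  exists X, O X /\ forall Y, O Y -> f X <= f Y.
Proof.
  intros Hf.
  (* Passing to [atan] bounds the set of values in advance, so that [completeness] applies; the sign
     turns the minimum into a supremum. *)
  set (E := fun y => exists X, O X /\ y = - atan (f X)).
  destruct (completeness E) as [l [Hl1 Hl2]].
  - exists (PI / 2). intros y (X & _ & ->). destruct (atan_bound (f X)). lra.
  - destruct dom_int as [c Hc]. exists (- atan (f c)), c. split; auto. now apply interior_in.
  - assert (S : forall k, exists X, O X /\ l - tk k < - atan (f X)).
    { intros k. apply NNPP. intros Hn. assert (Hb : is_upper_bound E (l - tk k)).
      { intros y (X & HX & ->). apply Rnot_lt_le. intros Hlt. apply Hn. now exists X. }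
      apply Hl2 in Hb. assert (P := tk_pos k). lra. }
    destruct (choice_seq _ S) as [u Hu].
    destruct (dom_BW u) as (phi & X & Hp & Hc & HX). { intros k; apply Hu. }
    exists X. split; auto. intros Y HY.
    assert (L : is_lim_seq (fun k => - atan (f (u (phi k)))) (- atan (f X))).
    { apply (is_lim_seq_opp (fun k => atan (f (u (phi k)))) (Finite (atan (f X)))).
      apply (is_lim_seq_continuous atan (fun k => f (u (phi k)))).
      - apply derivable_continuous_pt, derivable_pt_atan.
      - apply Hf; auto. intros; apply Hu. }
    assert (L2 : is_lim_seq (fun k => l - tk (phi k)) (l - 0)).
    { apply is_lim_seq_minus'; [apply is_lim_seq_const|].
      apply (is_lim_seq_subseq tk); [now apply inc_filterlim | apply tk_lim]. }
    assert (Q : l - 0 <= - atan (f X)).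
    { apply (is_lim_seq_le _ _ (Finite (l - 0)) (Finite (- atan (f X))) (fun k => Rlt_le _ _ (proj2 (Hu (phi k)))) L2 L). }
    assert (Q2 : - atan (f Y) <= l) by (apply Hl1; now exists Y).
    apply Rnot_lt_le. intros Hlt. apply atan_increasing in Hlt. lra.
Qed.

Lemma compact_max (f : pt -> R) :
  (forall u p, pconv u p -> (forall k, O (u k)) -> O p -> is_lim_seq (fun k => f (u k)) (f p)) ->
  exists X, O X /\ forall Y, O Y -> f Y <= f X.
Proof.
  intros Hf. destruct (compact_min (fun p => - f p)) as (X & HX & H).
  - intros u p H1 H2 H3. apply (is_lim_seq_opp (fun k => f (u k)) (Finite (f p))). now apply Hf.
  - exists X. split; auto. intros Y HY. specialize (H Y HY). lra.
Qed.

(** The homothety of centre [Y] and ratio [t] maps a ball about [c] into [O]. *)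
Lemma interior_seg c Y t : interior O c -> O Y -> 0 < t <= 1 ->
  interior O (padd (pscale (1 - t) Y) (pscale t c)).
Proof.
  intros Hc HY Ht. destruct (interior_ball O c Hc) as (r & Hr & Hb).
  apply (ball_interior O _ (t * r)); [nra|]. intros q Hq.
  set (Z := padd c (pscale (/ t) (psub q (padd (pscale (1 - t) Y) (pscale t c))))).
  assert (HZ : O Z).
  { apply Hb. unfold dist2. replace (psub c Z) with (pscale (/ t) (psub (padd (pscale (1 - t) Y) (pscale t c)) q)).
    - rewrite norm2_scale, Rabs_pos_eq by (apply Rlt_le, Rinv_0_lt_compat; lra).
      apply (Rmult_le_reg_l t); [lra|]. rewrite <- Rmult_assoc, Rinv_r, Rmult_1_l by lra. exact Hq.
    - unfold Z. pt_eq. }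
  replace q with (padd (pscale (1 - t) Y) (pscale t Z)).
  - apply dom_conv; auto. lra.
  - unfold Z. destruct q, Y, c; pt_unfold. f_equal; field; lra.
Qed.

(** [m] points from the nearest point [X] of [O] towards [Z]; a point of [O] beyond the line through
    [X] orthogonal to [m] would allow a step from [X] that comes closer to [Z]. *)
Lemma sep_strict Z : ~ O Z -> exists m, unit_pt m /\ forall Y, O Y -> dot m (psub Y Z) < 0.
Proof.
  intros HZ. destruct (compact_min (fun X => dist2 X Z)) as (X & HX & Hmin).
  { intros u p Hu _ _. apply lim_dist2; auto. apply pconv_const. }
  assert (Hne : psub Z X <> (0, 0)).
  { intros E. apply HZ. replace Z with X; auto. apply dist2_eq0. rewrite dist2_sym. unfold dist2. rewrite E.
    unfold norm2. replace (dot (0,0) (0,0)) with 0 by pt_eq. apply sqrt_0. }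
  destruct (normalize _ Hne) as (m & Hm & E). assert (P := norm2_pos _ Hne).
  set (d := norm2 (psub Z X)) in *.
  assert (HS : forall Y, O Y -> dot m (psub Y X) <= 0).
  { intros Y HY. apply Rnot_lt_le. intros Hlt.
    set (a := dot m (psub Y X)) in *. set (b := dot (psub Y X) (psub Y X)).
    assert (Hb : 0 <= b) by apply dot_self_ge0.
    assert (Hq : forall t, 0 <= t <= 1 -> 0 <= t * (t * b - 2 * d * a)).
    { intros t Ht. assert (H1 := Hmin _ (dom_conv X Y t HX HY Ht)).
      assert (H2 : dist2 X Z * dist2 X Z <= dist2 (padd (pscale (1 - t) X) (pscale t Y)) Z * dist2 (padd (pscale (1 - t) X) (pscale t Y)) Z).
      { apply Rmult_le_compat; auto; apply norm2_ge0. }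
      unfold dist2 in H2. rewrite !norm2_sq in H2.
      replace (psub (padd (pscale (1 - t) X) (pscale t Y)) Z) with (padd (pscale t (psub Y X)) (pscale (-1) (psub Z X))) in H2 by pt_eq.
      replace (psub X Z) with (pscale (-1) (psub Z X)) in H2 by pt_eq.
      rewrite E in H2. unfold a, b.
      replace (dot (padd (pscale t (psub Y X)) (pscale (-1) (pscale d m))) (padd (pscale t (psub Y X)) (pscale (-1) (pscale d m))))
        with (dot (pscale (-1) (pscale d m)) (pscale (-1) (pscale d m)) + t * (t * dot (psub Y X) (psub Y X) - 2 * d * dot m (psub Y X))) in H2.
      - lra.
      - clear. pt_eq. }
    (* With this [t] the term [t * b] stays below [d * a], which makes the quadratic of [Hq]
       negative. *)
    set (t := Rmin 1 (d * a / (b + 1))).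
    assert (0 < d * a) by nra.
    assert (T0 : 0 < d * a / (b + 1)) by (apply Rdiv_lt_0_compat; lra).
    assert (Ht : 0 < t <= 1). { unfold t. split; [apply Rmin_pos; lra | apply Rmin_l]. }
    assert (Ht2 : t * (b + 1) <= d * a).
    { assert (H1 : t <= d * a / (b + 1)) by apply Rmin_r.
      apply (Rmult_le_compat_r (b + 1)) in H1; [|lra]. unfold Rdiv in H1.
      rewrite Rmult_assoc, Rinv_l in H1 by lra. lra. }
    specialize (Hq t ltac:(lra)). nra. }
  exists m. split; auto. intros Y HY. specialize (HS Y HY).
  replace (dot m (psub Y Z)) with (dot m (psub Y X) - dot m (psub Z X)) by pt_eq.
  rewrite E. replace (dot m (pscale d m)) with (d * dot m m) by pt_eq. rewrite Hm. lra.
Qed.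

Lemma supp_lim u X n m : pconv u X -> pconv n m -> (forall k, supp O (u k) (n k)) -> supp O X m.
Proof.
  intros H1 H2 Hk Y HY. apply (lim_le_const (fun k => dot (n k) (psub Y (u k)))).
  - apply lim_dot; auto. apply pconv_sub2; auto. apply pconv_const.
  - intros k; now apply Hk.
Qed.

(** Points outside [O] tending to [Z] are strictly separated, and their unit normals have a limit.
    This covers boundary points, where the nearest-point argument gives no direction. *)
Lemma sep_int Z : ~ interior O Z -> exists m, unit_pt m /\ supp O Z m.
Proof.
  intros Hi.
  assert (S : forall k, exists qm : pt * pt, dist2 Z (fst qm) <= tk k /\ unit_pt (snd qm) /\ supp O (fst qm) (snd qm)).
  { intros k. apply NNPP. intros Hn. apply Hi. apply (ball_interior O Z (tk k)); [apply tk_pos|].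
    intros q Hq. apply NNPP. intros HOq. destruct (sep_strict q HOq) as (m & Hm & Hs).
    apply Hn. exists (q, m). cbn. repeat split; auto. intros Y HY. apply Rlt_le, Hs, HY. }
  destruct (choice_seq _ S) as [u Hu].
  destruct (BWu (fun k => snd (u k))) as (phi & m & Hp & Hc & Hm). { intros; apply Hu. }
  exists m. split; auto.
  apply (supp_lim (fun k => fst (u (phi k))) Z (fun k => snd (u (phi k))) m); auto.
  - apply (pconv_squeeze _ _ (fun k => tk (phi k))).
    + apply (is_lim_seq_subseq tk); [now apply inc_filterlim | apply tk_lim].
    + intros k. rewrite dist2_sym. apply Hu.
  - intros k; apply Hu.
Qed.

Lemma boundary_nrm X : boundary O X -> exists n, nrm O X n.
Proof.
  intros [Hc Hi]. destruct (sep_int X Hi) as (m & Hm & Hs). exists m. repeat split; auto.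
  now apply HO.
Qed.

Lemma nrm_boundary X n : nrm O X n -> boundary O X.
Proof.
  intros (HX & Hn & Hs). split.
  - intros e He. exists X. split; auto. now rewrite dist2_refl.
  - now apply supp_not_interior with n.
Qed.

Lemma exit_unique X n v X' n' t : exitp O X n v -> exitp O X' n' v -> X' = padd X (pscale t v) -> X' = X.
Proof.
  intros [(HX & Hn & Hs) Hv] [(HX' & Hn' & Hs') Hv'] E.
  assert (H1 := Hs X' HX'). assert (H2 := Hs' X HX). rewrite E in H1, H2.
  replace (dot n (psub (padd X (pscale t v)) X)) with (t * dot n v) in H1 by pt_eq.
  replace (dot n' (psub X (padd X (pscale t v)))) with (- t * dot n' v) in H2 by pt_eq.
  assert (t = 0) by nra. subst t. rewrite E. pt_eq.
Qed.

(** The exit is at the last parameter [l] whose point lies in [O]; the normal there pairs positively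
    with [v] because an interior point lies strictly behind on the same line. *)
Lemma exit_exists B v : v <> (0, 0) -> crosses O B v -> exists t n, exitp O (padd B (pscale t v)) n v.
Proof.
  intros Hv [s Hs]. destruct dom_bound as (M & HM0 & HM). assert (Pv := norm2_pos v Hv).
  set (E := fun t => O (padd B (pscale t v))).
  destruct (completeness E) as [l [Hl1 Hl2]].
  - exists ((M + norm2 B) / norm2 v). intros t Ht. specialize (HM _ Ht).
    apply (Rmult_le_reg_r (norm2 v)); auto. unfold Rdiv. rewrite Rmult_assoc, Rinv_l, Rmult_1_r by lra.
    assert (H := norm2_sub (padd B (pscale t v)) B).
    replace (psub (padd B (pscale t v)) B) with (pscale t v) in H by pt_eq.
    rewrite norm2_scale in H. assert (H2 := Rle_abs t). nra.
  - exists s. exact (interior_in _ _ Hs).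
  - assert (S : forall k, exists t, E t /\ l - tk k < t).
    { intros k. apply NNPP. intros Hn. assert (Hb : is_upper_bound E (l - tk k)).
      { intros y Hy. apply Rnot_lt_le. intros Hlt. apply Hn. now exists y. }
      apply Hl2 in Hb. assert (P := tk_pos k). lra. }
    destruct (choice_seq _ S) as [u Hu].
    assert (Lu : is_lim_seq u l).
    { apply (is_lim_seq_le_le (fun k => l - tk k) u (fun _ => l)).
      - intros k. split; [apply Rlt_le, Hu | apply Hl1, Hu].
      - replace (Finite l) with (Finite (l - 0)) by (f_equal; ring).
        apply is_lim_seq_minus'; [apply is_lim_seq_const | apply tk_lim].
      - apply is_lim_seq_const. }
    assert (HE : O (padd B (pscale l v))).
    { apply (dom_seq_closed (fun k => padd B (pscale (u k) v))).
      - apply pconv_add; [apply pconv_const|]. apply pconv_scale; auto. apply pconv_const.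
      - intros k; apply Hu. }
    assert (Hni : ~ interior O (padd B (pscale l v))).
    { intros Hi. destruct (interior_ball O _ Hi) as (r & Hr & Hb).
      assert (H := Hl1 (l + r / norm2 v)). enough (E (l + r / norm2 v)).
      { specialize (H H0). assert (0 < r / norm2 v) by now apply Rdiv_lt_0_compat. lra. }
      apply Hb. unfold dist2.
      replace (psub (padd B (pscale l v)) (padd B (pscale (l + r / norm2 v) v))) with (pscale (- (r / norm2 v)) v) by pt_eq.
      rewrite norm2_scale, Rabs_Ropp, Rabs_pos_eq by (apply Rlt_le, Rdiv_lt_0_compat; lra).
      right. field. lra. }
    destruct (sep_int _ Hni) as (n & Hn & Hsup).
    exists l, n. split; [now repeat split|].
    assert (H := supp_int O _ _ n Hs Hn Hsup).
    replace (dot n (psub (padd B (pscale s v)) (padd B (pscale l v)))) with ((s - l) * dot n v) in H by pt_eq.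
    assert (s <= l) by (apply Hl1; exact (interior_in _ _ Hs)).
    nra.
Qed.

(** Otherwise the points [X + tk k * d] carry support normals, which pair nonnegatively with [d]
    because [X] lies in [O]; their limit is a normal at [X], hence [n], against [dot n d < 0]. *)
Lemma smooth_inner X n d : nrm O X n -> smooth O X -> dot n d < 0 ->
  exists s0, 0 < s0 /\ forall s, 0 < s <= s0 -> interior O (padd X (pscale s d)).
Proof.
  intros HX Hsm Hd.
  assert (H : exists k, interior O (padd X (pscale (tk k) d))).
  { apply NNPP. intros Hn.
    assert (S : forall k, exists m, unit_pt m /\ supp O (padd X (pscale (tk k) d)) m).
    { intros k. apply sep_int. intros Hi. apply Hn. now exists k. }
    destruct (choice_seq _ S) as [u Hu].
    destruct (BWu u) as (phi & m & Hp & Hc & Hm). { intros; apply Hu. }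
    assert (Hs : supp O X m).
    { apply (supp_lim (fun k => padd X (pscale (tk (phi k)) d)) X (fun k => u (phi k)) m); auto.
      - replace X with (padd X (pscale 0 d)) at 1 by pt_eq.
        apply pconv_add; [apply pconv_const|]. apply pconv_scale; [|apply pconv_const].
        apply (is_lim_seq_subseq tk); [now apply inc_filterlim | apply tk_lim].
      - intros k; apply Hu. }
    assert (m = n) by (apply Hsm; auto; split; [apply HX | now split]). subst m.
    assert (0 <= dot n d); [|lra].
    apply (lim_ge_const (fun k => dot (u (phi k)) d)).
    - apply lim_dot; auto. apply pconv_const.
    - intros k. destruct (Hu (phi k)) as [_ H]. specialize (H X (proj1 HX)).
      replace (dot (u (phi k)) (psub X (padd X (pscale (tk (phi k)) d)))) with (- tk (phi k) * dot (u (phi k)) d) in H by pt_eq.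
      assert (P := tk_pos (phi k)). nra. }
  destruct H as [k Hk]. exists (tk k). split; [apply tk_pos|]. intros s Hs. assert (P := tk_pos k).
  replace (padd X (pscale s d)) with (padd (pscale (1 - s / tk k) X) (pscale (s / tk k) (padd X (pscale (tk k) d)))).
  - apply interior_seg; auto. { apply HX. }
    split; [apply Rdiv_lt_0_compat; lra|]. apply (Rmult_le_reg_r (tk k)); auto.
    unfold Rdiv; rewrite Rmult_assoc, Rinv_l; lra.
  - destruct X, d; pt_unfold. f_equal; field; lra.
Qed.

(** If secants to nearby boundary points kept an angle with the tangent, a limit secant direction
    [w] would satisfy [dot n w <= - eps]. But the normals at those points tend to a normal at [X],
    that is to [n], and each pairs nonnegatively with its own secant, whence [0 <= dot n w]. *)
Lemma smooth_tangent X n : nrm O X n -> smooth O X -> tangent_dir (boundary O) X (perp n).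
Proof.
  intros HX Hsm. split. { apply unit_nz, perp_unit, HX. }
  intros eps He. rewrite (norm2_unit (perp n)) by (apply perp_unit, HX).
  apply NNPP. intros Hn.
  assert (S : forall k, exists ym : pt * pt, nrm O (fst ym) (snd ym) /\ 0 < dist2 (fst ym) X < tk k /\
     dot n (psub (fst ym) X) <= - eps * dist2 (fst ym) X).
  { intros k. apply NNPP. intros Hk. apply Hn. exists (tk k). split; [apply tk_pos|]. intros y Hy Hd.
    apply Rnot_le_lt. intros Hle. apply Hk. destruct (boundary_nrm y Hy) as [m Hm]. exists (y, m). cbn.
    split; [easy|]. split; [easy|].
    replace (cross (perp n) (psub y X)) with (- dot n (psub y X)) in Hle by pt_eq.
    assert (H := proj2 (proj2 HX) y (proj1 Hm)). rewrite Rabs_pos_eq in Hle by lra. lra. }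
  destruct (choice_seq _ S) as [u Hu].
  destruct (BWu (fun k => snd (u k))) as (phi & m & Hp & Hc & Hm). { intros; apply Hu. }
  set (e := fun k => pscale (/ dist2 (fst (u k)) X) (psub (fst (u k)) X)).
  assert (He1 : forall k, unit_pt (e k)).
  { intros k. unfold e, unit_pt. destruct (Hu k) as (_ & [Hd _] & _). unfold dist2 in *.
    assert (Q := norm2_sq (psub (fst (u k)) X)).
    set (w := psub (fst (u k)) X) in *. clearbody w.
    replace (dot (pscale (/ norm2 w) w) (pscale (/ norm2 w) w)) with (/ norm2 w * / norm2 w * dot w w) by pt_eq.
    rewrite <- Q. field. lra. }
  assert (He2 : forall k, psub (fst (u k)) X = pscale (dist2 (fst (u k)) X) (e k)).
  { intros k. unfold e. destruct (Hu k) as (_ & [Hd _] & _). set (r := dist2 (fst (u k)) X) in *. clearbody r.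
    destruct (psub (fst (u k)) X). pt_unfold. f_equal; field; lra. }
  destruct (BWu (fun k => e (phi k))) as (psi & w & Hp' & Hc' & Hw). { intros; apply He1. }
  assert (Hs : supp O X m).
  { apply (supp_lim (fun k => fst (u (phi k))) X (fun k => snd (u (phi k))) m); auto.
    - apply (pconv_squeeze _ _ (fun k => tk (phi k))).
      + apply (is_lim_seq_subseq tk); [now apply inc_filterlim | apply tk_lim].
      + intros k. apply Rlt_le, Hu.
    - intros k; apply Hu. }
  assert (m = n) by (apply Hsm; auto; split; [apply HX | now split]). subst m.
  assert (A : 0 <= dot n w).
  { apply (lim_ge_const (fun k => dot (snd (u (phi (psi k)))) (e (phi (psi k))))).
    - apply lim_dot; auto. now apply (pconv_sub (fun k => snd (u (phi k)))).
    - intros k. destruct (Hu (phi (psi k))) as ((_ & _ & H) & [Hd _] & _). specialize (H X (proj1 HX)).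
      set (y := fst (u (phi (psi k)))) in *. set (q := snd (u (phi (psi k)))) in *.
      assert (E := He2 (phi (psi k))). fold y in E.
      replace (dot q (psub X y)) with (- dot q (psub y X)) in H by pt_eq. rewrite E in H.
      replace (dot q (pscale (dist2 y X) (e (phi (psi k))))) with (dist2 y X * dot q (e (phi (psi k)))) in H by pt_eq.
      nra. }
  assert (B : dot n w <= - eps).
  { apply (lim_le_const (fun k => dot n (e (phi (psi k))))).
    - apply lim_dot; auto. apply pconv_const.
    - intros k. destruct (Hu (phi (psi k))) as (_ & [Hd _] & H).
      set (y := fst (u (phi (psi k)))) in *. assert (E := He2 (phi (psi k))). fold y in E. rewrite E in H.
      replace (dot n (pscale (dist2 y X) (e (phi (psi k))))) with (dist2 y X * dot n (e (phi (psi k)))) in H by pt_eq.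
      nra. }
  lra.
Qed.

Lemma billiard_miss l : valid_oline l -> (forall t, ~ O (on_line l t)) -> billiard O l l.
Proof.
  intros Hl H. split; auto. left. split; auto. split; auto. split; auto. split.
  - pt_eq.
  - exists 1. split; [lra|]. destruct l as [? [? ?]]; pt_unfold. f_equal; ring.
Qed.

(** Smoothness at [X] is used three times: for interior points just behind [X], for the tangent
    line, and for the reflected ray entering [O]. *)
Lemma billiard_hit B v t X n : X = padd B (pscale t v) -> exitp O X n v -> smooth O X ->
  billiard O (B, v) (X, refl n v).
Proof.
  intros EX [HX Hv] Hsm.
  assert (Hv0 : v <> (0, 0)). { intros E; subst v; destruct n; pt_unfold; lra. }
  assert (Hn : unit_pt n) by apply HX.
  assert (Hr : refl n v <> (0, 0)).
  { intros E. assert (H := refl_dot n v Hn). rewrite E in H. rewrite dot_sym in Hv. destruct n; pt_unfold; lra. }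
  split; [exact Hv0|]. right. split.
  - destruct (smooth_inner X n (pscale (-1) v) HX Hsm) as (s0 & H0 & Hs).
    { replace (dot n (pscale (-1) v)) with (- dot n v) by pt_eq. lra. }
    exists (t - s0). unfold on_line; cbn [fst snd].
    replace (padd B (pscale (t - s0) v)) with (padd X (pscale s0 (pscale (-1) v))); [apply Hs; lra|].
    rewrite EX. pt_eq.
  - exists t, (perp n), (refl n v). unfold on_line; cbn [fst snd]. rewrite <- EX.
    split; [now apply nrm_boundary with n|]. split; [|split; [|split; [|split]]].
    + intros t' Ht' [Hcl _]. apply HO in Hcl. apply (proj2 (proj2 HX)) in Hcl. rewrite EX in Hcl.
      replace (dot n (psub (padd B (pscale t' v)) (padd B (pscale t v)))) with ((t' - t) * dot n v) in Hcl by pt_eq.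
      nra.
    + now apply smooth_tangent.
    (* The first sign is the right one: [reflect] with the tangent [perp n] agrees with [refl n]. *)
    + left. unfold reflect, refl.
      replace (dot (perp n) (perp n)) with 1 by (symmetry; apply perp_unit, Hn).
      rewrite (decomp n v Hn) at 1 2 3 4. clear - Hn. unfold unit_pt in Hn.
      generalize (dot n v) (cross n v). intros a b.
      replace (dot (padd (pscale a n) (pscale b (perp n))) n) with (a * dot n n) by pt_eq.
      replace (dot (padd (pscale a n) (pscale b (perp n))) (perp n)) with (b * dot n n) by pt_eq.
      rewrite Hn. destruct n; pt_unfold. f_equal; field.
    + destruct (smooth_inner X n (refl n v) HX Hsm) as (s0 & H0 & Hs).
      { rewrite dot_sym, refl_dot by auto. rewrite dot_sym. lra. }
      exists s0. split; auto. intros s Hss. apply interior_in, Hs. lra.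
    + split; [exact Hr|]. split; [exact Hr|]. split.
      * pt_eq.
      * exists 1. split; [lra|]. cbn. destruct (refl n v); pt_unfold. f_equal; ring.
Qed.

(** If a point of [O] lay on the other side of the line from the interior point [c], the segment
    joining them would meet the line at an interior point by [interior_seg]; the parameter [t]
    balances the two signed distances. *)
Lemma side_of_line B v : unit_pt v -> ~ crosses O B v ->
  (forall Y, O Y -> 0 <= cross v (psub Y B)) \/ (forall Y, O Y -> cross v (psub Y B) <= 0).
Proof.
  intros Hv Hc. destruct dom_int as [c Hci].
  assert (K : forall Y, O Y -> cross v (psub Y B) * cross v (psub c B) < 0 -> False).
  { intros Y HY H. apply Hc.
    set (a := cross v (psub Y B)) in *. set (b := cross v (psub c B)) in *.
    assert (Hab : a - b <> 0) by nra.
    set (t := a / (a - b)).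
    assert (Ht : 0 < t <= 1).
    { unfold t. destruct (Rlt_dec 0 (a - b)).
      - split; [apply Rdiv_lt_0_compat; nra|]. apply (Rmult_le_reg_r (a - b)); auto.
        unfold Rdiv; rewrite Rmult_assoc, Rinv_l; nra.
      - replace (a / (a - b)) with ((- a) / (b - a)) by (field; lra).
        split; [apply Rdiv_lt_0_compat; nra|]. apply (Rmult_le_reg_r (b - a)); [lra|].
        unfold Rdiv; rewrite Rmult_assoc, Rinv_l; nra. }
    assert (Hi := interior_seg c Y t Hci HY Ht).
    set (Z := padd (pscale (1 - t) Y) (pscale t c)) in *.
    exists (dot v (psub Z B)).
    replace (padd B (pscale (dot v (psub Z B)) v)) with Z; auto.
    assert (E := decomp v (psub Z B) Hv).
    replace (cross v (psub Z B)) with ((1 - t) * a + t * b) in E by (unfold Z, a, b; pt_eq).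
    replace ((1 - t) * a + t * b) with 0 in E by (unfold t; field; auto).
    replace Z with (padd B (psub Z B)) at 1 by pt_eq. rewrite E at 1. pt_eq. }
  assert (Hc0 : cross v (psub c B) <> 0).
  { intros E. apply Hc. exists (dot v (psub c B)).
    replace (padd B (pscale (dot v (psub c B)) v)) with c; auto.
    assert (E2 := decomp v (psub c B) Hv). rewrite E in E2.
    replace c with (padd B (psub c B)) at 1 by pt_eq. rewrite E2 at 1. pt_eq. }
  destruct (Rlt_dec 0 (cross v (psub c B))).
  - left. intros Y HY. apply Rnot_lt_le. intros H. apply (K Y HY). nra.
  - right. intros Y HY. apply Rnot_lt_le. intros H. apply (K Y HY). nra.
Qed.

Lemma crosses_open B v u : pconv u v -> crosses O B v -> exists N, forall k, (N <= k)%nat -> crosses O B (u k).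
Proof.
  intros Hu [s Hs]. destruct (interior_open O _ Hs) as (r & Hr & Hb).
  destruct (pconv_eventually (fun k => padd B (pscale s (u k))) (padd B (pscale s v)) r) as [N HN]; auto.
  { apply pconv_add; [apply pconv_const|]. apply pconv_scale; auto. apply is_lim_seq_const. }
  exists N. intros k Hk. exists s. apply Hb. rewrite dist2_sym. apply Rlt_le, HN, Hk.
Qed.

(** By compactness the missed line has a positive distance to [O]; turning it around [B] changes
    distances by at most [M + norm2 B] times the change of direction. *)
Lemma misses_open B v u : pconv u v -> unit_pt v -> (forall t, ~ O (padd B (pscale t v))) ->
  exists N, forall k, (N <= k)%nat -> forall t, ~ O (padd B (pscale t (u k))).
Proof.
  intros Hu Hv Hm.
  destruct (compact_min (fun Y => Rabs (cross v (psub Y B)))) as (X & HX & Hmin).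
  { intros w p Hw _ _. apply (is_lim_seq_abs (fun k => cross v (psub (w k) B)) (Finite _)).
    apply lim_cross; [apply pconv_const|]. apply pconv_sub2; auto. apply pconv_const. }
  assert (Hpos : 0 < Rabs (cross v (psub X B))).
  { apply Rabs_pos_lt. intros E. apply (Hm (dot v (psub X B))).
    assert (E2 := decomp v (psub X B) Hv). rewrite E in E2.
    replace (padd B (pscale (dot v (psub X B)) v)) with X; auto.
    replace X with (padd B (psub X B)) at 1 by pt_eq. rewrite E2 at 1. pt_eq. }
  destruct dom_bound as (M & HM0 & HM).
  assert (HB := norm2_ge0 B).
  destruct (pconv_eventually u v (Rabs (cross v (psub X B)) / (M + norm2 B)) Hu) as [N HN].
  { apply Rdiv_lt_0_compat; lra. }
  exists N. intros k Hk t Ht. specialize (HN k Hk). specialize (Hmin _ Ht).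
  set (Y := padd B (pscale t (u k))) in *.
  assert (E : cross v (psub Y B) = cross (psub v (u k)) (psub Y B)).
  { replace (cross (psub v (u k)) (psub Y B)) with (cross v (psub Y B) - cross (u k) (psub Y B)) by pt_eq.
    replace (cross (u k) (psub Y B)) with 0; [ring|]. unfold Y. destruct (u k); pt_eq. }
  rewrite E in Hmin. assert (H1 := cross_le (psub v (u k)) (psub Y B)).
  assert (H2 := norm2_sub Y B). specialize (HM Y Ht).
  rewrite norm2_sub_sym in H1. fold (dist2 (u k) v) in H1. assert (H4 : 0 <= dist2 (u k) v) by apply norm2_ge0.
  apply (Rmult_lt_compat_r (M + norm2 B)) in HN; [|lra].
  unfold Rdiv in HN. rewrite Rmult_assoc, Rinv_l in HN by lra. nra.
Qed.

End Convex.

(** * Corners *)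

Lemma partition_locate (s : nat -> R) (n : nat) t :
  (forall k, (k < n)%nat -> s k < s (S k)) -> s O <= t <= s n ->
  (exists k, (k <= n)%nat /\ t = s k) \/ (exists k, (k < n)%nat /\ s k < t < s (S k)).
Proof.
  intros Hs. induction n as [|n IH]; intros Ht.
  - left. exists O. split; [lia | lra].
  - destruct (Rle_dec t (s n)) as [H|H].
    + destruct IH as [(k & Hk & E)|(k & Hk & E)].
      * intros k Hk. apply Hs. lia.
      * lra.
      * left. exists k. split; [lia | easy].
      * right. exists k. split; [lia | easy].
    + destruct (Rle_lt_or_eq_dec t (s (S n))) as [H2|H2]; [lra| |].
      * right. exists n. split; [lia | lra].
      * left. exists (S n). split; [lia | easy].
Qed.

Lemma interior_max_deriv (f : R -> R) a b t l : a < t < b -> is_derive f t l ->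
  (forall x, a < x < b -> f x <= f t) -> l = 0.
Proof.
  intros Ht Hd Hm. apply is_derive_Reals in Hd.
  assert (pr : derivable_pt f t) by (exists l; exact Hd).
  rewrite <- (derive_pt_eq_0 f t l pr Hd).
  apply (deriv_maximum f a b t pr); try lra. intros x H1 H2. apply Hm; lra.
Qed.

(** Away from the finitely many break points the arc has a nonzero velocity. A normal, seen as a
    linear form, is maximal along the arc at [t], so it is orthogonal to the velocity; of the two
    opposite unit candidates an interior point excludes one. *)
Lemma nonsmooth_finite O : convex_compact_domain O -> pw_C4_jordan_curve (boundary O) ->
  exists L, forall X n, nrm O X n -> ~ In X L -> smooth O X.
Proof.
  intros HO (g1 & g2 & n & s & Hn & Hs0 & Hsn & Hinc & Harc & _ & _ & _ & Hcur).
  exists (map (fun k => (g1 (s k), g2 (s k))) (seq 0 (S n))).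
  intros X m HX HL.
  destruct (proj1 (Hcur X) (nrm_boundary O X m HX)) as (t & Ht & EX).
  destruct (partition_locate s n t Hinc) as [(k & Hk & E)|(k & Hk & Hkt)]; [lra| |].
  { exfalso. apply HL. rewrite EX, E. apply in_map_iff. exists k. split; auto. apply in_seq. lia. }
  destruct (Harc k Hk) as (f1 & f2 & [C1 _] & [C2 _] & Hf).
  assert (Hsk : forall j, (j <= n)%nat -> 0 <= s j).
  { induction j; intros Hj; [lra|]. assert (s j < s (S j)) by (apply Hinc; lia). assert (0 <= s j) by (apply IHj; lia). lra. }
  assert (Hsk1 : forall j, (j <= n)%nat -> s (n - j)%nat <= 1).
  { induction j; intros Hj; [replace (n - 0)%nat with n by lia; lra|].
    assert (s (n - S j)%nat < s (S (n - S j))) by (apply Hinc; lia).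
    replace (S (n - S j)) with (n - j)%nat in H by lia. assert (s (n - j)%nat <= 1) by (apply IHj; lia). lra. }
  assert (Hk0 := Hsk k ltac:(lia)). assert (Hk1 := Hsk1 (n - S k)%nat ltac:(lia)).
  replace (n - (n - S k))%nat with (S k) in Hk1 by lia.
  assert (D1 : is_derive f1 t (Derive f1 t)).
  { apply Derive_correct. apply (C1 1%nat t). lia. }
  assert (D2 : is_derive f2 t (Derive f2 t)).
  { apply Derive_correct. apply (C2 1%nat t). lia. }
  assert (Hperp : forall m, nrm O X m -> fst m * Derive f1 t + snd m * Derive f2 t = 0).
  { intros q (_ & _ & Hq).
    apply (interior_max_deriv (fun x => fst q * f1 x + snd q * f2 x) (s k) (s (S k)) t); auto.
    - apply (is_derive_plus (fun x => fst q * f1 x) (fun x => snd q * f2 x)).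
      + apply (is_derive_scal f1 t (fst q) _ D1).
      + apply (is_derive_scal f2 t (snd q) _ D2).
    - intros x Hx. destruct (Hf x ltac:(lra)) as (E1 & E2 & _). destruct (Hf t ltac:(lra)) as (F1 & F2 & _).
      rewrite E1, E2, F1, F2.
      assert (HB : boundary O (g1 x, g2 x)). { apply Hcur. exists x. split; [lra | easy]. }
      destruct HB as [HB _]. apply HO in HB. specialize (Hq _ HB). rewrite EX in Hq.
      unfold dot, psub in Hq; cbn in Hq. lra. }
  destruct (Hf t ltac:(lra)) as (_ & _ & Hnz).
  intros p p' Hp Hp'. assert (E1 := Hperp p Hp). assert (E2 := Hperp p' Hp').
  assert (Hc : cross p p' = 0).
  { destruct p as [x y], p' as [x' y']; unfold cross; cbn in *. destruct Hnz as [H|H].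
    - apply (Rmult_eq_reg_r (Derive f1 t)); auto.
      replace ((x * y' - y * x') * Derive f1 t) with (y' * (x * Derive f1 t + y * Derive f2 t) - y * (x' * Derive f1 t + y' * Derive f2 t)) by ring.
      rewrite E1, E2; ring.
    - apply (Rmult_eq_reg_r (Derive f2 t)); auto.
      replace ((x * y' - y * x') * Derive f2 t) with (x * (x' * Derive f1 t + y' * Derive f2 t) - x' * (x * Derive f1 t + y * Derive f2 t)) by ring.
      rewrite E1, E2; ring. }
  destruct (unit_eq_or p p') as [E|E]; auto; try apply Hp; try apply Hp'.
  exfalso. destruct (dom_int O HO) as [c Hci].
  assert (Q1 := supp_int O c X p Hci (proj1 (proj2 Hp)) (proj2 (proj2 Hp))).
  assert (Q2 := supp_int O c X p' Hci (proj1 (proj2 Hp')) (proj2 (proj2 Hp'))).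
  rewrite E in Q1. replace (dot (pscale (-1) p') (psub c X)) with (- dot p' (psub c X)) in Q1 by pt_eq. lra.
Qed.

Lemma eventually_not_in {T : Type} (L : list T) (u : nat -> T) (N : nat) :
  (forall i j, (N <= i)%nat -> (N <= j)%nat -> u i = u j -> i = j) ->
  exists N', forall k, (N' <= k)%nat -> ~ In (u k) L.
Proof.
  intros Hu. induction L as [|a L [N1 IH]].
  - exists O. intros k _ [].
  - destruct (classic (exists k, (N <= k)%nat /\ u k = a)) as [(k0 & Hk0 & E)|H].
    + exists (Nat.max N (Nat.max N1 (S k0))). intros k Hk [E2|E2].
      * assert (k = k0) by (apply Hu; try lia; congruence). lia.
      * apply (IH k); [lia | easy].
    + exists (Nat.max N N1). intros k Hk [E2|E2].
      * apply H. exists k. split; [lia | easy].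
      * apply (IH k); [lia | easy].
Qed.

Lemma infinite_pigeonhole {T : Type} (L : list T) (f : nat -> T) (S : nat -> Prop) :
  (forall N, exists k, (N <= k)%nat /\ S k) -> (forall k, S k -> In (f k) L) ->
  exists x, forall N, exists k, (N <= k)%nat /\ S k /\ f k = x.
Proof.
  revert S. induction L as [|a L IH]; intros S Hinf HL.
  - destruct (Hinf O) as (k & _ & Hk). destruct (HL k Hk).
  - destruct (classic (forall N, exists k, (N <= k)%nat /\ S k /\ f k = a)) as [H|H]; [now exists a|].
    apply not_all_ex_not in H. destruct H as [N0 HN0].
    destruct (IH (fun k => S k /\ f k <> a)) as [x Hx].
    + intros N. destruct (Hinf (Nat.max N N0)) as (k & Hk & HS). exists k. split; [lia|]. split; auto.
      intros E. apply HN0. exists k. split; [lia | easy].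
    + intros k [HS Hne]. destruct (HL k HS) as [E|E]; auto. congruence.
    + exists x. intros N. destruct (Hx N) as (k & Hk & [HS _] & E). now exists k.
Qed.

(** The second hypothesis leaves at most two values, so [infinite_pigeonhole] applies to a list of
    length one or two. *)
Lemma infinite_pigeonhole2 {T : Type} (f : nat -> T) (S : nat -> Prop) :
  (forall N, exists k, (N <= k)%nat /\ S k) ->
  (forall i j k, S i -> S j -> S k -> f i <> f j -> f j <> f k -> f i <> f k -> False) ->
  exists x, forall N, exists k, (N <= k)%nat /\ S k /\ f k = x.
Proof.
  intros Hinf H3. destruct (Hinf O) as (i & _ & Hi).
  destruct (classic (exists j, S j /\ f j <> f i)) as [(j & Hj & Hne)|H].
  - apply (infinite_pigeonhole (f i :: f j :: nil) f S); auto.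
    intros k Hk. destruct (classic (f k = f i)) as [E|E]; [now left|].
    destruct (classic (f k = f j)) as [E2|E2]; [now right; left|].
    exfalso. apply (H3 i j k); auto.
  - apply (infinite_pigeonhole (f i :: nil) f S); auto.
    intros k Hk. left. apply NNPP. intros E. apply H. exists k. split; auto.
Qed.

Lemma rot_cross s t v : unit_pt v -> cross (rot s v) (rot t v) = sin (t - s).
Proof.
  intros Hv. rewrite sin_minus.
  replace (cross (rot s v) (rot t v)) with ((sin t * cos s - cos t * sin s) * dot v v) by pt_eq.
  rewrite Hv; ring.
Qed.

Lemma cross_rot t v : unit_pt v -> cross v (rot t v) = sin t.
Proof.
  intros Hv. replace (cross v (rot t v)) with (sin t * dot v v) by pt_eq. rewrite Hv; ring.
Qed.

Lemma sin_eq0 x : Rabs x <= 2 -> sin x = 0 -> x = 0.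
Proof.
  intros Hx Hs. apply Rabs_le_between in Hx. assert (P := PI2_1).
  destruct (Rtotal_order x 0) as [H|[H|H]]; auto.
  - assert (sin x < 0) by (apply sin_lt_0_var; lra). lra.
  - assert (0 < sin x) by (apply sin_gt_0; lra). lra.
Qed.

Lemma refl_cross n a b : unit_pt n -> cross (refl n a) (refl n b) = - cross a b.
Proof.
  intros Hn.
  replace (cross (refl n a) (refl n b)) with (cross a b * (1 - 2 * dot n n)) by pt_eq.
  rewrite Hn; ring.
Qed.

Lemma line_meet B w w' s s' : padd B (pscale s w) = padd B (pscale s' w') -> padd B (pscale s w) <> B -> cross w w' = 0.
Proof.
  intros E Hne. assert (Hs : s <> 0). { intros ->. apply Hne. pt_eq. }
  assert (E1 : pscale s w = pscale s' w').
  { apply (f_equal (fun X => psub X B)) in E.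
    replace (psub (padd B (pscale s w)) B) with (pscale s w) in E by pt_eq.
    replace (psub (padd B (pscale s' w')) B) with (pscale s' w') in E by pt_eq. exact E. }
  apply (Rmult_eq_reg_l s); auto. replace (s * cross w w') with (cross (pscale s w) w') by pt_eq.
  rewrite E1. pt_eq.
Qed.

(** * Limits of exit points and extreme normals at a corner *)

Section Limits.
Variable O : pt -> Prop.
Hypothesis HO : convex_compact_domain O.

Lemma nrm_lim X Q n m : pconv X Q -> pconv n m -> (forall k, nrm O (X k) (n k)) -> nrm O Q m.
Proof.
  intros H1 H2 H. split; [|split].
  - apply (dom_seq_closed O HO X); auto. intros; apply H.
  - apply (lim_eq _ _ _ (lim_dot _ _ _ _ H2 H2)). intros k; apply H.
  - apply (supp_lim O X Q n m); auto. intros; apply H.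
Qed.

(** Transversality could be lost in the limit; it survives because the limit line contains an
    interior point, on which the support inequality of [m] is strict. *)
Lemma exit_limit (V : pt) (v : pt) (vk X n : nat -> pt) (t : nat -> R) (Q m : pt) :
  crosses O V v -> unit_pt v -> pconv vk v -> (forall k, X k = padd V (pscale (t k) (vk k))) ->
  (forall k, exitp O (X k) (n k) (vk k)) -> pconv X Q -> pconv n m ->
  exitp O Q m v /\ exists s, Q = padd V (pscale s v).
Proof.
  intros [s Hs] Hv Hvk HX Hex HQ Hm.
  assert (HN : nrm O Q m). { apply (nrm_lim X Q n m); auto. intros; apply Hex. }
  assert (Hc : cross v (psub Q V) = 0).
  { apply (lim_eq (fun k => cross (vk k) (psub (X k) V))).
    - apply lim_cross; auto. apply pconv_sub2; auto. apply pconv_const.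
    - intros k. rewrite HX. pt_eq. }
  assert (E := decomp v (psub Q V) Hv). rewrite Hc in E.
  set (r := dot v (psub Q V)) in *.
  assert (EQ : Q = padd V (pscale r v)).
  { replace Q with (padd V (psub Q V)) at 1 by pt_eq. rewrite E. pt_eq. }
  split; [|now exists r]. split; auto.
  assert (0 <= dot m v).
  { apply (lim_ge_const (fun k => dot (n k) (vk k))).
    - now apply lim_dot.
    - intros k. apply Rlt_le, Hex. }
  assert (H2 := supp_int O _ Q m Hs (proj1 (proj2 HN)) (proj2 (proj2 HN))).
  rewrite EQ in H2. replace (dot m (psub (padd V (pscale s v)) (padd V (pscale r v)))) with ((s - r) * dot m v) in H2 by pt_eq.
  destruct H as [H|H]; auto. rewrite <- H in H2. lra.
Qed.

(* [n] is the extreme normal at [Q] on the side of [a]. *)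
Definition edge (Q n a : pt) : Prop :=
  exists e, unit_pt e /\ dot n e = 0 /\ (forall m, nrm O Q m -> dot m e <= 0) /\ 0 <= dot a e.

(** A limit [e] of the directions from [Q] to [X k] pairs nonpositively with every normal at [Q],
    since the [X k] lie in [O]; the support inequalities at [X k], tested on [Q], give the opposite
    sign for [m]. *)
Lemma edge_limit (X n : nat -> pt) (Q m a : pt) :
  pconv X Q -> pconv n m -> (forall k, nrm O (X k) (n k)) -> (forall k, X k <> Q) ->
  (forall k, 0 <= dot a (psub (X k) Q)) -> edge Q m a.
Proof.
  intros HX Hn HN Hne Ha.
  assert (S : forall k, exists e, unit_pt e /\ psub (X k) Q = pscale (norm2 (psub (X k) Q)) e).
  { intros k. apply normalize. intros E. apply (Hne k). apply dist2_eq0. unfold dist2. rewrite E.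
    unfold norm2. replace (dot (0,0) (0,0)) with 0 by pt_eq. apply sqrt_0. }
  assert (P : forall k, 0 < norm2 (psub (X k) Q)).
  { intros k. destruct (norm2_ge0 (psub (X k) Q)) as [|E]; auto. exfalso. symmetry in E. now apply (Hne k), dist2_eq0. }
  destruct (choice_seq _ S) as [u Hu].
  destruct (BWu u) as (phi & e & Hp & Hc & He). { intros; apply Hu. }
  assert (F : forall q, (forall k, 0 <= dot q (psub (X k) Q)) -> 0 <= dot q e).
  { intros q Hq. apply (lim_ge_const (fun k => dot q (u (phi k)))).
    - apply lim_dot; auto. apply pconv_const.
    - intros k. specialize (Hq (phi k)). specialize (P (phi k)). rewrite (proj2 (Hu (phi k))) in Hq.
      replace (dot q (pscale (norm2 (psub (X (phi k)) Q)) (u (phi k)))) with (norm2 (psub (X (phi k)) Q) * dot q (u (phi k))) in Hq by pt_eq.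
      nra. }
  assert (G : forall q, nrm O Q q -> dot q e <= 0).
  { intros q Hq. assert (H := F (pscale (-1) q)).
    replace (dot (pscale (-1) q) e) with (- dot q e) in H by pt_eq.
    enough (0 <= - dot q e) by lra. apply H. intros k.
    replace (dot (pscale (-1) q) (psub (X k) Q)) with (- dot q (psub (X k) Q)) by pt_eq.
    assert (H0 := proj2 (proj2 Hq) (X k) (proj1 (HN k))). lra. }
  exists e. split; auto. split; [|split; auto].
  assert (HQ : nrm O Q m) by (apply (nrm_lim X Q n m); auto).
  apply Rle_antisym; [now apply G|].
  apply (lim_ge_const (fun k => dot (n (phi k)) (u (phi k)))).
  - apply lim_dot; auto. now apply (pconv_sub n).
  - intros k. assert (H0 := proj2 (proj2 (HN (phi k))) Q (proj1 HQ)). specialize (P (phi k)).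
    replace (dot (n (phi k)) (psub Q (X (phi k)))) with (- dot (n (phi k)) (psub (X (phi k)) Q)) in H0 by pt_eq.
    rewrite (proj2 (Hu (phi k))) in H0.
    replace (dot (n (phi k)) (pscale (norm2 (psub (X (phi k)) Q)) (u (phi k)))) with (norm2 (psub (X (phi k)) Q) * dot (n (phi k)) (u (phi k))) in H0 by pt_eq.
    nra.
Qed.

Lemma nrm_eq_of_orth X n m e : nrm O X n -> nrm O X m -> unit_pt e -> dot n e = 0 -> dot m e = 0 -> n = m.
Proof.
  intros Hn Hm He E1 E2.
  assert (Hc : cross n m = 0).
  { assert (H := decomp e n He). assert (H' := decomp e m He). rewrite (dot_sym e n), E1 in H. rewrite (dot_sym e m), E2 in H'.
    rewrite H, H'. pt_eq. }
  destruct (unit_eq_or n m) as [E|E]; auto; try apply Hn; try apply Hm.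
  exfalso. destruct (dom_int O HO) as [c Hci].
  assert (Q1 := supp_int O c X n Hci (proj1 (proj2 Hn)) (proj2 (proj2 Hn))).
  assert (Q2 := supp_int O c X m Hci (proj1 (proj2 Hm)) (proj2 (proj2 Hm))).
  rewrite E in Q1. replace (dot (pscale (-1) m) (psub c X)) with (- dot m (psub c X)) in Q1 by pt_eq. lra.
Qed.

(** The two edge directions are orthogonal to [n], hence equal or opposite; lying on different sides
    of [v], they are opposite. Every normal at [Q] is then orthogonal to them. *)
Lemma edges_both_sides Q n v : nrm O Q n -> 0 < dot n v -> edge Q n (perp v) -> edge Q n (pscale (-1) (perp v)) -> smooth O Q.
Proof.
  intros HQ Hv (e & He & E0 & Em & Ea) (f & Hf & F0 & Fm & Fa).
  assert (Hn : unit_pt n) by apply HQ.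
  assert (P : forall g, unit_pt g -> dot n g = 0 -> dot (perp v) g <> 0).
  { intros g Hg G0 H. assert (D := decomp g v Hg).
    replace (cross g v) with (- dot (perp v) g) in D by pt_eq. rewrite H in D.
    rewrite D in Hv. replace (dot n (padd (pscale (dot g v) g) (pscale (- 0) (perp g)))) with (dot g v * dot n g) in Hv by pt_eq.
    rewrite G0 in Hv. lra. }
  assert (Pe := P e He E0).
  replace (dot (pscale (-1) (perp v)) f) with (- dot (perp v) f) in Fa by pt_eq.
  assert (Hc : cross e f = 0).
  { assert (H := decomp n e Hn). assert (H' := decomp n f Hn). rewrite E0 in H. rewrite F0 in H'. rewrite H, H'. pt_eq. }
  destruct (unit_eq_or e f He Hf Hc) as [E|E]; [subst f; lra|].
  intros m m' Hm Hm'.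
  assert (Z : forall q, nrm O Q q -> dot q e = 0).
  { intros q Hq. assert (A := Em q Hq). assert (B := Fm q Hq). rewrite E in A |- *.
    replace (dot q (pscale (-1) f)) with (- dot q f) in A |- * by pt_eq. lra. }
  apply (nrm_eq_of_orth Q m m' e); auto.
Qed.

End Limits.

(** * Tangent rays to the inner domain and smoothness of the outer one *)

Definition finitely_nonsmooth (O : pt -> Prop) : Prop :=
  exists L, forall X n, nrm O X n -> ~ In X L -> smooth O X.

Definition commuting_pair (O1 O2 : pt -> Prop) : Prop :=
  convex_compact_domain O1 /\ convex_compact_domain O2 /\ compactly_contained O1 O2 /\
  finitely_nonsmooth O1 /\ finitely_nonsmooth O2 /\ billiards_commute O1 O2.

(* [sg], which is 1 or -1, tells on which side of the ray the domain lies. *)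
Definition tangent_ray (O : pt -> Prop) (sg : R) (X e : pt) : Prop :=
  unit_pt e /\ (exists k, 0 < k /\ O (padd X (pscale k e))) /\
  forall Y, O Y -> sg * cross e (psub Y X) <= 0.

Lemma pscale_unit_inj a b n m : 0 < a -> 0 < b -> unit_pt n -> unit_pt m -> pscale a n = pscale b m -> n = m.
Proof.
  intros Ha Hb Hn Hm E.
  assert (F : a * a = b * b).
  { replace (a * a) with (dot (pscale a n) (pscale a n)).
    - rewrite E. replace (dot (pscale b m) (pscale b m)) with (b * b * dot m m) by pt_eq. rewrite Hm; ring.
    - replace (dot (pscale a n) (pscale a n)) with (a * a * dot n n) by pt_eq. rewrite Hn; ring. }
  assert (a = b) by nra. subst b. destruct n as [x y], m as [x' y']. pt_unfold. injection E; intros.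
  f_equal; apply (Rmult_eq_reg_l a); lra.
Qed.

Lemma sign_cases sg : sg * sg = 1 -> sg = 1 \/ sg = -1.
Proof.
  intros H. assert (F : (sg - 1) * (sg + 1) = 0) by lra. apply Rmult_integral in F. destruct F; [left | right]; lra.
Qed.

Lemma sin_sg_tk_inj sg i j : sg * sg = 1 -> sin (sg * tk j - sg * tk i) = 0 -> i = j.
Proof.
  intros Hsg H. apply tk_inj.
  assert (A := tk_pos i). assert (A' := tk_pos j). assert (B1 := tk_le1 i). assert (B' := tk_le1 j).
  apply sin_eq0 in H; destruct (sign_cases sg Hsg); subst sg; try lra; apply Rabs_le; lra.
Qed.

Lemma lim_sg_tk sg : is_lim_seq (fun k => sg * tk k) 0.
Proof.
  replace 0 with (sg * 0) by ring. apply is_lim_seq_mult'; [apply is_lim_seq_const | apply tk_lim].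
Qed.

(** The rays from [c] turned by [sg * tk k] leave [O] at pairwise distinct points, which eventually
    avoid [Q] and the finite list of corners. They all lie on the side [sg] of the ray through [Q],
    so a limit of their normals is the extreme one there. *)
Lemma approach_from_side O Q c n v r sg :
  convex_compact_domain O -> finitely_nonsmooth O -> interior O c -> unit_pt v -> 0 < r ->
  Q = padd c (pscale r v) -> exitp O Q n v -> sg * sg = 1 ->
  exists (X m : nat -> pt) n', pconv X Q /\ pconv m n' /\ (forall k, nrm O (X k) (m k) /\ smooth O (X k)) /\
    0 < dot n' v /\ edge O Q n' (pscale sg (perp v)).
Proof.
  intros HO (L & HL) Hc Hv Hr EQ Hex Hsg.
  set (vk := fun k => rot (sg * tk k) v).
  assert (Hvk : pconv vk v) by apply pconv_rot, lim_sg_tk.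
  assert (Hu : forall k, unit_pt (vk k)) by (intros; now apply rot_unit).
  assert (Hcr : forall w, crosses O c w). { intros w. exists 0. replace (padd c (pscale 0 w)) with c by pt_eq. exact Hc. }
  assert (S : forall k, exists tm : R * pt, exitp O (padd c (pscale (fst tm) (vk k))) (snd tm) (vk k)).
  { intros k. destruct (exit_exists O HO c (vk k)) as (t & m & H); auto. { now apply unit_nz. } now exists (t, m). }
  destruct (choice_seq _ S) as [tm Htm].
  set (X := fun k => padd c (pscale (fst (tm k)) (vk k))).
  assert (Ht : forall k, 0 < fst (tm k)).
  { intros k. destruct (Htm k) as [(_ & U & Hs) Hd]. assert (H := supp_int O c _ _ Hc U Hs).
    replace (dot (snd (tm k)) (psub c (padd c (pscale (fst (tm k)) (vk k))))) with (- fst (tm k) * dot (snd (tm k)) (vk k)) in H by pt_eq.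
    nra. }
  assert (Hlim : exists phi n', inc phi /\ pconv (fun k => X (phi k)) Q /\ pconv (fun k => snd (tm (phi k))) n' /\ 0 < dot n' v).
  { destruct (dom_BW O HO X) as (phi & Q' & Hp & HX & _). { intros k; apply Htm. }
    destruct (BWu (fun k => snd (tm (phi k)))) as (psi & n' & Hp' & Hn' & _). { intros k; apply Htm. }
    exists (fun k => phi (psi k)), n'. split; [now apply inc_comp|].
    assert (HX' : pconv (fun k => X (phi (psi k))) Q') by now apply (pconv_sub (fun k => X (phi k))).
    destruct (exit_limit O HO c v (fun k => vk (phi (psi k))) (fun k => X (phi (psi k))) (fun k => snd (tm (phi (psi k))))
       (fun k => fst (tm (phi (psi k)))) Q' n') as (A & s & E); auto.
    { apply (pconv_sub vk); auto. now apply inc_comp. }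
    { intros k. apply Htm. }
    assert (Q' = Q).
    { apply (exit_unique O Q n v Q' n' (s - r)); auto. rewrite E, EQ. pt_eq. }
    rewrite H in HX'. split; auto. split; auto. apply A. }
  destruct Hlim as (phi & n' & Hp & HX & Hm & Hd).
  assert (Hinj : forall i j, X i = X j -> i = j).
  { intros i j E.
    assert (Hcc : cross (vk i) (vk j) = 0).
    { apply (line_meet c _ _ (fst (tm i)) (fst (tm j))); [exact E|]. intros EB.
      apply (supp_not_interior O c (snd (tm i))); [apply Htm | rewrite <- EB; apply Htm | exact Hc]. }
    unfold vk in Hcc. rewrite rot_cross in Hcc by auto.
    now apply (sin_sg_tk_inj sg). }
  destruct (eventually_not_in L X 0%nat) as [N HN]; [intros; now apply Hinj|].
  destruct (eventually_not_in (Q :: nil) X 0%nat) as [N' HN']; [intros; now apply Hinj|].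
  set (psi := fun k => phi (k + N + N')%nat).
  assert (Hpsi : inc psi). { intros i j Hij. apply Hp. lia. }
  assert (Hge : forall k, (N <= psi k /\ N' <= psi k)%nat). { intros k. unfold psi. assert (H := inc_ge phi Hp (k + N + N')%nat). lia. }
  assert (Hsh : inc (fun k => (k + N + N')%nat)) by (intros i j; lia).
  exists (fun k => X (psi k)), (fun k => snd (tm (psi k))), n'.
  assert (P1 : pconv (fun k => X (psi k)) Q) by now apply (pconv_sub (fun k => X (phi k)) Q (fun k => (k + N + N')%nat)).
  assert (P2 : pconv (fun k => snd (tm (psi k))) n') by now apply (pconv_sub (fun k => snd (tm (phi k))) n' (fun k => (k + N + N')%nat)).
  split; auto. split; auto. split; [|split; auto].
  - intros k. split; [apply Htm|]. apply (HL _ (snd (tm (psi k)))); [apply Htm | apply HN, Hge].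
  - apply (edge_limit O HO (fun k => X (psi k)) (fun k => snd (tm (psi k)))); auto.
    + intros k; apply Htm.
    + intros k E. apply (HN' (psi k)); [apply Hge|]. left. auto.
    + intros k. unfold X. rewrite EQ.
      replace (dot (pscale sg (perp v)) (psub (padd c (pscale (fst (tm (psi k))) (vk (psi k)))) (padd c (pscale r v))))
        with (sg * (fst (tm (psi k)) * cross v (vk (psi k)))) by pt_eq.
      unfold vk. rewrite cross_rot by auto.
      assert (A := tk_pos (psi k)). assert (B := tk_le1 (psi k)). specialize (Ht (psi k)). assert (Pi := PI2_1).
      destruct (sign_cases sg Hsg); subst sg.
      * assert (0 < sin (1 * tk (psi k))) by (apply sin_gt_0; lra). nra.
      * assert (sin (-1 * tk (psi k)) < 0) by (apply sin_lt_0_var; lra). nra.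
Qed.

(** * Consequences of commutation at the outer boundary *)

Section Pair.
Variables O1 O2 : pt -> Prop.
Hypothesis HS : commuting_pair O1 O2.

Lemma cv1 : convex_compact_domain O1. Proof. apply HS. Qed.
Lemma cv2 : convex_compact_domain O2. Proof. apply HS. Qed.

Lemma inner_interior Y : O1 Y -> interior O2 Y.
Proof.
  intros HY. destruct HS as (_ & _ & H & _). apply H. intros e He. exists Y. split; auto. now rewrite dist2_refl.
Qed.

Lemma inner_in Y : O1 Y -> O2 Y.
Proof. intros H; now apply interior_in, inner_interior. Qed.

Lemma inner_lt B n Y : nrm O2 B n -> O1 Y -> dot n (psub Y B) < 0.
Proof. intros (_ & Hn & Hs) HY. apply (supp_int O2); auto. now apply inner_interior. Qed.

Lemma outer_bdry_not_inner B n : nrm O2 B n -> ~ O1 B.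
Proof.
  intros HB H. assert (E := inner_lt B n B HB H). replace (dot n (psub B B)) with 0 in E by pt_eq. lra.
Qed.

(** Compactness of [O1] turns pointwise interiority into one margin [k]; the Lipschitz constants of
    tangent rays, normals and exit points rest on it. *)
Lemma inner_gap : exists k, 0 < k /\ forall Y Z, O1 Y -> dist2 Y Z <= k -> O2 Z.
Proof.
  apply NNPP. intros Hn.
  assert (S : forall k, exists yz : pt * pt, O1 (fst yz) /\ dist2 (fst yz) (snd yz) <= tk k /\ ~ O2 (snd yz)).
  { intros k. apply NNPP. intros Hk. apply Hn. exists (tk k). split; [apply tk_pos|]. intros Y Z HY HZ.
    apply NNPP. intros HO. apply Hk. now exists (Y, Z). }
  destruct (choice_seq _ S) as [u Hu].
  destruct (dom_BW O1 cv1 (fun k => fst (u k))) as (phi & p & Hp & Hc & HO). { intros; apply Hu. }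
  destruct (interior_ball O2 p (inner_interior p HO)) as (r & Hr & Hb).
  destruct (pconv_eventually _ _ (r / 2) Hc) as [N HN]; [lra|].
  destruct (tk_small (r / 2)) as [N' HN']; [lra|].
  set (k := Nat.max N N'). destruct (Hu (phi k)) as (_ & A & B). apply B, Hb.
  assert (T := dist2_tri p (fst (u (phi k))) (snd (u (phi k)))).
  assert (C := HN k ltac:(lia)). assert (D := inc_ge phi Hp k). assert (E := HN' (phi k) ltac:(lia)).
  rewrite dist2_sym in C. lra.
Qed.

Lemma inner_gap_normal : exists k, 0 < k /\ forall B n Y, nrm O2 B n -> O1 Y -> dot n (psub Y B) <= - k.
Proof.
  destruct inner_gap as (k & Hk & H). exists k. split; auto. intros B n Y (_ & Hn & Hs) HY.
  apply (supp_ball O2 Y k B n Hn Hs); [lra|]. intros q Hq. now apply (H Y).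
Qed.

Lemma ray_meets_pos B n v t : nrm O2 B n -> 0 < dot n v -> O1 (padd B (pscale t v)) -> t < 0.
Proof.
  intros HB Hv HO. assert (E := inner_lt B n _ HB HO).
  replace (dot n (psub (padd B (pscale t v)) B)) with (t * dot n v) in E by pt_eq. nra.
Qed.

Lemma exits_distinct B n (w : nat -> pt) (X : nat -> pt) (t : nat -> R) sg v N :
  nrm O2 B n -> unit_pt v -> (forall i, (N <= i)%nat -> X i = padd B (pscale (t i) (w i)) /\ O1 (X i)) ->
  sg * sg = 1 -> (forall i j, Rabs (cross (w i) (w j)) = Rabs (sin (sg * tk j - sg * tk i))) ->
  forall i j, (N <= i)%nat -> (N <= j)%nat -> X i = X j -> i = j.
Proof.
  intros HB Hv HX Hsg Hw i j Hi Hj E. destruct (HX i Hi) as [Ei Oi]. destruct (HX j Hj) as [Ej Oj].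
  assert (Hc : cross (w i) (w j) = 0).
  { apply (line_meet B _ _ (t i) (t j)); [congruence|]. rewrite <- Ei. intros EB. rewrite EB in Oi.
    now apply (outer_bdry_not_inner B n). }
  specialize (Hw i j). rewrite Hc, Rabs_R0 in Hw.
  apply (sin_sg_tk_inj sg); auto.
  destruct (Req_dec (sin (sg * tk j - sg * tk i)) 0) as [|H]; auto. apply Rabs_pos_lt in H. lra.
Qed.

Lemma rot_cross_abs sg v i j : unit_pt v -> Rabs (cross (rot (sg * tk i) v) (rot (sg * tk j) v)) = Rabs (sin (sg * tk j - sg * tk i)).
Proof. intros Hv. now rewrite rot_cross. Qed.

Lemma rot_refl_cross_abs n sg v i j : unit_pt n -> unit_pt v ->
  Rabs (cross (refl n (rot (sg * tk i) v)) (refl n (rot (sg * tk j) v))) = Rabs (sin (sg * tk j - sg * tk i)).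
Proof. intros Hn Hv. rewrite refl_cross, Rabs_Ropp by auto. now rewrite rot_cross. Qed.

(* If the reflected line crossed the inner domain, the inner billiard would move it while fixing the incoming line, so the two compositions would differ. *)
Lemma miss_reflects_to_noncrossing B n v : nrm O2 B n -> smooth O2 B -> unit_pt v -> 0 < dot n v ->
  (forall t, ~ O1 (padd B (pscale t v))) -> ~ crosses O1 B (refl n v).
Proof.
  intros HB Hsm Hv Hnv Hmiss Hcr.
  assert (Hn : unit_pt n) by apply HB.
  set (vk := fun k => rot (1 * tk k) v).
  assert (Hvk : pconv vk v) by apply pconv_rot, lim_sg_tk.
  assert (Hwk : pconv (fun k => refl n (vk k)) (refl n v)) by (apply pconv_refl; auto; apply pconv_const).
  destruct (misses_open O1 cv1 B v vk Hvk Hv Hmiss) as [N1 HN1].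
  destruct (crosses_open O1 B (refl n v) _ Hwk Hcr) as [N2 HN2].
  destruct (lim_eventually_gt (fun k => dot n (vk k)) (dot n v) 0) as [N3 HN3]; auto.
  { apply lim_dot; auto. apply pconv_const. }
  set (N := Nat.max N1 (Nat.max N2 N3)).
  assert (Hu : forall k, unit_pt (vk k)) by (intros; now apply rot_unit).
  assert (S : forall k, exists tm : R * pt, (N <= k)%nat -> exitp O1 (padd B (pscale (fst tm) (refl n (vk k)))) (snd tm) (refl n (vk k))).
  { intros k. destruct (classic (N <= k)%nat) as [Hk|Hk].
    - destruct (exit_exists O1 cv1 B (refl n (vk k))) as (t & m & H).
      + apply unit_nz, refl_unit; auto.
      + apply HN2. lia.
      + now exists (t, m).
    - exists (0, v). easy. }
  destruct (choice_seq _ S) as [tm Htm].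
  destruct HS as (_ & _ & _ & (L & HL) & _ & Hcom).
  (* Among the rotated lines, which keep both the miss and the crossing, one is chosen whose exit
     from [O1] is no corner, so that the inner billiard is defined on it. *)
  destruct (eventually_not_in L (fun k => padd B (pscale (fst (tm k)) (refl n (vk k)))) N) as [N' HN'].
  { apply (exits_distinct B n (fun k => refl n (vk k)) _ (fun k => fst (tm k)) 1 v N); auto; try lra.
    - intros i Hi. split; auto. apply (Htm i Hi).
    - intros i j. unfold vk. now apply rot_refl_cross_abs. }
  set (k := Nat.max N N'). specialize (Htm k ltac:(lia)). specialize (HN' k ltac:(lia)). cbn beta in HN'.
  set (X := padd B (pscale (fst (tm k)) (refl n (vk k)))) in *. set (m := snd (tm k)) in *.
  assert (HsX : smooth O1 X). { apply (HL X m); auto. apply Htm. }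
  assert (Hv0 := unit_nz _ (Hu k)).
  assert (A1 : billiard O1 (B, vk k) (B, vk k)).
  { apply billiard_miss; auto. intros t. apply HN1. lia. }
  assert (A2 : billiard O2 (B, vk k) (B, refl n (vk k))).
  { apply (billiard_hit O2 cv2 B (vk k) 0); auto. { pt_eq. } split; auto. apply HN3. lia. }
  assert (A3 : billiard O1 (B, refl n (vk k)) (X, refl m (refl n (vk k)))).
  { apply (billiard_hit O1 cv1 B (refl n (vk k)) (fst (tm k))); auto. }
  (* Commutation makes the reflected direction at [X] a positive multiple of the incoming one, while
     reflection reverses the component along [m]. *)
  destruct (Hcom _ _ _ _ _ A1 A2 A2 A3) as (_ & _ & _ & c & Hc & E). cbn in E.
  assert (Hm : unit_pt m) by apply Htm.
  assert (F := refl_dot m (refl n (vk k)) Hm). rewrite E in F.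
  replace (dot (pscale c (refl n (vk k))) m) with (c * dot (refl n (vk k)) m) in F by pt_eq.
  destruct Htm as [_ G]. rewrite dot_sym in G. nra.
Qed.

(** For unit [n], the reflection in the line spanned by [n]: light reaching [B] along
    [pscale (-1) e] leaves along [mirror n e], so this map acts on the rays from [B] into the
    domain. *)
Definition mirror (n e : pt) : pt := pscale (-1) (refl n e).

Lemma mirror_unit n e : unit_pt n -> unit_pt e -> unit_pt (mirror n e).
Proof.
  intros Hn He. unfold unit_pt, mirror.
  replace (dot (pscale (-1) (refl n e)) (pscale (-1) (refl n e))) with (dot (refl n e) (refl n e)) by pt_eq.
  now apply refl_unit.
Qed.

Lemma mirror_dot n e : unit_pt n -> dot n (mirror n e) = dot n e.
Proof.
  intros Hn. unfold mirror. replace (dot n (pscale (-1) (refl n e))) with (- dot (refl n e) n) by pt_eq.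
  rewrite refl_dot by auto. rewrite (dot_sym e n); ring.
Qed.

Lemma mirror_invol n e : unit_pt n -> mirror n (mirror n e) = e.
Proof.
  intros Hn. unfold mirror.
  replace (refl n (pscale (-1) (refl n e))) with (pscale (-1) (refl n (refl n e))).
  - rewrite refl_invol by auto. pt_eq.
  - pt_eq.
Qed.

Lemma mirror_cross n a b : unit_pt n -> cross (mirror n a) (mirror n b) = - cross a b.
Proof.
  intros Hn. rewrite <- (refl_cross n a b Hn). unfold mirror. pt_eq.
Qed.

Lemma mirror_cross_l n a b : unit_pt n -> cross (mirror n a) b = - cross a (mirror n b).
Proof. intros Hn. rewrite <- (mirror_cross n a (mirror n b)) by auto. now rewrite mirror_invol. Qed.

Lemma mirror_sum n e : unit_pt n -> padd e (mirror n e) = pscale (2 * dot n e) n.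
Proof. intros _. unfold mirror. pt_eq. Qed.

Lemma tangent_ray_inward B n sg e : nrm O2 B n -> tangent_ray O1 sg B e -> dot n e < 0.
Proof.
  intros HB (_ & (k & Hk & HO) & _). assert (E := inner_lt B n _ HB HO).
  replace (dot n (psub (padd B (pscale k e)) B)) with (k * dot n e) in E by pt_eq. nra.
Qed.

Lemma inward_parallel n e f : unit_pt e -> unit_pt f -> dot n e < 0 -> dot n f < 0 -> cross e f = 0 -> e = f.
Proof.
  intros He Hf E F Hc. destruct (unit_eq_or e f He Hf Hc) as [|H]; auto.
  rewrite H in E. replace (dot n (pscale (-1) f)) with (- dot n f) in E by pt_eq. lra.
Qed.

Lemma tangent_ray_unique B n sg e f : sg * sg = 1 -> nrm O2 B n -> tangent_ray O1 sg B e -> tangent_ray O1 sg B f -> e = f.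
Proof.
  intros Hsg HB He Hf. assert (E := tangent_ray_inward _ _ _ _ HB He). assert (F := tangent_ray_inward _ _ _ _ HB Hf).
  destruct He as (Ue & (k & Hk & Oe) & He). destruct Hf as (Uf & (l & Hl & Of) & Hf).
  apply (inward_parallel n); auto.
  assert (A := He _ Of). assert (C := Hf _ Oe).
  replace (cross e (psub (padd B (pscale l f)) B)) with (l * cross e f) in A by pt_eq.
  replace (cross f (psub (padd B (pscale k e)) B)) with (- k * cross e f) in C by pt_eq.
  set (x := cross e f) in *.
  assert (A' : sg * x <= 0) by nra. assert (C' : 0 <= sg * x) by nra.
  assert (sg * x = 0) by lra. apply Rmult_integral in H. destruct H; nra.
Qed.

(** Seen from [B], the inner domain lies in an open half-plane, so the slope with respect to
    [pscale (-1) n] is continuous on it; a point where [sg] times the slope is minimal spans the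
    tangent ray. *)
Lemma tangent_ray_exists B n sg : nrm O2 B n -> exists e, tangent_ray O1 sg B e.
Proof.
  intros HB.
  assert (Hd : forall Y, O1 Y -> dot n (psub Y B) < 0) by (intros; now apply inner_lt).
  destruct (compact_min O1 cv1 (fun Y => sg * dot (perp n) (psub Y B) / dot (pscale (-1) n) (psub Y B))) as (T & HT & Hmin).
  { intros u p Hu _ Hp. assert (L : pconv (fun k => psub (u k) B) (psub p B)) by (apply pconv_sub2; auto; apply pconv_const).
    apply is_lim_seq_div'.
    - apply is_lim_seq_mult'; [apply is_lim_seq_const|]. apply lim_dot; auto. apply pconv_const.
    - apply lim_dot; auto. apply pconv_const.
    - specialize (Hd p Hp). replace (dot (pscale (-1) n) (psub p B)) with (- dot n (psub p B)) by pt_eq. lra. }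
  assert (HdT := Hd T HT).
  assert (Hne : psub T B <> (0,0)). { intros E. rewrite E in HdT. destruct n; pt_unfold; lra. }
  destruct (normalize _ Hne) as (e & He & E). assert (P := norm2_pos _ Hne). set (r := norm2 (psub T B)) in *.
  exists e. split; auto. split.
  - exists r. split; auto. rewrite <- E. replace (padd B (psub T B)) with T by pt_eq. exact HT.
  - intros Y HY. specialize (Hmin Y HY). specialize (Hd Y HY).
    replace (dot (pscale (-1) n) (psub T B)) with (- dot n (psub T B)) in Hmin by pt_eq.
    replace (dot (pscale (-1) n) (psub Y B)) with (- dot n (psub Y B)) in Hmin by pt_eq.
    set (aT := - dot n (psub T B)) in *. set (aY := - dot n (psub Y B)) in *.
    set (bT := dot (perp n) (psub T B)) in *. set (bY := dot (perp n) (psub Y B)) in *.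
    assert (H1 : sg * bT * aY <= sg * bY * aT).
    { apply (Rmult_le_compat_r (aT * aY)) in Hmin; [|unfold aT, aY; nra].
      replace (sg * bT / aT * (aT * aY)) with (sg * bT * aY) in Hmin by (field; unfold aT; lra).
      replace (sg * bY / aY * (aT * aY)) with (sg * bY * aT) in Hmin by (field; unfold aY; lra). exact Hmin. }
    assert (Ec : r * cross e (psub Y B) = bT * aY - bY * aT).
    { replace (r * cross e (psub Y B)) with (cross (psub T B) (psub Y B)) by (rewrite E; pt_eq).
      assert (Hn : dot n n = 1) by apply HB. unfold aT, aY, bT, bY.
      replace (cross (psub T B) (psub Y B)) with (dot n n * cross (psub T B) (psub Y B)) by (rewrite Hn; ring).
      generalize (psub T B) (psub Y B); intros; pt_eq. }
    assert (sg * (r * cross e (psub Y B)) <= 0) by (rewrite Ec; lra).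
    apply (Rmult_le_reg_l r); auto. lra.
Qed.

Definition bisecting (B n : pt) : Prop := forall sg e, sg * sg = 1 -> tangent_ray O1 sg B e -> tangent_ray O1 (- sg) B (mirror n e).

(** A point of [O1] beyond the mirrored ray may be replaced by an interior one, [Z]. The mirror
    image [w] of the direction [d] from [B] to [Z] then lies outside the tangent ray [e], so the
    line reaching [B] along [pscale (-1) w] misses [O1]; yet it is reflected through [Z], against
    [miss_reflects_to_noncrossing]. *)
Lemma mirror_side B n sg e : nrm O2 B n -> smooth O2 B -> sg * sg = 1 -> tangent_ray O1 sg B e ->
  forall Y, O1 Y -> - sg * cross (mirror n e) (psub Y B) <= 0.
Proof.
  intros HB Hsm Hsg He Y HY. apply Rnot_lt_le. intros Hlt.
  assert (Hn : unit_pt n) by apply HB. assert (Ue : unit_pt e) by apply He.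
  destruct (dom_int O1 cv1) as [c Hc].
  set (a := sg * cross (mirror n e) (psub Y B)) in *. set (b := sg * cross (mirror n e) (psub c B)).
  assert (Ha : a < 0) by (unfold a; lra).
  (* A small [t] moves [Y] towards the interior point [c] without leaving the forbidden side. *)
  assert (Ht : exists t, 0 < t <= 1 /\ (1 - t) * a + t * b < 0).
  { exists (Rmin 1 (- a / (2 * (Rabs (b - a) + 1)))). assert (R0 := Rabs_pos (b - a)). assert (R1 := Rle_abs (b - a)).
    assert (Q : 0 < - a / (2 * (Rabs (b - a) + 1))) by (apply Rdiv_lt_0_compat; lra).
    set (t := Rmin 1 (- a / (2 * (Rabs (b - a) + 1)))).
    assert (T0 : 0 < t) by (apply Rmin_pos; lra). assert (T1 : t <= 1) by apply Rmin_l.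
    assert (T2 : t <= - a / (2 * (Rabs (b - a) + 1))) by apply Rmin_r.
    split; [lra|]. apply (Rmult_le_compat_r (2 * (Rabs (b - a) + 1))) in T2; [|lra].
    unfold Rdiv in T2; rewrite Rmult_assoc, Rinv_l in T2 by lra. nra. }
  destruct Ht as (t & Ht & Hneg).
  assert (HZ := interior_seg O1 cv1 c Y t Hc HY Ht). set (Z := padd (pscale (1 - t) Y) (pscale t c)) in *.
  assert (HZc : sg * cross (mirror n e) (psub Z B) < 0).
  { replace (sg * cross (mirror n e) (psub Z B)) with ((1 - t) * a + t * b); [lra|]. unfold Z, a, b.
    pt_eq. }
  assert (HdZ := inner_lt B n Z HB (interior_in _ _ HZ)).
  assert (Hne : psub Z B <> (0,0)). { intros E. rewrite E in HdZ. destruct n; pt_unfold; lra. }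
  destruct (normalize _ Hne) as (d & Hd & E). assert (P := norm2_pos _ Hne). set (r := norm2 (psub Z B)) in *.
  rewrite E in HZc, HdZ.
  replace (cross (mirror n e) (pscale r d)) with (r * cross (mirror n e) d) in HZc by pt_eq.
  replace (dot n (pscale r d)) with (r * dot n d) in HdZ by pt_eq.
  assert (HZd : sg * cross (mirror n e) d < 0) by nra. assert (Hnd : dot n d < 0) by nra.
  rewrite mirror_cross_l in HZd by auto.
  set (w := mirror n d) in *. assert (Hw : unit_pt w) by now apply mirror_unit.
  assert (Hnw : dot n w < 0) by (unfold w; now rewrite mirror_dot).
  apply (miss_reflects_to_noncrossing B n (pscale (-1) w)); auto.
  - unfold unit_pt. rewrite <- Hw. pt_eq.
  - replace (dot n (pscale (-1) w)) with (- dot n w) by pt_eq. lra.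
  - intros s Hs. destruct He as (_ & _ & He). assert (A := He _ Hs). assert (C := inner_lt B n _ HB Hs).
    replace (cross e (psub (padd B (pscale s (pscale (-1) w))) B)) with (- s * cross e w) in A by pt_eq.
    replace (dot n (psub (padd B (pscale s (pscale (-1) w))) B)) with (- s * dot n w) in C by pt_eq.
    assert (s < 0) by nra. nra.
  - exists r. replace (refl n (pscale (-1) w)) with d.
    + rewrite <- E. replace (padd B (psub Z B)) with Z by pt_eq. exact HZ.
    + replace (refl n (pscale (-1) w)) with (mirror n w); [unfold w; now rewrite mirror_invol|].
      unfold mirror. pt_eq.
Qed.

(** [mirror_side], used for [e] and for the opposite tangent ray [f], bounds the cross product of
    [mirror n e] and [f] from both sides, so it vanishes. *)
Lemma smooth_bisecting B n : nrm O2 B n -> smooth O2 B -> bisecting B n.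
Proof.
  intros HB Hsm sg e Hsg He.
  assert (Hsg' : - sg * - sg = 1) by lra.
  destruct (tangent_ray_exists B n (- sg) HB) as [f Hf].
  enough (mirror n e = f) by now subst f.
  assert (Hn : unit_pt n) by apply HB.
  assert (A := mirror_side B n sg e HB Hsm Hsg He). assert (C := mirror_side B n (- sg) f HB Hsm Hsg' Hf).
  assert (E1 := tangent_ray_inward _ _ _ _ HB He). assert (F1 := tangent_ray_inward _ _ _ _ HB Hf).
  destruct He as (Ue & (k & Hk & Oe) & _). destruct Hf as (Uf & (l & Hl & Of) & _).
  apply (inward_parallel n); auto.
  - now apply mirror_unit.
  - now rewrite mirror_dot.
  - specialize (A _ Of). specialize (C _ Oe).
    replace (cross (mirror n e) (psub (padd B (pscale l f)) B)) with (l * cross (mirror n e) f) in A by pt_eq.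
    replace (cross (mirror n f) (psub (padd B (pscale k e)) B)) with (k * cross (mirror n f) e) in C by pt_eq.
    rewrite (mirror_cross_l n f e Hn) in C.
    replace (cross f (mirror n e)) with (- cross (mirror n e) f) in C by pt_eq.
    set (x := cross (mirror n e) f) in *.
    assert (A' : - sg * x <= 0) by nra. assert (C' : sg * x <= 0) by nra.
    assert (Z : sg * x = 0) by lra. apply Rmult_integral in Z. destruct Z; nra.
Qed.

(** Only the positive length needs care: a limit length zero would place [B] in [O1]. *)
Lemma tangent_ray_lim Bk B n sg ek e : sg * sg = 1 -> nrm O2 B n -> pconv Bk B -> pconv ek e ->
  (forall k, tangent_ray O1 sg (Bk k) (ek k)) -> tangent_ray O1 sg B e.
Proof.
  intros Hsg HB HBk Hek H.
  assert (Ue : unit_pt e). { apply (lim_eq _ _ _ (lim_dot _ _ _ _ Hek Hek)). intros k; apply H. }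
  assert (S : forall k, exists r, 0 < r /\ O1 (padd (Bk k) (pscale r (ek k)))) by (intros k; apply H).
  destruct (choice_seq _ S) as [r Hr].
  destruct (dom_BW O1 cv1 (fun k => padd (Bk k) (pscale (r k) (ek k)))) as (phi & T & Hp & Hc & HT). { intros; apply Hr. }
  split; auto. split.
  - assert (HBp : pconv (fun k => Bk (phi k)) B) by now apply pconv_sub.
    assert (Hep : pconv (fun k => ek (phi k)) e) by now apply (pconv_sub ek).
    assert (Hd : pconv (fun k => psub (padd (Bk (phi k)) (pscale (r (phi k)) (ek (phi k)))) (Bk (phi k))) (psub T B)) by now apply pconv_sub2.
    assert (C0 : cross e (psub T B) = 0).
    { apply (lim_eq _ _ _ (lim_cross _ _ _ _ Hep Hd)). intros k. pt_eq. }
    assert (C1 : 0 <= dot e (psub T B)).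
    { apply (lim_ge_const _ _ _ (lim_dot _ _ _ _ Hep Hd)). intros k.
      replace (dot (ek (phi k)) (psub (padd (Bk (phi k)) (pscale (r (phi k)) (ek (phi k)))) (Bk (phi k)))) with (r (phi k) * dot (ek (phi k)) (ek (phi k))) by pt_eq.
      destruct (H (phi k)) as (U & _). rewrite U. destruct (Hr (phi k)). lra. }
    assert (D := decomp e (psub T B) Ue). rewrite C0 in D.
    exists (dot e (psub T B)).
    assert (ET : padd B (pscale (dot e (psub T B)) e) = T).
    { replace T with (padd B (psub T B)) at 2 by pt_eq. rewrite D at 2. pt_eq. }
    split; [|now rewrite ET].
    destruct C1 as [|C1]; auto. exfalso. rewrite <- C1 in ET. apply (outer_bdry_not_inner B n HB).
    rewrite <- ET in HT. replace (padd B (pscale 0 e)) with B in HT by pt_eq. exact HT.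
  - intros Y HY. apply (lim_le_const (fun k => sg * cross (ek k) (psub Y (Bk k)))).
    + apply is_lim_seq_mult'; [apply is_lim_seq_const|]. apply lim_cross; auto. apply pconv_sub2; auto. apply pconv_const.
    + intros k. now apply H.
Qed.

Lemma bisecting_lim Bk nk B n : nrm O2 B n -> pconv Bk B -> pconv nk n ->
  (forall k, nrm O2 (Bk k) (nk k) /\ bisecting (Bk k) (nk k)) -> bisecting B n.
Proof.
  intros HB HBk Hnk H sg e Hsg He.
  assert (S : forall k, exists f, tangent_ray O1 sg (Bk k) f) by (intros k; apply (tangent_ray_exists _ (nk k)), H).
  destruct (choice_seq _ S) as [f Hf].
  destruct (BWu f) as (phi & g & Hp & Hc & Hg). { intros k; apply Hf. }
  assert (HBp : pconv (fun k => Bk (phi k)) B) by now apply pconv_sub.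
  assert (Hnp : pconv (fun k => nk (phi k)) n) by now apply (pconv_sub nk).
  assert (E : g = e).
  { apply (tangent_ray_unique B n sg); auto. apply (tangent_ray_lim (fun k => Bk (phi k)) B n sg (fun k => f (phi k))); auto. }
  subst g. apply (tangent_ray_lim (fun k => Bk (phi k)) B n (- sg) (fun k => mirror (nk (phi k)) (f (phi k)))); auto; try lra.
  - apply pconv_scale; [apply is_lim_seq_const|]. now apply pconv_refl.
  - intros k. apply (proj2 (H (phi k))); auto.
Qed.

(** By [mirror_sum] the normal is the normalized opposite of the sum of the two tangent rays, which
    depend on [B] alone. *)
Lemma bisecting_unique B n m : nrm O2 B n -> nrm O2 B m -> bisecting B n -> bisecting B m -> n = m.
Proof.
  intros Hn Hm Bn Bm. destruct (tangent_ray_exists B n 1 Hn) as [e He].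
  assert (A := Bn 1 e ltac:(lra) He). assert (C := Bm 1 e ltac:(lra) He).
  assert (E := tangent_ray_unique B n (-(1)) _ _ ltac:(lra) Hn A C).
  assert (N := tangent_ray_inward _ _ _ _ Hn He). assert (M := tangent_ray_inward _ _ _ _ Hm He).
  assert (S1 := mirror_sum n e (proj1 (proj2 Hn))). assert (S2 := mirror_sum m e (proj1 (proj2 Hm))).
  rewrite E in S1. rewrite S1 in S2.
  apply (pscale_unit_inj (- (2 * dot n e)) (- (2 * dot m e))); try apply Hn; try apply Hm; try lra.
  transitivity (pscale (-1) (pscale (2 * dot n e) n)); [pt_eq|]. rewrite S2. pt_eq.
Qed.

(* A corner would have two distinct limit normals, both bisecting the same pair of tangent rays. *)
Lemma outer_smooth B : smooth O2 B.
Proof.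
  intros n0 n0' Hn0 Hn0'.
  destruct (dom_int O2 cv2) as [c Hc].
  assert (Hd := supp_int O2 c B n0 Hc (proj1 (proj2 Hn0)) (proj2 (proj2 Hn0))).
  assert (Hne : psub B c <> (0,0)). { intros E. replace (psub c B) with (pscale (-1) (psub B c)) in Hd by pt_eq. rewrite E in Hd. destruct n0; pt_unfold; lra. }
  destruct (normalize _ Hne) as (v & Hv & E). assert (P := norm2_pos _ Hne). set (r := norm2 (psub B c)) in *.
  assert (EB : B = padd c (pscale r v)). { rewrite <- E. pt_eq. }
  assert (Hex : exitp O2 B n0 v).
  { split; auto. replace (psub c B) with (pscale (- r) v) in Hd by (rewrite EB; pt_eq).
    replace (dot n0 (pscale (- r) v)) with (- r * dot n0 v) in Hd by pt_eq. nra. }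
  assert (HF : finitely_nonsmooth O2) by apply HS.
  assert (K : forall sg, sg * sg = 1 -> exists n', nrm O2 B n' /\ bisecting B n' /\ 0 < dot n' v /\ edge O2 B n' (pscale sg (perp v))).
  { intros sg Hsg. destruct (approach_from_side O2 B c n0 v r sg cv2 HF Hc Hv P EB Hex Hsg) as (X & m & n' & HX & Hm & Hsm & Hd' & He).
    exists n'. assert (HN : nrm O2 B n') by (apply (nrm_lim O2 cv2 X B m); auto; intros; apply Hsm).
    split; auto. split; auto. apply (bisecting_lim X m); auto. intros k. split; [apply Hsm|].
    apply smooth_bisecting; apply Hsm. }
  destruct (K 1 ltac:(lra)) as (n1 & N1 & B1 & D1 & E1). destruct (K (-1) ltac:(lra)) as (n2 & N2 & B2 & D2 & E2).
  assert (n2 = n1) by (apply (bisecting_unique B); auto). subst n2.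
  apply (edges_both_sides O2 cv2 B n1 v); auto.
  replace (perp v) with (pscale 1 (perp v)) by pt_eq. auto.
Qed.

Lemma outer_bisecting B n : nrm O2 B n -> bisecting B n.
Proof. intros HB. apply smooth_bisecting; auto. apply outer_smooth. Qed.

End Pair.

(** * Closed quadrilaterals *)

(** Nonstrict, so that it passes to limits; the positive lengths of the sides at [qA] are recovered
    later from [O1] lying strictly inside [O2]. *)
Definition along (X Y w : pt) : Prop := cross w (psub Y X) = 0 /\ 0 <= dot w (psub Y X).

(** A line of direction [qv] leaves the inner domain at [qA] and the outer one at [qB]; reflected at
    [qA] instead, it reaches the outer boundary at [qC]. The reflected lines at [qB] and [qC] meet
    at [qD]. The normal [qn] is part of the data because [qA] may be a corner. *)
Record cfg := { qA : pt; qn : pt; qB : pt; qb : pt; qC : pt; qc : pt; qD : pt; qv : pt }.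

(** Directions of the remaining sides: [qw1] from [qA] to [qC], [qw2] from [qB] to [qD], [qv1] from
    [qC] to [qD]. *)
Definition qw1 q := refl (qn q) (qv q).
Definition qw2 q := refl (qb q) (qv q).
Definition qv1 q := refl (qc q) (qw1 q).

Lemma along_eq X Y w : unit_pt w -> along X Y w -> Y = padd X (pscale (dot w (psub Y X)) w).
Proof.
  intros Hw [Hc _]. assert (D := decomp w (psub Y X) Hw). rewrite Hc in D.
  replace Y with (padd X (psub Y X)) at 1 by pt_eq. rewrite D at 1. pt_eq.
Qed.

Lemma along_intro X w t : unit_pt w -> 0 <= t -> along X (padd X (pscale t w)) w.
Proof.
  intros Hw Ht. split.
  - pt_eq.
  - replace (dot w (psub (padd X (pscale t w)) X)) with (t * dot w w) by pt_eq. rewrite Hw; lra.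
Qed.

Lemma along_lim X Y w X' Y' w' : pconv X X' -> pconv Y Y' -> pconv w w' -> (forall k, along (X k) (Y k) (w k)) -> along X' Y' w'.
Proof.
  intros HX HY Hw H. assert (L := pconv_sub2 _ _ _ _ HY HX). split.
  - apply (lim_eq _ _ _ (lim_cross _ _ _ _ Hw L)). intros k; apply H.
  - apply (lim_ge_const _ _ _ (lim_dot _ _ _ _ Hw L)). intros k; apply H.
Qed.

Section Quads.
Variables O1 O2 : pt -> Prop.
Hypothesis HS : commuting_pair O1 O2.
Let H1 := cv1 O1 O2 HS.
Let H2 := cv2 O1 O2 HS.

(* The normal at [qD q] is represented by [psub (qw2 q) (qv1 q)], which is not normalized and vanishes in degenerate cases. *)
Definition quad (q : cfg) : Prop :=
  nrm O1 (qA q) (qn q) /\ nrm O2 (qB q) (qb q) /\ nrm O2 (qC q) (qc q) /\ O1 (qD q) /\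
  unit_pt (qv q) /\ 0 <= dot (qn q) (qv q) /\
  along (qA q) (qB q) (qv q) /\ along (qA q) (qC q) (qw1 q) /\
  along (qB q) (qD q) (qw2 q) /\ along (qC q) (qD q) (qv1 q) /\
  supp O1 (qD q) (psub (qw2 q) (qv1 q)).

Definition qconv (u : nat -> cfg) (q : cfg) : Prop :=
  (pconv (fun k => qA (u k)) (qA q) /\ pconv (fun k => qn (u k)) (qn q)) /\
  (pconv (fun k => qB (u k)) (qB q) /\ pconv (fun k => qb (u k)) (qb q)) /\
  (pconv (fun k => qC (u k)) (qC q) /\ pconv (fun k => qc (u k)) (qc q)) /\
  (pconv (fun k => qD (u k)) (qD q) /\ pconv (fun k => qv (u k)) (qv q)).

Lemma qconv_w1 u q : qconv u q -> pconv (fun k => qw1 (u k)) (qw1 q).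
Proof. intros H. apply pconv_refl; apply H. Qed.
Lemma qconv_w2 u q : qconv u q -> pconv (fun k => qw2 (u k)) (qw2 q).
Proof. intros H. apply pconv_refl; apply H. Qed.
Lemma qconv_v1 u q : qconv u q -> pconv (fun k => qv1 (u k)) (qv1 q).
Proof. intros H. apply pconv_refl; [apply H | now apply qconv_w1]. Qed.

(** Every clause of [quad] is a closed condition, which is why its inequalities are nonstrict; the
    components are extracted one after another. *)
Lemma quad_compact (u : nat -> cfg) : (forall k, quad (u k)) -> exists phi q, inc phi /\ qconv (fun k => u (phi k)) q /\ quad q.
Proof.
  intros H.
  destruct (dom_BW O1 H1 (fun k => qA (u k))) as (f1 & A & I1 & CA & _). { intros; apply H. }
  destruct (BWu (fun k => qn (u (f1 k)))) as (f2 & n & I2 & Cn & _). { intros; apply H. }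
  destruct (dom_BW O2 H2 (fun k => qB (u (f1 (f2 k))))) as (f3 & B & I3 & CB & _). { intros; apply H. }
  destruct (BWu (fun k => qb (u (f1 (f2 (f3 k)))))) as (f4 & b & I4 & Cb & _). { intros; apply H. }
  destruct (dom_BW O2 H2 (fun k => qC (u (f1 (f2 (f3 (f4 k))))))) as (f5 & C & I5 & CC & _). { intros; apply H. }
  destruct (BWu (fun k => qc (u (f1 (f2 (f3 (f4 (f5 k)))))))) as (f6 & c & I6 & Cc & _). { intros; apply H. }
  destruct (dom_BW O1 H1 (fun k => qD (u (f1 (f2 (f3 (f4 (f5 (f6 k)))))))) ) as (f7 & D & I7 & CD & HD). { intros; apply H. }
  destruct (BWu (fun k => qv (u (f1 (f2 (f3 (f4 (f5 (f6 (f7 k)))))))))) as (f8 & v & I8 & Cv & Hv). { intros; apply H. }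
  assert (J7 := inc_comp _ _ I7 I8). assert (J6 := inc_comp _ _ I6 J7). assert (J5 := inc_comp _ _ I5 J6).
  assert (J4 := inc_comp _ _ I4 J5). assert (J3 := inc_comp _ _ I3 J4). assert (J2 := inc_comp _ _ I2 J3). assert (J1 := inc_comp _ _ I1 J2).
  cbn beta in *.
  apply (pconv_sub _ _ _ J2) in CA. apply (pconv_sub _ _ _ J3) in Cn. apply (pconv_sub _ _ _ J4) in CB.
  apply (pconv_sub _ _ _ J5) in Cb. apply (pconv_sub _ _ _ J6) in CC. apply (pconv_sub _ _ _ J7) in Cc. apply (pconv_sub _ _ _ I8) in CD.
  set (phi := fun k => f1 (f2 (f3 (f4 (f5 (f6 (f7 (f8 k)))))))) in *.
  set (q := Build_cfg A n B b C c D v).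
  assert (Q : qconv (fun k => u (phi k)) q) by (repeat split; (apply CA || apply Cn || apply CB || apply Cb || apply CC || apply Cc || apply CD || apply Cv)).
  exists phi, q. split; [exact J1|]. split; auto.
  split; [|split; [|split; [|split; [|split; [|split]]]]].
  - apply (nrm_lim O1 H1 (fun k => qA (u (phi k))) A (fun k => qn (u (phi k)))); try apply Q. intros; apply H.
  - apply (nrm_lim O2 H2 (fun k => qB (u (phi k))) B (fun k => qb (u (phi k)))); try apply Q. intros; apply H.
  - apply (nrm_lim O2 H2 (fun k => qC (u (phi k))) C (fun k => qc (u (phi k)))); try apply Q. intros; apply H.
  - exact HD.
  - exact Hv.
  - apply (lim_ge_const (fun k => dot (qn (u (phi k))) (qv (u (phi k))))); [apply lim_dot; apply Q|]. intros; apply H.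
  - assert (W1 := qconv_w1 _ _ Q). assert (W2 := qconv_w2 _ _ Q). assert (V1 := qconv_v1 _ _ Q).
    split; [|split; [|split; [|split]]].
    + apply (along_lim (fun k => qA (u (phi k))) (fun k => qB (u (phi k))) (fun k => qv (u (phi k)))); try apply Q. intros; apply H.
    + apply (along_lim (fun k => qA (u (phi k))) (fun k => qC (u (phi k))) (fun k => qw1 (u (phi k)))); auto; try apply Q. intros; apply H.
    + apply (along_lim (fun k => qB (u (phi k))) (fun k => qD (u (phi k))) (fun k => qw2 (u (phi k)))); auto; try apply Q. intros; apply H.
    + apply (along_lim (fun k => qC (u (phi k))) (fun k => qD (u (phi k))) (fun k => qv1 (u (phi k)))); auto; try apply Q. intros; apply H.
    + apply (supp_lim O1 (fun k => qD (u (phi k))) D (fun k => psub (qw2 (u (phi k))) (qv1 (u (phi k))))); try apply Q.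
      * now apply pconv_sub2.
      * intros; apply H.
Qed.

Section OneQuad.
Variable q : cfg.
Hypothesis Hq : quad q.

Lemma quad_uw1 : unit_pt (qw1 q). Proof. apply refl_unit; apply Hq. Qed.
Lemma quad_uw2 : unit_pt (qw2 q). Proof. apply refl_unit; apply Hq. Qed.
Lemma quad_uv1 : unit_pt (qv1 q). Proof. apply refl_unit; [apply Hq | apply quad_uw1]. Qed.

Lemma quad_AB : qB q = padd (qA q) (pscale (dot (qv q) (psub (qB q) (qA q))) (qv q)).
Proof. apply along_eq; apply Hq. Qed.
Lemma quad_AC : qC q = padd (qA q) (pscale (dot (qw1 q) (psub (qC q) (qA q))) (qw1 q)).
Proof. apply along_eq; [apply quad_uw1 | apply Hq]. Qed.
Lemma quad_BD : qD q = padd (qB q) (pscale (dot (qw2 q) (psub (qD q) (qB q))) (qw2 q)).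
Proof. apply along_eq; [apply quad_uw2 | apply Hq]. Qed.
Lemma quad_CD : qD q = padd (qC q) (pscale (dot (qv1 q) (psub (qD q) (qC q))) (qv1 q)).
Proof. apply along_eq; [apply quad_uv1 | apply Hq]. Qed.

Lemma quad_AB_pos : 0 < dot (qv q) (psub (qB q) (qA q)) /\ 0 < dot (qb q) (qv q).
Proof.
  destruct Hq as (HA & HB & _ & _ & _ & _ & (_ & Hr) & _).
  assert (E := inner_lt O1 O2 HS (qB q) (qb q) (qA q) HB (proj1 HA)).
  assert (F := quad_AB). set (r := dot (qv q) (psub (qB q) (qA q))) in *.
  rewrite F in E.
  replace (dot (qb q) (psub (qA q) (padd (qA q) (pscale r (qv q))))) with (- r * dot (qb q) (qv q)) in E by pt_eq.
  destruct Hr as [Hr|Hr]; [|rewrite <- Hr in E; lra]. split; [auto | nra].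
Qed.

Lemma quad_AC_pos : 0 < dot (qw1 q) (psub (qC q) (qA q)) /\ 0 < dot (qc q) (qw1 q).
Proof.
  destruct Hq as (HA & _ & HC & _ & _ & _ & _ & (_ & Hr) & _).
  assert (E := inner_lt O1 O2 HS (qC q) (qc q) (qA q) HC (proj1 HA)).
  assert (F := quad_AC). set (r := dot (qw1 q) (psub (qC q) (qA q))) in *.
  rewrite F in E.
  replace (dot (qc q) (psub (qA q) (padd (qA q) (pscale r (qw1 q))))) with (- r * dot (qc q) (qw1 q)) in E by pt_eq.
  destruct Hr as [Hr|Hr]; [|rewrite <- Hr in E; lra]. split; [auto | nra].
Qed.

Lemma quad_b_w2 : dot (qb q) (qw2 q) = - dot (qb q) (qv q).
Proof. rewrite dot_sym. unfold qw2. rewrite refl_dot by apply Hq. now rewrite dot_sym. Qed.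

Lemma quad_c_v1 : dot (qc q) (qv1 q) = - dot (qc q) (qw1 q).
Proof. rewrite dot_sym. unfold qv1. rewrite refl_dot by apply Hq. now rewrite dot_sym. Qed.

Lemma quad_n_w1 : dot (qn q) (qw1 q) = - dot (qn q) (qv q).
Proof. rewrite dot_sym. unfold qw1. rewrite refl_dot by apply Hq. now rewrite dot_sym. Qed.

Lemma quad_exit : crosses O1 (qB q) (qv q) -> exitp O1 (qA q) (qn q) (qv q).
Proof.
  intros [s Hs]. destruct Hq as (HA & _ & _ & _ & _ & Hn & _). split; auto.
  assert (E := supp_int O1 _ (qA q) (qn q) Hs (proj1 (proj2 HA)) (proj2 (proj2 HA))).
  rewrite quad_AB in E. set (r := dot (qv q) (psub (qB q) (qA q))) in *.
  replace (dot (qn q) (psub (padd (padd (qA q) (pscale r (qv q))) (pscale s (qv q))) (qA q))) with ((r + s) * dot (qn q) (qv q)) in E by pt_eq.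
  destruct Hn as [Hn|Hn]; auto. rewrite <- Hn in E. lra.
Qed.

Lemma exit_eq O X n X' n' v : smooth O X -> exitp O X n v -> exitp O X' n' v -> (exists t, X' = padd X (pscale t v)) -> X' = X /\ n' = n.
Proof.
  intros Hs HX HX' [t E]. assert (X' = X) by now apply (exit_unique O X n v X' n' t). split; auto. subst X'.
  rewrite H in HX'. apply Hs; [apply HX' | apply HX].
Qed.

(** Equal directions into [qD] would make [qB] and [qC] exits from [O2] of one reversed line, hence
    equal. Both sides at [qA] would then have the same direction, although reflection reverses the
    normal component. *)
Lemma quad_w2_neq_v1 : 0 < dot (qn q) (qv q) -> qw2 q <> qv1 q.
Proof.
  intros Hn E.
  destruct quad_AB_pos as [Pr Pb]. destruct quad_AC_pos as [Pr' Pc].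
  assert (Eb := quad_b_w2). assert (Ec := quad_c_v1). rewrite <- E in Ec.
  assert (F := quad_BD). assert (F' := quad_CD). rewrite <- E in F'.
  set (s := dot (qw2 q) (psub (qD q) (qB q))) in *. set (s' := dot (qw2 q) (psub (qD q) (qC q))) in *.
  destruct (exit_eq O2 (qB q) (qb q) (qC q) (qc q) (pscale (-1) (qw2 q))) as [EC Ecb].
  - now apply outer_smooth with O1.
  - split; [apply Hq|]. replace (dot (qb q) (pscale (-1) (qw2 q))) with (- dot (qb q) (qw2 q)) by pt_eq. lra.
  - split; [apply Hq|]. replace (dot (qc q) (pscale (-1) (qw2 q))) with (- dot (qc q) (qw2 q)) by pt_eq. lra.
  - exists (s' - s). replace (qC q) with (padd (qD q) (pscale (- s') (qw2 q))) by (rewrite F' at 1; pt_eq).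
    rewrite F. pt_eq.
  - assert (G := quad_AB). assert (G' := quad_AC). rewrite EC in G', Pr'.
    set (r := dot (qv q) (psub (qB q) (qA q))) in *. set (r' := dot (qw1 q) (psub (qB q) (qA q))) in *.
    assert (EE : qv q = qw1 q).
    { apply (pscale_unit_inj r r'); auto; try apply Hq; try apply quad_uw1.
      transitivity (psub (qB q) (qA q)); [rewrite G | rewrite G']; pt_eq. }
    assert (K := quad_n_w1). rewrite <- EE in K. lra.
Qed.

End OneQuad.

(** [qB] and [qC] are exits of prescribed rays. At [qD] the vector [psub (qw2 q) (qv1 q)] supports
    [O1] and pairs positively with [qw2 q], which forces the position along the side from [qB]. *)
Lemma quad_unique q p : quad q -> quad p -> qA q = qA p -> qn q = qn p -> qv q = qv p -> 0 < dot (qn q) (qv q) -> q = p.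
Proof.
  intros Hq Hp EA En Ev Hn.
  assert (EB : qB p = qB q /\ qb p = qb q).
  { apply (exit_eq O2 _ _ _ _ (qv q)).
    - now apply outer_smooth with O1.
    - split; [apply Hq | now apply quad_AB_pos].
    - split; [apply Hp | rewrite Ev; now apply quad_AB_pos].
    - assert (G := quad_AB q Hq). assert (G' := quad_AB p Hp). rewrite <- EA, <- Ev in G'.
      set (r := dot (qv q) (psub (qB q) (qA q))) in *. set (r' := dot (qv q) (psub (qB p) (qA q))) in *.
      exists (r' - r). rewrite G, G'. pt_eq. }
  destruct EB as [EB Eb].
  assert (Ew1 : qw1 p = qw1 q) by (unfold qw1; congruence).
  assert (Ew2 : qw2 p = qw2 q) by (unfold qw2; congruence).
  assert (EC : qC p = qC q /\ qc p = qc q).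
  { apply (exit_eq O2 _ _ _ _ (qw1 q)).
    - now apply outer_smooth with O1.
    - split; [apply Hq | now apply quad_AC_pos].
    - split; [apply Hp | rewrite <- Ew1; now apply quad_AC_pos].
    - assert (G := quad_AC q Hq). assert (G' := quad_AC p Hp). rewrite <- EA, Ew1 in G'.
      set (r := dot (qw1 q) (psub (qC q) (qA q))) in *. set (r' := dot (qw1 q) (psub (qC p) (qA q))) in *.
      exists (r' - r). rewrite G, G'. pt_eq. }
  destruct EC as [EC Ec].
  assert (Ev1 : qv1 p = qv1 q) by (unfold qv1; congruence).
  assert (ED : qD p = qD q).
  { assert (Hne := quad_w2_neq_v1 q Hq Hn).
    (* Twice this pairing is the squared length of the difference, both directions being units. *)
    assert (Pos : 0 < dot (psub (qw2 q) (qv1 q)) (qw2 q)).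
    { assert (U2 := quad_uw2 q Hq). assert (U1 := quad_uv1 q Hq).
      assert (P : 0 < dot (psub (qw2 q) (qv1 q)) (psub (qw2 q) (qv1 q))).
      { destruct (dot_self_ge0 (psub (qw2 q) (qv1 q))) as [|E]; auto. exfalso. apply Hne, dist2_eq0.
        unfold dist2, norm2. rewrite <- E. apply sqrt_0. }
      replace (dot (psub (qw2 q) (qv1 q)) (psub (qw2 q) (qv1 q))) with (2 * dot (psub (qw2 q) (qv1 q)) (qw2 q) + (dot (qv1 q) (qv1 q) - dot (qw2 q) (qw2 q))) in P
        by pt_eq.
      rewrite U1, U2 in P. lra. }
    assert (G := quad_BD q Hq). assert (G' := quad_BD p Hp). rewrite EB, Ew2 in G'.
    set (r := dot (qw2 q) (psub (qD q) (qB q))) in *. set (r' := dot (qw2 q) (psub (qD p) (qB q))) in *.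
    assert (S1 : dot (psub (qw2 q) (qv1 q)) (psub (qD p) (qD q)) <= 0) by (apply Hq; apply Hp).
    assert (S2 : dot (psub (qw2 q) (qv1 q)) (psub (qD q) (qD p)) <= 0). { rewrite <- Ew2, <- Ev1. apply Hp; apply Hq. }
    assert (E12 : psub (qD p) (qD q) = pscale (r' - r) (qw2 q)) by (rewrite G, G'; pt_eq).
    assert (E21 : psub (qD q) (qD p) = pscale (- (r' - r)) (qw2 q)) by (rewrite G, G'; pt_eq).
    rewrite E12 in S1. rewrite E21 in S2. generalize dependent (psub (qw2 q) (qv1 q)). intros u Pos S1 S2.
    replace (dot u (pscale (r' - r) (qw2 q))) with ((r' - r) * dot u (qw2 q)) in S1 by pt_eq.
    replace (dot u (pscale (- (r' - r)) (qw2 q))) with (- (r' - r) * dot u (qw2 q)) in S2 by pt_eq.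
    assert (r' - r = 0) by nra. rewrite G, G'. replace r' with r by lra. reflexivity. }
  destruct q, p; cbn in *; congruence.
Qed.

(** If [O1] lay on one side of the reflected line, so would a tangent ray from [B]; reflected back
    by [outer_bisecting], this keeps the original line from entering the open side of the tangent
    ray [e], where the interior lies. *)
Lemma crosses_refl B b v : nrm O2 B b -> unit_pt v -> 0 < dot b v -> crosses O1 B v -> crosses O1 B (refl b v).
Proof.
  intros HB Hv Hbv [s Hs]. apply NNPP. intros Hn.
  assert (Hb : unit_pt b) by apply HB.
  assert (Hneg := ray_meets_pos O1 O2 HS B b v s HB Hbv (interior_in _ _ Hs)).
  assert (K : forall sg, sg * sg = 1 -> (forall Y, O1 Y -> sg * cross (refl b v) (psub Y B) <= 0) -> False).
  { intros sg Hsg Hside. destruct (tangent_ray_exists O1 O2 HS B b (- sg) HB) as [e He].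
    assert (Hf := outer_bisecting O1 O2 HS B b HB (- sg) e ltac:(lra) He).
    destruct Hf as (_ & (k & Hk & Of) & _). specialize (Hside _ Of).
    replace (refl b v) with (mirror b (pscale (-1) v)) in Hside by (unfold mirror; pt_eq).
    replace (cross (mirror b (pscale (-1) v)) (psub (padd B (pscale k (mirror b e))) B)) with (k * cross (mirror b (pscale (-1) v)) (mirror b e)) in Hside
      by pt_eq.
    rewrite mirror_cross in Hside by auto.
    destruct He as (Ue & _ & He).
    assert (Hsup : supp O1 B (pscale (- sg) (perp e))).
    { intros Y HY. specialize (He Y HY). replace (dot (pscale (- sg) (perp e)) (psub Y B)) with (- sg * cross e (psub Y B)) by pt_eq. exact He. }
    assert (U : unit_pt (pscale (- sg) (perp e))).
    { unfold unit_pt. replace (dot (pscale (- sg) (perp e)) (pscale (- sg) (perp e))) with (sg * sg * dot e e) by pt_eq. rewrite Hsg, Ue; ring. }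
    assert (E := supp_int O1 _ B _ Hs U Hsup).
    replace (dot (pscale (- sg) (perp e)) (psub (padd B (pscale s v)) B)) with (- sg * s * cross e v) in E by pt_eq.
    replace (cross (pscale (-1) v) e) with (cross e v) in Hside by pt_eq.
    assert (A : 0 <= sg * cross e v) by nra. nra. }
  destruct (side_of_line O1 H1 B (refl b v)) as [H|H]; auto.
  - now apply refl_unit.
  - apply (K (-1)); [lra|]. intros Y HY. specialize (H Y HY). lra.
  - apply (K 1); [lra|]. intros Y HY. specialize (H Y HY). lra.
Qed.

(** Here commutation closes the quadrilateral. The two compositions lead to the lines [(C, v1)] and
    [(D, refl m w2)]; their equality gives [refl m w2 = v1] and puts [D] on the line through [C].
    Smoothness at [A] and [D] is what makes the inner billiard defined on the lines involved. *)
Lemma quad_of_smooth A n B b D m v r s : unit_pt v -> exitp O1 A n v -> smooth O1 A -> exitp O2 B b v -> B = padd A (pscale r v) ->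
  exitp O1 D m (refl b v) -> D = padd B (pscale s (refl b v)) -> smooth O1 D ->
  exists C c, quad (Build_cfg A n B b C c D v).
Proof.
  intros Hv HA HsA HB EB HD ED HsD.
  assert (Un : unit_pt n) by apply HA. assert (Ub : unit_pt b) by apply HB. assert (Um : unit_pt m) by apply HD.
  set (w1 := refl n v). assert (Uw1 : unit_pt w1) by now apply refl_unit.
  set (w2 := refl b v) in *. assert (Uw2 : unit_pt w2) by now apply refl_unit.
  destruct (exit_exists O2 H2 A w1) as (t & c & HC).
  { now apply unit_nz. }
  { exists 0. replace (padd A (pscale 0 w1)) with A by pt_eq. apply (inner_interior O1 O2 HS), HA. }
  set (C := padd A (pscale t w1)) in *. set (v1 := refl c w1).
  assert (Uc : unit_pt c) by apply HC.
  assert (Uv1 : unit_pt v1) by now apply refl_unit.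
  assert (B1 : billiard O1 (A, v) (A, w1)).
  { apply (billiard_hit O1 H1 A v 0); auto. pt_eq. }
  assert (B2 : billiard O2 (A, w1) (C, v1)).
  { apply (billiard_hit O2 H2 A w1 t); auto. now apply outer_smooth with O1. }
  assert (B3 : billiard O2 (A, v) (B, w2)).
  { apply (billiard_hit O2 H2 A v r); auto. now apply outer_smooth with O1. }
  assert (B4 : billiard O1 (B, w2) (D, refl m w2)).
  { apply (billiard_hit O1 H1 B w2 s); auto. }
  assert (Hcom : billiards_commute O1 O2) by apply HS.
  destruct (Hcom _ _ _ _ _ B1 B2 B3 B4) as (_ & _ & Ecr & k & Hk & Ek). cbn [fst snd] in Ecr, Ek.
  assert (Ev1 : refl m w2 = v1).
  { apply (pscale_unit_inj 1 k); auto; try lra. { now apply refl_unit. } rewrite <- Ek. pt_eq. }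
  assert (Rb : dot b w2 = - dot b v) by (rewrite dot_sym; unfold w2; rewrite refl_dot by auto; now rewrite dot_sym).
  assert (Rc : dot c v1 = - dot c w1) by (rewrite dot_sym; unfold v1; rewrite refl_dot by auto; now rewrite dot_sym).
  exists C, c. unfold quad, qw2, qv1, qw1; cbn.
  fold w1 w2 v1.
  split; [apply HA|]. split; [apply HB|]. split; [apply HC|]. split; [apply HD|]. split; auto.
  split; [apply Rlt_le, HA|].
  split; [|split; [|split; [|split]]].
  - rewrite EB. apply along_intro; auto.
    assert (E := inner_lt O1 O2 HS B b A (proj1 HB) (proj1 (proj1 HA))). rewrite EB in E.
    replace (dot b (psub A (padd A (pscale r v)))) with (- r * dot b v) in E by pt_eq.
    destruct HB as [_ HB]. nra.
  - apply along_intro; auto.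
    assert (E := inner_lt O1 O2 HS C c A (proj1 HC) (proj1 (proj1 HA))). unfold C in E.
    replace (dot c (psub A (padd A (pscale t w1)))) with (- t * dot c w1) in E by pt_eq.
    destruct HC as [_ HC]. nra.
  - rewrite ED. apply along_intro; auto.
    assert (E := inner_lt O1 O2 HS B b D (proj1 HB) (proj1 (proj1 HD))). rewrite ED in E.
    replace (dot b (psub (padd B (pscale s w2)) B)) with (s * dot b w2) in E by pt_eq.
    destruct HB as [_ HB]. nra.
  - assert (Ecr' : cross v1 (psub D C) = 0).
    { replace (cross v1 (psub D C)) with (- cross (psub D C) v1) by pt_eq. rewrite Ecr; ring. }
    split; auto.
    assert (E := inner_lt O1 O2 HS C c D (proj1 HC) (proj1 (proj1 HD))).
    rewrite (decomp v1 (psub D C) Uv1), Ecr' in E.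
    replace (dot c (padd (pscale (dot v1 (psub D C)) v1) (pscale 0 (perp v1)))) with (dot v1 (psub D C) * dot c v1) in E by pt_eq.
    destruct HC as [_ HC]. nra.
  (* [w2 - v1] is the multiple [2 * dot w2 m] of the outward normal at [D], which is why [quad] lets
     it stand for that normal. *)
  - rewrite <- Ev1. intros Y HY. unfold refl at 1.
    replace (psub w2 (psub w2 (pscale (2 * dot w2 m) m))) with (pscale (2 * dot w2 m) m) by pt_eq.
    replace (dot (pscale (2 * dot w2 m) m) (psub Y D)) with (2 * dot m w2 * dot m (psub Y D)) by pt_eq.
    destruct HD as [(_ & _ & HD) HD2]. specialize (HD Y HY). nra.
Qed.

(** Turning the line about [B] moves both [qA] and [qD] through pairwise distinct points, so both
    eventually avoid the corners of [O1]; the shift [K] discards the initial indices. *)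
Lemma quads_near B b v sg : nrm O2 B b -> unit_pt v -> 0 < dot b v -> crosses O1 B v -> sg * sg = 1 ->
  exists K u, (forall k, quad (u k) /\ qB (u k) = B /\ qb (u k) = b /\ qv (u k) = rot (sg * tk (K + k)) v /\
     smooth O1 (qA (u k)) /\ smooth O1 (qD (u k)) /\ 0 < dot (qn (u k)) (qv (u k))) /\
     (forall i j, qA (u i) = qA (u j) -> i = j) /\ (forall i j, qD (u i) = qD (u j) -> i = j).
Proof.
  intros HB Hv Hbv Hcr Hsg.
  assert (Hb : unit_pt b) by apply HB.
  set (vk := fun k => rot (sg * tk k) v).
  assert (Hvk : pconv vk v) by apply pconv_rot, lim_sg_tk.
  assert (Hwk : pconv (fun k => refl b (vk k)) (refl b v)) by (apply pconv_refl; auto; apply pconv_const).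
  assert (Hu : forall k, unit_pt (vk k)) by (intros; now apply rot_unit).
  destruct (crosses_open O1 B v vk Hvk Hcr) as [N1 HN1].
  destruct (crosses_open O1 B (refl b v) _ Hwk (crosses_refl B b v HB Hv Hbv Hcr)) as [N2 HN2].
  destruct (lim_eventually_gt (fun k => dot b (vk k)) (dot b v) 0) as [N3 HN3]; auto.
  { apply lim_dot; auto. apply pconv_const. }
  set (N := Nat.max N1 (Nat.max N2 N3)).
  assert (SA : forall k, exists tm : R * pt, (N <= k)%nat -> exitp O1 (padd B (pscale (fst tm) (vk k))) (snd tm) (vk k)).
  { intros k. destruct (classic (N <= k)%nat) as [Hk|Hk]; [|now exists (0, v)].
    destruct (exit_exists O1 H1 B (vk k)) as (t & m & H); [apply unit_nz; auto | apply HN1; lia | now exists (t, m)]. }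
  assert (SD : forall k, exists tm : R * pt, (N <= k)%nat -> exitp O1 (padd B (pscale (fst tm) (refl b (vk k)))) (snd tm) (refl b (vk k))).
  { intros k. destruct (classic (N <= k)%nat) as [Hk|Hk]; [|now exists (0, v)].
    destruct (exit_exists O1 H1 B (refl b (vk k))) as (t & m & H); [apply unit_nz, refl_unit; auto | apply HN2; lia | now exists (t, m)]. }
  destruct (choice_seq _ SA) as [ta Hta]. destruct (choice_seq _ SD) as [td Htd].
  set (XA := fun k => padd B (pscale (fst (ta k)) (vk k))) in *.
  set (XD := fun k => padd B (pscale (fst (td k)) (refl b (vk k)))) in *.
  assert (IA : forall i j, (N <= i)%nat -> (N <= j)%nat -> XA i = XA j -> i = j).
  { apply (exits_distinct O1 O2 HS B b vk XA (fun k => fst (ta k)) sg v N); auto.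
    - intros i Hi. split; auto. apply (Hta i Hi).
    - intros. unfold vk. now apply rot_cross_abs. }
  assert (ID : forall i j, (N <= i)%nat -> (N <= j)%nat -> XD i = XD j -> i = j).
  { apply (exits_distinct O1 O2 HS B b (fun k => refl b (vk k)) XD (fun k => fst (td k)) sg v N); auto.
    - intros i Hi. split; auto. apply (Htd i Hi).
    - intros. unfold vk. now apply rot_refl_cross_abs. }
  assert (HF : finitely_nonsmooth O1) by apply HS. destruct HF as [L HL].
  destruct (eventually_not_in L XA N IA) as [NA HNA]. destruct (eventually_not_in L XD N ID) as [ND HND].
  set (K := Nat.max N (Nat.max NA ND)).
  assert (SQ : forall k, exists q, quad q /\ qB q = B /\ qb q = b /\ qv q = vk (K + k)%nat /\ qA q = XA (K + k)%nat /\ qD q = XD (K + k)%nat /\ qn q = snd (ta (K + k)%nat)).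
  { intros k. set (j := (K + k)%nat). assert (Hj : (K <= j)%nat) by lia.
    assert (EA := Hta j ltac:(lia)). assert (ED := Htd j ltac:(lia)).
    destruct (quad_of_smooth (XA j) (snd (ta j)) B b (XD j) (snd (td j)) (vk j) (- fst (ta j)) (fst (td j))) as (C & c & HQ); auto.
    - apply (HL _ (snd (ta j))); [apply EA | apply HNA; lia].
    - split; auto. apply HN3. lia.
    - unfold XA. pt_eq.
    - apply (HL _ (snd (td j))); [apply ED | apply HND; lia].
    - exists (Build_cfg (XA j) (snd (ta j)) B b C c (XD j) (vk j)). repeat split; auto; apply HQ. }
  destruct (choice_seq _ SQ) as [u Hq].
  exists K, u. split; [|split].
  - intros k. destruct (Hq k) as (Q & EB & Eb & Ev & EA & ED & En).
    split; auto. split; auto. split; auto. split; auto. rewrite EA, ED, En, Ev.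
    assert (FA := Hta (K + k)%nat ltac:(lia)). assert (FD := Htd (K + k)%nat ltac:(lia)).
    split; [|split].
    + apply (HL _ (snd (ta (K + k)%nat))); [apply FA | apply HNA; lia].
    + apply (HL _ (snd (td (K + k)%nat))); [apply FD | apply HND; lia].
    + apply FA.
  - intros i j E. destruct (Hq i) as (_ & _ & _ & _ & EA & _). destruct (Hq j) as (_ & _ & _ & _ & EA' & _).
    assert (K + i = K + j)%nat by (apply IA; try lia; congruence). lia.
  - intros i j E. destruct (Hq i) as (_ & _ & _ & _ & _ & ED & _). destruct (Hq j) as (_ & _ & _ & _ & _ & ED' & _).
    assert (K + i = K + j)%nat by (apply ID; try lia; congruence). lia.
Qed.

Lemma inc_add K : inc (fun k => (K + k)%nat).
Proof. intros i j; lia. Qed.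

(** [qD] may fall on a corner, where commutation says nothing directly. The quadrilateral is
    obtained as a limit of those of [quads_near], and smoothness at [A] identifies the limit normal
    with [n]. *)
Lemma quad_exists A n v : nrm O1 A n -> smooth O1 A -> unit_pt v -> 0 < dot n v ->
  exists q, quad q /\ qA q = A /\ qn q = n /\ qv q = v.
Proof.
  intros HA HsA Hv Hnv.
  destruct (exit_exists O2 H2 A v) as (r & b & HB).
  { now apply unit_nz. }
  { exists 0. replace (padd A (pscale 0 v)) with A by pt_eq. apply (inner_interior O1 O2 HS), HA. }
  set (B := padd A (pscale r v)) in *.
  assert (Hcr : crosses O1 B v).
  { destruct (smooth_inner O1 H1 A n (pscale (-1) v) HA HsA) as (s0 & Hs0 & Hin).
    { replace (dot n (pscale (-1) v)) with (- dot n v) by pt_eq. lra. }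
    exists (- r - s0). replace (padd B (pscale (- r - s0) v)) with (padd A (pscale s0 (pscale (-1) v))) by (unfold B; pt_eq).
    apply Hin; lra. }
  destruct (quads_near B b v 1 (proj1 HB) Hv (proj2 HB) Hcr ltac:(lra)) as (K & u & Hu & _).
  destruct (quad_compact u) as (phi & q & Hp & Hc & HQ). { intros; apply Hu. }
  assert (EB : qB q = B).
  { apply (pconv_uniq (fun k => qB (u (phi k)))); [apply Hc|].
    apply (pconv_squeeze _ _ (fun _ => 0)); [apply is_lim_seq_const|].
    intros k. destruct (Hu (phi k)) as (_ & E & _). rewrite E, dist2_refl. lra. }
  assert (Ev : qv q = v).
  { apply (pconv_uniq (fun k => qv (u (phi k)))); [apply Hc|].
    assert (L : pconv (fun k => rot (1 * tk k) v) v) by apply pconv_rot, lim_sg_tk.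
    apply (pconv_sub _ _ _ (inc_comp _ _ (inc_add K) Hp)) in L.
    apply (pconv_squeeze _ _ (fun k => dist2 (rot (1 * tk (K + phi k)) v) v)).
    - now apply pconv_dist in L.
    - intros k. destruct (Hu (phi k)) as (_ & _ & _ & E & _). rewrite E. lra. }
  assert (Hex : exitp O1 (qA q) (qn q) (qv q)).
  { apply quad_exit; auto. now rewrite EB, Ev. }
  rewrite Ev in Hex.
  destruct (exit_eq O1 A n (qA q) (qn q) v) as [EA En]; auto.
  - now split.
  - assert (G := quad_AB q HQ). rewrite EB, Ev in G. set (t := dot v (psub B (qA q))) in *.
    exists (r - t). unfold B in G. transitivity (padd (padd A (pscale r v)) (pscale (- t) v)).
    + rewrite G. pt_eq.
    + pt_eq.
  - exists q. repeat split; auto; apply HQ.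
Qed.

End Quads.

(** * The excess of a quadrilateral *)

Lemma refl_lipschitz n n' v v' : unit_pt n -> unit_pt n' -> unit_pt v' ->
  norm2 (psub (refl n v) (refl n' v')) <= norm2 (psub v v') + 4 * norm2 (psub n n').
Proof.
  intros Hn Hn' Hv'.
  replace (psub (refl n v) (refl n' v')) with (padd (refl n (psub v v'))
     (padd (pscale (2 * dot v' n') (psub n' n)) (pscale (2 * dot v' (psub n' n)) n))) by pt_eq.
  eapply Rle_trans; [apply norm2_add|].
  assert (E : norm2 (refl n (psub v v')) = norm2 (psub v v')).
  { unfold norm2. f_equal. generalize (psub v v'); intros d.
    replace (dot (refl n d) (refl n d)) with (dot d d + 4 * dot d n * dot d n * (dot n n - 1)) by pt_eq. rewrite Hn; ring. }
  rewrite E. apply Rplus_le_compat_l. eapply Rle_trans; [apply norm2_add|]. rewrite !norm2_scale, (norm2_sub_sym n n').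
  rewrite (norm2_unit n Hn). rewrite !Rabs_mult, (Rabs_pos_eq 2) by lra.
  assert (C1 := cauchy_schwarz v' n'). assert (C2 := cauchy_schwarz v' (psub n' n)).
  rewrite (norm2_unit v' Hv') in C1, C2. rewrite (norm2_unit n' Hn') in C1.
  assert (P := norm2_ge0 (psub n' n)). nra.
Qed.

Lemma sin_abs_le x : Rabs (sin x) <= Rabs x.
Proof.
  destruct (Rtotal_order x 0) as [H|[H|H]].
  - rewrite (Rabs_left x) by auto. assert (E := sin_lt_x (- x) ltac:(lra)). rewrite sin_neg in E.
    apply Rabs_le. split; [lra|]. destruct (Rle_dec x (-1)).
    + assert (B := SIN_bound x). lra.
    + assert (sin x < 0) by (apply sin_lt_0_var; assert (P := PI2_1); lra). lra.
  - subst. rewrite sin_0. lra.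
  - rewrite (Rabs_pos_eq x) by lra. assert (E := sin_lt_x x H). apply Rabs_le. split; [|lra].
    destruct (Rle_dec 1 x).
    + assert (B := SIN_bound x). lra.
    + assert (0 < sin x) by (apply sin_gt_0; assert (P := PI2_1); lra). lra.
Qed.

Lemma rot_lipschitz x y v : unit_pt v -> norm2 (psub (rot x v) (rot y v)) <= Rabs (x - y).
Proof.
  intros Hv. apply norm2_le; [apply Rabs_pos|].
  assert (E : dot (psub (rot x v) (rot y v)) (psub (rot x v) (rot y v)) = 4 * (sin ((x - y) / 2) * sin ((x - y) / 2))).
  { replace (dot (psub (rot x v) (rot y v)) (psub (rot x v) (rot y v)))
      with ((Rsqr (sin x) + Rsqr (cos x) + (Rsqr (sin y) + Rsqr (cos y)) - 2 * (cos x * cos y + sin x * sin y)) * dot v v)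
      by (unfold Rsqr; pt_eq).
    rewrite !sin2_cos2, Hv, <- cos_minus. replace (x - y) with (2 * ((x - y) / 2)) at 1 by field.
    rewrite cos_2a_sin. ring. }
  rewrite E. assert (H := sin_abs_le ((x - y) / 2)).
  assert (H0 := Rabs_pos (sin ((x - y) / 2))).
  replace (sin ((x - y) / 2) * sin ((x - y) / 2)) with (Rabs (sin ((x - y) / 2)) * Rabs (sin ((x - y) / 2)))
    by (rewrite <- Rabs_mult; apply Rabs_pos_eq, Rle_0_sqr).
  assert (Rabs ((x - y) / 2) = Rabs (x - y) / 2).
  { unfold Rdiv. rewrite Rabs_mult, (Rabs_pos_eq (/ 2)); lra. }
  rewrite H1 in H. nra.
Qed.

(** A unit vector can only change to second order along itself; this makes the contribution of the
    turning sides to the excess quadratic. *)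
Lemma dot_unit_diff v v' : unit_pt v -> unit_pt v' -> dot v (psub v' v) = - (norm2 (psub v' v) * norm2 (psub v' v)) / 2.
Proof.
  intros Hv Hv'. rewrite norm2_sq.
  replace (dot (psub v' v) (psub v' v)) with (dot v' v' - dot v v - 2 * dot v (psub v' v)) by pt_eq.
  rewrite Hv, Hv'. field.
Qed.

(** Side lengths are written as pairings with unit directions, so that [excess_dual] can regroup
    them by vertices. *)
Definition excess (q : cfg) : R :=
  dot (qv q) (psub (qB q) (qA q)) + dot (qw2 q) (psub (qD q) (qB q))
  - dot (qw1 q) (psub (qC q) (qA q)) - dot (qv1 q) (psub (qD q) (qC q)).

(** Envelope estimate: the support value [dot u X] varies with [u] as if [X] were fixed, up to the
    product of the two displacements. *)
Lemma support_increment X u X' u' : dot u (psub X' X) <= 0 -> dot u' (psub X X') <= 0 ->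
  0 <= dot u' X' - dot u X - dot (psub u' u) X <= norm2 (psub X' X) * norm2 (psub u' u).
Proof.
  intros H H'. split.
  - replace (dot u' X' - dot u X - dot (psub u' u) X) with (- dot u' (psub X X')) by pt_eq. lra.
  - replace (dot u' X' - dot u X - dot (psub u' u) X) with (dot (psub X' X) (psub u' u) + dot u (psub X' X)) by pt_eq.
    assert (E := dot_le (psub X' X) (psub u' u)). lra.
Qed.

(** * Lipschitz dependence of quadrilaterals on the line, and constancy of the excess *)

Section Excess.
Variables O1 O2 : pt -> Prop.
Hypothesis HS : commuting_pair O1 O2.
Let H1 := cv1 O1 O2 HS.
Let H2 := cv2 O1 O2 HS.
Notation quad := (quad O1 O2).

(** Each ray contains a point of [O1] at distance at least [ka], which lies on the allowed side of
    the other ray; hence [ka * Rabs (cross e e')] is at most [d]. This controls the distance of [e]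
    and [e'] as long as their angle is not obtuse. *)
Lemma tangent_ray_lipschitz : exists K, 0 <= K /\ forall B b B' b' sg e e', sg * sg = 1 -> nrm O2 B b -> nrm O2 B' b' ->
  tangent_ray O1 sg B e -> tangent_ray O1 sg B' e' -> norm2 (psub e e') <= K * dist2 B B'.
Proof.
  destruct (inner_gap_normal O1 O2 HS) as (ka & Hka & Hgap).
  destruct (dom_bound O2 H2) as (M & HM0 & HM).
  destruct (dom_int O1 H1) as [c Hc]. destruct (interior_ball O1 c Hc) as (r & Hr & Hball).
  exists (2 / ka + 2 * (1 + 2 * M / ka) / r).
  assert (P1 : 0 < 2 / ka) by (apply Rdiv_lt_0_compat; lra).
  assert (P2 : 0 < 2 * M / ka) by (apply Rdiv_lt_0_compat; lra).
  assert (P3 : 0 < 2 * (1 + 2 * M / ka) / r) by (apply Rdiv_lt_0_compat; lra).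
  split; [lra|].
  intros B b B' b' sg e e' Hsg HB HB' (Ue & (k & Hk & Oe) & He) (Ue' & (k' & Hk' & Oe') & He').
  assert (Hd := norm2_ge0 (psub B B')). fold (dist2 B B') in Hd. set (d := dist2 B B') in *.
  assert (Sg := sign_cases sg Hsg).
  assert (Kk : forall B b e k, nrm O2 B b -> unit_pt e -> 0 < k -> O1 (padd B (pscale k e)) -> ka <= k).
  { clear - Hgap. intros B b e k HB He Hk HO. specialize (Hgap B b _ HB HO).
    replace (dot b (psub (padd B (pscale k e)) B)) with (k * dot b e) in Hgap by pt_eq.
    assert (C := cauchy_schwarz b e). rewrite (norm2_unit b), (norm2_unit e) in C by (apply He || apply HB).
    apply Rabs_le_between in C. nra. }
  assert (Lk := Kk _ _ _ _ HB Ue Hk Oe). assert (Lk' := Kk _ _ _ _ HB' Ue' Hk' Oe').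
  assert (Cd : forall f, unit_pt f -> Rabs (cross f (psub B B')) <= d).
  { intros f Hf. assert (C := cross_le f (psub B B')). rewrite (norm2_unit f Hf) in C. unfold d, dist2. lra. }
  set (x := sg * cross e e').
  assert (X1 : - k * x <= d).
  { assert (A := He' _ Oe). replace (sg * cross e' (psub (padd B (pscale k e)) B')) with (sg * cross e' (psub B B') - k * x) in A by (unfold x; pt_eq).
    assert (C := Cd e' Ue'). apply Rabs_le_between in C. destruct Sg; subst sg; lra. }
  assert (X2 : k' * x <= d).
  { assert (A := He _ Oe'). replace (sg * cross e (psub (padd B' (pscale k' e')) B)) with (- (sg * cross e (psub B B')) + k' * x) in A by (unfold x; pt_eq).
    assert (C := Cd e Ue). apply Rabs_le_between in C. destruct Sg; subst sg; lra. }
  assert (X : ka * Rabs x <= d).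
  { unfold Rabs; destruct (Rcase_abs x); nra. }
  assert (Sq : dot e e' * dot e e' + x * x = 1).
  { unfold x. replace (dot e e' * dot e e' + sg * cross e e' * (sg * cross e e')) with (dot e e' * dot e e' + (sg * sg) * (cross e e' * cross e e')) by ring.
    rewrite Hsg. replace (dot e e' * dot e e' + 1 * (cross e e' * cross e e')) with (dot e e * dot e' e') by pt_eq. rewrite Ue, Ue'. ring. }
  assert (Nsq : dot (psub e e') (psub e e') = 2 - 2 * dot e e').
  { replace (dot (psub e e') (psub e e')) with (dot e e + dot e' e' - 2 * dot e e') by pt_eq. rewrite Ue, Ue'. ring. }
  assert (Xa : Rabs x * Rabs x = x * x) by (rewrite <- Rabs_mult; apply Rabs_pos_eq, Rle_0_sqr).
  assert (Hx0 := Rabs_pos x).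
  assert (Hxd : Rabs x <= d / ka). { apply (Rmult_le_reg_l ka); auto. replace (ka * (d / ka)) with d by (field; lra). exact X. }
  assert (D0 : 0 <= d / ka) by (apply Rmult_le_pos; [lra | apply Rlt_le, Rinv_0_lt_compat; lra]).
  destruct (Rle_dec 0 (dot e e')) as [Hp|Hp].
  - apply Rle_trans with (2 / ka * d).
    + replace (2 / ka * d) with (2 * (d / ka)) by (field; lra). apply norm2_le; [lra|]. rewrite Nsq. nra.
    + apply Rmult_le_compat_r; lra.
  (* For an obtuse angle, both rays still have the ball about [c] on the same side, which forces [d]
     to be at least a fixed multiple of [r]; the trivial bound 2 then suffices. *)
  - apply Rnot_le_lt in Hp.
    assert (Ball : forall B e, unit_pt e -> (forall Y, O1 Y -> sg * cross e (psub Y B) <= 0) -> sg * cross e (psub c B) <= - r).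
    { intros Z f Uf Hf.
      assert (Hsup : supp O1 Z (pscale sg (perp f))).
      { intros Y HY. specialize (Hf Y HY). replace (dot (pscale sg (perp f)) (psub Y Z)) with (sg * cross f (psub Y Z)) by pt_eq. exact Hf. }
      assert (U : unit_pt (pscale sg (perp f))).
      { unfold unit_pt. replace (dot (pscale sg (perp f)) (pscale sg (perp f))) with (sg * sg * dot f f) by pt_eq. rewrite Hsg, Uf; ring. }
      assert (E := supp_ball O1 c r Z _ U Hsup ltac:(lra) Hball).
      replace (dot (pscale sg (perp f)) (psub c Z)) with (sg * cross f (psub c Z)) in E by pt_eq. exact E. }
    assert (Be := Ball B e Ue He). assert (Be' := Ball B' e' Ue' He').
    assert (Ed := decomp e e' Ue).
    assert (E1 : sg * cross e' (psub c B) = dot e e' * (sg * cross e (psub c B)) + x * cross (perp e) (psub c B)).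
    { unfold x. rewrite Ed at 1. pt_eq. }
    assert (E2 : sg * cross e' (psub c B) = sg * cross e' (psub c B') - sg * cross e' (psub B B')) by pt_eq.
    assert (C1 := Cd e' Ue'). apply Rabs_le_between in C1.
    assert (C2 := cross_le (perp e) (psub c B)). rewrite (norm2_unit (perp e)) in C2 by now apply perp_unit.
    assert (C3 := norm2_sub c B). assert (C4 := HM c (inner_in O1 O2 HS c (interior_in _ _ Hc))). assert (C5 := HM B (proj1 HB)).
    assert (C6 : Rabs (x * cross (perp e) (psub c B)) <= Rabs x * (2 * M)) by (rewrite Rabs_mult; apply Rmult_le_compat_l; lra).
    apply Rabs_le_between in C6.
    assert (E3 : r <= d + Rabs x * (2 * M)) by (destruct Sg; subst sg; nra).
    assert (E4 : r <= d * (1 + 2 * M / ka)).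
    { replace (d * (1 + 2 * M / ka)) with (d + d / ka * (2 * M)) by (field; lra). nra. }
    apply Rle_trans with (2 * (1 + 2 * M / ka) / r * d).
    + apply Rle_trans with 2.
      * apply norm2_le; [lra|]. rewrite Nsq. nra.
      * apply (Rmult_le_reg_r r); auto. replace (2 * (1 + 2 * M / ka) / r * d * r) with (2 * (d * (1 + 2 * M / ka))) by (field; lra). lra.
    + apply Rmult_le_compat_r; lra.
Qed.

(** By [mirror_sum], [pscale a b] is minus the sum of two tangent rays, each Lipschitz in [B]. The
    length [a] is at least [ka / M], because a point of [O1] on the ray has depth at least [ka] and
    distance at most [2 * M]. *)
Lemma outer_normal_lipschitz : exists K, 0 <= K /\ forall B b B' b', nrm O2 B b -> nrm O2 B' b' ->
  norm2 (psub b b') <= K * dist2 B B'.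
Proof.
  destruct tangent_ray_lipschitz as (K & HK & Hlip).
  destruct (inner_gap_normal O1 O2 HS) as (ka & Hka & Hgap).
  destruct (dom_bound O2 H2) as (M & HM0 & HM).
  assert (Pk : 0 < M / ka) by (apply Rdiv_lt_0_compat; lra).
  exists (4 * K * (M / ka)). split; [nra|].
  intros B b B' b' HB HB'.
  destruct (tangent_ray_exists O1 O2 HS B b 1 HB) as [e He]. destruct (tangent_ray_exists O1 O2 HS B' b' 1 HB') as [e' He'].
  assert (Hm := outer_bisecting O1 O2 HS B b HB 1 e ltac:(lra) He).
  assert (Hm' := outer_bisecting O1 O2 HS B' b' HB' 1 e' ltac:(lra) He').
  assert (L1 := Hlip B b B' b' 1 e e' ltac:(lra) HB HB' He He').
  assert (L2 := Hlip B b B' b' (-(1)) _ _ ltac:(lra) HB HB' Hm Hm').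
  assert (Ub : unit_pt b) by apply HB. assert (Ub' : unit_pt b') by apply HB'.
  assert (S1 := mirror_sum b e Ub). assert (S2 := mirror_sum b' e' Ub').
  set (d := dist2 B B') in *. assert (Hd : 0 <= d) by apply norm2_ge0.
  set (a := - (2 * dot b e)). set (a' := - (2 * dot b' e')).
  assert (Hs : norm2 (psub (pscale a b) (pscale a' b')) <= 2 * K * d).
  { replace (psub (pscale a b) (pscale a' b')) with (pscale (-1) (padd (psub e e') (psub (mirror b e) (mirror b' e')))).
    - rewrite norm2_scale, Rabs_left by lra. assert (T := norm2_add (psub e e') (psub (mirror b e) (mirror b' e'))). lra.
    - replace (padd (psub e e') (psub (mirror b e) (mirror b' e'))) with (psub (padd e (mirror b e)) (padd e' (mirror b' e')))
        by pt_eq.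
      rewrite S1, S2. unfold a, a'. pt_eq. }
  assert (Low : forall Z z f, nrm O2 Z z -> tangent_ray O1 1 Z f -> ka / M <= - (2 * dot z f)).
  { intros Z z f HZ (Uf & (k & Hk & Of) & _). assert (G := Hgap Z z _ HZ Of).
    replace (dot z (psub (padd Z (pscale k f)) Z)) with (k * dot z f) in G by pt_eq.
    assert (Kb : k <= 2 * M).
    { assert (T := norm2_sub (padd Z (pscale k f)) Z). replace (psub (padd Z (pscale k f)) Z) with (pscale k f) in T by pt_eq.
      rewrite norm2_scale, (norm2_unit f Uf), Rabs_pos_eq in T by lra.
      assert (T1 := HM Z (proj1 HZ)). assert (T2 := HM _ (inner_in O1 O2 HS _ Of)). lra. }
    apply (Rmult_le_reg_r M); auto. replace (ka / M * M) with ka by (field; lra). nra. }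
  assert (La := Low B b e HB He). assert (La' := Low B' b' e' HB' He'). fold a in La. fold a' in La'.
  assert (Pm : 0 < ka / M) by (apply Rdiv_lt_0_compat; lra).
  assert (Da : Rabs (a - a') <= norm2 (psub (pscale a b) (pscale a' b'))).
  { assert (N1 : norm2 (pscale a b) = a) by (rewrite norm2_scale, (norm2_unit b Ub), Rabs_pos_eq; lra).
    assert (N2 : norm2 (pscale a' b') = a') by (rewrite norm2_scale, (norm2_unit b' Ub'), Rabs_pos_eq; lra).
    assert (T1 := norm2_add (psub (pscale a b) (pscale a' b')) (pscale a' b')).
    replace (padd (psub (pscale a b) (pscale a' b')) (pscale a' b')) with (pscale a b) in T1 by pt_eq.
    assert (T2 := norm2_add (psub (pscale a' b') (pscale a b)) (pscale a b)).
    replace (padd (psub (pscale a' b') (pscale a b)) (pscale a b)) with (pscale a' b') in T2 by pt_eq.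
    rewrite (norm2_sub_sym (pscale a' b')) in T2. apply Rabs_le. lra. }
  assert (F : a * norm2 (psub b b') <= 4 * K * d).
  { replace (a * norm2 (psub b b')) with (norm2 (pscale a (psub b b'))) by (rewrite norm2_scale, Rabs_pos_eq; lra).
    replace (pscale a (psub b b')) with (psub (psub (pscale a b) (pscale a' b')) (pscale (a - a') b')) by pt_eq.
    eapply Rle_trans; [apply norm2_sub|]. rewrite norm2_scale, (norm2_unit b' Ub'). lra. }
  assert (N0 := norm2_ge0 (psub b b')).
  assert (F2 : ka / M * norm2 (psub b b') <= 4 * K * d) by nra.
  apply (Rmult_le_reg_l (ka / M)); auto. replace (ka / M * (4 * K * (M / ka) * d)) with (4 * K * d) by (field; lra). exact F2.
Qed.

(** The gap bounds the transversality [dot b v] below by [ka / (2 * M)], so the support line at one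
    exit limits how much longer the other ray can be. *)
Lemma exit_lipschitz : exists K, 0 <= K /\ forall A v v' B b B' b' r r', O1 A -> unit_pt v -> unit_pt v' ->
  nrm O2 B b -> nrm O2 B' b' -> 0 <= r -> 0 <= r' -> B = padd A (pscale r v) -> B' = padd A (pscale r' v') ->
  dist2 B B' <= K * norm2 (psub v v').
Proof.
  destruct (inner_gap_normal O1 O2 HS) as (ka & Hka & Hgap).
  destruct (dom_bound O2 H2) as (M & HM0 & HM).
  assert (P : 0 < 2 * M * (2 * M) / ka) by (apply Rdiv_lt_0_compat; nra).
  exists (2 * M * (2 * M) / ka + 2 * M). split; [lra|].
  assert (K : forall A v v' B b B' r r', O1 A -> unit_pt v -> unit_pt v' -> nrm O2 B b -> O2 B' -> 0 <= r -> 0 <= r' ->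
    B = padd A (pscale r v) -> B' = padd A (pscale r' v') -> r' <= 2 * M /\ r' - r <= 2 * M * (2 * M) / ka * norm2 (psub v v')).
  { intros A v v' B b B' r r' HA Hv Hv' HB HB' Hr Hr' E E'.
    assert (Bd : forall X w t, O2 X -> unit_pt w -> 0 <= t -> X = padd A (pscale t w) -> t <= 2 * M).
    { intros X w t HX Hw Ht EX. assert (T := norm2_sub X A). rewrite EX in T at 1.
      replace (psub (padd A (pscale t w)) A) with (pscale t w) in T by pt_eq.
      rewrite norm2_scale, (norm2_unit w Hw), Rabs_pos_eq in T by lra.
      assert (T1 := HM X HX). assert (T2 := HM _ (inner_in O1 O2 HS _ HA)). lra. } assert (Br' := Bd B' v' r' HB' Hv' Hr' E'). split; auto.
    assert (G := Hgap B b A HB HA). rewrite E in G.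
    replace (dot b (psub A (padd A (pscale r v)))) with (- (r * dot b v)) in G by pt_eq.
    assert (S := proj2 (proj2 HB) B' HB'). rewrite E, E' in S.
    replace (dot b (psub (padd A (pscale r' v')) (padd A (pscale r v)))) with ((r' - r) * dot b v - r' * dot b (psub v v')) in S by pt_eq.
    assert (C := dot_le b (psub v v')). rewrite (norm2_unit b) in C by apply HB.
    assert (N0 := norm2_ge0 (psub v v')). set (N := norm2 (psub v v')) in *.
    destruct (Rle_dec (r' - r) 0) as [Hn|Hn].
    { assert (0 <= 2 * M * (2 * M) / ka * N) by (apply Rmult_le_pos; lra). lra. }
    apply Rnot_le_lt in Hn.
    assert (Q : (r' - r) * dot b v <= 2 * M * N) by nra.
    assert (Q2 : ka <= 2 * M * dot b v) by nra.
    apply (Rmult_le_reg_l ka); auto. replace (ka * (2 * M * (2 * M) / ka * N)) with (2 * M * (2 * M * N)) by (field; lra).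
    nra. }
  intros A v v' B b B' b' r r' HA Hv Hv' HB HB' Hr Hr' E E'.
  destruct (K A v v' B b B' r r') as [K1 K2]; auto. { apply HB'. }
  destruct (K A v' v B' b' B r' r) as [K3 K4]; auto. { apply HB. }
  rewrite (norm2_sub_sym v' v) in K4. set (N := norm2 (psub v v')) in *. assert (N0 : 0 <= N) by apply norm2_ge0.
  unfold dist2. rewrite E, E'.
  replace (psub (padd A (pscale r v)) (padd A (pscale r' v'))) with (padd (pscale (r - r') v) (pscale r' (psub v v'))) by pt_eq.
  eapply Rle_trans; [apply norm2_add|]. rewrite !norm2_scale, (norm2_unit v Hv), (Rabs_pos_eq r') by lra. fold N.
  assert (Rabs (r - r') <= 2 * M * (2 * M) / ka * N) by (apply Rabs_le; lra). nra.
Qed.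

(** The bounds compose those for exits, normals and reflections. No rate is claimed for [qD], whose
    mere continuity will be enough for the derivative of the excess. The summand 1 in the constant
    serves the bound on [d] itself. *)
Lemma quads_lipschitz : exists K, 0 <= K /\ forall q p, quad q -> quad p -> qA q = qA p -> qn q = qn p ->
  let d := norm2 (psub (qv p) (qv q)) in
  norm2 (psub (qw1 p) (qw1 q)) <= K * d /\ norm2 (psub (qw2 p) (qw2 q)) <= K * d /\ norm2 (psub (qv1 p) (qv1 q)) <= K * d /\
  norm2 (psub (qB p) (qB q)) <= K * d /\ norm2 (psub (qC p) (qC q)) <= K * d /\ d <= K * d.
Proof.
  destruct outer_normal_lipschitz as (K1 & HK1 & Hn). destruct exit_lipschitz as (K2 & HK2 & He).
  exists (1 + K2 + 4 * K1 * K2). split; [nra|].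
  intros q p Hq Hp EA En d. assert (Hd : 0 <= d) by apply norm2_ge0.
  assert (EB : norm2 (psub (qB p) (qB q)) <= K2 * d).
  { apply (He (qA q) (qv p) (qv q) (qB p) (qb p) (qB q) (qb q) (dot (qv p) (psub (qB p) (qA p))) (dot (qv q) (psub (qB q) (qA q)))); try apply Hq; try apply Hp.
    - rewrite EA. now apply (quad_AB O1 O2).
    - now apply (quad_AB O1 O2). }
  assert (Eb : norm2 (psub (qb p) (qb q)) <= K1 * (K2 * d)).
  { eapply Rle_trans; [apply (Hn (qB p) _ (qB q)); [apply Hp | apply Hq]|]. unfold dist2. nra. }
  assert (Ew1 : norm2 (psub (qw1 p) (qw1 q)) <= d).
  { unfold qw1. rewrite <- En. eapply Rle_trans; [apply refl_lipschitz; apply Hq|].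
    replace (norm2 (psub (qn q) (qn q))) with 0; [unfold d; lra|]. symmetry. apply dist2_refl. }
  assert (Ew2 : norm2 (psub (qw2 p) (qw2 q)) <= d + 4 * (K1 * (K2 * d))).
  { unfold qw2. eapply Rle_trans; [apply refl_lipschitz; (apply Hq || apply Hp)|]. fold d. lra. }
  assert (EC : norm2 (psub (qC p) (qC q)) <= K2 * d).
  { eapply Rle_trans.
    - apply (He (qA q) (qw1 p) (qw1 q) (qC p) (qc p) (qC q) (qc q) (dot (qw1 p) (psub (qC p) (qA p))) (dot (qw1 q) (psub (qC q) (qA q)))); try apply Hq; try apply Hp.
      + now apply (quad_uw1 O1 O2).
      + now apply (quad_uw1 O1 O2).
      + rewrite EA. now apply (quad_AC O1 O2).
      + now apply (quad_AC O1 O2).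
    - apply Rmult_le_compat_l; auto. }
  assert (Ec : norm2 (psub (qc p) (qc q)) <= K1 * (K2 * d)).
  { eapply Rle_trans; [apply (Hn (qC p) _ (qC q)); [apply Hp | apply Hq]|]. unfold dist2. nra. }
  assert (Ev1 : norm2 (psub (qv1 p) (qv1 q)) <= d + 4 * (K1 * (K2 * d))).
  { unfold qv1. eapply Rle_trans; [apply refl_lipschitz; try (apply Hq || apply Hp); now apply (quad_uw1 O1 O2)|]. lra. }
  assert (0 <= K1 * (K2 * d)) by (apply Rmult_le_pos; nra).
  assert (0 <= K2 * d) by nra.
  repeat split; nra.
Qed.

Lemma quad_supp_B q : quad q -> supp O2 (qB q) (psub (qv q) (qw2 q)).
Proof.
  intros Hq Y HY. unfold qw2, refl.
  replace (dot (psub (qv q) (psub (qv q) (pscale (2 * dot (qv q) (qb q)) (qb q)))) (psub Y (qB q))) with (2 * dot (qb q) (qv q) * dot (qb q) (psub Y (qB q))) by pt_eq.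
  assert (E : dot (qb q) (psub Y (qB q)) <= 0) by (apply Hq; auto). assert (F := proj2 (quad_AB_pos O1 O2 HS q Hq)). nra.
Qed.

Lemma quad_supp_C q : quad q -> supp O2 (qC q) (psub (qw1 q) (qv1 q)).
Proof.
  intros Hq Y HY. unfold qv1, refl. assert (F := proj2 (quad_AC_pos O1 O2 HS q Hq)). set (w := qw1 q) in *. clearbody w.
  replace (dot (psub w (psub w (pscale (2 * dot w (qc q)) (qc q)))) (psub Y (qC q))) with (2 * dot (qc q) w * dot (qc q) (psub Y (qC q))) by pt_eq.
  assert (E : dot (qc q) (psub Y (qC q)) <= 0) by (apply Hq; auto). nra.
Qed.

Lemma excess_dual q : excess q = dot (psub (qv q) (qw2 q)) (qB q) + dot (psub (qw2 q) (qv1 q)) (qD q)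
  - dot (psub (qv q) (qw1 q)) (qA q) - dot (psub (qw1 q) (qv1 q)) (qC q).
Proof. unfold excess. pt_eq. Qed.

(* Each vertex is critical for the excess, so only second-order terms survive. *)
Lemma excess_increment : exists M, 0 <= M /\ forall q p, quad q -> quad p -> qA q = qA p ->
  Rabs (excess p - excess q) <=
    M * (norm2 (psub (qv p) (qv q)) * norm2 (psub (qv p) (qv q)) + norm2 (psub (qw1 p) (qw1 q)) * norm2 (psub (qw1 p) (qw1 q))
       + norm2 (psub (qw2 p) (qw2 q)) * norm2 (psub (qw2 p) (qw2 q)) + norm2 (psub (qv1 p) (qv1 q)) * norm2 (psub (qv1 p) (qv1 q)))
    + norm2 (psub (qB p) (qB q)) * (norm2 (psub (qv p) (qv q)) + norm2 (psub (qw2 p) (qw2 q)))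
    + norm2 (psub (qC p) (qC q)) * (norm2 (psub (qw1 p) (qw1 q)) + norm2 (psub (qv1 p) (qv1 q)))
    + norm2 (psub (qD p) (qD q)) * (norm2 (psub (qw2 p) (qw2 q)) + norm2 (psub (qv1 p) (qv1 q))).
Proof.
  destruct (dom_bound O2 H2) as (M & HM0 & HM). exists M. split; [lra|].
  intros q p Hq Hp EA.
  assert (Uv : unit_pt (qv q)) by apply Hq. assert (Uv' : unit_pt (qv p)) by apply Hp.
  assert (U1 := quad_uw1 O1 O2 q Hq). assert (U1' := quad_uw1 O1 O2 p Hp).
  assert (U2 := quad_uw2 O1 O2 q Hq). assert (U2' := quad_uw2 O1 O2 p Hp).
  assert (U3 := quad_uv1 O1 O2 q Hq). assert (U3' := quad_uv1 O1 O2 p Hp).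
  assert (GB := quad_AB O1 O2 q Hq). assert (GC := quad_AC O1 O2 q Hq). assert (GD := quad_BD O1 O2 q Hq). assert (GE := quad_CD O1 O2 q Hq).
  assert (IB := support_increment _ _ _ _ (quad_supp_B q Hq (qB p) (proj1 (proj1 (proj2 Hp)))) (quad_supp_B p Hp (qB q) (proj1 (proj1 (proj2 Hq))))).
  assert (IC := support_increment _ _ _ _ (quad_supp_C q Hq (qC p) (proj1 (proj1 (proj2 (proj2 Hp))))) (quad_supp_C p Hp (qC q) (proj1 (proj1 (proj2 (proj2 Hq)))))).
  assert (ID : dot (psub (qw2 q) (qv1 q)) (psub (qD p) (qD q)) <= 0) by (apply Hq; apply Hp).
  assert (ID' : dot (psub (qw2 p) (qv1 p)) (psub (qD q) (qD p)) <= 0) by (apply Hp; apply Hq).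
  assert (ID2 := support_increment _ _ _ _ ID ID'). clear ID ID'.
  assert (BA := HM _ (inner_in O1 O2 HS _ (proj1 (proj1 Hq)))).
  assert (BB := HM _ (proj1 (proj1 (proj2 Hq)))). assert (BC := HM _ (proj1 (proj1 (proj2 (proj2 Hq))))).
  assert (BD : norm2 (qD q) <= M) by (apply HM, (inner_in O1 O2 HS); apply Hq).
  assert (R : forall X Y w t, unit_pt w -> Y = padd X (pscale t w) -> norm2 X <= M -> norm2 Y <= M -> Rabs t <= 2 * M).
  { intros X Y w t Hw E HX HY. assert (T := norm2_sub Y X). rewrite E in T at 1.
    replace (psub (padd X (pscale t w)) X) with (pscale t w) in T by pt_eq. rewrite norm2_scale, (norm2_unit w Hw) in T. lra. }
  assert (R1 := R _ _ _ _ Uv GB BA BB). assert (R2 := R _ _ _ _ U1 GC BA BC).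
  assert (R3 := R _ _ _ _ U2 GD BB BD). assert (R4 := R _ _ _ _ U3 GE BC BD). clear R.
  set (r1 := dot (qv q) (psub (qB q) (qA q))) in *. set (r2 := dot (qw1 q) (psub (qC q) (qA q))) in *.
  set (r3 := dot (qw2 q) (psub (qD q) (qB q))) in *. set (r4 := dot (qv1 q) (psub (qD q) (qC q))) in *.
  rewrite !excess_dual, <- EA.
  assert (V1 := dot_unit_diff _ _ Uv Uv'). assert (V2 := dot_unit_diff _ _ U1 U1').
  assert (V3 := dot_unit_diff _ _ U2 U2'). assert (V4 := dot_unit_diff _ _ U3 U3').
  set (w1 := qw1 q) in *. set (w2 := qw2 q) in *. set (v1 := qv1 q) in *. set (v := qv q) in *.
  set (w1' := qw1 p) in *. set (w2' := qw2 p) in *. set (v1' := qv1 p) in *. set (v' := qv p) in *.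
  set (A := qA q) in *. set (B := qB q) in *. set (C := qC q) in *. set (D := qD q) in *.
  set (B' := qB p) in *. set (C' := qC p) in *. set (D' := qD p) in *.
  (* With the vertices frozen, the variation pairs each side with the change of its own unit
     direction, hence is of second order by [dot_unit_diff]. *)
  assert (Main : dot (psub (psub v' w2') (psub v w2)) B + dot (psub (psub w2' v1') (psub w2 v1)) D
     - dot (psub (psub v' w1') (psub v w1)) A - dot (psub (psub w1' v1') (psub w1 v1)) C
     = r1 * dot v (psub v' v) + r3 * dot w2 (psub w2' w2) - r2 * dot w1 (psub w1' w1) - r4 * dot v1 (psub v1' v1)).
  { transitivity (dot (psub B A) (psub v' v) + dot (psub D B) (psub w2' w2) - dot (psub C A) (psub w1' w1) - dot (psub D C) (psub v1' v1)).
    - clearbody A B C D v w1 w2 v1 v' w1' w2' v1'. pt_eq.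
    - replace (psub B A) with (pscale r1 v) by (rewrite GB at 1; clearbody r1 A v; pt_eq).
      replace (psub D B) with (pscale r3 w2) by (rewrite GD at 1; clearbody r3 B w2; pt_eq).
      replace (psub C A) with (pscale r2 w1) by (rewrite GC at 1; clearbody r2 A w1; pt_eq).
      replace (psub D C) with (pscale r4 v1) by (rewrite GE at 1; clearbody r4 C v1; pt_eq).
      clearbody r1 r2 r3 r4 v w1 w2 v1 v' w1' w2' v1'. pt_eq. }
  rewrite V1, V2, V3, V4 in Main.
  assert (NB : norm2 (psub (psub v' w2') (psub v w2)) <= norm2 (psub v' v) + norm2 (psub w2' w2)).
  { replace (psub (psub v' w2') (psub v w2)) with (psub (psub v' v) (psub w2' w2)) by (clearbody v w2 v' w2'; pt_eq). apply norm2_sub. }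
  assert (NC : norm2 (psub (psub w1' v1') (psub w1 v1)) <= norm2 (psub w1' w1) + norm2 (psub v1' v1)).
  { replace (psub (psub w1' v1') (psub w1 v1)) with (psub (psub w1' w1) (psub v1' v1)) by (clearbody w1 v1 w1' v1'; pt_eq). apply norm2_sub. }
  assert (ND : norm2 (psub (psub w2' v1') (psub w2 v1)) <= norm2 (psub w2' w2) + norm2 (psub v1' v1)).
  { replace (psub (psub w2' v1') (psub w2 v1)) with (psub (psub w2' w2) (psub v1' v1)) by (clearbody w2 v1 w2' v1'; clear; pt_eq). apply norm2_sub. }
  assert (EA' : dot (psub v' w1') A - dot (psub v w1) A = dot (psub (psub v' w1') (psub v w1)) A) by (clearbody v w1 v' w1' A; pt_eq).
  assert (PB := norm2_ge0 (psub B' B)). assert (PC := norm2_ge0 (psub C' C)). assert (PD := norm2_ge0 (psub D' D)).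
  assert (QB : norm2 (psub B' B) * norm2 (psub (psub v' w2') (psub v w2)) <= norm2 (psub B' B) * (norm2 (psub v' v) + norm2 (psub w2' w2))) by now apply Rmult_le_compat_l.
  assert (QC : norm2 (psub C' C) * norm2 (psub (psub w1' v1') (psub w1 v1)) <= norm2 (psub C' C) * (norm2 (psub w1' w1) + norm2 (psub v1' v1))) by now apply Rmult_le_compat_l.
  assert (QD : norm2 (psub D' D) * norm2 (psub (psub w2' v1') (psub w2 v1)) <= norm2 (psub D' D) * (norm2 (psub w2' w2) + norm2 (psub v1' v1))) by now apply Rmult_le_compat_l.
  assert (Sq : forall t a, Rabs t <= 2 * M -> Rabs (t * (- (a * a) / 2)) <= M * (a * a)).
  { intros t a Ht. rewrite Rabs_mult, (Rabs_left1 (- (a * a) / 2)) by nra. nra. }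
  assert (T1 := Sq r1 (norm2 (psub v' v)) R1). assert (T2 := Sq r2 (norm2 (psub w1' w1)) R2).
  assert (T3 := Sq r3 (norm2 (psub w2' w2)) R3). assert (T4 := Sq r4 (norm2 (psub v1' v1)) R4).
  apply Rabs_le_between in T1, T2, T3, T4.
  apply Rabs_le. lra.
Qed.

Lemma choice_fun {X T : Type} (P : X -> T -> Prop) : (forall x, exists y, P x y) -> exists f, forall x, P x (f x).
Proof.
  intros H. exists (fun k => proj1_sig (constructive_indefinite_description _ (H k))).
  intros k. apply (proj2_sig (constructive_indefinite_description _ (H k))).
Qed.

Lemma pconv_rot_at (t : nat -> R) (x : R) v : is_lim_seq t x -> pconv (fun k => rot (t k) v) (rot x v).
Proof.
  intros Ht. unfold rot. apply pconv_add; apply pconv_scale; try apply pconv_const.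
  - apply (is_lim_seq_continuous cos t x); auto. apply continuity_cos.
  - apply (is_lim_seq_continuous sin t x); auto. apply continuity_sin.
Qed.

Lemma excess_lim u q : qconv u q -> is_lim_seq (fun k => excess (u k)) (excess q).
Proof.
  intros H. unfold excess. assert (W1 := qconv_w1 _ _ H). assert (W2 := qconv_w2 _ _ H). assert (V1 := qconv_v1 _ _ H).
  apply is_lim_seq_minus'; [apply is_lim_seq_minus'; [apply is_lim_seq_plus'|]|]; apply lim_dot; auto; try apply pconv_sub2; apply H.
Qed.

(** Reflection at [qA] does nothing, so the paths through [qB] and through [qC] coincide. *)
Lemma excess_tangent q : quad q -> dot (qn q) (qv q) = 0 -> excess q = 0.
Proof.
  intros Hq Hn.
  assert (Ew : qw1 q = qv q).
  { unfold qw1, refl. rewrite (dot_sym (qv q)), Hn. pt_eq. }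
  assert (GB := quad_AB O1 O2 q Hq). assert (GC := quad_AC O1 O2 q Hq). rewrite Ew in GC.
  set (r := dot (qv q) (psub (qB q) (qA q))) in *. set (r' := dot (qv q) (psub (qC q) (qA q))) in *.
  destruct (exit_eq O2 (qB q) (qb q) (qC q) (qc q) (qv q)) as [EC Ec].
  - now apply outer_smooth with O1.
  - split; [apply Hq | now apply (quad_AB_pos O1 O2 HS)].
  - split; [apply Hq |]. rewrite <- Ew. now apply (quad_AC_pos O1 O2 HS).
  - exists (r' - r). rewrite GB, GC. pt_eq.
  - unfold excess. unfold qv1, qw2. rewrite EC, Ec, Ew. ring.
Qed.

(** The angle [x] in (0, PI) of the line with the tangent at [qA] parametrizes the transversal
    quadrilaterals with this vertex. The excess has zero derivative in [x], and its limit as [x]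
    tends to zero vanishes by [excess_tangent]. *)
Lemma excess_zero q : quad q -> smooth O1 (qA q) -> excess q = 0.
Proof.
  intros Hq HsA.
  destruct (proj1 (proj2 (proj2 (proj2 (proj2 (proj2 Hq)))))) as [Hn|Hn]; [|now apply excess_tangent].
  set (A := qA q) in *. set (n := qn q) in *.
  assert (HA : nrm O1 A n) by apply Hq. assert (Un : unit_pt n) by apply HA.
  (* Since [perp w = n], the direction [rot x w] has normal component [sin x], positive for [x] in
     (0, PI). *)
  set (w := pscale (-1) (perp n)).
  assert (Ew : perp w = n) by (unfold w; pt_eq).
  assert (Uw : unit_pt w). { unfold unit_pt, w. replace (dot (pscale (-1) (perp n)) (pscale (-1) (perp n))) with (dot n n) by pt_eq. exact Un. }
  assert (Hnv : forall x, dot n (rot x w) = sin x).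
  { intros x. rewrite <- Ew. replace (dot (perp w) (rot x w)) with (sin x * dot w w) by pt_eq. rewrite Uw; ring. }
  assert (S : forall x, exists p, 0 < x < PI -> quad p /\ qA p = A /\ qn p = n /\ qv p = rot x w).
  { intros x. destruct (classic (0 < x < PI)) as [Hx|Hx]; [|now exists q].
    destruct (quad_exists O1 O2 HS A n (rot x w)) as (p & Hp); auto.
    - now apply rot_unit.
    - rewrite Hnv. apply sin_gt_0; lra.
    - now exists p. }
  destruct (choice_fun _ S) as [Q HQ]. clear S.
  (* A limit of quadrilaterals at angles tending to [x] is a quadrilateral at angle [x], and
     [quad_unique] identifies it with [Q x]; hence [qD] is continuous. *)
  assert (Hcont : forall x, 0 < x < PI -> forall eps, 0 < eps -> exists del, 0 < del /\ forall y, 0 < y < PI -> Rabs (y - x) < del ->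
      norm2 (psub (qD (Q y)) (qD (Q x))) < eps).
  { intros x Hx eps He. apply NNPP. intros Hno.
    assert (S : forall k, exists y, 0 < y < PI /\ Rabs (y - x) < tk k /\ eps <= norm2 (psub (qD (Q y)) (qD (Q x)))).
    { intros k. apply NNPP. intros Hk. apply Hno. exists (tk k). split; [apply tk_pos|]. intros y Hy Hyx.
      apply Rnot_le_lt. intros Hle. apply Hk. now exists y. }
    destruct (choice_seq _ S) as [y Hy].
    destruct (quad_compact O1 O2 HS (fun k => Q (y k))) as (phi & p & Hp & Hc & Hqp). { intros k; apply HQ, Hy. }
    assert (Ly : is_lim_seq (fun k => y (phi k)) x).
    { apply (is_lim_seq_subseq y); [now apply inc_filterlim|]. apply is_lim_seq_spec. intros e.
      destruct (tk_small e (cond_pos e)) as [N HN]. exists N. intros k Hk. eapply Rlt_trans; [apply Hy | now apply HN]. }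
    assert (Ep : Q x = p).
    { destruct (HQ x Hx) as (Qx & EAx & Enx & Evx). apply (quad_unique O1 O2 HS); auto.
      - rewrite EAx. apply (pconv_uniq (fun k => qA (Q (y (phi k))))); [|apply Hc].
        apply (pconv_squeeze _ _ (fun _ => 0)); [apply is_lim_seq_const|]. intros k.
        destruct (HQ (y (phi k))) as (_ & E & _); [apply Hy|]. rewrite E, dist2_refl; lra.
      - rewrite Enx. apply (pconv_uniq (fun k => qn (Q (y (phi k))))); [|apply Hc].
        apply (pconv_squeeze _ _ (fun _ => 0)); [apply is_lim_seq_const|]. intros k.
        destruct (HQ (y (phi k))) as (_ & _ & E & _); [apply Hy|]. rewrite E, dist2_refl; lra.
      - rewrite Evx. apply (pconv_uniq (fun k => rot (y (phi k)) w)); [now apply pconv_rot_at|].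
        apply (pconv_squeeze _ _ (fun k => dist2 (qv (Q (y (phi k)))) (qv p))).
        + apply pconv_dist. apply Hc.
        + intros k. destruct (HQ (y (phi k))) as (_ & _ & _ & E); [apply Hy|]. rewrite E; lra.
      - rewrite Enx, Evx, Hnv. apply sin_gt_0; lra. }
    destruct (pconv_eventually _ _ eps (proj1 (proj2 (proj2 (proj2 Hc)))) He) as [N HN].
    specialize (HN N ltac:(lia)). rewrite <- Ep in HN. destruct (Hy (phi N)) as (_ & _ & Hb). unfold dist2 in HN. lra. }
  destruct quads_lipschitz as (K & HK & HL). destruct excess_increment as (M & HM & HI).
  assert (Hder : forall x, 0 < x < PI -> is_derive (fun x => excess (Q x)) x 0).
  { intros x Hx. apply is_derive_Reals. intros eps He.
    (* [c] counts the four direction terms weighted by [M] and the four products at [qB] and [qC];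
       [c2] multiplies the displacement of [qD], which tends to zero. *)
    set (c := 4 * M * (K * K) + 4 * (K * K)). set (c2 := 2 * K).
    assert (Hc : 0 <= c) by (unfold c; nra). assert (Hc2 : 0 <= c2) by (unfold c2; nra).
    destruct (Hcont x Hx (eps / (2 * (c2 + 1)))) as (d1 & Hd1 & HD). { apply Rdiv_lt_0_compat; lra. }
    set (del := Rmin (Rmin d1 (eps / (2 * (c + 1)))) (Rmin x (PI - x))).
    assert (E0 : 0 < eps / (2 * (c + 1))) by (apply Rdiv_lt_0_compat; lra).
    assert (Hdel : 0 < del) by (unfold del; repeat apply Rmin_pos; lra).
    exists (mkposreal del Hdel). cbn. intros h Hh Hhd.
    assert (B1 : del <= d1) by (unfold del; eapply Rle_trans; [apply Rmin_l | apply Rmin_l]).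
    assert (B2 : del <= eps / (2 * (c + 1))) by (unfold del; eapply Rle_trans; [apply Rmin_l | apply Rmin_r]).
    assert (B3 : del <= x) by (unfold del; eapply Rle_trans; [apply Rmin_r | apply Rmin_l]).
    assert (B4 : del <= PI - x) by (unfold del; eapply Rle_trans; [apply Rmin_r | apply Rmin_r]).
    assert (Hxh : 0 < x + h < PI) by (apply Rabs_def2 in Hhd; lra).
    destruct (HQ x Hx) as (Qx & EAx & Enx & Evx). destruct (HQ (x + h) Hxh) as (Qh & EAh & Enh & Evh).
    specialize (HD (x + h) Hxh). replace (x + h - x) with h in HD by ring. specialize (HD ltac:(lra)).
    destruct (HL (Q x) (Q (x + h)) Qx Qh ltac:(congruence) ltac:(congruence)) as (L1 & L2 & L3 & L4 & L5 & L6).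
    assert (I := HI (Q x) (Q (x + h)) Qx Qh ltac:(congruence)).
    assert (Hv : norm2 (psub (qv (Q (x + h))) (qv (Q x))) <= Rabs h).
    { rewrite Evx, Evh. eapply Rle_trans; [now apply rot_lipschitz|]. right. f_equal; ring. }
    assert (P0 := norm2_ge0 (psub (qv (Q (x + h))) (qv (Q x)))). assert (P1 := norm2_ge0 (psub (qw1 (Q (x + h))) (qw1 (Q x)))).
    assert (P2 := norm2_ge0 (psub (qw2 (Q (x + h))) (qw2 (Q x)))). assert (P3 := norm2_ge0 (psub (qv1 (Q (x + h))) (qv1 (Q x)))).
    assert (P4 := norm2_ge0 (psub (qB (Q (x + h))) (qB (Q x)))). assert (P5 := norm2_ge0 (psub (qC (Q (x + h))) (qC (Q x)))).
    assert (P6 := norm2_ge0 (psub (qD (Q (x + h))) (qD (Q x)))).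
    set (a0 := norm2 (psub (qv (Q (x + h))) (qv (Q x)))) in *. set (a1 := norm2 (psub (qw1 (Q (x + h))) (qw1 (Q x)))) in *.
    set (a2 := norm2 (psub (qw2 (Q (x + h))) (qw2 (Q x)))) in *. set (a3 := norm2 (psub (qv1 (Q (x + h))) (qv1 (Q x)))) in *.
    set (a4 := norm2 (psub (qB (Q (x + h))) (qB (Q x)))) in *. set (a5 := norm2 (psub (qC (Q (x + h))) (qC (Q x)))) in *.
    set (a6 := norm2 (psub (qD (Q (x + h))) (qD (Q x)))) in *.
    set (t := K * Rabs h). assert (Kh : K * a0 <= t) by (unfold t; nra).
    assert (Sq : forall a b, 0 <= a <= t -> 0 <= b <= t -> a * b <= t * t) by (intros; apply Rmult_le_compat; lra).
    assert (Q0 := Sq a0 a0 ltac:(lra) ltac:(lra)). assert (Q1 := Sq a1 a1 ltac:(lra) ltac:(lra)).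
    assert (Q2 := Sq a2 a2 ltac:(lra) ltac:(lra)). assert (Q3 := Sq a3 a3 ltac:(lra) ltac:(lra)).
    assert (Q4 := Sq a4 a0 ltac:(lra) ltac:(lra)). assert (Q5 := Sq a4 a2 ltac:(lra) ltac:(lra)).
    assert (Q6 := Sq a5 a1 ltac:(lra) ltac:(lra)). assert (Q7 := Sq a5 a3 ltac:(lra) ltac:(lra)).
    assert (Q8 : a6 * (a2 + a3) <= a6 * (2 * t)) by (apply Rmult_le_compat_l; lra).
    assert (Fin : Rabs (excess (Q (x + h)) - excess (Q x)) <= c * Rabs h * Rabs h + c2 * Rabs h * a6).
    { eapply Rle_trans; [exact I|]. unfold c, c2. 
      assert (M * (a0 * a0 + a1 * a1 + a2 * a2 + a3 * a3) <= M * (4 * (t * t))) by (apply Rmult_le_compat_l; lra).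
      unfold t in *. lra. }
    assert (Hh0 : 0 < Rabs h) by now apply Rabs_pos_lt.
    rewrite Rminus_0_r. unfold Rdiv. rewrite Rabs_mult, (Rabs_inv h).
    apply (Rmult_lt_reg_r (Rabs h)); auto. rewrite Rmult_assoc, Rinv_l, Rmult_1_r by lra.
    eapply Rle_lt_trans; [exact Fin|].
    assert (F1 : c * Rabs h <= eps / 2).
    { assert (Rabs h <= eps / (2 * (c + 1))) by lra. apply Rle_trans with ((c + 1) * (eps / (2 * (c + 1)))); [nra|]. right. field. lra. }
    assert (F2 : c2 * a6 < eps / 2).
    { apply Rlt_le_trans with ((c2 + 1) * (eps / (2 * (c2 + 1)))); [nra|]. right. field. lra. }
    nra. }
  assert (Hconst : forall x y, 0 < x < PI -> 0 < y < PI -> excess (Q x) = excess (Q y)).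
  { assert (K0 : forall x y, 0 < x < PI -> 0 < y < PI -> x < y -> excess (Q x) = excess (Q y)).
    { intros x y Hx Hy Hxy. apply (eq_is_derive (fun x => excess (Q x)) x y); auto.
      intros t Ht. apply Hder. lra. }
    intros x y Hx Hy. destruct (Rtotal_order x y) as [H|[H|H]]; [now apply K0 | now subst | symmetry; now apply K0]. }
  assert (Pi2 := PI2_1).
  assert (Htk : forall k, 0 < tk k < PI) by (intros k; assert (A1 := tk_pos k); assert (A2 := tk_le1 k); lra).
  assert (Hz : excess (Q 1) = 0).
  { destruct (quad_compact O1 O2 HS (fun k => Q (tk k))) as (phi & p & Hp & Hc & Hqp). { intros k; now apply HQ. }
    assert (Ez : excess p = 0).
    { apply excess_tangent; auto.
      apply (lim_uniq (fun k => dot (qn (Q (tk (phi k)))) (qv (Q (tk (phi k)))))).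
      - apply lim_dot; apply Hc.
      - apply (is_lim_seq_ext (fun k => sin (tk (phi k)))).
        + intros k. destruct (HQ _ (Htk (phi k))) as (_ & _ & E & E'). now rewrite E, E', Hnv.
        + rewrite <- sin_0. apply (is_lim_seq_continuous sin (fun k => tk (phi k)) 0).
          * apply continuity_sin.
          * apply (is_lim_seq_subseq tk); [now apply inc_filterlim | apply tk_lim]. }
    rewrite <- Ez. symmetry. apply (lim_eq (fun k => excess (Q (tk (phi k))))); [now apply (excess_lim (fun k => Q (tk (phi k))))|].
    intros k. apply Hconst; auto. lra. }
  assert (Uv : unit_pt (qv q)) by apply Hq.
  assert (Dv := decomp w (qv q) Uw).
  replace (cross w (qv q)) with (dot n (qv q)) in Dv by (rewrite <- Ew; pt_eq). rewrite Ew in Dv.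
  assert (Sq : dot w (qv q) * dot w (qv q) + dot n (qv q) * dot n (qv q) = 1).
  { transitivity (dot w w * dot (qv q) (qv q)); [rewrite <- Ew; pt_eq | rewrite Uw, Uv; ring]. }
  set (x := acos (dot w (qv q))).
  assert (Hb : -1 < dot w (qv q) < 1) by (split; nra).
  assert (Hx : 0 < x < PI) by (apply acos_bound_lt; auto).
  assert (Cx : cos x = dot w (qv q)) by (apply cos_acos; lra).
  assert (Sx : sin x = dot n (qv q)).
  { assert (P : 0 < sin x) by (apply sin_gt_0; lra). assert (T := sin2_cos2 x). unfold Rsqr in T. rewrite Cx in T. nra. }
  destruct (HQ x Hx) as (Qx & EAx & Enx & Evx).
  assert (E : q = Q x).
  { apply (quad_unique O1 O2 HS); auto. rewrite Evx. unfold rot. rewrite Cx, Sx, Ew. exact Dv. }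
  rewrite E, <- Hz. apply Hconst; auto. lra.
Qed.

End Excess.

(** * Concurrent support lines and smoothness of the inner domain *)

Definition unitize (u : pt) : pt := pscale (/ norm2 u) u.

Lemma unitize_unit u : u <> (0,0) -> unit_pt (unitize u).
Proof.
  intros H. assert (P := norm2_pos u H). assert (S := norm2_sq u). unfold unit_pt, unitize.
  replace (dot (pscale (/ norm2 u) u) (pscale (/ norm2 u) u)) with (/ norm2 u * / norm2 u * dot u u) by pt_eq.
  rewrite <- S. field. lra.
Qed.

Lemma unitize_eq u : u <> (0,0) -> u = pscale (norm2 u) (unitize u).
Proof.
  intros H. assert (P := norm2_pos u H). unfold unitize. apply pt_ext; cbn; field; lra.
Qed.

Lemma unitize_lim u p : p <> (0,0) -> pconv u p -> pconv (fun k => unitize (u k)) (unitize p).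
Proof.
  intros Hp H. apply pconv_scale; auto. assert (P := norm2_pos p Hp).
  apply (is_lim_seq_inv (fun k => norm2 (u k)) (Finite (norm2 p))); [now apply lim_norm2|].
  intros E. injection E. lra.
Qed.

Lemma psub_nz a b : a <> b -> psub a b <> (0,0).
Proof.
  intros H E. apply H. apply pt_ext; [apply (f_equal fst) in E | apply (f_equal snd) in E]; cbn in E; lra.
Qed.

(* [X] has signed distances [-p] and [p'] to the lines through it directed by [w] and [v1]. *)
Lemma bisector_moment X w v1 p p' k : unit_pt w -> unit_pt v1 -> cross X w = - p -> cross X v1 = p' ->
  dot X (psub w v1) = k -> (p' - p) * (1 - dot w v1) = k * cross w v1.
Proof.
  unfold unit_pt. intros Hw Hv Hp Hp' Hk. subst k p'. replace p with (- cross X w) by lra.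
  assert (Z : forall a b : R, 2 * a = 2 * b -> a = b) by (intros; lra). apply Z. clear Z.
  transitivity ((cross X v1 - - cross X w) * (dot w w + dot v1 v1 - 2 * dot w v1)); [rewrite Hw, Hv; ring|].
  transitivity (2 * (dot X (psub w v1) * cross w v1) + cross X (perp (psub w v1)) * (dot w w - dot v1 v1) * 0
     + (dot w w - dot v1 v1) * (cross X w - cross X v1)); [pt_eq | rewrite Hw, Hv; ring].
Qed.

(** The quotient of [cross w v1] by [1 - dot w v1] is the cotangent of half the angle from [w] to
    [v1], so [g] determines this angle. *)
Lemma unit_from_moments w w' v1 g : unit_pt w -> unit_pt w' -> unit_pt v1 -> w <> v1 -> w' <> v1 ->
  cross w v1 = g * (1 - dot w v1) -> cross w' v1 = g * (1 - dot w' v1) -> w = w'.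
Proof.
  intros Hw Hw' Hv Hn Hn' E E'.
  assert (K : forall u, unit_pt u -> u <> v1 -> cross u v1 = g * (1 - dot u v1) -> (1 - dot u v1) * (1 + g * g) = 2).
  { intros u Hu Hne Eu.
    assert (S : dot u v1 * dot u v1 + cross u v1 * cross u v1 = 1).
    { transitivity (dot u u * dot v1 v1); [pt_eq | rewrite Hu, Hv; ring]. }
    assert (N : 1 - dot u v1 <> 0).
    { intros Z. apply Hne. apply dist2_eq0. unfold dist2, norm2.
      replace (dot (psub u v1) (psub u v1)) with (dot u u + dot v1 v1 - 2 * dot u v1) by pt_eq. rewrite Hu, Hv.
      replace (1 + 1 - 2 * dot u v1) with 0 by lra. apply sqrt_0. }
    rewrite Eu in S. apply (Rmult_eq_reg_l (1 - dot u v1)); auto. nra. }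
  assert (A := K w Hw Hn E). assert (A' := K w' Hw' Hn' E').
  assert (G : 1 + g * g <> 0) by nra.
  assert (D : dot w v1 = dot w' v1).
  { assert (1 - dot w v1 = 1 - dot w' v1) by (apply (Rmult_eq_reg_r (1 + g * g)); lra). lra. }
  assert (C : cross w v1 = cross w' v1) by (rewrite E, E', D; ring).
  rewrite (decomp v1 w Hv), (decomp v1 w' Hv), (dot_sym v1 w), (dot_sym v1 w'), D.
  replace (cross v1 w) with (- cross w v1) by pt_eq. replace (cross v1 w') with (- cross w' v1) by pt_eq. now rewrite C.
Qed.

(** All [k1], [k2], [k3] being negative, the coefficients cannot share a sign; the one opposed to
    the two others will single out the vector lying between the others. *)
Lemma three_signs a b c k1 k2 k3 : k1 < 0 -> k2 < 0 -> k3 < 0 -> a <> 0 -> b <> 0 -> c <> 0 -> a * k1 + b * k2 + c * k3 = 0 ->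
  (a * b < 0 /\ a * c < 0) \/ (b * a < 0 /\ b * c < 0) \/ (c * a < 0 /\ c * b < 0).
Proof.
  intros K1 K2 K3 Ha Hb Hc E.
  destruct (Rdichotomy a 0 Ha), (Rdichotomy b 0 Hb), (Rdichotomy c 0 Hc);
    first [exfalso; nra | left; split; nra | right; left; split; nra | right; right; split; nra].
Qed.

Lemma same_sign_zero b c x y : 0 < b * c -> x <= 0 -> y <= 0 -> b * x + c * y = 0 -> x = 0 /\ y = 0.
Proof.
  intros Hbc Hx Hy E. assert (Hb : b <> 0) by (intros ->; lra). assert (Hc : c <> 0) by (intros ->; lra).
  assert (Z : b * x = 0 /\ c * y = 0).
  { destruct (Rdichotomy b 0 Hb); destruct (Rdichotomy c 0 Hc); try (exfalso; nra).
    - assert (0 <= b * x) by nra. assert (0 <= c * y) by nra. lra.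
    - assert (b * x <= 0) by nra. assert (c * y <= 0) by nra. lra. }
  destruct Z as [Z1 Z2]. apply Rmult_integral in Z1, Z2. destruct Z1, Z2; lra.
Qed.

(** A planar cone has only two extreme rays. Of three distinct normals one is a positive combination
    of the others, as the relation [Id] paired with an interior point shows; its edge direction then
    annihilates the others too, and they coincide. *)
Lemma three_edges O Q n1 n2 n3 a1 a2 a3 : convex_compact_domain O -> nrm O Q n1 -> nrm O Q n2 -> nrm O Q n3 ->
  edge O Q n1 a1 -> edge O Q n2 a2 -> edge O Q n3 a3 -> n1 <> n2 -> n2 <> n3 -> n1 <> n3 -> False.
Proof.
  intros HO H1 H2 H3 (e1 & U1 & Z1 & M1 & _) (e2 & U2 & Z2 & M2 & _) (e3 & U3 & Z3 & M3 & _) D12 D23 D13.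
  destruct (dom_int O HO) as [c Hc].
  assert (K : forall n, nrm O Q n -> dot n (psub c Q) < 0).
  { intros n (_ & U & S). now apply (supp_int O). }
  assert (C : forall n m, nrm O Q n -> nrm O Q m -> n <> m -> cross n m <> 0).
  { intros n m Hn Hm Hne E. destruct (unit_eq_or n m) as [|Eo]; auto; try apply Hn; try apply Hm.
    assert (A := K n Hn). assert (B := K m Hm). rewrite Eo in A.
    replace (dot (pscale (-1) m) (psub c Q)) with (- dot m (psub c Q)) in A by pt_eq. lra. }
  assert (Id : forall z, cross n2 n3 * dot n1 z + cross n3 n1 * dot n2 z + cross n1 n2 * dot n3 z = 0).
  { intros z. pt_eq. }
  destruct (three_signs (cross n2 n3) (cross n3 n1) (cross n1 n2) _ _ _ (K n1 H1) (K n2 H2) (K n3 H3)) as [[S S']|[[S S']|[S S']]]; auto.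
  - assert (I := Id e1). rewrite Z1 in I.
    destruct (same_sign_zero (cross n3 n1) (cross n1 n2) (dot n2 e1) (dot n3 e1)); auto; try nra.
    apply D12. apply (nrm_eq_of_orth O HO Q n1 n2 e1); auto.
  - assert (I := Id e2). rewrite Z2 in I.
    destruct (same_sign_zero (cross n2 n3) (cross n1 n2) (dot n1 e2) (dot n3 e2)); auto; try nra.
    apply D12. apply (nrm_eq_of_orth O HO Q n1 n2 e2); auto.
  - assert (I := Id e3). rewrite Z3 in I.
    destruct (same_sign_zero (cross n2 n3) (cross n3 n1) (dot n1 e3) (dot n2 e3)); auto; try nra.
    apply D13. apply (nrm_eq_of_orth O HO Q n1 n3 e3); auto.
Qed.

(** A point or a direction has at most two tangents to a smooth convex curve. At the contact point
    of the middle one of three, the two other support inequalities become equalities, so another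
    support line touches at the same point and has, by smoothness, the same normal. *)
Lemma three_in_pencil O (n m : pt) (p p' : R) B1 b1 x1 y1 B2 b2 x2 y2 B3 b3 x3 y3 :
  convex_compact_domain O -> (forall X, smooth O X) -> nrm O B1 b1 -> nrm O B2 b2 -> nrm O B3 b3 ->
  b1 = padd (pscale x1 n) (pscale y1 m) -> dot b1 B1 = x1 * p + y1 * p' -> y1 <> 0 ->
  b2 = padd (pscale x2 n) (pscale y2 m) -> dot b2 B2 = x2 * p + y2 * p' -> y2 <> 0 ->
  b3 = padd (pscale x3 n) (pscale y3 m) -> dot b3 B3 = x3 * p + y3 * p' -> y3 <> 0 ->
  b1 <> b2 -> b2 <> b3 -> b1 <> b3 -> False.
Proof.
  intros HO Hsm N1 N2 N3 E1 F1 Y1 E2 F2 Y2 E3 F3 Y3 D12 D23 D13.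
  destruct (dom_int O HO) as [c Hc].
  assert (K : forall B b, nrm O B b -> dot b (psub c B) < 0).
  { intros B b (_ & U & S). now apply (supp_int O). }
  assert (P : forall B b x y B' b' x' y', nrm O B b -> nrm O B' b' -> b = padd (pscale x n) (pscale y m) -> dot b B = x * p + y * p' -> y <> 0 ->
     b' = padd (pscale x' n) (pscale y' m) -> dot b' B' = x' * p + y' * p' -> y' <> 0 -> b <> b' -> x * y' - x' * y <> 0).
  { intros B b x y B' b' x' y' HB HB' Eb Fb Yb Eb' Fb' Yb' Hne Z. apply Hne.
    assert (V : pscale y' b = pscale y b').
    { rewrite Eb, Eb'. apply dist2_eq0. unfold dist2.
      replace (psub (pscale y' (padd (pscale x n) (pscale y m))) (pscale y (padd (pscale x' n) (pscale y' m)))) with (pscale (x * y' - x' * y) n) by pt_eq.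
      rewrite Z, norm2_scale, Rabs_R0. ring. }
    assert (H : y' * dot b B = y * dot b' B').
    { rewrite Fb, Fb'. assert (x * y' = x' * y) by lra. replace (y' * (x * p + y * p')) with (x * y' * p + y * y' * p') by ring. rewrite H; ring. }
    assert (Kb := K B b HB). assert (Kb' := K B' b' HB').
    assert (Q : y' * dot b (psub c B) = y * dot b' (psub c B')).
    { replace (y' * dot b (psub c B)) with (dot (pscale y' b) c - y' * dot b B) by pt_eq.
      replace (y * dot b' (psub c B')) with (dot (pscale y b') c - y * dot b' B') by pt_eq. now rewrite V, H. }
    destruct (Rdichotomy y 0 Yb); destruct (Rdichotomy y' 0 Yb'); try nra.
    - apply (pscale_unit_inj (- y') (- y)); try lra; try apply HB; try apply HB'.
      transitivity (pscale (-1) (pscale y' b)); [pt_eq|]. rewrite V. pt_eq.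
    - apply (pscale_unit_inj y' y); auto; try apply HB; try apply HB'. }
  assert (P23 := P _ _ _ _ _ _ _ _ N2 N3 E2 F2 Y2 E3 F3 Y3 D23).
  assert (P12 := P _ _ _ _ _ _ _ _ N1 N2 E1 F1 Y1 E2 F2 Y2 D12).
  assert (P31 := P _ _ _ _ _ _ _ _ N3 N1 E3 F3 Y3 E1 F1 Y1 (fun e => D13 (eq_sym e))).
  assert (Id : forall Y, (x2 * y3 - x3 * y2) * dot b1 (psub Y B1) + (x3 * y1 - x1 * y3) * dot b2 (psub Y B2) + (x1 * y2 - x2 * y1) * dot b3 (psub Y B3) = 0).
  { intros Y.
    replace (dot b1 (psub Y B1)) with (dot b1 Y - dot b1 B1) by pt_eq. replace (dot b2 (psub Y B2)) with (dot b2 Y - dot b2 B2) by pt_eq.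
    replace (dot b3 (psub Y B3)) with (dot b3 Y - dot b3 B3) by pt_eq. rewrite F1, F2, F3, E1, E2, E3. pt_eq. }
  assert (Z : forall B b, dot b (psub B B) = 0) by (intros; pt_eq).
  assert (Sm : forall B b B' b', nrm O B b -> nrm O B' b' -> dot b' (psub B B') = 0 -> b = b').
  { intros B b B' b' HB HB' H. apply (Hsm B); auto. split; [apply HB|]. split; [apply HB'|]. intros Y HY.
    assert (T := proj2 (proj2 HB') Y HY). replace (dot b' (psub Y B)) with (dot b' (psub Y B') - dot b' (psub B B')) by pt_eq. lra. }
  assert (Le : forall B b B' b', nrm O B b -> nrm O B' b' -> dot b (psub B' B) <= 0).
  { intros B b B' b' HB HB'. apply HB, HB'. }
  destruct (three_signs _ _ _ _ _ _ (K B1 b1 N1) (K B2 b2 N2) (K B3 b3 N3) P23 P31 P12 (Id c)) as [[S S']|[[S S']|[S S']]].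
  - assert (I := Id B1). rewrite Z in I.
    destruct (same_sign_zero (x3 * y1 - x1 * y3) (x1 * y2 - x2 * y1) (dot b2 (psub B1 B2)) (dot b3 (psub B1 B3))); [nra | exact (Le _ _ _ _ N2 N1) | exact (Le _ _ _ _ N3 N1) | lra |].
    apply D12. now apply (Sm B1 b1 B2 b2).
  - assert (I := Id B2). rewrite Z in I.
    destruct (same_sign_zero (x2 * y3 - x3 * y2) (x1 * y2 - x2 * y1) (dot b1 (psub B2 B1)) (dot b3 (psub B2 B3))); [nra | exact (Le _ _ _ _ N1 N2) | exact (Le _ _ _ _ N3 N2) | lra |].
    apply D12. symmetry. now apply (Sm B2 b2 B1 b1).
  - assert (I := Id B3). rewrite Z in I.
    destruct (same_sign_zero (x2 * y3 - x3 * y2) (x3 * y1 - x1 * y3) (dot b1 (psub B3 B1)) (dot b2 (psub B3 B2))); [nra | exact (Le _ _ _ _ N1 N3) | exact (Le _ _ _ _ N2 N3) | lra |].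
    apply D13. symmetry. now apply (Sm B3 b3 B1 b1).
Qed.

(** * Concurrency from zero excess, and its effect on corners of the inner domain *)

Section Concurrency.
Variables O1 O2 : pt -> Prop.
Hypothesis HS : commuting_pair O1 O2.
Let H1 := cv1 O1 O2 HS.
Let H2 := cv2 O1 O2 HS.
Notation quad := (quad O1 O2).

Definition uD q := psub (qw2 q) (qv1 q).

(* The four tangent lines at the vertices of a quadrilateral of zero excess are concurrent, possibly at infinity. *)
Lemma concurrent q : quad q -> excess q = 0 -> 0 < dot (qn q) (qv q) ->
  exists l m, uD q = padd (pscale l (qn q)) (pscale m (qb q)) /\
    dot (uD q) (qD q) = l * dot (qn q) (qA q) + m * dot (qb q) (qB q).
Proof.
  intros Hq Hex Hn.
  assert (Un : unit_pt (qn q)) by apply Hq. assert (Ub : unit_pt (qb q)) by apply Hq. assert (Uv : unit_pt (qv q)) by apply Hq.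
  assert (U1 := quad_uw1 O1 O2 q Hq). assert (U2 := quad_uw2 O1 O2 q Hq). assert (U3 := quad_uv1 O1 O2 q Hq).
  assert (GB := quad_AB O1 O2 q Hq). assert (GC := quad_AC O1 O2 q Hq). assert (GD := quad_BD O1 O2 q Hq). assert (GE := quad_CD O1 O2 q Hq).
  destruct (quad_AB_pos O1 O2 HS q Hq) as [Pr Pb]. destruct (quad_AC_pos O1 O2 HS q Hq) as [_ Pc].
  assert (Hne := quad_w2_neq_v1 O1 O2 HS q Hq Hn). assert (Hc1 := quad_c_v1 O1 O2 q Hq).
  assert (Hne1 : qw1 q <> qv1 q). { intros E. rewrite <- E in Hc1. lra. }
  destruct (Req_dec (cross (qn q) (qb q)) 0) as [Hcr|Hcr].
  (* Parallel tangents at [qA] and [qB]: closing up with zero excess forces equal opposite sides and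
     [qv1 = qv], so the figure is a parallelogram. *)
  - assert (En : qb q = qn q).
    { destruct (unit_eq_or (qn q) (qb q)) as [E|E]; auto. rewrite E in Hn.
      replace (dot (pscale (-1) (qb q)) (qv q)) with (- dot (qb q) (qv q)) in Hn by pt_eq. lra. }
    assert (Ew : qw2 q = qw1 q) by (unfold qw2, qw1; now rewrite En).
    assert (Hw : qw1 q = psub (qv q) (pscale (2 * dot (qn q) (qv q)) (qn q))) by (unfold qw1, refl; rewrite (dot_sym (qv q)); reflexivity).
    unfold excess in Hex. rewrite Ew in *. unfold uD. rewrite Ew, En.
    set (r := dot (qv q) (psub (qB q) (qA q))) in *. set (s := dot (qw1 q) (psub (qC q) (qA q))) in *.
    set (s' := dot (qw1 q) (psub (qD q) (qB q))) in *. set (s'' := dot (qv1 q) (psub (qD q) (qC q))) in *.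
    set (a := dot (qn q) (qv q)) in *.
    assert (Hvw : dot (qv q) (qw1 q) = 1 - 2 * (a * a)).
    { rewrite Hw. unfold a. replace (dot (qv q) (psub (qv q) (pscale (2 * dot (qn q) (qv q)) (qn q)))) with (dot (qv q) (qv q) - 2 * (dot (qn q) (qv q) * dot (qn q) (qv q))) by pt_eq. rewrite Uv; ring. }
    assert (Hnw : dot (qn q) (qw1 q) = - a) by apply (quad_n_w1 O1 O2 q Hq).
    assert (V : padd (pscale r (qv q)) (pscale (s' - s) (qw1 q)) = pscale s'' (qv1 q)).
    { transitivity (psub (psub (qD q) (qA q)) (psub (qC q) (qA q))).
      - rewrite GD at 1. rewrite GB at 1. rewrite GC at 1. pt_eq.
      - rewrite GE at 1. pt_eq. }
    assert (Hs : s'' = r + (s' - s)) by lra.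
    assert (N : r * r + (s' - s) * (s' - s) + 2 * r * (s' - s) * (1 - 2 * (a * a)) = s'' * s'').
    { rewrite <- Hvw. transitivity (dot (pscale s'' (qv1 q)) (pscale s'' (qv1 q))).
      - rewrite <- V. transitivity (r * r * dot (qv q) (qv q) + (s' - s) * (s' - s) * dot (qw1 q) (qw1 q) + 2 * r * (s' - s) * dot (qv q) (qw1 q)).
        + rewrite Uv, U1; ring.
        + pt_eq.
      - transitivity (s'' * s'' * dot (qv1 q) (qv1 q)); [pt_eq | rewrite U3; ring]. }
    assert (D0 : s' - s = 0).
    { rewrite Hs in N. assert (Z : (r * (a * a)) * (s' - s) = 0) by lra. apply Rmult_integral in Z. destruct Z as [Z|Z]; auto.
      assert (0 < r * (a * a)) by (apply Rmult_lt_0_compat; nra). lra. }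
    assert (Hs2 : s'' = r) by lra. rewrite Hs2, D0 in V.
    assert (Ev : qv1 q = qv q).
    { apply (pscale_unit_inj r r); auto. rewrite <- V. pt_eq. }
    rewrite Ev.
    assert (HD : dot (qn q) (qD q) = dot (qn q) (qA q) + r * a - s' * a).
    { rewrite GD. replace (dot (qn q) (padd (qB q) (pscale s' (qw1 q)))) with (dot (qn q) (qB q) + s' * dot (qn q) (qw1 q)) by pt_eq.
      rewrite Hnw, GB. replace (dot (qn q) (padd (qA q) (pscale r (qv q)))) with (dot (qn q) (qA q) + r * dot (qn q) (qv q)) by pt_eq.
      fold a. ring. }
    assert (HB : dot (qn q) (qB q) = dot (qn q) (qA q) + r * a).
    { rewrite GB. unfold a. pt_eq. }
    assert (EuD : psub (qw1 q) (qv q) = pscale (- 2 * a) (qn q)) by (rewrite Hw; fold a; pt_eq).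
    (* The sum of the coefficients is forced by [qb = qn]; the second one is then read off from the
       distance [r * a] between the parallel tangents. *)
    exists (- 2 * a + 2 * a * (r - s') / r), (- 2 * a * (r - s') / r). rewrite EuD. split.
    + apply pt_ext; cbn; field; lra.
    + replace (dot (pscale (-2 * a) (qn q)) (qD q)) with (-2 * a * dot (qn q) (qD q)) by pt_eq.
      rewrite HD, HB. field. lra.
  (* [P] is the common point of the tangents at [qA] and [qB]. Moments about [P] are constant along
     a side and change sign under reflection in a line through [P]. *)
  - set (t := dot (qb q) (psub (qB q) (qA q)) / cross (qn q) (qb q)).
    set (P := padd (qA q) (pscale t (perp (qn q)))).
    assert (PA : dot (qn q) P = dot (qn q) (qA q)) by (unfold P; pt_eq).
    assert (PB : dot (qb q) P = dot (qb q) (qB q)).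
    { unfold P. replace (dot (qb q) (padd (qA q) (pscale t (perp (qn q))))) with (dot (qb q) (qA q) + t * cross (qn q) (qb q)) by pt_eq.
      unfold t. replace (dot (qb q) (psub (qB q) (qA q))) with (dot (qb q) (qB q) - dot (qb q) (qA q)) by pt_eq. field. auto. }
    set (A' := psub (qA q) P). set (B' := psub (qB q) P). set (C' := psub (qC q) P). set (D' := psub (qD q) P).
    assert (ZA : dot (qn q) A' = 0). { unfold A'. replace (dot (qn q) (psub (qA q) P)) with (dot (qn q) (qA q) - dot (qn q) P) by pt_eq. lra. }
    assert (ZB : dot (qb q) B' = 0). { unfold B'. replace (dot (qb q) (psub (qB q) P)) with (dot (qb q) (qB q) - dot (qb q) P) by pt_eq. lra. }
    assert (Rf : forall n v X, unit_pt n -> dot n X = 0 -> cross X (refl n v) = - cross X v /\ dot (psub v (refl n v)) X = 0).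
    { intros n v X Hn1 HX. split.
      - replace (cross X (refl n v)) with (cross X v - 2 * dot v n * cross X n) by pt_eq.
        assert (E := decomp n X Hn1). rewrite HX in E.
        assert (E2 : cross X n = - cross n X) by pt_eq.
        assert (E3 : cross X v = cross n X * - dot v n).
        { rewrite E at 1. replace (cross (padd (pscale 0 n) (pscale (cross n X) (perp n))) v) with (cross n X * - dot v n) by pt_eq. ring. }
        rewrite E3, E2. ring.
      - replace (dot (psub v (refl n v)) X) with (2 * dot v n * dot n X) by pt_eq. rewrite HX; ring. }
    destruct (Rf _ (qv q) A' Un ZA) as [CA SA]. destruct (Rf _ (qv q) B' Ub ZB) as [CB SB].
    fold (qw1 q) in CA, SA. fold (qw2 q) in CB, SB.
    assert (Ln : forall X Y w s, Y = padd X (pscale s w) -> cross (psub Y P) w = cross (psub X P) w).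
    { intros X Y w s E. rewrite E. generalize P; intros; pt_eq. }
    assert (L1 := Ln _ _ _ _ GB). assert (L2 := Ln _ _ _ _ GC). assert (L3 := Ln _ _ _ _ GD). assert (L4 := Ln _ _ _ _ GE).
    fold A' B' C' D' in L1, L2, L3, L4.
    assert (Hk : dot C' (psub (qw1 q) (qv1 q)) = dot D' (psub (qw2 q) (qv1 q))).
    { rewrite excess_dual in Hex.
      assert (Tr : dot (psub (qv q) (qw2 q)) (qB q) + dot (psub (qw2 q) (qv1 q)) (qD q) - dot (psub (qv q) (qw1 q)) (qA q) - dot (psub (qw1 q) (qv1 q)) (qC q)
        = dot (psub (qv q) (qw2 q)) B' + dot D' (psub (qw2 q) (qv1 q)) - dot (psub (qv q) (qw1 q)) A' - dot C' (psub (qw1 q) (qv1 q))).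
      { unfold A', B', C', D'. generalize P (qw1 q) (qw2 q) (qv1 q); intros; pt_eq. }
      lra. }
    (* If the support line at [qD] missed [P], [bisector_moment] at [C'] and at [D'] would give
       [qw1] and [qw2] the same half-angle cotangent with [qv1]; then [qw1 = qw2], and the tangents
       at [qA] and [qB] would be parallel. *)
    assert (Key : dot D' (psub (qw2 q) (qv1 q)) = 0).
    { destruct (Req_dec (dot D' (psub (qw2 q) (qv1 q))) 0) as [|Hk0]; auto. exfalso.
      set (k := dot D' (psub (qw2 q) (qv1 q))) in *. set (p := cross A' (qv q)) in *. set (p' := cross D' (qv1 q)) in *.
      assert (M1 := bisector_moment C' (qw1 q) (qv1 q) p p' k U1 U3 ltac:(lra) ltac:(lra) Hk).
      assert (M2 := bisector_moment D' (qw2 q) (qv1 q) p p' k U2 U3 ltac:(lra) eq_refl eq_refl).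
      assert (E : qw1 q = qw2 q).
      { apply (unit_from_moments _ _ (qv1 q) ((p' - p) / k)); auto.
        - apply (Rmult_eq_reg_l k); auto. rewrite <- M1. field; auto.
        - apply (Rmult_eq_reg_l k); auto. rewrite <- M2. field; auto. }
      apply Hcr. assert (En : qn q = qb q).
      { apply (pscale_unit_inj (2 * dot (qv q) (qn q)) (2 * dot (qv q) (qb q))); auto; try (rewrite dot_sym; lra).
        transitivity (psub (qv q) (qw1 q)); [unfold qw1; generalize (qv q) (qn q); intros; pt_eq|].
        rewrite E. unfold qw2; generalize (qv q) (qb q); intros; pt_eq. }
      rewrite En. pt_eq. }
    set (u := psub (qw2 q) (qv1 q)) in *. unfold uD. fold u.
    set (l := cross u (qb q) / cross (qn q) (qb q)). set (m := cross (qn q) u / cross (qn q) (qb q)).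
    assert (Eu : u = padd (pscale l (qn q)) (pscale m (qb q))).
    { unfold l, m. clearbody u. clear - Hcr. destruct (qn q) as [n1 n2], (qb q) as [b1 b2], u as [u1 u2].
      pt_unfold. apply pt_ext; cbn; field; auto. }
    exists l, m. split; auto.
    assert (E0 : dot u (qD q) = dot u P).
    { unfold D' in Key. replace (dot (psub (qD q) P) u) with (dot u (qD q) - dot u P) in Key by (generalize P u; intros; pt_eq). lra. }
    rewrite E0, <- PA, <- PB. rewrite Eu at 1. generalize P l m; intros; pt_eq.
Qed.

Definition qm q := unitize (uD q).

Lemma uD_nz q : quad q -> 0 < dot (qn q) (qv q) -> uD q <> (0,0).
Proof. intros Hq Hn. apply psub_nz. now apply (quad_w2_neq_v1 O1 O2 HS). Qed.

Lemma qm_nrm q : quad q -> 0 < dot (qn q) (qv q) -> nrm O1 (qD q) (qm q).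
Proof.
  intros Hq Hn. assert (Hz := uD_nz q Hq Hn). split; [apply Hq|]. split; [now apply unitize_unit|].
  intros Y HY. assert (S : dot (uD q) (psub Y (qD q)) <= 0) by (apply Hq; auto).
  rewrite (unitize_eq (uD q) Hz) in S. fold (qm q) in S. assert (P := norm2_pos _ Hz).
  replace (dot (pscale (norm2 (uD q)) (qm q)) (psub Y (qD q))) with (norm2 (uD q) * dot (qm q) (psub Y (qD q))) in S by pt_eq.
  nra.
Qed.

Lemma qm_exit q : quad q -> 0 < dot (qn q) (qv q) -> exitp O1 (qD q) (qm q) (qw2 q).
Proof.
  intros Hq Hn. split; [now apply qm_nrm|]. assert (Hz := uD_nz q Hq Hn). assert (P := norm2_pos _ Hz).
  assert (U2 := quad_uw2 O1 O2 q Hq). assert (U3 := quad_uv1 O1 O2 q Hq).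
  assert (Q : 0 < dot (uD q) (qw2 q)).
  { assert (S := norm2_sq (uD q)).
    replace (dot (uD q) (uD q)) with (2 * dot (uD q) (qw2 q) + (dot (qv1 q) (qv1 q) - dot (qw2 q) (qw2 q))) in S
      by (unfold uD; pt_eq).
    rewrite U2, U3 in S. nra. }
  unfold qm, unitize. replace (dot (pscale (/ norm2 (uD q)) (uD q)) (qw2 q)) with (/ norm2 (uD q) * dot (uD q) (qw2 q)) by pt_eq.
  apply Rmult_lt_0_compat; auto. now apply Rinv_0_lt_compat.
Qed.

Lemma concurrent_unit q : quad q -> excess q = 0 -> 0 < dot (qn q) (qv q) ->
  exists l m, qm q = padd (pscale l (qn q)) (pscale m (qb q)) /\
    dot (qm q) (qD q) = l * dot (qn q) (qA q) + m * dot (qb q) (qB q).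
Proof.
  intros Hq Hex Hn. destruct (concurrent q Hq Hex Hn) as (l & m & E & F).
  exists (/ norm2 (uD q) * l), (/ norm2 (uD q) * m). unfold qm, unitize. split.
  - rewrite E at 2. pt_eq.
  - replace (dot (pscale (/ norm2 (uD q)) (uD q)) (qD q)) with (/ norm2 (uD q) * dot (uD q) (qD q)) by pt_eq.
    rewrite F. ring.
Qed.

(** A limit of quadrilaterals through [B] for lines turned by [- sg * tk k]: their vertices [qA]
    approach [Q] from the side [sg], so the limit normal is the extreme one there. At [qD] the side
    does not matter, whence the reference direction [(0,0)]. *)
Lemma corner_quad Q n0 v sg : exitp O1 Q n0 v -> unit_pt v -> crosses O1 Q v -> sg * sg = 1 ->
  exists q, quad q /\ qA q = Q /\ qv q = v /\ excess q = 0 /\ 0 < dot (qn q) (qv q) /\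
    edge O1 Q (qn q) (pscale sg (perp v)) /\ edge O1 (qD q) (qm q) (0,0).
Proof.
  intros HQ Hv [s Hs] Hsg.
  destruct (exit_exists O2 H2 Q v) as (r & b & HB).
  { now apply unit_nz. }
  { exists 0. replace (padd Q (pscale 0 v)) with Q by pt_eq. apply (inner_interior O1 O2 HS), HQ. }
  set (B := padd Q (pscale r v)) in *.
  assert (Hcr : crosses O1 B v).
  { exists (s - r). replace (padd B (pscale (s - r) v)) with (padd Q (pscale s v)) by (unfold B; pt_eq). exact Hs. }
  destruct (quads_near O1 O2 HS B b v (- sg) (proj1 HB) Hv (proj2 HB) Hcr ltac:(lra)) as (K & u & Hu & IA & ID).
  destruct (quad_compact O1 O2 HS u) as (phi & q & Hp & Hc & Hq). { intros; apply Hu. }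
  assert (EB : qB q = B).
  { apply (pconv_uniq (fun k => qB (u (phi k)))); [apply Hc|].
    apply (pconv_squeeze _ _ (fun _ => 0)); [apply is_lim_seq_const|].
    intros k. destruct (Hu (phi k)) as (_ & E & _). rewrite E, dist2_refl. lra. }
  assert (Ev : qv q = v).
  { apply (pconv_uniq (fun k => qv (u (phi k)))); [apply Hc|].
    assert (L : pconv (fun k => rot (- sg * tk k) v) v) by apply pconv_rot, lim_sg_tk.
    apply (pconv_sub _ _ _ (inc_comp _ _ (inc_add K) Hp)) in L.
    apply (pconv_squeeze _ _ (fun k => dist2 (rot (- sg * tk (K + phi k)) v) v)).
    - now apply pconv_dist in L.
    - intros k. destruct (Hu (phi k)) as (_ & _ & _ & E & _). rewrite E. lra. }
  assert (Hex : exitp O1 (qA q) (qn q) (qv q)).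
  { apply (quad_exit O1 O2); auto. now rewrite EB, Ev. }
  assert (EA : qA q = Q).
  { rewrite Ev in Hex. assert (G := quad_AB O1 O2 q Hq). rewrite EB, Ev in G. set (t := dot v (psub B (qA q))) in *.
    apply (exit_unique O1 Q n0 v (qA q) (qn q) (r - t)); auto.
    transitivity (padd B (pscale (- t) v)).
    - rewrite G. pt_eq.
    - unfold B. pt_eq. }
  assert (Hn : 0 < dot (qn q) (qv q)) by apply Hex.
  destruct (eventually_not_in (Q :: nil) (fun k => qA (u k)) 0%nat) as [N1 HN1]; [intros; now apply IA|].
  destruct (eventually_not_in (qD q :: nil) (fun k => qD (u k)) 0%nat) as [N2 HN2]; [intros; now apply ID|].
  set (psi := fun k => phi (N1 + N2 + k)%nat).
  assert (Hpsi : inc psi) by (apply (inc_comp phi (fun k => (N1 + N2 + k)%nat)); [auto | apply inc_add]).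
  assert (Hge : forall k, (N1 <= psi k /\ N2 <= psi k)%nat). { intros k. unfold psi. assert (H := inc_ge phi Hp (N1 + N2 + k)%nat). lia. }
  assert (Sub : forall (w : nat -> pt) p, pconv (fun k => w (phi k)) p -> pconv (fun k => w (psi k)) p).
  { intros w p H. apply (pconv_sub (fun k => w (phi k)) p (fun k => (N1 + N2 + k)%nat)); [apply inc_add | exact H]. }
  exists q. split; auto. split; auto. split; auto. split; [|split; auto; split].
  - apply (lim_eq (fun k => excess (u (phi k)))); [now apply (excess_lim (fun k => u (phi k)))|].
    intros k. apply (excess_zero O1 O2 HS); apply Hu.
  - apply (edge_limit O1 H1 (fun k => qA (u (psi k))) (fun k => qn (u (psi k)))).
    + apply (Sub (fun k => qA (u k))). rewrite <- EA. apply Hc.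
    + apply (Sub (fun k => qn (u k))). apply Hc.
    + intros k. apply Hu.
    + intros k E. apply (HN1 (psi k)); [apply Hge|]. now left.
    + intros k. destruct (Hu (psi k)) as (Qk & Bk & _ & Vk & _). assert (G := quad_AB O1 O2 _ Qk). 
      destruct (quad_AB_pos O1 O2 HS _ Qk) as [Pk _].
      set (t := dot (qv (u (psi k))) (psub (qB (u (psi k))) (qA (u (psi k))))) in *. rewrite Bk, Vk in G.
      set (th := - sg * tk (K + psi k)) in *.
      replace (qA (u (psi k))) with (padd B (pscale (- t) (rot th v))) by (rewrite G; pt_eq).
      unfold B. replace (dot (pscale sg (perp v)) (psub (padd (padd Q (pscale r v)) (pscale (- t) (rot th v))) Q)) with (- (sg * (t * cross v (rot th v))))
        by pt_eq.
      rewrite cross_rot by auto.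
      assert (A1 := tk_pos (K + psi k)). assert (A2 := tk_le1 (K + psi k)). assert (Pi := PI2_1).
      destruct (sign_cases sg Hsg) as [Es|Es]; unfold th; rewrite Es.
      * assert (sin (- (1) * tk (K + psi k)) < 0) by (apply sin_lt_0_var; lra). nra.
      * assert (0 < sin (- (-1) * tk (K + psi k))) by (apply sin_gt_0; lra). nra.
  - apply (edge_limit O1 H1 (fun k => qD (u (psi k))) (fun k => qm (u (psi k)))).
    + apply (Sub (fun k => qD (u k))). apply Hc.
    + apply (Sub (fun k => qm (u k))). apply (unitize_lim (fun k => uD (u (phi k)))); [now apply uD_nz|].
      apply pconv_sub2; [now apply (qconv_w2 (fun k => u (phi k))) | now apply (qconv_v1 (fun k => u (phi k)))].
    + intros k. apply qm_nrm; apply Hu.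
    + intros k E. apply (HN2 (psi k)); [apply Hge|]. now left.
    + intros k. replace (dot (0,0) (psub (qD (u (psi k))) (qD q))) with 0 by pt_eq. lra.
Qed.

(** The normal chosen at a corner [qA] affects only the path through [qC]. *)
Lemma quads_same_BD q p : quad q -> quad p -> qA q = qA p -> qv q = qv p -> 0 < dot (qn q) (qv q) -> 0 < dot (qn p) (qv p) ->
  qB p = qB q /\ qb p = qb q /\ qD p = qD q.
Proof.
  intros Hq Hp EA Ev Hn Hn'.
  destruct (exit_eq O2 (qB q) (qb q) (qB p) (qb p) (qv q)) as [EB Eb].
  - now apply outer_smooth with O1.
  - split; [apply Hq | now apply (quad_AB_pos O1 O2 HS)].
  - split; [apply Hp | rewrite Ev; now apply (quad_AB_pos O1 O2 HS)].
  - assert (G := quad_AB O1 O2 q Hq). assert (G' := quad_AB O1 O2 p Hp). rewrite <- EA, <- Ev in G'.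
    set (r := dot (qv q) (psub (qB q) (qA q))) in *. set (r' := dot (qv q) (psub (qB p) (qA q))) in *.
    exists (r' - r). rewrite G, G'. pt_eq.
  - split; auto. split; auto.
    assert (Ew : qw2 p = qw2 q) by (unfold qw2; congruence).
    assert (X := qm_exit q Hq Hn). assert (X' := qm_exit p Hp Hn'). rewrite Ew in X'.
    assert (G := quad_BD O1 O2 q Hq). assert (G' := quad_BD O1 O2 p Hp). rewrite EB, Ew in G'.
    set (r := dot (qw2 q) (psub (qD q) (qB q))) in *. set (r' := dot (qw2 q) (psub (qD p) (qB q))) in *.
    apply (exit_unique O1 (qD q) (qm q) (qw2 q) (qD p) (qm p) (r' - r)); auto.
    rewrite G, G'. pt_eq.
Qed.

(** The two extreme normals at the corner give two quadrilaterals with the same [qB] and [qD]. Were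
    [qD] smooth, both would express its one normal with the same coefficient on [qb], so the terms
    along the two nonparallel normals at [qA] vanish: the support line at [qD] would be that at
    [qB], which misses [O1]. *)
Lemma corner_to_corner q n0 : quad q -> excess q = 0 -> 0 < dot (qn q) (qv q) -> crosses O1 (qA q) (qv q) -> exitp O1 (qA q) n0 (qv q) ->
  ~ smooth O1 (qA q) -> ~ smooth O1 (qD q).
Proof.
  intros Hq _ Hn Hcr Hex Hns HsD.
  assert (Uv : unit_pt (qv q)) by apply Hq.
  destruct (corner_quad (qA q) n0 (qv q) 1 Hex Uv Hcr ltac:(lra)) as (p & Hp & EAp & Evp & Xp & Np & Ep & _).
  destruct (corner_quad (qA q) n0 (qv q) (-1) Hex Uv Hcr ltac:(lra)) as (z & Hz & EAz & Evz & Xz & Nz & Ez & _).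
  destruct (quads_same_BD q p Hq Hp) as (Bp & bp & Dp); auto. destruct (quads_same_BD q z Hq Hz) as (Bz & bz & Dz); auto.
  assert (Hne : qn p <> qn z).
  { intros E. apply Hns. apply (edges_both_sides O1 H1 (qA q) (qn p) (qv q)).
    - rewrite <- EAp. apply Hp.
    - now rewrite <- Evp.
    - replace (perp (qv q)) with (pscale 1 (perp (qv q))) by pt_eq. exact Ep.
    - rewrite E. exact Ez. }
  assert (EM : qm z = qm p).
  { apply HsD; [rewrite <- Dz | rewrite <- Dp]; now apply qm_nrm. }
  destruct (concurrent_unit p Hp Xp Np) as (l1 & m1 & E1 & F1). destruct (concurrent_unit z Hz Xz Nz) as (l2 & m2 & E2 & F2).
  rewrite bp, Bp, Dp, EAp in *. rewrite bz, Bz, Dz, EAz in *. rewrite EM in E2, F2.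
  assert (Hb : 0 < dot (qb q) (psub (qB q) (qA q))).
  { assert (L := inner_lt O1 O2 HS (qB q) (qb q) (qA q) (proj1 (proj2 Hq)) (proj1 (proj1 Hq))).
    replace (dot (qb q) (psub (qB q) (qA q))) with (- dot (qb q) (psub (qA q) (qB q))) by pt_eq. lra. }
  assert (HbD := inner_lt O1 O2 HS (qB q) (qb q) (qD q) (proj1 (proj2 Hq)) (proj1 (proj2 (proj2 (proj2 Hq))))).
  assert (G1 : dot (qm p) (psub (qD q) (qA q)) = m1 * dot (qb q) (psub (qB q) (qA q))).
  { replace (dot (qm p) (psub (qD q) (qA q))) with (dot (qm p) (qD q) - dot (qm p) (qA q)) by pt_eq.
    rewrite F1, E1. pt_eq. }
  assert (G2 : dot (qm p) (psub (qD q) (qA q)) = m2 * dot (qb q) (psub (qB q) (qA q))).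
  { replace (dot (qm p) (psub (qD q) (qA q))) with (dot (qm p) (qD q) - dot (qm p) (qA q)) by pt_eq.
    rewrite F2, E2. pt_eq. }
  assert (Em : m1 = m2). { apply (Rmult_eq_reg_r (dot (qb q) (psub (qB q) (qA q)))); lra. }
  subst m2.
  assert (EL : pscale l1 (qn p) = pscale l2 (qn z)).
  { transitivity (psub (qm p) (pscale m1 (qb q))); [rewrite E1 at 1 | rewrite E2 at 1]; pt_eq. }
  assert (L0 : l1 = 0).
  { apply (Rmult_eq_reg_r (cross (qn p) (qn z))).
    - transitivity (cross (pscale l1 (qn p)) (qn z)); [pt_eq|]. rewrite EL. pt_eq.
    - intros Hc. destruct (unit_eq_or (qn p) (qn z)) as [|E]; auto; try apply Hp; try apply Hz.
      rewrite E, Evp in Np. rewrite Evz in Nz. replace (dot (pscale (-1) (qn z)) (qv q)) with (- dot (qn z) (qv q)) in Np by pt_eq. lra. }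
  assert (Z : m1 * dot (qb q) (psub (qD q) (qB q)) = 0).
  { assert (T : dot (qm p) (qD q) = m1 * dot (qb q) (qD q)) by (rewrite E1, L0; pt_eq).
    replace (m1 * dot (qb q) (psub (qD q) (qB q))) with (m1 * dot (qb q) (qD q) - m1 * dot (qb q) (qB q)) by pt_eq. rewrite <- T, F1, L0. ring. }
  apply Rmult_integral in Z. destruct Z as [Z|Z]; [|lra].
  assert (U : unit_pt (qm p)) by (apply unitize_unit; now apply uD_nz).
  rewrite E1, L0, Z in U. unfold unit_pt in U.
  replace (dot (padd (pscale 0 (qn p)) (pscale 0 (qb q))) (padd (pscale 0 (qn p)) (pscale 0 (qb q)))) with 0 in U by pt_eq. lra.
Qed.

(** The relation of [concurrent_unit] is solved for [qb]. Its coefficient [m] cannot vanish: the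
    support lines at [qA] and [qD] would coincide, while the path from [qA] over [qB] to [qD] would
    move strictly outward from this line. *)
Lemma pencil_coeffs q : quad q -> excess q = 0 -> 0 < dot (qn q) (qv q) ->
  exists x y, y <> 0 /\ qb q = padd (pscale x (qn q)) (pscale y (qm q)) /\
    dot (qb q) (qB q) = x * dot (qn q) (qA q) + y * dot (qm q) (qD q).
Proof.
  intros Hq Hex Hn. destruct (concurrent_unit q Hq Hex Hn) as (l & m & E & F).
  assert (HM := qm_nrm q Hq Hn). assert (Hx := qm_exit q Hq Hn).
  destruct (Req_dec m 0) as [Hm|Hm].
  - exfalso. subst m.
    assert (E' : qm q = pscale l (qn q)) by (rewrite E; pt_eq).
    assert (Hl : l <> 0).
    { intros Z. subst l. assert (U := proj1 (proj2 HM)). rewrite E' in U. unfold unit_pt in U.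
      replace (dot (pscale 0 (qn q)) (pscale 0 (qn q))) with 0 in U by pt_eq. lra. }
    assert (ZD : dot (qn q) (psub (qD q) (qA q)) = 0).
    { apply (Rmult_eq_reg_l l); auto. rewrite E' in F.
      replace (l * dot (qn q) (psub (qD q) (qA q))) with (dot (pscale l (qn q)) (qD q) - l * dot (qn q) (qA q)) by pt_eq. rewrite F. ring. }
    destruct (dom_int O1 H1) as [c Hc].
    assert (K1 := supp_int O1 c (qA q) (qn q) Hc (proj1 (proj2 (proj1 Hq))) (proj2 (proj2 (proj1 Hq)))).
    assert (K2 := supp_int O1 c (qD q) (qm q) Hc (proj1 (proj2 HM)) (proj2 (proj2 HM))).
    rewrite E' in K2. replace (dot (pscale l (qn q)) (psub c (qD q))) with (l * (dot (qn q) (psub c (qA q)) - dot (qn q) (psub (qD q) (qA q)))) in K2 by pt_eq.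
    rewrite ZD in K2. assert (Pl : 0 < l) by nra.
    destruct Hx as [_ Hx]. rewrite E' in Hx. replace (dot (pscale l (qn q)) (qw2 q)) with (l * dot (qn q) (qw2 q)) in Hx by pt_eq.
    assert (Pw : 0 < dot (qn q) (qw2 q)) by nra.
    destruct (quad_AB_pos O1 O2 HS q Hq) as [Pr _].
    assert (Ps : 0 <= dot (qw2 q) (psub (qD q) (qB q))) by apply Hq.
    assert (G := quad_BD O1 O2 q Hq). assert (G' := quad_AB O1 O2 q Hq).
    set (s := dot (qw2 q) (psub (qD q) (qB q))) in *. set (r := dot (qv q) (psub (qB q) (qA q))) in *.
    assert (T : dot (qn q) (psub (qD q) (qA q)) = r * dot (qn q) (qv q) + s * dot (qn q) (qw2 q)).
    { rewrite G, G'. pt_eq. }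
    nra.
  - exists (- l / m), (1 / m). split; [|split].
    + unfold Rdiv. rewrite Rmult_1_l. now apply Rinv_neq_0_compat.
    + rewrite E. apply pt_ext; cbn; field; auto.
    + rewrite F. field. auto.
Qed.

(* Seen in the common tangent line, the mirror image of the corner [A] would lie on two distinct lines through [D]. *)
Lemma same_tangent_same_line q p : quad q -> quad p -> qA q = qA p -> qD q = qD p -> qb q = qb p -> qv q = qv p.
Proof.
  intros Hq Hp EA ED Eb.
  destruct (quad_AB_pos O1 O2 HS q Hq) as [Pr Pb]. destruct (quad_AB_pos O1 O2 HS p Hp) as [Pr' Pb'].
  assert (Ps : 0 <= dot (qw2 q) (psub (qD q) (qB q))) by apply Hq. assert (Ps' : 0 <= dot (qw2 p) (psub (qD p) (qB p))) by apply Hp.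
  assert (G := quad_AB O1 O2 q Hq). assert (G' := quad_AB O1 O2 p Hp). assert (F := quad_BD O1 O2 q Hq). assert (F' := quad_BD O1 O2 p Hp).
  assert (S1 : dot (qb q) (psub (qB p) (qB q)) <= 0) by (apply Hq; apply Hp).
  assert (S2 : dot (qb p) (psub (qB q) (qB p)) <= 0) by (apply Hp; apply Hq). rewrite <- Eb in S2.
  set (r := dot (qv q) (psub (qB q) (qA q))) in *. set (r' := dot (qv p) (psub (qB p) (qA p))) in *.
  set (s := dot (qw2 q) (psub (qD q) (qB q))) in *. set (s' := dot (qw2 p) (psub (qD p) (qB p))) in *.
  rewrite <- EA in G'. rewrite <- Eb in Pb'.
  assert (Ub : unit_pt (qb q)) by apply Hq.
  assert (T : r * dot (qb q) (qv q) = r' * dot (qb q) (qv p)).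
  { rewrite G, G' in S1, S2.
    replace (dot (qb q) (psub (padd (qA q) (pscale r' (qv p))) (padd (qA q) (pscale r (qv q))))) with (r' * dot (qb q) (qv p) - r * dot (qb q) (qv q)) in S1 by pt_eq.
    replace (dot (qb q) (psub (padd (qA q) (pscale r (qv q))) (padd (qA q) (pscale r' (qv p))))) with (r * dot (qb q) (qv q) - r' * dot (qb q) (qv p)) in S2 by pt_eq.
    lra. }
  assert (W : forall v t u B D, B = padd (qA q) (pscale t v) -> D = padd B (pscale u (refl (qb q) v)) ->
     psub D (padd (qA q) (pscale (2 * (t * dot (qb q) v)) (qb q))) = pscale (t + u) (refl (qb q) v)).
  { intros v t u B D EB EDD. rewrite EDD, EB. clear. pt_eq. }
  assert (W1 := W _ _ _ _ _ G F). assert (Fp : qD p = padd (qB p) (pscale s' (refl (qb q) (qv p)))) by (rewrite Eb; exact F').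
  assert (W2 := W _ _ _ _ _ G' Fp). rewrite <- ED, <- T, W1 in W2.
  assert (E : refl (qb q) (qv q) = refl (qb q) (qv p)).
  { apply (pscale_unit_inj (r + s) (r' + s')); try lra; auto; apply refl_unit; auto; try apply Hq; apply Hp. }
  rewrite <- (refl_invol (qb q) (qv q)), <- (refl_invol (qb q) (qv p)) by auto. now rewrite E.
Qed.

(** Quadrilaterals issue from a corner [Q] in infinitely many directions. Repeated pigeonholing
    fixes [qD] among finitely many corners, the extreme normals at [Q] and at [qD] among two each,
    and [qb] among at most two members of a pencil. Two distinct directions are then equal by
    [same_tangent_same_line]. *)
Lemma inner_smooth Q : smooth O1 Q.
Proof.
  apply NNPP. intros Hns.
  assert (HQ : exists n0, nrm O1 Q n0).
  { apply NNPP. intros H. apply Hns. intros n n' Hn. exfalso. apply H. now exists n. }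
  destruct HQ as [n0 HQ].
  destruct (dom_int O1 H1) as [c Hc].
  assert (Hd := supp_int O1 c Q n0 Hc (proj1 (proj2 HQ)) (proj2 (proj2 HQ))).
  assert (Hne : psub Q c <> (0,0)). { intros E. replace (psub c Q) with (pscale (-1) (psub Q c)) in Hd by pt_eq. rewrite E in Hd. destruct n0; pt_unfold; lra. }
  destruct (normalize _ Hne) as (v & Hv & E). assert (P := norm2_pos _ Hne). set (r := norm2 (psub Q c)) in *.
  assert (Hcv : crosses O1 Q v).
  { exists (- r). replace (padd Q (pscale (- r) v)) with c; auto. transitivity (psub Q (psub Q c)); [pt_eq|]. rewrite E. pt_eq. }
  assert (Hnv : 0 < dot n0 v).
  { replace (psub c Q) with (pscale (-1) (psub Q c)) in Hd by pt_eq. rewrite E in Hd.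
    replace (dot n0 (pscale (-1) (pscale r v))) with (- r * dot n0 v) in Hd by pt_eq. nra. }
  set (vk := fun k => rot (1 * tk k) v).
  assert (Hvk : pconv vk v) by apply pconv_rot, lim_sg_tk.
  destruct (crosses_open O1 Q v vk Hvk Hcv) as [N1 HN1].
  destruct (lim_eventually_gt (fun k => dot n0 (vk k)) (dot n0 v) 0) as [N2 HN2]; auto.
  { apply lim_dot; auto. apply pconv_const. }
  set (N := Nat.max N1 N2).
  assert (Hu : forall k, unit_pt (vk k)) by (intros; now apply rot_unit).
  assert (S : forall k, exists q, quad q /\ qA q = Q /\ qv q = vk (N + k)%nat /\ excess q = 0 /\ 0 < dot (qn q) (qv q) /\
    edge O1 Q (qn q) (pscale 1 (perp (vk (N + k)%nat))) /\ edge O1 (qD q) (qm q) (0,0)).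
  { intros k. apply (corner_quad Q n0); auto; try lra.
    - split; auto. apply HN2. lia.
    - apply HN1. lia. }
  destruct (choice_seq _ S) as [u Hu']. clear S.
  assert (HF : finitely_nonsmooth O1) by apply HS. destruct HF as [L HL].
  destruct (infinite_pigeonhole L (fun k => qD (u k)) (fun _ => True)) as [D HD].
  { intros M. exists M. split; auto. }
  { intros k _. destruct (Hu' k) as (Hq & EA & Ev & Hx & Hn & _). apply NNPP. intros Hin.
    apply (corner_to_corner (u k) n0); auto.
    - rewrite EA, Ev. apply HN1. lia.
    - rewrite EA, Ev. split; auto. apply HN2. lia.
    - now rewrite EA.
    - apply (HL _ (qm (u k))); auto. now apply qm_nrm. }
  assert (HnQ : forall k, nrm O1 Q (qn (u k))). { intros k. destruct (Hu' k) as (Hq & EA & _). rewrite <- EA. apply Hq. }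
  destruct (infinite_pigeonhole2 (fun k => qn (u k)) (fun k => True /\ qD (u k) = D)) as [n Hn].
  { intros M. destruct (HD M) as (k & Hk & _ & ED). exists k. auto. }
  { intros i j k _ _ _. apply (three_edges O1 Q _ _ _ (pscale 1 (perp (vk (N + i)%nat))) (pscale 1 (perp (vk (N + j)%nat))) (pscale 1 (perp (vk (N + k)%nat)))); auto; apply Hu'. }
  destruct (infinite_pigeonhole2 (fun k => qm (u k)) (fun k => (True /\ qD (u k) = D) /\ qn (u k) = n)) as [m Hm].
  { intros M. destruct (Hn M) as (k & Hk & ED & En). exists k. auto. }
  { assert (T : forall k, (True /\ qD (u k) = D) /\ qn (u k) = n -> nrm O1 D (qm (u k)) /\ edge O1 D (qm (u k)) (0,0)).
    { intros k [[_ ED] _]. destruct (Hu' k) as (Hq & _ & _ & _ & Hnn & _ & Hed). rewrite <- ED. split; auto. now apply qm_nrm. }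
    intros i j k Hi Hj Hk. destruct (T i Hi). destruct (T j Hj). destruct (T k Hk).
    apply (three_edges O1 D _ _ _ (0,0) (0,0) (0,0)); auto. }
  destruct (infinite_pigeonhole2 (fun k => qb (u k)) (fun k => ((True /\ qD (u k) = D) /\ qn (u k) = n) /\ qm (u k) = m)) as [b Hb].
  { intros M. destruct (Hm M) as (k & Hk & ED & Em). exists k. auto. }
  { assert (T : forall k, ((True /\ qD (u k) = D) /\ qn (u k) = n) /\ qm (u k) = m -> nrm O2 (qB (u k)) (qb (u k)) /\
      exists x y, y <> 0 /\ qb (u k) = padd (pscale x n) (pscale y m) /\ dot (qb (u k)) (qB (u k)) = x * dot n Q + y * dot m D).
    { intros k [[[_ ED] En] Em]. destruct (Hu' k) as (Hq & EA & _ & Hx & Hnn & _). split; [apply Hq|].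
      rewrite <- ED, <- En, <- Em, <- EA. now apply pencil_coeffs. }
    intros i j k Hi Hj Hk.
    destruct (T i Hi) as (Ni & xi & yi & Yi & Ei & Fi). destruct (T j Hj) as (Nj & xj & yj & Yj & Ej & Fj). destruct (T k Hk) as (Nk & xk & yk & Yk & Ek & Fk).
    apply (three_in_pencil O2 n m (dot n Q) (dot m D) (qB (u i)) (qb (u i)) xi yi (qB (u j)) (qb (u j)) xj yj (qB (u k)) (qb (u k)) xk yk); auto.
    intros X. now apply outer_smooth with O1. }
  destruct (Hb 0%nat) as (i & _ & [[[_ EDi] _] _] & Ebi). destruct (Hb (S i)) as (j & Hij & [[[_ EDj] _] _] & Ebj).
  destruct (Hu' i) as (Qi & Ai & Vi & _). destruct (Hu' j) as (Qj & Aj & Vj & _).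
  assert (Ev : qv (u i) = qv (u j)) by (apply same_tangent_same_line; auto; congruence).
  rewrite Vi, Vj in Ev. assert (C : cross (vk (N + i)%nat) (vk (N + j)%nat) = 0) by (rewrite Ev; pt_eq).
  unfold vk in C. rewrite rot_cross in C by auto. apply (sin_sg_tk_inj 1) in C; [lia | lra].
Qed.

End Concurrency.

(** * Support functions and tangents from a circle *)

Definition nv (t : R) : pt := (cos t, sin t).

Definition support_fun (O : pt -> Prop) (p0 : pt) (h : R -> R) : Prop :=
  forall t, (exists X, O X /\ dot (nv t) (psub X p0) = h t) /\ forall Y, O Y -> dot (nv t) (psub Y p0) <= h t.

Lemma nv_unit t : unit_pt (nv t).
Proof. unfold unit_pt, nv, dot; cbn. assert (H := sin2_cos2 t). unfold Rsqr in H. lra. Qed.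

Lemma nv_dot s t : dot (nv s) (nv t) = cos (s - t).
Proof. unfold nv, dot; cbn. now rewrite cos_minus. Qed.

Lemma nv_rot t : nv t = rot t (1, 0).
Proof. unfold nv. apply pt_ext; pt_unfold; ring. Qed.

Lemma nv_lipschitz s t : norm2 (psub (nv s) (nv t)) <= Rabs (s - t).
Proof. rewrite !nv_rot. apply rot_lipschitz. unfold unit_pt; pt_unfold; ring. Qed.

Lemma cos_plus_2PI t : cos (t + 2 * PI) = cos t.
Proof. rewrite cos_plus, cos_2PI, sin_2PI. ring. Qed.

Lemma sin_plus_2PI t : sin (t + 2 * PI) = sin t.
Proof. rewrite sin_plus, cos_2PI, sin_2PI. ring. Qed.

Lemma nv_period t : nv (t + 2 * PI) = nv t.
Proof. unfold nv. now rewrite cos_plus_2PI, sin_plus_2PI. Qed.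

Lemma nv_between a b c : sin (c - a) <> 0 ->
  nv b = padd (pscale (sin (c - b) / sin (c - a)) (nv a)) (pscale (sin (b - a) / sin (c - a)) (nv c)).
Proof.
  intros H. unfold Rsqr in *.
  apply pt_ext; cbn.
  - apply (Rmult_eq_reg_l (sin (c - a))); auto.
    replace (sin (c - a) * (sin (c - b) / sin (c - a) * cos a + sin (b - a) / sin (c - a) * cos c)) with (sin (c - b) * cos a + sin (b - a) * cos c) by (field; auto).
    rewrite !sin_minus. ring.
  - apply (Rmult_eq_reg_l (sin (c - a))); auto.
    replace (sin (c - a) * (sin (c - b) / sin (c - a) * sin a + sin (b - a) / sin (c - a) * sin c)) with (sin (c - b) * sin a + sin (b - a) * sin c) by (field; auto).
    rewrite !sin_minus. ring.
Qed.

Lemma unit_angle w m : unit_pt m -> exists t, - PI <= t <= PI /\ m = nv (w + t).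
Proof.
  intros Hm. assert (Un := nv_unit w).
  assert (D := decomp (nv w) m Un).
  assert (S : dot (nv w) m * dot (nv w) m + cross (nv w) m * cross (nv w) m = 1).
  { transitivity (dot (nv w) (nv w) * dot m m); [pt_eq | rewrite Un, Hm; ring]. }
  set (c := dot (nv w) m) in *. set (s := cross (nv w) m) in *.
  assert (Hc : -1 <= c <= 1) by (split; nra).
  assert (B := acos_bound c). assert (Ca := cos_acos c Hc).
  assert (Sa := sin2_cos2 (acos c)). unfold Rsqr in Sa. rewrite Ca in Sa.
  assert (Sp : 0 <= sin (acos c)) by (apply sin_ge_0; lra).
  assert (K : forall t, cos t = c -> sin t = s -> m = nv (w + t)).
  { intros t Ht Ht'. rewrite D. unfold nv. rewrite cos_plus, sin_plus, Ht, Ht'. apply pt_ext; cbn; ring. }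
  destruct (Rle_dec 0 s).
  - exists (acos c). split; [lra|]. apply K; auto. nra.
  - exists (- acos c). split; [lra|]. apply K; [now rewrite cos_neg|]. rewrite sin_neg. nra.
Qed.

Lemma refl_refl_rot a b v : refl (nv b) (refl (nv a) v) = rot (2 * (b - a)) v.
Proof.
  unfold rot. replace (2 * (b - a)) with (2 * b - 2 * a) by ring. rewrite cos_minus, sin_minus, !cos_2a_sin, !sin_2a.
  assert (Sa := sin2_cos2 a). assert (Sb := sin2_cos2 b). unfold Rsqr in *.
  destruct v as [x y]. unfold nv.
  set (ca := cos a) in *. set (sa := sin a) in *. set (cb := cos b) in *. set (sb := sin b) in *.
  assert (Ea : ca * ca = 1 - sa * sa) by lra. assert (Eb : cb * cb = 1 - sb * sb) by lra.
  apply pt_ext; pt_unfold.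
  - transitivity (x - 2 * (x * (ca * ca) + y * sa * ca) - 2 * (x * (cb * cb) + y * sb * cb - 2 * (x * (ca * ca) * (cb * cb) + y * sa * ca * (cb * cb) + x * ca * sa * (sb * cb) + y * sa * sa * sb * cb))); [ring|].
    rewrite Ea, Eb. ring.
  - transitivity (y - 2 * (x * ca * sa + y * sa * sa) - 2 * (x * cb * sb + y * sb * sb - 2 * (x * (ca * ca) * cb * sb + y * sa * ca * cb * sb + x * ca * sa * sb * sb + y * sa * sa * sb * sb))); [ring|].
    rewrite Ea. ring.
Qed.

(** * Tangents to one domain from the points of an enclosing circle *)

Section Angles.
Variables (O : pt -> Prop) (p0 : pt) (h : R -> R) (Rad : R).
Hypothesis HO : convex_compact_domain O.
Hypothesis Hp0 : interior O p0.
Hypothesis Hh : support_fun O p0 h.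
Hypothesis HR : forall t, h t < Rad.

Lemma support_pos t : 0 < h t.
Proof.
  destruct (interior_ball O p0 Hp0) as (r & Hr & Hb).
  destruct (Hh t) as [_ H]. specialize (H (padd p0 (pscale r (nv t)))).
  replace (dot (nv t) (psub (padd p0 (pscale r (nv t))) p0)) with (r * dot (nv t) (nv t)) in H by pt_eq.
  rewrite (nv_unit t) in H. enough (r * 1 <= h t) by lra. apply H, Hb. unfold dist2.
  replace (psub p0 (padd p0 (pscale r (nv t)))) with (pscale (- r) (nv t)) by pt_eq.
  rewrite norm2_scale, (norm2_unit _ (nv_unit t)), Rabs_Ropp, Rabs_pos_eq; lra.
Qed.

Lemma support_period t : h (t + 2 * PI) = h t.
Proof.
  destruct (Hh t) as [(X & HX & EX) HY]. destruct (Hh (t + 2 * PI)) as [(X' & HX' & EX') HY']. rewrite nv_period in *.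
  apply Rle_antisym; [rewrite <- EX' | rewrite <- EX]; auto.
Qed.

Lemma support_cont t : continuous h t.
Proof.
  destruct (dom_bound O HO) as (M & HM0 & HM).
  set (K := M + norm2 p0). assert (HK : 0 < K) by (unfold K; assert (H := norm2_ge0 p0); lra).
  assert (L : forall s t, h s - h t <= K * Rabs (s - t)).
  { intros s u. destruct (Hh s) as [(X & HX & EX) _]. destruct (Hh u) as [_ HY]. specialize (HY X HX). rewrite <- EX.
    assert (C := dot_le (psub (nv s) (nv u)) (psub X p0)).
    replace (dot (psub (nv s) (nv u)) (psub X p0)) with (dot (nv s) (psub X p0) - dot (nv u) (psub X p0)) in C by pt_eq.
    assert (N1 := nv_lipschitz s u). assert (N2 := norm2_sub X p0). specialize (HM X HX).
    assert (P1 := norm2_ge0 (psub (nv s) (nv u))). assert (P2 := norm2_ge0 (psub X p0)).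
    assert (norm2 (psub (nv s) (nv u)) * norm2 (psub X p0) <= Rabs (s - u) * K).
    { apply Rmult_le_compat; auto. unfold K; lra. }
    lra. }
  apply continuity_pt_filterlim. intros eps He. exists (eps / K). split; [apply Rdiv_lt_0_compat; lra|].
  intros x [_ Hx]. cbn in *. unfold Rdist in *. assert (L1 := L x t). assert (L2 := L t x). rewrite (Rabs_minus_sym t x) in L2.
  apply Rle_lt_trans with (K * Rabs (x - t)); [apply Rabs_le; lra|].
  apply (Rmult_lt_compat_l K) in Hx; auto. replace (K * (eps / K)) with eps in Hx by (field; lra). exact Hx.
Qed.

(** Angle at [p0] between the normal of a support line and either point where this line meets the
    circle of radius [Rad]. *)
Definition phi t := acos (h t / Rad).

Lemma Rad_pos : 0 < Rad.
Proof. assert (A := support_pos 0). assert (B := HR 0). lra. Qed.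

Lemma ratio_bound t : 0 < h t / Rad < 1.
Proof.
  assert (A := support_pos t). assert (B := HR t). assert (C := Rad_pos). split.
  - now apply Rdiv_lt_0_compat.
  - apply (Rmult_lt_reg_r Rad); auto. unfold Rdiv. rewrite Rmult_assoc, Rinv_l; lra.
Qed.

Lemma phi_cos t : Rad * cos (phi t) = h t.
Proof.
  assert (A := ratio_bound t). unfold phi. rewrite cos_acos by lra. field. assert (C := Rad_pos). lra.
Qed.

Lemma phi_bound t : 0 < phi t < PI / 2.
Proof.
  assert (A := ratio_bound t). assert (B : 0 < phi t < PI) by (apply acos_bound_lt; lra).
  split; [apply B|]. apply Rnot_le_lt. intros H.
  assert (C := phi_cos t). assert (D := support_pos t). assert (E := Rad_pos).
  assert (cos (phi t) <= 0) by (apply cos_le_0; lra). nra.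
Qed.

Lemma phi_cont t : continuous phi t.
Proof.
  apply (continuous_comp (fun t => h t / Rad) acos).
  - apply (continuous_mult h (fun _ => / Rad)); [apply support_cont | apply continuous_const].
  - apply continuity_pt_filterlim. apply derivable_continuous_pt. apply derivable_pt_acos. assert (A := ratio_bound t). lra.
Qed.

Lemma phi_period t : phi (t + 2 * PI) = phi t.
Proof. unfold phi. now rewrite support_period. Qed.

(** The point of the circle at angle [w] lies on the support line of [t] and strictly beyond that of
    [w], as [h w < Rad]. Since [nv t'] is a positive combination of [nv t] and [nv w], it lies
    strictly beyond the support line of [t'] as well. *)
Lemma inside_tangents w t t' : Rad * cos (t - w) = h t -> Rabs (t - w) < PI / 2 -> t < t' < w \/ w < t' < t -> h t' < Rad * cos (t' - w).
Proof.
  intros Ht Hb Hbt. apply Rabs_def2 in Hb.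
  assert (Hs : sin (w - t) <> 0).
  { destruct Hbt; [assert (0 < sin (w - t)) by (apply sin_gt_0; lra) | assert (sin (w - t) < 0) by (apply sin_lt_0_var; lra)]; lra. }
  assert (H1 : 0 < sin (w - t') / sin (w - t)).
  { destruct Hbt.
    - apply Rdiv_lt_0_compat; apply sin_gt_0; lra.
    - replace (sin (w - t') / sin (w - t)) with ((- sin (w - t')) / (- sin (w - t))) by (field; auto).
      rewrite <- !sin_neg. apply Rdiv_lt_0_compat; apply sin_gt_0; lra. }
  assert (H2 : 0 < sin (t' - t) / sin (w - t)).
  { destruct Hbt.
    - apply Rdiv_lt_0_compat; apply sin_gt_0; lra.
    - replace (sin (t' - t) / sin (w - t)) with ((- sin (t' - t)) / (- sin (w - t))) by (field; auto).
      rewrite <- !sin_neg. apply Rdiv_lt_0_compat; apply sin_gt_0; lra. }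
  assert (E := nv_between t t' w Hs).
  destruct (Hh t') as [(X & HX & EX) _]. rewrite <- EX, <- nv_dot, E.
  destruct (Hh t) as [_ A]. destruct (Hh w) as [_ B]. specialize (A X HX). specialize (B X HX). specialize (HR w).
  set (l := sin (w - t') / sin (w - t)) in *. set (m := sin (t' - t) / sin (w - t)) in *.
  replace (dot (padd (pscale l (nv t)) (pscale m (nv w))) (psub X p0)) with (l * dot (nv t) (psub X p0) + m * dot (nv w) (psub X p0))
    by pt_eq.
  replace (dot (padd (pscale l (nv t)) (pscale m (nv w))) (nv w)) with (l * dot (nv t) (nv w) + m * dot (nv w) (nv w))
    by pt_eq.
  rewrite nv_dot, (nv_unit w). rewrite <- Ht in A. nra.
Qed.

(** Angular position of one of the two intersections of the circle with the support line of normal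
    angle [t]; [sg] selects which. *)
Definition foot (sg t : R) := t + sg * phi t.

Lemma foot_cont sg t : continuous (foot sg) t.
Proof.
  apply (continuous_plus (fun t => t) (fun t => sg * phi t)); [apply continuous_id|].
  apply (continuous_mult (fun _ => sg) phi); [apply continuous_const | apply phi_cont].
Qed.

Lemma foot_period sg t : foot sg (t + 2 * PI) = foot sg t + 2 * PI.
Proof. unfold foot. rewrite phi_period. ring. Qed.

(** If two feet were in the wrong order, one normal angle would lie between the other and its foot;
    [inside_tangents] then makes its [phi] larger than this order allows. *)
Lemma foot_incr sg s t : sg * sg = 1 -> s < t -> foot sg s < foot sg t.
Proof.
  intros Hsg Hst. apply Rnot_le_lt. intros Hle. unfold foot in Hle.
  assert (Bs := phi_bound s). assert (Bt := phi_bound t). assert (RP := Rad_pos).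
  destruct (sign_cases sg Hsg); subst sg.
  - assert (K : h t < Rad * cos (t - (s + phi s))).
    { apply (inside_tangents (s + phi s) s t).
      - replace (s - (s + phi s)) with (- phi s) by ring. rewrite cos_neg. apply phi_cos.
      - replace (s - (s + phi s)) with (- phi s) by ring. rewrite Rabs_Ropp, Rabs_pos_eq; lra.
      - left. lra. }
    rewrite <- (phi_cos t) in K. apply Rmult_lt_reg_l in K; auto.
    replace (t - (s + phi s)) with (- (s + phi s - t)) in K by ring. rewrite cos_neg in K.
    assert (phi t <= s + phi s - t) by lra.
    assert (cos (s + phi s - t) <= cos (phi t)) by (apply cos_decr_1; lra). lra.
  - assert (K : h s < Rad * cos (s - (t - phi t))).
    { apply (inside_tangents (t - phi t) t s).
      - replace (t - (t - phi t)) with (phi t) by ring. apply phi_cos.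
      - replace (t - (t - phi t)) with (phi t) by ring. rewrite Rabs_pos_eq; lra.
      - right. lra. }
    rewrite <- (phi_cos s) in K. apply Rmult_lt_reg_l in K; auto.
    assert (cos (s - (t - phi t)) <= cos (phi s)) by (apply cos_decr_1; lra). lra.
Qed.

Lemma foot_inj sg s t : sg * sg = 1 -> foot sg s = foot sg t -> s = t.
Proof.
  intros Hsg E. destruct (Rtotal_order s t) as [H|[H|H]]; auto; apply (foot_incr sg _ _ Hsg) in H; lra.
Qed.

Lemma foot_surj sg w : sg * sg = 1 -> exists t, foot sg t = w.
Proof.
  intros Hsg.
  destruct (IVT_gen (foot sg) (w - PI) (w + PI) w) as (t & _ & Ht).
  - intros x. apply continuity_pt_filterlim. apply foot_cont.
  - assert (A := phi_bound (w - PI)). assert (B := phi_bound (w + PI)). unfold foot.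
    assert (w - PI + sg * phi (w - PI) <= w /\ w <= w + PI + sg * phi (w + PI)) as [U V] by (destruct (sign_cases sg Hsg); subst sg; lra).
    split; [eapply Rle_trans; [apply Rmin_l | exact U] | eapply Rle_trans; [exact V | apply Rmax_r]].
  - now exists t.
Qed.

Lemma tangents_through w m X : nrm O X m -> dot m (psub X (padd p0 (pscale Rad (nv w)))) = 0 ->
  exists sg t, (sg = 1 \/ sg = -1) /\ foot sg t = w /\ m = nv t.
Proof.
  intros HX HP. destruct (unit_angle w m) as (t & Ht & Em); [apply HX|].
  assert (E : h (w + t) = Rad * cos t).
  { destruct (Hh (w + t)) as [(Y & HY & EY) HZ]. rewrite <- Em in *. assert (A := proj2 (proj2 HX) Y HY). assert (B := HZ X (proj1 HX)).
    replace (dot m (psub X (padd p0 (pscale Rad (nv w))))) with (dot m (psub X p0) - Rad * dot m (nv w)) in HP by pt_eq.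
    replace (dot m (psub Y X)) with (dot m (psub Y p0) - dot m (psub X p0)) in A by pt_eq.
    rewrite Em, nv_dot in HP. replace (w + t - w) with t in HP by ring. rewrite Em in A, B, EY. lra. } assert (RP := Rad_pos).
  assert (Hr : h (w + t) / Rad = cos t) by (rewrite E; field; lra).
  destruct (Rle_dec 0 t).
  - exists (-1), (w + t). split; auto. split; auto. unfold foot, phi. rewrite Hr, acos_cos by lra. ring.
  - exists 1, (w + t). split; auto. split; auto. unfold foot, phi. rewrite Hr. replace (cos t) with (cos (- t)) by apply cos_neg.
    rewrite acos_cos by lra. ring.
Qed.

End Angles.

Lemma support_fun_exists O p0 : convex_compact_domain O -> exists h, support_fun O p0 h.
Proof.
  intros HO. assert (S : forall t, exists y, (exists X, O X /\ dot (nv t) (psub X p0) = y) /\ forall Y, O Y -> dot (nv t) (psub Y p0) <= y).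
  { intros t. destruct (compact_max O HO (fun X => dot (nv t) (psub X p0))) as (X & HX & H).
    - intros u p Hu _ _. apply lim_dot; [apply pconv_const|]. apply pconv_sub2; auto. apply pconv_const.
    - exists (dot (nv t) (psub X p0)). split; auto. now exists X. }
  destruct (choice_fun _ S) as [h Hh]. now exists h.
Qed.

Lemma nrm_at O p0 h t : support_fun O p0 h -> exists X, nrm O X (nv t) /\ dot (nv t) (psub X p0) = h t.
Proof.
  intros Hh. destruct (Hh t) as [(X & HX & EX) HY]. exists X. split; auto. split; auto. split; [apply nv_unit|].
  intros Y HOY. specialize (HY Y HOY). replace (dot (nv t) (psub Y X)) with (dot (nv t) (psub Y p0) - dot (nv t) (psub X p0)) by pt_eq. lra.
Qed.

(** * The four tangents from a point outside both domains *)

Section Concentric.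
Variables O1 O2 : pt -> Prop.
Hypothesis HS : commuting_pair O1 O2.
Let H1 := cv1 O1 O2 HS.
Let H2 := cv2 O1 O2 HS.
Variables (p0 : pt) (h1 h2 : R -> R) (Rad : R).
Hypothesis Hp0 : interior O1 p0.
Hypothesis Hh1 : support_fun O1 p0 h1.
Hypothesis Hh2 : support_fun O2 p0 h2.
Hypothesis HR : forall t, h2 t < Rad.

Lemma support_lt t : h1 t < h2 t.
Proof.
  destruct (nrm_at O1 p0 h1 t Hh1) as (X & HX & EX).
  destruct (nrm_at O2 p0 h2 t Hh2) as (Y & HY & EY).
  assert (E := inner_lt O1 O2 HS Y (nv t) X HY (proj1 HX)).
  replace (dot (nv t) (psub X Y)) with (dot (nv t) (psub X p0) - dot (nv t) (psub Y p0)) in E by pt_eq. lra.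
Qed.

(** Let [P] be the point of the circle at angle [w]. In the quadrilateral issuing from the contact
    point of [al] towards that of [be], the two other support lines pass through [P] by concurrency,
    and are identified with [ga] and [de]. The two products of reflections are rotations by
    [2 * (ga - al)] and [2 * (de - be)] with the same effect on [qv]; this gives the claim modulo
    [PI], and the range of [phi] removes the ambiguity. *)
Lemma concentric_tangents w al be ga de : foot h1 Rad 1 al = w -> foot h2 Rad 1 be = w ->
  foot h2 Rad (-1) ga = w -> foot h1 Rad (-1) de = w -> al + de = be + ga.
Proof.
  intros Ea Eb Eg Ed.
  assert (HR1 : forall t, h1 t < Rad) by (intros t; assert (A := support_lt t); specialize (HR t); lra).
  assert (Hp2 : interior O2 p0) by (apply (inner_interior O1 O2 HS); now apply interior_in).
  assert (Pi := PI_RGT_0).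
  assert (Ba := phi_bound O1 p0 h1 Rad Hp0 Hh1 HR1 al). assert (Bd := phi_bound O1 p0 h1 Rad Hp0 Hh1 HR1 de).
  assert (Bb := phi_bound O2 p0 h2 Rad Hp2 Hh2 HR be). assert (Bg := phi_bound O2 p0 h2 Rad Hp2 Hh2 HR ga).
  assert (Ca := phi_cos O1 p0 h1 Rad Hp0 Hh1 HR1 al). assert (Cb := phi_cos O2 p0 h2 Rad Hp2 Hh2 HR be).
  assert (RP := Rad_pos O2 p0 h2 Rad Hp2 Hh2 HR).
  unfold foot in *.
  assert (Fa : phi h1 Rad al = w - al) by lra. assert (Fb : phi h2 Rad be = w - be) by lra.
  (* [h1 < h2] makes [phi] smaller for the outer domain, so at [al] its foot falls short of [w]. *)
  assert (Hab : al < be).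
  { apply Rnot_le_lt. intros Hle.
    assert (K : foot h2 Rad 1 be <= foot h2 Rad 1 al).
    { destruct Hle as [Hlt|E]; [apply Rlt_le, (foot_incr O2 p0 h2 Rad Hp2 Hh2 HR 1); auto; lra | now rewrite E; right]. }
    unfold foot in K.
    assert (Cb' := phi_cos O2 p0 h2 Rad Hp2 Hh2 HR al). assert (Bb' := phi_bound O2 p0 h2 Rad Hp2 Hh2 HR al).
    assert (L := support_lt al).
    assert (cos (phi h2 Rad al) <= cos (phi h1 Rad al)) by (apply cos_decr_1; lra). nra. }
  destruct (nrm_at O1 p0 h1 al Hh1) as (A & HA & EA). destruct (nrm_at O2 p0 h2 be Hh2) as (B & HB & EB).
  set (P := padd p0 (pscale Rad (nv w))).
  assert (On : forall (h : R -> R) t X, dot (nv t) (psub X p0) = h t -> Rad * cos (w - t) = h t -> dot (nv t) (psub X P) = 0).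
  { intros h t X E F. unfold P.
    replace (dot (nv t) (psub X (padd p0 (pscale Rad (nv w))))) with (dot (nv t) (psub X p0) - Rad * dot (nv t) (nv w)) by pt_eq.
    rewrite nv_dot. replace (t - w) with (- (w - t)) by ring. rewrite cos_neg. lra. }
  assert (PA := On h1 al A EA ltac:(rewrite <- Fa; exact Ca)). assert (PB := On h2 be B EB ltac:(rewrite <- Fb; exact Cb)). clear On.
  (* Points of [O2] on the outer tangent lie strictly outside the inner one; later this rules out
     [be] for [qC] and [al] for [qD]. *)
  assert (Beyond : forall X, O2 X -> dot (nv be) (psub X P) = 0 -> 0 < dot (nv al) (psub X P)).
  { intros X HX E.
    assert (Hs : 0 < sin (w - al)) by (apply sin_gt_0; lra).
    rewrite (nv_between al be w) in E by lra.
    assert (L1 : 0 < sin (w - be) / sin (w - al)) by (apply Rdiv_lt_0_compat; auto; apply sin_gt_0; lra).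
    assert (L2 : 0 < sin (be - al) / sin (w - al)) by (apply Rdiv_lt_0_compat; auto; apply sin_gt_0; lra).
    set (l := sin (w - be) / sin (w - al)) in *. set (m := sin (be - al) / sin (w - al)) in *.
    replace (dot (padd (pscale l (nv al)) (pscale m (nv w))) (psub X P)) with (l * dot (nv al) (psub X P) + m * dot (nv w) (psub X P)) in E
      by pt_eq.
    assert (W : dot (nv w) (psub X P) < 0).
    { unfold P. replace (dot (nv w) (psub X (padd p0 (pscale Rad (nv w))))) with (dot (nv w) (psub X p0) - Rad * dot (nv w) (nv w)) by pt_eq.
      rewrite (nv_unit w). assert (T := proj2 (Hh2 w) X HX). specialize (HR w). lra. }
    nra. }
  assert (QB := Beyond B (proj1 HB) PB).
  assert (HBA : 0 < dot (nv al) (psub B A)).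
  { replace (dot (nv al) (psub B A)) with (dot (nv al) (psub B P) - dot (nv al) (psub A P)) by pt_eq. lra. }
  assert (Hne : psub B A <> (0,0)). { intros E. rewrite E in HBA. unfold dot in HBA; cbn in HBA. lra. }
  destruct (normalize _ Hne) as (v & Hv & E). assert (Pr := norm2_pos _ Hne). set (r := norm2 (psub B A)) in *.
  assert (Hnv : 0 < dot (nv al) v).
  { rewrite E in HBA. replace (dot (nv al) (pscale r v)) with (r * dot (nv al) v) in HBA by pt_eq. nra. }
  assert (EBr : B = padd A (pscale r v)) by (rewrite <- E; pt_eq).
  destruct (quad_exists O1 O2 HS A (nv al) v) as (q & Hq & EqA & Eqn & Eqv); auto. { now apply (inner_smooth O1 O2). }
  assert (Hex := excess_zero O1 O2 HS q Hq ltac:(now apply (inner_smooth O1 O2))).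
  assert (Hn : 0 < dot (qn q) (qv q)) by (rewrite Eqn, Eqv; exact Hnv).
  destruct (quad_AB_pos O1 O2 HS q Hq) as [Pq Pb]. destruct (quad_AC_pos O1 O2 HS q Hq) as [Pq' Pc].
  assert (HexB : exitp O2 B (nv be) v).
  { split; auto. assert (T := inner_lt O1 O2 HS B (nv be) A HB (proj1 HA)).
    replace (psub A B) with (pscale (- r) v) in T by (rewrite EBr; pt_eq).
    replace (dot (nv be) (pscale (- r) v)) with (- r * dot (nv be) v) in T by pt_eq. nra. }
  destruct (exit_eq O2 B (nv be) (qB q) (qb q) v) as [EqB Eqb]; auto.
  { now apply outer_smooth with O1. }
  { rewrite Eqv in Pb. split; auto. apply Hq. }
  { assert (G := quad_AB O1 O2 q Hq). rewrite EqA, Eqv in G. set (t := dot v (psub (qB q) A)) in *. exists (t - r).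
    rewrite G, EBr. pt_eq. }
  destruct (concurrent O1 O2 HS q Hq Hex Hn) as (l & m & El & Fl).
  rewrite Eqn, Eqb in El. rewrite Eqn, Eqb, EqA, EqB in Fl.
  assert (SA : dot (nv al) A = dot (nv al) P).
  { replace (dot (nv al) (psub A P)) with (dot (nv al) A - dot (nv al) P) in PA by pt_eq. lra. }
  assert (SB : dot (nv be) B = dot (nv be) P).
  { replace (dot (nv be) (psub B P)) with (dot (nv be) B - dot (nv be) P) in PB by pt_eq. lra. }
  assert (SD : dot (uD q) (qD q) = dot (uD q) P).
  { rewrite Fl, SA, SB, El. pt_eq. }
  assert (HzD := uD_nz O1 O2 HS q Hq Hn). assert (NzD := norm2_pos _ HzD). assert (ED := unitize_eq (uD q) HzD). fold (qm q) in ED.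
  assert (PD : dot (qm q) (psub (qD q) P) = 0).
  { apply (Rmult_eq_reg_l (norm2 (uD q))); [|lra].
    transitivity (dot (uD q) (qD q) - dot (uD q) P); [|lra]. rewrite ED at 2 3. pt_eq. }
  assert (SC : dot (psub (qw1 q) (qv1 q)) (qC q) = dot (psub (qw1 q) (qv1 q)) P).
  { rewrite excess_dual in Hex. fold (uD q) in Hex. rewrite SD, EqA, EqB in Hex.
    assert (TA : dot (psub (qv q) (qw1 q)) A = dot (psub (qv q) (qw1 q)) P).
    { unfold qw1, refl. rewrite Eqn.
      replace (dot (psub (qv q) (psub (qv q) (pscale (2 * dot (qv q) (nv al)) (nv al)))) A) with (2 * dot (qv q) (nv al) * dot (nv al) A) by pt_eq.
      rewrite SA. pt_eq. }
    assert (TB : dot (psub (qv q) (qw2 q)) B = dot (psub (qv q) (qw2 q)) P).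
    { unfold qw2, refl. rewrite Eqb.
      replace (dot (psub (qv q) (psub (qv q) (pscale (2 * dot (qv q) (nv be)) (nv be)))) B) with (2 * dot (qv q) (nv be) * dot (nv be) B) by pt_eq.
      rewrite SB. pt_eq. }
    rewrite TA, TB in Hex. unfold uD in Hex.
    transitivity (dot (psub (qv q) (qw2 q)) P + dot (psub (qw2 q) (qv1 q)) P - dot (psub (qv q) (qw1 q)) P); [lra|].
    pt_eq. }
  assert (PC : dot (qc q) (psub (qC q) P) = 0).
  { apply (Rmult_eq_reg_l (2 * dot (qc q) (qw1 q))); [|lra].
    transitivity (dot (psub (qw1 q) (qv1 q)) (qC q) - dot (psub (qw1 q) (qv1 q)) P); [|lra].
    unfold qv1, refl. pt_eq. }
  destruct (tangents_through O2 p0 h2 Rad Hp2 Hh2 HR w (qc q) (qC q)) as (s1 & t1 & Hs1 & Et1 & Ec); [apply Hq | exact PC |].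
  destruct (tangents_through O1 p0 h1 Rad Hp0 Hh1 HR1 w (qm q) (qD q)) as (s2 & t2 & Hs2 & Et2 & Em); [now apply (qm_nrm O1 O2) | exact PD |].
  assert (Nc : qc q = nv ga).
  { destruct Hs1; subst s1.
    - exfalso. assert (t1 = be) by (apply (foot_inj O2 p0 h2 Rad Hp2 Hh2 HR 1); [lra | unfold foot in *; lra]). subst t1.
      rewrite Ec in PC. assert (T := Beyond (qC q) (proj1 (proj1 (proj2 (proj2 Hq)))) PC).
      assert (G := quad_AC O1 O2 q Hq). set (t := dot (qw1 q) (psub (qC q) (qA q))) in *. rewrite EqA in G.
      assert (N1 := quad_n_w1 O1 O2 q Hq). rewrite Eqn in N1, Hn.
      rewrite G in T. replace (dot (nv al) (psub (padd A (pscale t (qw1 q))) P)) with (dot (nv al) (psub A P) + t * dot (nv al) (qw1 q)) in T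
        by pt_eq.
      rewrite PA, N1 in T. nra.
    - rewrite Ec. f_equal. apply (foot_inj O2 p0 h2 Rad Hp2 Hh2 HR (-1)); [lra | unfold foot in *; lra]. }
  assert (Nm : qm q = nv de).
  { destruct Hs2; subst s2.
    - exfalso. assert (t2 = al) by (apply (foot_inj O1 p0 h1 Rad Hp0 Hh1 HR1 1); [lra | unfold foot in *; lra]). subst t2.
      destruct (qm_exit O1 O2 HS q Hq Hn) as [_ T]. rewrite Em in T.
      assert (Ps : 0 <= dot (qw2 q) (psub (qD q) (qB q))) by apply Hq.
      assert (G := quad_BD O1 O2 q Hq). set (t := dot (qw2 q) (psub (qD q) (qB q))) in *. rewrite EqB in G.
      rewrite Em in PD. rewrite G in PD.
      replace (dot (nv al) (psub (padd B (pscale t (qw2 q))) P)) with (dot (nv al) (psub B P) + t * dot (nv al) (qw2 q)) in PD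
        by pt_eq. nra.
    - rewrite Em. f_equal. apply (foot_inj O1 p0 h1 Rad Hp0 Hh1 HR1 (-1)); [lra | unfold foot in *; lra]. }
  (* [qv1] differs from [qw2] by a nonzero multiple of [qm] and both are units, so it is the
     reflection of [qw2]. *)
  assert (Ev1 : qv1 q = refl (qm q) (qw2 q)).
  { assert (U2 := quad_uw2 O1 O2 q Hq). assert (U3 := quad_uv1 O1 O2 q Hq).
    assert (Um : unit_pt (qm q)) by now apply unitize_unit.
    set (la := norm2 (uD q)) in *.
    assert (Ev : qv1 q = psub (qw2 q) (pscale la (qm q))).
    { rewrite <- ED. unfold uD. pt_eq. }
    assert (Z : la * (la - 2 * dot (qw2 q) (qm q)) = 0).
    { unfold unit_pt in U3. rewrite Ev in U3.
      replace (dot (psub (qw2 q) (pscale la (qm q))) (psub (qw2 q) (pscale la (qm q)))) with (dot (qw2 q) (qw2 q) - 2 * la * dot (qw2 q) (qm q) + la * la * dot (qm q) (qm q)) in U3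
        by pt_eq.
      rewrite U2, Um in U3. lra. }
    apply Rmult_integral in Z. destruct Z as [Z|Z]; [lra|].
    rewrite Ev. unfold refl. replace (2 * dot (qw2 q) (qm q)) with la by lra. reflexivity. }
  assert (Rot : rot (2 * (ga - al)) (qv q) = rot (2 * (de - be)) (qv q)).
  { rewrite <- !refl_refl_rot, <- Nc, <- Nm, <- Eqn, <- Eqb. unfold qv1, qw1, qw2 in Ev1. exact Ev1. }
  assert (Uv : unit_pt (qv q)) by apply Hq.
  assert (C1 : cos (2 * (ga - al) - 2 * (de - be)) = 1).
  { rewrite cos_minus. transitivity (dot (rot (2 * (ga - al)) (qv q)) (rot (2 * (de - be)) (qv q))).
    - replace (dot (rot (2 * (ga - al)) (qv q)) (rot (2 * (de - be)) (qv q))) with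
       ((cos (2 * (ga - al)) * cos (2 * (de - be)) + sin (2 * (ga - al)) * sin (2 * (de - be))) * dot (qv q) (qv q)) by pt_eq.
      rewrite Uv. ring.
    - rewrite Rot. apply rot_unit; auto. }
  replace (2 * (ga - al) - 2 * (de - be)) with (2 * (ga + be - al - de)) in C1 by ring. rewrite cos_2a_sin in C1.
  assert (Sx : sin (ga + be - al - de) = 0) by nra.
  set (x := ga + be - al - de) in *.
  assert (Bx : - PI < x < PI) by (unfold x; lra).
  destruct (Rtotal_order x 0) as [L|[L|L]].
  - assert (0 < sin (- x)) by (apply sin_gt_0; lra). rewrite sin_neg in H. lra.
  - unfold x in L. lra.
  - assert (0 < sin x) by (apply sin_gt_0; lra). lra.
Qed.

End Concentric.

(** * Young's formula and Chebyshev polynomials *)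

Definition cont (f : R -> R) : Prop := forall x, continuous f x.

Lemma cont_const c : cont (fun _ => c).
Proof. intros x. apply continuous_const. Qed.
Lemma cont_id : cont (fun x => x).
Proof. intros x. apply continuous_id. Qed.
Lemma cont_plus f g : cont f -> cont g -> cont (fun x => f x + g x).
Proof. intros F G x. apply (continuous_plus f g); auto. Qed.
Lemma cont_opp f : cont f -> cont (fun x => - f x).
Proof. intros F x. apply (continuous_opp f); auto. Qed.
Lemma cont_minus f g : cont f -> cont g -> cont (fun x => f x - g x).
Proof. intros F G x. apply (continuous_minus f g); auto. Qed.
Lemma cont_mult f g : cont f -> cont g -> cont (fun x => f x * g x).
Proof. intros F G x. apply (continuous_mult f g); auto. Qed.
Lemma cont_pow f n : cont f -> cont (fun x => f x ^ n).
Proof.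
  intros F. induction n; cbn.
  - apply cont_const.
  - now apply cont_mult.
Qed.
Lemma cont_comp f g : cont f -> cont g -> cont (fun x => g (f x)).
Proof. intros F G x. apply (continuous_comp f g); auto. Qed.
Lemma cont_cos f : cont f -> cont (fun x => cos (f x)).
Proof. intros F. apply (cont_comp f cos F). intros x. apply continuous_cos. Qed.
Lemma cont_sin f : cont f -> cont (fun x => sin (f x)).
Proof. intros F. apply (cont_comp f sin F). intros x. apply continuous_sin. Qed.

Lemma cont_ex f a b : cont f -> ex_RInt f a b.
Proof. intros F. apply (@ex_RInt_continuous R_CompleteNormedModule). intros; apply F. Qed.

Ltac ct := try assumption; lazymatch goal with
  | |- cont (fun x => x) => apply cont_id
  | |- cont (fun _ => ?c) => apply cont_const
  | |- cont (fun x => @?f x + @?g x) => apply (cont_plus f g); ct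
  | |- cont (fun x => @?f x - @?g x) => apply (cont_minus f g); ct
  | |- cont (fun x => @?f x * @?g x) => apply (cont_mult f g); ct
  | |- cont (fun x => - @?f x) => apply (cont_opp f); ct
  | |- cont (fun x => @?f x ^ ?n) => apply (cont_pow f n); ct
  | |- cont (fun x => cos (@?f x)) => apply (cont_cos f); ct
  | |- cont (fun x => sin (@?f x)) => apply (cont_sin f); ct
  | |- cont (fun x => ?f x) => change (cont f); ct
  | |- cont ?f => let g := eval unfold f in f in change (cont g); ct
  | |- _ => idtac
  end.

Lemma RInt_plus_c f g a b : cont f -> cont g -> RInt (fun x => f x + g x) a b = RInt f a b + RInt g a b.
Proof. intros F G. apply (RInt_plus f g); now apply cont_ex. Qed.
Lemma RInt_minus_c f g a b : cont f -> cont g -> RInt (fun x => f x - g x) a b = RInt f a b - RInt g a b.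
Proof. intros F G. apply (RInt_minus f g); now apply cont_ex. Qed.
Lemma RInt_scal_c c f a b : cont f -> RInt (fun x => c * f x) a b = c * RInt f a b.
Proof. intros F. apply (RInt_scal f a b c). now apply cont_ex. Qed.
Lemma RInt_ext_c (f g : R -> R) a b : (forall x, f x = g x) -> RInt f a b = RInt g a b.
Proof. intros H. apply RInt_ext. intros; apply H. Qed.
Lemma RInt_chasles_c f a b c : cont f -> RInt f a b + RInt f b c = RInt f a c.
Proof. intros F. apply (RInt_Chasles f); now apply cont_ex. Qed.

Lemma RInt_shift f a b s : cont f -> RInt (fun x => f (x + s)) a b = RInt f (a + s) (b + s).
Proof.
  intros F. apply is_RInt_unique.
  apply (is_RInt_ext (fun y => scal 1 (f (1 * y + s)))).
  - intros x _. change (1 * f (1 * x + s) = f (x + s)). now rewrite !Rmult_1_l.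
  - apply (is_RInt_comp_lin f 1 s a b). rewrite !Rmult_1_l. apply (RInt_correct f). now apply cont_ex.
Qed.

Lemma RInt_period (f : R -> R) T a : cont f -> (forall x, f (x + T) = f x) -> RInt f a (a + T) = RInt f 0 T.
Proof.
  intros F HT. assert (B := RInt_chasles_c f a T (a + T) F).
  assert (C := RInt_shift f 0 a T F). rewrite Rplus_0_l in C.
  rewrite (RInt_ext_c _ f) in C by auto. rewrite <- (RInt_chasles_c f a 0 T F) in B. rewrite <- C in B.
  assert (D : RInt f a 0 + RInt f 0 a = 0) by (rewrite RInt_chasles_c by auto; apply (RInt_point a f)). lra.
Qed.

Lemma RInt_abs_le f a b M : cont f -> a <= b -> (forall t, a <= t <= b -> Rabs (f t) <= M) -> Rabs (RInt f a b) <= (b - a) * M.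
Proof. intros F Hab H. apply (abs_RInt_le_const f a b M); auto. now apply cont_ex. Qed.

Lemma RInt_deriv (f df : R -> R) a b : (forall x, is_derive f x (df x)) -> cont df -> RInt df a b = f b - f a.
Proof. intros D C. apply is_RInt_unique. apply (is_RInt_derive f df); auto. Qed.

(** Continuity of [f] makes the increments of [F] negligible compared with [v - u], so [F] has zero
    derivative even where [f] has none. *)
Lemma const_of_small_increments (F f : R -> R) K : 0 <= K -> cont f -> (forall u v, u < v -> Rabs (F v - F u) <= K * (v - u) * Rabs (f v - f u)) ->
  forall a b, F a = F b.
Proof.
  intros HK Hf H.
  assert (D : forall x, is_derive F x 0).
  { intros x. apply is_derive_Reals. intros eps He.
    assert (Hc := Hf x). apply continuity_pt_filterlim in Hc.
    destruct (Hc (eps / (K + 1))) as (del & Hdel & Hd). { apply Rdiv_lt_0_compat; lra. }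
    exists (mkposreal del Hdel). cbn. intros t Ht Htd.
    assert (E : Rabs (f (x + t) - f x) < eps / (K + 1)).
    { apply Hd. split; [split; [exact I | lra]|]. cbn. unfold Rdist. now replace (x + t - x) with t by ring. }
    assert (P := Rabs_pos_lt t Ht).
    assert (G : Rabs (F (x + t) - F x) <= K * Rabs t * Rabs (f (x + t) - f x)).
    { destruct (Rle_dec 0 t).
      - assert (A := H x (x + t) ltac:(lra)). replace (x + t - x) with t in A by ring. rewrite (Rabs_pos_eq t) by lra. exact A.
      - assert (A := H (x + t) x ltac:(lra)). replace (x - (x + t)) with (- t) in A by ring.
        rewrite (Rabs_minus_sym (F x)), (Rabs_minus_sym (f x)) in A. rewrite (Rabs_left t) by lra. exact A. }
    rewrite Rminus_0_r. unfold Rdiv. rewrite Rabs_mult, (Rabs_inv t). apply (Rmult_lt_reg_r (Rabs t)); auto.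
    rewrite Rmult_assoc, Rinv_l, Rmult_1_r by lra. eapply Rle_lt_trans; [exact G|].
    apply Rle_lt_trans with (K * Rabs t * (eps / (K + 1))).
    - apply Rmult_le_compat_l; [nra | lra].
    - apply Rlt_le_trans with ((K + 1) * Rabs t * (eps / (K + 1))).
      + apply Rmult_lt_compat_r; [apply Rdiv_lt_0_compat; lra | nra].
      + right. field. lra. }
  assert (L : forall a b, a < b -> F a = F b).
  { intros a b Hab. apply (eq_is_derive F a b); auto. }
  intros a b. destruct (Rtotal_order a b) as [E|[E|E]]; [auto | now subst | symmetry; auto].
Qed.

(** Integration by parts for a monotone continuous [f]: over an interval, each integral differs from
    the one with a frozen factor by at most [C * (v - u) * (f v - f u)], and
    [const_of_small_increments] applies to the defect. *)
Lemma young_formula (psi dpsi f g : R -> R) C a b : 0 <= C -> (forall x, is_derive psi x (dpsi x)) -> cont dpsi ->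
  (forall x, Rabs (dpsi x) <= C) -> cont f -> cont g -> (forall x y, x < y -> f x < f y) -> (forall x, g (f x) = x) ->
  (forall x, f (g x) = x) ->
  RInt (fun t => psi (f t)) a b + RInt (fun w => dpsi w * g w) (f a) (f b) = b * psi (f b) - a * psi (f a).
Proof.
  intros HC D Cd Bd Cf Cg Hf Hgf Hfg.
  assert (Cp : cont psi). { intros x. apply (ex_derive_continuous psi). now exists (dpsi x). }
  assert (Cpf : cont (fun t => psi (f t))) by now apply cont_comp.
  assert (Cdg : cont (fun w => dpsi w * g w)) by ct.
  assert (Lip : forall x y, x <= y -> Rabs (psi y - psi x) <= C * (y - x)).
  { intros x y Hxy. rewrite <- (RInt_deriv psi dpsi x y D Cd), Rmult_comm. apply RInt_abs_le; auto. }
  set (F := fun y => RInt (fun t => psi (f t)) a y + RInt (fun w => dpsi w * g w) (f a) (f y) - y * psi (f y)).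
  assert (E : F a = F b).
  { apply (const_of_small_increments F f (2 * C)); [lra | auto|]. intros u v Huv. unfold F.
    assert (A := RInt_chasles_c _ a u v Cpf). assert (B := RInt_chasles_c _ (f a) (f u) (f v) Cdg).
    assert (Hfuv := Hf u v Huv). rewrite (Rabs_pos_eq (f v - f u)) by lra.
    assert (P1 : RInt (fun t => psi (f t) - psi (f u)) u v = RInt (fun t => psi (f t)) u v - (v - u) * psi (f u)).
    { rewrite (RInt_minus_c (fun t => psi (f t)) (fun _ => psi (f u))) by ct. f_equal. apply (RInt_const u v (psi (f u))). }
    assert (P2 : RInt (fun w => dpsi w * (g w - v)) (f u) (f v) = RInt (fun w => dpsi w * g w) (f u) (f v) - v * (psi (f v) - psi (f u))).
    { rewrite <- (RInt_deriv psi dpsi (f u) (f v) D Cd), <- RInt_scal_c, <- RInt_minus_c by ct. apply RInt_ext_c. intros; ring. }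
    assert (Q1 : Rabs (RInt (fun t => psi (f t) - psi (f u)) u v) <= (v - u) * (C * (f v - f u))).
    { apply RInt_abs_le; [ct | lra |]. intros t Ht. 
      assert (f u <= f t). { destruct (proj1 Ht) as [L|L]; [apply Rlt_le, Hf; auto | subst; lra]. }
      assert (f t <= f v). { destruct (proj2 Ht) as [L|L]; [apply Rlt_le, Hf; auto | subst; lra]. }
      eapply Rle_trans; [now apply Lip|]. nra. }
    assert (Q2 : Rabs (RInt (fun w => dpsi w * (g w - v)) (f u) (f v)) <= (f v - f u) * (C * (v - u))).
    { apply RInt_abs_le; [ct | lra |]. intros w Hw. rewrite Rabs_mult.
      assert (u <= g w). { apply Rnot_lt_le. intros L. apply Hf in L. rewrite Hfg in L. lra. }
      assert (g w <= v). { apply Rnot_lt_le. intros L. apply Hf in L. rewrite Hfg in L. lra. }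
      apply Rmult_le_compat; auto; try apply Rabs_pos. apply Rabs_le. lra. }
    replace (RInt (fun t => psi (f t)) a v + RInt (fun w => dpsi w * g w) (f a) (f v) - v * psi (f v)
      - (RInt (fun t => psi (f t)) a u + RInt (fun w => dpsi w * g w) (f a) (f u) - u * psi (f u)))
      with (RInt (fun t => psi (f t) - psi (f u)) u v + RInt (fun w => dpsi w * (g w - v)) (f u) (f v)) by (rewrite P1, P2; lra).
    eapply Rle_trans; [apply Rabs_triang|]. lra. }
  assert (Z1 : RInt (fun t => psi (f t)) a a = 0) by apply (RInt_point a (fun t => psi (f t))).
  assert (Z2 : RInt (fun w => dpsi w * g w) (f a) (f a) = 0) by apply (RInt_point (f a) (fun w => dpsi w * g w)).
  unfold F in E. rewrite Z1, Z2 in E. lra.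
Qed.

(** The phase [c] covers cosines and sines of frequency [n] at once and absorbs translations. *)
Definition wave (n : nat) (c x : R) := cos (INR n * x - c).

Lemma wave_cont n c : cont (wave n c).
Proof. unfold wave. ct. Qed.

Lemma cos_add_INR x n : cos (x + INR n * (2 * PI)) = cos x.
Proof. replace (INR n * (2 * PI)) with (2 * INR n * PI) by ring. apply cos_period. Qed.

Lemma sin_add_INR x n : sin (x + INR n * (2 * PI)) = sin x.
Proof. replace (INR n * (2 * PI)) with (2 * INR n * PI) by ring. apply sin_period. Qed.

Lemma wave_period n c x : wave n c (x + 2 * PI) = wave n c x.
Proof.
  unfold wave. replace (INR n * (x + 2 * PI) - c) with (INR n * x - c + INR n * (2 * PI)) by ring. apply cos_add_INR.
Qed.

Definition period (f : R -> R) := forall x, f (x + 2 * PI) = f x.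

(** Young's formula is used for [f] with inverse [g] and for the identity map over the range [f 0]
    to [f 0 + 2 * PI]; the boundary terms agree, and the difference leaves a periodic integrand in
    [g w - w]. *)
Lemma two_angle_identity (f g : R -> R) n c : cont f -> cont g -> (forall x y, x < y -> f x < f y) -> (forall x, g (f x) = x) ->
  (forall x, f (g x) = x) -> (forall x, f (x + 2 * PI) = f x + 2 * PI) ->
  RInt (fun t => wave n c (f t)) 0 (2 * PI) =
  RInt (wave n c) 0 (2 * PI) - RInt (fun w => - INR n * sin (INR n * w - c) * (g w - w)) 0 (2 * PI).
Proof.
  intros Cf Cg Hf Hgf Hfg Hper.
  set (d := fun w => - INR n * sin (INR n * w - c)).
  assert (Cd : cont d) by (unfold d; ct).
  assert (D : forall x, is_derive (wave n c) x (d x)).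
  { intros x. unfold wave, d. auto_derive; auto. unfold Rminus. ring. }
  assert (Bd : forall x, Rabs (d x) <= INR n).
  { intros x. unfold d. rewrite Rabs_mult, Rabs_Ropp, (Rabs_pos_eq (INR n)) by apply pos_INR.
    assert (B := SIN_bound (INR n * x - c)). assert (P := pos_INR n).
    assert (Rabs (sin (INR n * x - c)) <= 1) by (apply Rabs_le; lra). nra. }
  assert (Hg : forall x, g (x + 2 * PI) = g x + 2 * PI).
  { intros x. rewrite <- (Hgf (g x + 2 * PI)). now rewrite Hper, Hfg. }
  assert (Y1 := young_formula (wave n c) d f g (INR n) 0 (2 * PI) (pos_INR n) D Cd Bd Cf Cg Hf Hgf Hfg).
  assert (Y2 := young_formula (wave n c) d (fun x => x) (fun x => x) (INR n) (f 0) (f 0 + 2 * PI) (pos_INR n) D Cd Bd cont_id cont_id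
     (fun x y H => H) (fun x => eq_refl) (fun x => eq_refl)).
  assert (Ef : f (2 * PI) = f 0 + 2 * PI) by (assert (E0 := Hper 0); now rewrite Rplus_0_l in E0).
  rewrite Ef in Y1. cbn beta in Y2. rewrite wave_period in Y1. rewrite wave_period in Y2.
  assert (Sp : RInt (fun w => d w * (g w - w)) (f 0) (f 0 + 2 * PI) = RInt (fun w => d w * g w) (f 0) (f 0 + 2 * PI) - RInt (fun w => d w * w) (f 0) (f 0 + 2 * PI)).
  { rewrite <- RInt_minus_c by ct. apply RInt_ext_c. intros; ring. }
  assert (P1 : RInt (fun w => d w * (g w - w)) (f 0) (f 0 + 2 * PI) = RInt (fun w => d w * (g w - w)) 0 (2 * PI)).
  { apply (RInt_period (fun w => d w * (g w - w)) (2 * PI)); [ct|]. intros x. rewrite Hg. unfold d.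
    replace (INR n * (x + 2 * PI) - c) with (INR n * x - c + INR n * (2 * PI)) by ring. rewrite sin_add_INR. ring. }
  assert (P2 : RInt (wave n c) (f 0) (f 0 + 2 * PI) = RInt (wave n c) 0 (2 * PI)).
  { apply RInt_period; [apply wave_cont | apply wave_period]. }
  change (RInt (fun t => wave n c t) (f 0) (f 0 + 2 * PI)) with (RInt (wave n c) (f 0) (f 0 + 2 * PI)) in Y2.
  fold d in Sp. change (fun w : R => - INR n * sin (INR n * w - c) * (g w - w)) with (fun w => d w * (g w - w)). lra.
Qed.

Lemma inverse_cont (f g : R -> R) : (forall x y, x < y -> f x < f y) -> (forall x, f (g x) = x) -> cont g.
Proof.
  intros Hf Hfg x. apply continuity_pt_filterlim. intros eps He.
  assert (A := Hf (g x - eps) (g x) ltac:(lra)). assert (B := Hf (g x) (g x + eps) ltac:(lra)). rewrite Hfg in A, B.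
  exists (Rmin (x - f (g x - eps)) (f (g x + eps) - x)). split; [apply Rmin_pos; lra|].
  intros y [_ Hy]. cbn in *. unfold Rdist in *.
  assert (L1 := Rmin_l (x - f (g x - eps)) (f (g x + eps) - x)). assert (L2 := Rmin_r (x - f (g x - eps)) (f (g x + eps) - x)).
  apply Rabs_def2 in Hy.
  assert (M : forall u v, f u < f v -> u < v).
  { intros u v Huv. destruct (Rtotal_order u v) as [H|[H|H]]; auto; [subst; lra | apply Hf in H; lra]. }
  apply Rabs_def1.
  - enough (g y < g x + eps) by lra. apply M. rewrite Hfg. lra.
  - enough (g x - eps < g y) by lra. apply M. rewrite Hfg. lra.
Qed.


(** * Chebyshev polynomials near zero *)

Lemma cos_step k t : cos ((k + 2) * t) = 2 * cos t * cos ((k + 1) * t) - cos (k * t).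
Proof.
  replace ((k + 2) * t) with ((k + 1) * t + t) by ring. replace (k * t) with ((k + 1) * t - t) by ring.
  rewrite cos_plus, cos_minus. ring.
Qed.

(** The Chebyshev polynomials of degrees [2 * m] and [2 * m + 1] in [cos t], cut off after order
    four. The recurrence [cos_step] links neighbouring degrees, so both parities are carried through
    one induction. *)
Lemma chebyshev_expansion (m : nat) : exists C, 0 <= C /\ forall t, let x := cos t in let M := INR m in
  Rabs (cos (2 * M * t) - (-1) ^ m * (1 - 2 * M ^ 2 * x ^ 2 + 2 / 3 * M ^ 2 * (M ^ 2 - 1) * x ^ 4)) <= C * Rabs x ^ 5 /\
  Rabs (cos ((2 * M + 1) * t) - (-1) ^ m * ((2 * M + 1) * x - (2 * M + 1) * ((2 * M + 1) ^ 2 - 1) / 6 * x ^ 3)) <= C * Rabs x ^ 5.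
Proof.
  induction m as [|m (C & HC & IH)].
  - exists 0. split; [lra|]. intros t x M. unfold M; cbn [INR]. split; right.
    + replace (2 * 0 * t) with 0 by ring. rewrite cos_0. match goal with |- Rabs ?e = _ => replace e with 0 by field end. rewrite Rabs_R0; ring.
    + replace ((2 * 0 + 1) * t) with t by ring. fold x. match goal with |- Rabs ?e = _ => replace e with 0 by field end. rewrite Rabs_R0; ring.
  - set (N := INR (S m)). set (K := Rabs (4 / 3 * N ^ 2 * (N ^ 2 - 1))).
    (* The even degree costs [3 * C]; the odd one costs [2 * (3 * C) + C], plus [K] for the fifth
       power produced by the recurrence. *)
    exists (7 * C + K). assert (HK : 0 <= K) by apply Rabs_pos. split; [lra|].
    intros t x M. destruct (IH t) as [A B]. clear IH. fold x in A, B.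
    set (P := INR m) in *. assert (EM : M = P + 1) by (unfold M, P; apply S_INR).
    assert (EN : N = P + 1) by (unfold N, P; apply S_INR).
    set (s := (-1) ^ m) in *. replace ((-1) ^ S m) with (- s) by (unfold s; cbn; ring).
    assert (Bx : Rabs x <= 1) by (apply Rabs_le; apply COS_bound).
    assert (Hx5 : 0 <= Rabs x ^ 5) by (apply pow_le, Rabs_pos).
    assert (Hs : Rabs s = 1). { unfold s. rewrite pow_1_abs. reflexivity. }
    set (a := cos (2 * P * t)) in *. set (b := cos ((2 * P + 1) * t)) in *.
    set (ea := a - s * (1 - 2 * P ^ 2 * x ^ 2 + 2 / 3 * P ^ 2 * (P ^ 2 - 1) * x ^ 4)) in *.
    set (eb := b - s * ((2 * P + 1) * x - (2 * P + 1) * ((2 * P + 1) ^ 2 - 1) / 6 * x ^ 3)) in *.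
    assert (E1 : cos (2 * M * t) = 2 * x * b - a).
    { rewrite EM. replace (2 * (P + 1)) with (2 * P + 2) by ring. apply cos_step. }
    assert (E2 : cos ((2 * M + 1) * t) = 2 * x * cos (2 * M * t) - b).
    { rewrite EM. replace (2 * (P + 1) + 1) with (2 * P + 1 + 2) by ring. rewrite cos_step. fold x b. f_equal. f_equal. f_equal. ring. }
    assert (D1 : cos (2 * M * t) - - s * (1 - 2 * M ^ 2 * x ^ 2 + 2 / 3 * M ^ 2 * (M ^ 2 - 1) * x ^ 4) = 2 * x * eb - ea).
    { rewrite E1, EM. unfold ea, eb. field. }
    assert (F1 : Rabs (2 * x * eb - ea) <= 3 * C * Rabs x ^ 5).
    { replace (2 * x * eb - ea) with (2 * (x * eb) + - ea) by ring. eapply Rle_trans; [apply Rabs_triang|].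
      rewrite Rabs_Ropp, !Rabs_mult, (Rabs_pos_eq 2) by lra. assert (P0 := Rabs_pos x). assert (P1 := Rabs_pos eb).
      assert (Rabs x * Rabs eb <= 1 * (C * Rabs x ^ 5)) by (apply Rmult_le_compat; auto). lra. }
    split.
    + rewrite D1. nra.
    + set (ec := cos (2 * M * t) - - s * (1 - 2 * M ^ 2 * x ^ 2 + 2 / 3 * M ^ 2 * (M ^ 2 - 1) * x ^ 4)) in *.
      assert (D2 : cos ((2 * M + 1) * t) - - s * ((2 * M + 1) * x - (2 * M + 1) * ((2 * M + 1) ^ 2 - 1) / 6 * x ^ 3)
         = 2 * (x * ec) + - eb + - (s * (4 / 3 * N ^ 2 * (N ^ 2 - 1)) * x ^ 5)).
      { rewrite E2, EN. unfold ec, eb. rewrite EM. field. }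
      rewrite D2. rewrite <- D1 in F1.
      assert (E5 : Rabs (- (s * (4 / 3 * N ^ 2 * (N ^ 2 - 1)) * x ^ 5)) = K * Rabs x ^ 5).
      { rewrite Rabs_Ropp, Rabs_mult, Rabs_mult, Hs, Rmult_1_l, RPow_abs. reflexivity. }
      eapply Rle_trans; [apply Rabs_triang|]. rewrite E5.
      assert (T1 : Rabs (2 * (x * ec) + - eb) <= 7 * C * Rabs x ^ 5).
      { eapply Rle_trans; [apply Rabs_triang|]. rewrite Rabs_Ropp, !Rabs_mult, (Rabs_pos_eq 2) by lra.
        assert (P0 := Rabs_pos x). assert (P1 := Rabs_pos ec).
        assert (Rabs x * Rabs ec <= 1 * (3 * C * Rabs x ^ 5)) by (apply Rmult_le_compat; auto). lra. }
      lra.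
Qed.

Lemma coeffs_zero a b K s0 : 0 < s0 -> 0 <= K -> (forall s, 0 < s < s0 -> Rabs (a + b * s ^ 2) <= K * s ^ 3) -> a = 0 /\ b = 0.
Proof.
  intros Hs0 HK H.
  assert (Z : forall u L, 0 <= L -> (forall s, 0 < s < Rmin s0 1 -> Rabs u <= L * s) -> u = 0).
  { intros u L HL Hu. destruct (Req_dec u 0) as [|Hne]; auto. exfalso. assert (P := Rabs_pos_lt u Hne).
    set (s := Rmin (Rmin s0 1 / 2) (Rabs u / (2 * (L + 1)))).
    assert (Q : 0 < Rmin s0 1) by (apply Rmin_pos; lra).
    assert (Q2 : 0 < Rabs u / (2 * (L + 1))) by (apply Rdiv_lt_0_compat; lra).
    assert (S1 : 0 < s) by (apply Rmin_pos; lra). assert (S2 : s <= Rmin s0 1 / 2) by apply Rmin_l.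
    assert (S3 : s <= Rabs u / (2 * (L + 1))) by apply Rmin_r.
    specialize (Hu s ltac:(lra)).
    assert ((L + 1) * s <= Rabs u / 2).
    { apply Rle_trans with ((L + 1) * (Rabs u / (2 * (L + 1)))); [apply Rmult_le_compat_l; lra|]. right. field. lra. }
    nra. }
  assert (A0 : a = 0).
  { apply (Z a (K + Rabs b)); [assert (P := Rabs_pos b); lra|]. intros s Hs.
    assert (M1 := Rmin_l s0 1). assert (M2 := Rmin_r s0 1). specialize (H s ltac:(lra)).
    replace a with (a + b * s ^ 2 + - (b * s ^ 2)) by ring. eapply Rle_trans; [apply Rabs_triang|].
    rewrite Rabs_Ropp, Rabs_mult, (Rabs_pos_eq (s ^ 2)) by nra. assert (P := Rabs_pos b).
    assert (s ^ 2 <= s) by nra. assert (s ^ 3 <= s) by nra. nra. }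
  split; auto. subst a. apply (Z b K HK). intros s Hs.
  assert (M1 := Rmin_l s0 1). specialize (H s ltac:(lra)).
  rewrite Rplus_0_l, Rabs_mult, (Rabs_pos_eq (s ^ 2)) in H by nra.
  apply (Rmult_le_reg_r (s ^ 2)); [nra|]. nra.
Qed.

(** * Fourier coefficients *)

(** Equalities of integrals arise at the carrier of a Coquelicot structure; [ring] and [field]
    expect them at type [R]. *)
Ltac real_eq := match goal with |- @eq _ ?a ?b => change (@eq R a b) end.

Lemma wave_abs n c x : Rabs (wave n c x) <= 1.
Proof. apply Rabs_le. apply COS_bound. Qed.

Lemma RInt_wave n c : n <> 0%nat -> RInt (wave n c) 0 (2 * PI) = 0.
Proof.
  intros Hn. assert (Hn' : INR n <> 0) by now apply not_0_INR.
  rewrite (RInt_deriv (fun x => sin (INR n * x - c) / INR n) (wave n c)).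
  - replace (INR n * (2 * PI) - c) with (INR n * 0 - c + INR n * (2 * PI)) by ring. rewrite sin_add_INR. lra.
  - intros x. unfold wave. auto_derive; auto. unfold Rminus. field. auto.
  - apply wave_cont.
Qed.

Lemma cos_prod a b : cos a * cos b = / 2 * (cos (a + b) + cos (a - b)).
Proof. rewrite cos_plus, cos_minus. field. Qed.

Lemma wave_orth n m c d : n <> m -> RInt (fun x => wave n c x * wave m d x) 0 (2 * PI) = 0.
Proof.
  intros Hnm.
  assert (K : forall n m c d, (m < n)%nat -> RInt (fun x => wave n c x * wave m d x) 0 (2 * PI) = 0).
  { clear. intros n m c d Hlt.
    rewrite (RInt_ext_c _ (fun x => / 2 * (wave (n + m) (c + d) x + wave (n - m) (c - d) x))).
    - assert (C1 := wave_cont (n + m) (c + d)). assert (C2 := wave_cont (n - m) (c - d)).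
      rewrite (RInt_scal_c (/ 2) (fun x => wave (n + m) (c + d) x + wave (n - m) (c - d) x)) by now apply cont_plus.
      rewrite RInt_plus_c, !RInt_wave by (auto; lia). real_eq; ring.
    - intros x. unfold wave. rewrite plus_INR, minus_INR by lia. rewrite cos_prod.
      apply (f_equal2 Rmult eq_refl), (f_equal2 Rplus); apply (f_equal cos); ring. }
  destruct (Nat.lt_ge_cases m n); auto.
  rewrite (RInt_ext_c _ (fun x => wave m d x * wave n c x)) by (intros; ring). apply K. lia.
Qed.

Lemma wave_self n c d : n <> 0%nat -> RInt (fun x => wave n c x * wave n d x) 0 (2 * PI) = PI * cos (c - d).
Proof.
  intros Hn. rewrite (RInt_ext_c _ (fun x => / 2 * (wave (n + n) (c + d) x + cos (c - d)))).
  - assert (C1 := wave_cont (n + n) (c + d)). assert (C2 := cont_const (cos (c - d))).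
    rewrite (RInt_scal_c (/ 2) (fun x => wave (n + n) (c + d) x + cos (c - d))) by now apply cont_plus.
    rewrite (RInt_plus_c (wave (n + n) (c + d)) (fun _ => cos (c - d))), RInt_wave by (auto; lia).
    rewrite RInt_const. change (scal (2 * PI - 0) (cos (c - d))) with ((2 * PI - 0) * cos (c - d)). real_eq; field.
  - intros x. unfold wave. rewrite plus_INR, cos_prod. apply (f_equal2 Rmult eq_refl), (f_equal2 Rplus); [apply (f_equal cos); ring|].
    rewrite <- cos_neg. apply (f_equal cos); ring.
Qed.

Lemma wave_step n c : exists m a k e, forall x, wave n c x * (1 - cos x) = wave n c x - / 2 * (wave m a x + wave k e x).
Proof.
  destruct n as [|n].
  - exists 1%nat, c, 1%nat, (- c). intros x. unfold wave. cbn [INR].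
    replace (1 * x - - c) with (x - (0 * x - c)) by ring. replace (1 * x - c) with (x + (0 * x - c)) by ring.
    generalize (0 * x - c). intros u. rewrite cos_plus, cos_minus. field.
  - exists (S (S n)), c, n, c. intros x. unfold wave. rewrite !S_INR.
    replace ((INR n + 1 + 1) * x - c) with ((INR n + 1) * x - c + x) by ring. replace (INR n * x - c) with ((INR n + 1) * x - c - x) by ring.
    generalize ((INR n + 1) * x - c). intros u. rewrite cos_plus, cos_minus. field.
Qed.

(** A wave times [1 - cos x] is a combination of waves, so the exponent can be lowered by one. *)
Lemma kernel_orth F : cont F -> (forall n c, RInt (fun x => wave n c x * F x) 0 (2 * PI) = 0) ->
  forall N n c, RInt (fun x => wave n c x * ((1 - cos x) ^ N * F x)) 0 (2 * PI) = 0.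
Proof.
  intros CF H N. induction N as [|N IH]; intros n c.
  - transitivity (RInt (fun x => wave n c x * F x) 0 (2 * PI)); [|apply H]. apply RInt_ext_c. intros; cbn; ring.
  - destruct (wave_step n c) as (m & a & k & e & E).
    rewrite (RInt_ext_c _ (fun x => wave n c x * ((1 - cos x) ^ N * F x) - / 2 * (wave m a x * ((1 - cos x) ^ N * F x) + wave k e x * ((1 - cos x) ^ N * F x)))).
    + assert (C1 := wave_cont n c). assert (C2 := wave_cont m a). assert (C3 := wave_cont k e).
      assert (K : cont (fun x => (1 - cos x) ^ N * F x)) by ct.
      rewrite (RInt_minus_c (fun x => wave n c x * ((1 - cos x) ^ N * F x)) (fun x => / 2 * (wave m a x * ((1 - cos x) ^ N * F x) + wave k e x * ((1 - cos x) ^ N * F x)))).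
      * rewrite (RInt_scal_c (/ 2) (fun x => wave m a x * ((1 - cos x) ^ N * F x) + wave k e x * ((1 - cos x) ^ N * F x))).
        -- rewrite (RInt_plus_c (fun x => wave m a x * ((1 - cos x) ^ N * F x)) (fun x => wave k e x * ((1 - cos x) ^ N * F x))), !IH.
           ++ real_eq; ring.
           ++ apply (cont_mult (wave m a)); auto.
           ++ apply (cont_mult (wave k e)); auto.
        -- apply cont_plus; [apply (cont_mult (wave m a)) | apply (cont_mult (wave k e))]; auto.
      * apply (cont_mult (wave n c)); auto.
      * apply cont_mult; [apply cont_const|]. apply cont_plus; [apply (cont_mult (wave m a)) | apply (cont_mult (wave k e))]; auto.
    + intros x. cbn [pow].
      transitivity (wave n c x * (1 - cos x) * ((1 - cos x) ^ N * F x)); [ring|]. rewrite E. ring.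
Qed.

Definition kernel_mass N := RInt (fun x => (1 - cos x) ^ N) 0 (2 * PI).

(** The derivative of [sin x * (1 - cos x) ^ N] integrates to zero. The outcome says that the kernel
    concentrates at [PI], where [1 + cos x] vanishes. *)
Lemma kernel_defect N : (INR N + 1) * RInt (fun x => (1 + cos x) * (1 - cos x) ^ N) 0 (2 * PI) = kernel_mass N.
Proof.
  assert (E : RInt (fun x => (INR N + 1) * ((1 + cos x) * (1 - cos x) ^ N) - (1 - cos x) ^ N) 0 (2 * PI) = 0).
  { rewrite (RInt_deriv (fun x => sin x * (1 - cos x) ^ N)).
    - rewrite sin_2PI, sin_0. real_eq; ring.
    - intros x. auto_derive; auto. destruct N as [|N].
      + cbn. ring.
      + rewrite S_INR. cbn [Nat.pred pow]. assert (S := sin2_cos2 x). unfold Rsqr in S.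
        assert (S' : sin x * sin x = (1 - cos x) * (1 + cos x)) by lra.
        transitivity (cos x * ((1 - cos x) * (1 - cos x) ^ N) + (INR N + 1) * (sin x * sin x) * (1 - cos x) ^ N); [unfold Rminus; ring|].
        rewrite S'. ring.
    - ct. }
  rewrite (RInt_minus_c (fun x => (INR N + 1) * ((1 + cos x) * (1 - cos x) ^ N)) (fun x => (1 - cos x) ^ N)) in E by ct.
  rewrite (RInt_scal_c (INR N + 1) (fun x => (1 + cos x) * (1 - cos x) ^ N)) in E by ct. unfold kernel_mass. lra.
Qed.

Lemma kernel_mass_pos N : 0 < kernel_mass N.
Proof.
  induction N as [|N IH].
  - unfold kernel_mass. rewrite (RInt_ext_c _ (fun _ => 1)) by (intros; cbn; ring).
    rewrite RInt_const. change (scal (2 * PI - 0) 1) with ((2 * PI - 0) * 1). assert (P := PI_RGT_0). lra.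
  - assert (D := kernel_defect N). set (J := RInt (fun x => (1 + cos x) * (1 - cos x) ^ N) 0 (2 * PI)) in *.
    assert (E : kernel_mass (S N) = 2 * kernel_mass N - J).
    { unfold kernel_mass, J. rewrite <- (RInt_scal_c 2 (fun x => (1 - cos x) ^ N)) by ct.
      rewrite <- (RInt_minus_c (fun x => 2 * (1 - cos x) ^ N) (fun x => (1 + cos x) * (1 - cos x) ^ N)) by ct.
      apply RInt_ext_c. intros; cbn; ring. }
    rewrite E. assert (P := pos_INR N). nra.
Qed.

(** Were [F PI] positive, [F] would dominate [c0 / 2 - L * (1 + cos x)]. Against the kernel, the
    integral of [1 + cos x] is only the fraction [1 / (N + 1)] of the mass, so for large [N] an
    integral known to vanish would be positive. *)
Lemma fourier_at_pi F : cont F -> (forall n c, RInt (fun x => wave n c x * F x) 0 (2 * PI) = 0) -> F PI <= 0.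
Proof.
  intros CF H. apply Rnot_lt_le. intros Hpos. assert (Pi := PI_RGT_0).
  set (c0 := F PI) in *.
  destruct (continuity_ab_min F 0 (2 * PI)) as (mx & Hm & _).
  { lra. } { intros c _. apply continuity_pt_filterlim. apply CF. }
  set (m := F mx) in *.
  assert (Hc := CF PI). apply continuity_pt_filterlim in Hc. destruct (Hc (c0 / 2)) as (eta & Heta & He). { lra. }
  set (et := Rmin (eta / 2) 1). assert (E0 : 0 < et) by (apply Rmin_pos; lra).
  assert (E1 : et <= eta / 2) by apply Rmin_l. assert (E2 : et <= 1) by apply Rmin_r. assert (P1 := PI2_1).
  set (q := 1 - cos et).
  assert (Hq : 0 < q). { unfold q. assert (cos et < cos 0) by (apply cos_decreasing_1; lra). rewrite cos_0 in H0. lra. }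
  (* At distance more than [et] from [PI] one has [1 + cos x >= q], so this [L] brings the minorant
     below the minimum [m] of [F]. *)
  set (L := (Rabs m + c0) / q).
  assert (HL : 0 < L). { unfold L. apply Rdiv_lt_0_compat; auto. assert (Pm := Rabs_pos m). lra. }
  assert (Low : forall x, 0 <= x <= 2 * PI -> c0 / 2 - L * (1 + cos x) <= F x).
  { intros x Hx. assert (B := COS_bound x). destruct (Rle_dec (Rabs (x - PI)) et) as [Hn|Hn].
    - assert (c0 / 2 <= F x).
      { destruct (Req_dec x PI) as [->|Hne]; [fold c0; lra|].
        assert (G : Rabs (F x - F PI) < c0 / 2).
        { apply (He x). split; [split; [exact I | auto]|]. cbn. unfold Rdist. lra. }
        apply Rabs_def2 in G. fold c0 in G. lra. }
      nra.
    - apply Rnot_le_lt in Hn.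
      assert (C : - cos et <= cos x).
      { replace (cos x) with (- cos (Rabs (x - PI))).
        - assert (cos (Rabs (x - PI)) <= cos et); [|lra]. apply cos_decr_1; try lra; try apply Rabs_pos. apply Rabs_le. lra.
        - unfold Rabs; destruct (Rcase_abs (x - PI)).
          + replace (- (x - PI)) with (PI - x) by ring. rewrite cos_minus, cos_PI, sin_PI. ring.
          + rewrite cos_minus, cos_PI, sin_PI. ring. }
      assert (HLq : L * q = Rabs m + c0) by (unfold L; field; lra).
      assert (L * q <= L * (1 + cos x)) by (apply Rmult_le_compat_l; unfold q; lra).
      assert (Ab := Rle_abs (- m)). rewrite Rabs_Ropp in Ab. specialize (Hm x Hx). fold m in Hm. lra. }
  destruct (INR_unbounded (2 * L / c0)) as [N HN].
  assert (Z := kernel_orth F CF H N 0%nat 0).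
  assert (Kc : cont (fun x => (1 - cos x) ^ N)) by ct.
  assert (D := kernel_defect N). assert (Pm := kernel_mass_pos N).
  set (J := RInt (fun x => (1 + cos x) * (1 - cos x) ^ N) 0 (2 * PI)) in *.
  assert (Cmp : c0 / 2 * kernel_mass N - L * J <= RInt (fun x => wave 0 0 x * ((1 - cos x) ^ N * F x)) 0 (2 * PI)).
  { unfold kernel_mass, J. rewrite <- (RInt_scal_c (c0 / 2) (fun x => (1 - cos x) ^ N)) by ct.
    rewrite <- (RInt_scal_c L (fun x => (1 + cos x) * (1 - cos x) ^ N)) by ct.
    rewrite <- (RInt_minus_c (fun x => c0 / 2 * (1 - cos x) ^ N) (fun x => L * ((1 + cos x) * (1 - cos x) ^ N))) by ct.
    apply RInt_le; [lra | | |].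
    - apply cont_ex. ct.
    - apply cont_ex. apply (cont_mult (wave 0 0)); [apply wave_cont | ct].
    - intros x Hx. unfold wave. cbn [INR]. replace (0 * x - 0) with 0 by ring. rewrite cos_0.
      specialize (Low x ltac:(lra)). assert (B := COS_bound x). assert (P : 0 <= (1 - cos x) ^ N) by (apply pow_le; lra). nra. }
  rewrite Z in Cmp.
  assert (HN2 : 2 * L < c0 * INR N). { apply (Rmult_lt_compat_l c0) in HN; auto. replace (c0 * (2 * L / c0)) with (2 * L) in HN by (field; lra). lra. } rewrite <- D in Cmp.
  assert (PJ : 0 < J) by nra. nra.
Qed.

(** A translation moves any point to [PI] and only changes the phases of the waves; the bound is
    then applied to [F] and to its opposite. *)
Lemma fourier_zero F : cont F -> period F -> (forall n c, RInt (fun x => wave n c x * F x) 0 (2 * PI) = 0) -> forall x, F x = 0.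
Proof.
  intros CF PF H x. set (s := x - PI).
  assert (Cs : cont (fun y => F (y + s))).
  { apply (cont_comp (fun y => y + s) F); auto. ct. }
  assert (Hs : forall n c, RInt (fun y => wave n c y * F (y + s)) 0 (2 * PI) = 0).
  { intros n c. transitivity (RInt (fun x => wave n (c + INR n * s) x * F x) 0 (2 * PI)); [|apply H].
    set (G := fun y => wave n (c + INR n * s) y * F y).
    assert (CG : cont G) by (apply cont_mult; [apply wave_cont | auto]).
    rewrite (RInt_ext_c _ (fun y => G (y + s))).
    - rewrite RInt_shift by auto. rewrite Rplus_0_l, (Rplus_comm (2 * PI)). apply RInt_period; auto.
      intros y. unfold G. now rewrite wave_period, PF.
    - intros y. unfold G, wave. f_equal. apply (f_equal cos). ring. }
  assert (A := fourier_at_pi _ Cs Hs).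
  assert (B : - F (PI + s) <= 0).
  { apply (fourier_at_pi (fun y => - F (y + s))); [ct|]. intros n c.
    rewrite (RInt_ext_c _ (fun y => (-1) * (wave n c y * F (y + s)))) by (intros; ring).
    rewrite (RInt_scal_c (-1) (fun y => wave n c y * F (y + s))), Hs; [real_eq; ring|]. apply (cont_mult (wave n c)); auto. apply wave_cont. }
  cbn beta in A. replace (PI + s) with x in A, B by (unfold s; ring). lra.
Qed.

Lemma trig_form F N : cont F -> period F -> N <> 0%nat ->
  (forall n c, n <> 0%nat -> n <> N -> RInt (fun x => wave n c x * F x) 0 (2 * PI) = 0) ->
  exists e p q, forall x, F x = e + p * cos (INR N * x) + q * sin (INR N * x).
Proof.
  intros CF PF HN H. assert (Pi := PI_RGT_0).
  set (e := RInt F 0 (2 * PI) / (2 * PI)).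
  set (p := RInt (fun x => wave N 0 x * F x) 0 (2 * PI) / PI). set (q := RInt (fun x => wave N (PI / 2) x * F x) 0 (2 * PI) / PI).
  set (G := fun x => F x - (e * wave 0 0 x + (p * wave N 0 x + q * wave N (PI / 2) x))).
  assert (C0 := wave_cont 0 0). assert (C1 := wave_cont N 0). assert (C2 := wave_cont N (PI / 2)).
  assert (Ca : cont (fun x => p * wave N 0 x + q * wave N (PI / 2) x)).
  { apply cont_plus; (apply cont_mult; [apply cont_const | auto]). }
  assert (Cb : cont (fun x => e * wave 0 0 x + (p * wave N 0 x + q * wave N (PI / 2) x))).
  { apply cont_plus; auto. apply cont_mult; [apply cont_const | auto]. }
  assert (CG : cont G) by now apply cont_minus.
  assert (PG : period G) by (intros x; unfold G; now rewrite PF, !wave_period).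
  assert (Sp : forall n c, RInt (fun x => wave n c x * G x) 0 (2 * PI) = RInt (fun x => wave n c x * F x) 0 (2 * PI)
     - (e * RInt (fun x => wave n c x * wave 0 0 x) 0 (2 * PI) + (p * RInt (fun x => wave n c x * wave N 0 x) 0 (2 * PI) + q * RInt (fun x => wave n c x * wave N (PI / 2) x) 0 (2 * PI)))).
  { intros n c. assert (Cn := wave_cont n c).
    assert (K0 : cont (fun x => wave n c x * wave 0 0 x)) by now apply cont_mult.
    assert (K1 : cont (fun x => wave n c x * wave N 0 x)) by now apply cont_mult.
    assert (K2 : cont (fun x => wave n c x * wave N (PI / 2) x)) by now apply cont_mult.
    assert (KF : cont (fun x => wave n c x * F x)) by now apply cont_mult.
    assert (L0 : cont (fun x => e * (wave n c x * wave 0 0 x))) by (apply cont_mult; [apply cont_const | auto]).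
    assert (L1 : cont (fun x => p * (wave n c x * wave N 0 x))) by (apply cont_mult; [apply cont_const | auto]).
    assert (L2 : cont (fun x => q * (wave n c x * wave N (PI / 2) x))) by (apply cont_mult; [apply cont_const | auto]).
    assert (L12 : cont (fun x => p * (wave n c x * wave N 0 x) + q * (wave n c x * wave N (PI / 2) x))) by now apply cont_plus.
    rewrite <- (RInt_scal_c e _ _ _ K0), <- (RInt_scal_c p _ _ _ K1), <- (RInt_scal_c q _ _ _ K2).
    rewrite <- (RInt_plus_c _ _ _ _ L1 L2), <- (RInt_plus_c _ _ _ _ L0 L12).
    rewrite <- RInt_minus_c; [|auto | now apply cont_plus]. apply RInt_ext_c. intros x. unfold G. ring. }
  assert (Z : forall n c, RInt (fun x => wave n c x * G x) 0 (2 * PI) = 0).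
  { intros n c. rewrite Sp. destruct (Nat.eq_dec n 0) as [->|Hn0]; [|destruct (Nat.eq_dec n N) as [->|HnN]].
    - rewrite !(wave_orth 0 N) by auto.
      assert (W : forall x, wave 0 c x = cos c). { intros x. unfold wave. cbn [INR]. replace (0 * x - c) with (- c) by ring. apply cos_neg. }
      assert (W0 : forall x, wave 0 0 x = 1). { intros x. unfold wave. cbn [INR]. replace (0 * x - 0) with 0 by ring. apply cos_0. }
      rewrite (RInt_ext_c (fun x => wave 0 c x * F x) (fun x => cos c * F x)) by (intros; now rewrite W).
      rewrite (RInt_ext_c (fun x => wave 0 c x * wave 0 0 x) (fun _ => cos c)) by (intros; rewrite W, W0; ring).
      rewrite RInt_scal_c by auto. rewrite RInt_const. change (scal (2 * PI - 0) (cos c)) with ((2 * PI - 0) * cos c). unfold e. real_eq; field. lra.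
    - rewrite (wave_orth N 0) by auto. rewrite !wave_self by auto.
      assert (KF0 : cont (fun x => wave N 0 x * F x)) by now apply cont_mult.
      assert (KF1 : cont (fun x => wave N (PI / 2) x * F x)) by now apply cont_mult.
      rewrite (RInt_ext_c (fun x => wave N c x * F x) (fun x => cos c * (wave N 0 x * F x) + sin c * (wave N (PI / 2) x * F x))).
      + rewrite (RInt_plus_c (fun x => cos c * (wave N 0 x * F x)) (fun x => sin c * (wave N (PI / 2) x * F x))) by (apply cont_mult; [apply cont_const | auto]).
        rewrite (RInt_scal_c _ _ _ _ KF0), (RInt_scal_c _ _ _ _ KF1).
        rewrite Rminus_0_r, cos_minus, cos_PI2, sin_PI2. unfold p, q. real_eq; field. lra.
      + intros x. unfold wave. rewrite !cos_minus, cos_PI2, sin_PI2, cos_0, sin_0. ring.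
    - rewrite H, (wave_orth n 0), !(wave_orth n N) by auto. real_eq; ring. }
  exists e, p, q. intros x. assert (A := fourier_zero G CG PG Z x). unfold G in A.
  assert (W0 : wave 0 0 x = 1). { unfold wave. cbn [INR]. replace (0 * x - 0) with 0 by ring. apply cos_0. }
  assert (W1 : wave N 0 x = cos (INR N * x)) by (unfold wave; now rewrite Rminus_0_r).
  assert (W2 : wave N (PI / 2) x = sin (INR N * x)) by (unfold wave; rewrite cos_minus, cos_PI2, sin_PI2; ring).
  rewrite W0, W1, W2 in A. lra.
Qed.

(** With [s = / Rad] the cosines are [s * h1] and [s * h2]. The expansion turns the equality of
    integrals into a bound of order [s ^ 5] on [s ^ j * (be * A1 + ga * A2 * s ^ 2)]; as [j <= 2],
    an error of order [s ^ 3] remains for [coeffs_zero]. *)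
Lemma moment_match (W h1 h2 : R -> R) k al be ga C R0 H (j : nat) : cont W -> (forall x, Rabs (W x) <= 1) -> cont h1 -> cont h2 ->
  (forall t, 0 <= h1 t <= H) -> (forall t, 0 <= h2 t <= H) -> 0 <= C -> 0 < R0 -> (1 <= j <= 2)%nat ->
  (forall t, Rabs (cos (k * t) - (al + be * cos t ^ j + ga * cos t ^ (j + 2))) <= C * Rabs (cos t) ^ 5) ->
  (forall Rad, R0 < Rad -> exists f1 f2, cont f1 /\ cont f2 /\ (forall t, Rad * cos (f1 t) = h1 t) /\ (forall t, Rad * cos (f2 t) = h2 t) /\
     RInt (fun t => W t * cos (k * f1 t)) 0 (2 * PI) = RInt (fun t => W t * cos (k * f2 t)) 0 (2 * PI)) ->
  be * RInt (fun t => W t * (h1 t ^ j - h2 t ^ j)) 0 (2 * PI) = 0 /\ ga * RInt (fun t => W t * (h1 t ^ (j + 2) - h2 t ^ (j + 2))) 0 (2 * PI) = 0.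
Proof.
  intros CW BW C1 C2 B1 B2 HC HR0 Hj Hexp Hrad. assert (Pi := PI_RGT_0).
  assert (HH : 0 <= H) by (specialize (B1 0); lra).
  set (A1 := RInt (fun t => W t * (h1 t ^ j - h2 t ^ j)) 0 (2 * PI)). set (A2 := RInt (fun t => W t * (h1 t ^ (j + 2) - h2 t ^ (j + 2))) 0 (2 * PI)).
  set (K := 2 * PI * (2 * C * H ^ 5)).
  assert (HH5 : 0 <= H ^ 5) by now apply pow_le.
  assert (HK : 0 <= K) by (unfold K; apply Rmult_le_pos; [lra|]; apply Rmult_le_pos; lra).
  apply (coeffs_zero (be * A1) (ga * A2) K (Rmin 1 (/ R0))); auto.
  { apply Rmin_pos; [lra | now apply Rinv_0_lt_compat]. }
  intros s Hs. assert (M1 := Rmin_l 1 (/ R0)). assert (M2 := Rmin_r 1 (/ R0)).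
  assert (Hrs : R0 < / s). { rewrite <- (Rinv_inv R0). apply Rinv_lt_contravar; [apply Rmult_lt_0_compat; [lra | now apply Rinv_0_lt_compat] | lra]. }
  destruct (Hrad (/ s) Hrs) as (f1 & f2 & F1 & F2 & E1 & E2 & EI).
  assert (X1 : forall t, cos (f1 t) = s * h1 t) by (intros t; rewrite <- E1; field; lra).
  assert (X2 : forall t, cos (f2 t) = s * h2 t) by (intros t; rewrite <- E2; field; lra).
  set (P := fun x => al + be * x ^ j + ga * x ^ (j + 2)).
  assert (Er : forall (f h : R -> R) t, cos (f t) = s * h t -> 0 <= h t <= H -> Rabs (cos (k * f t) - P (s * h t)) <= C * H ^ 5 * s ^ 5).
  { intros f h t X B. specialize (Hexp (f t)). rewrite X in Hexp. fold (P (s * h t)) in Hexp. eapply Rle_trans; [exact Hexp|].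
    rewrite Rmult_assoc. apply Rmult_le_compat_l; auto. rewrite Rabs_pos_eq by nra. rewrite Rpow_mult_distr, Rmult_comm.
    apply Rmult_le_compat_r; [apply pow_le; lra|]. apply pow_incr. lra. }
  set (err := fun t => W t * ((cos (k * f2 t) - P (s * h2 t)) - (cos (k * f1 t) - P (s * h1 t)))).
  assert (Cerr : cont err). { unfold err, P. ct. }
  assert (Eerr : RInt err 0 (2 * PI) = s ^ j * (be * A1 + ga * A2 * s ^ 2)).
  { assert (Q1 : cont (fun t => W t * cos (k * f1 t))) by ct. assert (Q2 : cont (fun t => W t * cos (k * f2 t))) by ct.
    assert (Q3 : cont (fun t => W t * (h1 t ^ j - h2 t ^ j))) by ct. assert (Q4 : cont (fun t => W t * (h1 t ^ (j + 2) - h2 t ^ (j + 2)))) by ct.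
    transitivity (RInt (fun t => W t * cos (k * f2 t)) 0 (2 * PI) - RInt (fun t => W t * cos (k * f1 t)) 0 (2 * PI) + (s ^ j * be * A1 + s ^ (j + 2) * ga * A2)); [|rewrite EI, pow_add; real_eq; ring].
    unfold A1, A2. rewrite <- (RInt_scal_c (s ^ j * be) _ _ _ Q3), <- (RInt_scal_c (s ^ (j + 2) * ga) _ _ _ Q4), <- (RInt_minus_c _ _ _ _ Q2 Q1).
    rewrite <- RInt_plus_c by (apply cont_mult; [apply cont_const | auto]).
    rewrite <- RInt_plus_c; [|now apply cont_minus | apply cont_plus; (apply cont_mult; [apply cont_const | auto])].
    apply RInt_ext_c. intros t. unfold err, P. rewrite !Rpow_mult_distr. ring. }
  assert (Berr : Rabs (RInt err 0 (2 * PI)) <= (2 * PI - 0) * (2 * C * H ^ 5 * s ^ 5)).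
  { apply RInt_abs_le; auto; [lra|]. intros t _. unfold err. rewrite Rabs_mult.
    assert (G1 := Er f1 h1 t (X1 t) (B1 t)). assert (G2 := Er f2 h2 t (X2 t) (B2 t)).
    assert (T := Rabs_triang (cos (k * f2 t) - P (s * h2 t)) (- (cos (k * f1 t) - P (s * h1 t)))). rewrite Rabs_Ropp in T.
    fold (Rminus (cos (k * f2 t) - P (s * h2 t)) (cos (k * f1 t) - P (s * h1 t))) in T.
    specialize (BW t). assert (Q0 := Rabs_pos (W t)).
    assert (Q1 := Rabs_pos (cos (k * f2 t) - P (s * h2 t) - (cos (k * f1 t) - P (s * h1 t)))).
    apply Rle_trans with (1 * (2 * C * H ^ 5 * s ^ 5)); [|lra]. apply Rmult_le_compat; auto. lra. }
  rewrite Eerr, Rabs_mult, (Rabs_pos_eq (s ^ j)) in Berr by (apply pow_le; lra).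
  assert (Hs3 : 0 < s ^ j) by (apply pow_lt; lra).
  apply (Rmult_le_reg_l (s ^ j)); auto. eapply Rle_trans; [exact Berr|]. unfold K.
  assert (Hp : s ^ 5 <= s ^ j * s ^ 3).
  { destruct j as [|[|[|j]]]; try lia; cbn; [|right; ring]. assert (0 < s) by lra. assert (0 <= s * (s * (s * s))) by (repeat apply Rmult_le_pos; lra).
    nra. }
  assert (0 <= 2 * PI * (2 * C * H ^ 5)) by exact HK. nra.
Qed.

(** * The shape of the support functions *)

Lemma wave_two_sided n c t f : wave n c (t + 1 * f) + wave n c (t + -1 * f) = 2 * (wave n c t * cos (INR n * f)).
Proof.
  unfold wave. replace (INR n * (t + 1 * f) - c) with (INR n * t - c + INR n * f) by ring.
  replace (INR n * (t + -1 * f) - c) with (INR n * t - c - INR n * f) by ring.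
  generalize (INR n * t - c). intros u. rewrite cos_plus, cos_minus. ring.
Qed.

Lemma wave_antipode n c x : wave n (c + INR n * PI) x = (-1) ^ n * wave n c x.
Proof.
  unfold wave. replace (INR n * x - (c + INR n * PI)) with (INR n * x - c - INR n * PI) by ring. generalize (INR n * x - c). intros u.
  induction n as [|n IH].
  - cbn. replace (u - 0 * PI) with u by ring. ring.
  - rewrite S_INR. replace (u - (INR n + 1) * PI) with (u - INR n * PI - PI) by ring.
    generalize dependent (u - INR n * PI). intros z IH. rewrite cos_minus, cos_PI, sin_PI, IH. cbn. ring.
Qed.

(** A half turn multiplies a wave of frequency [n] by [(-1) ^ n]; adding or subtracting the
    translate of a function thus isolates one parity of frequencies. *)
Lemma RInt_antipode k n c : cont k -> period k ->
  RInt (fun t => wave n c t * k (t + PI)) 0 (2 * PI) = (-1) ^ n * RInt (fun t => wave n c t * k t) 0 (2 * PI).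
Proof.
  intros Ck Pk. assert (Cw := wave_cont n c). assert (Cwk : cont (fun t => wave n c t * k t)) by now apply cont_mult.
  rewrite <- (RInt_scal_c ((-1) ^ n) _ _ _ Cwk).
  set (G := fun y => (-1) ^ n * (wave n c y * k y)).
  assert (CG : cont G) by (apply cont_mult; [apply cont_const | auto]).
  rewrite (RInt_ext_c _ (fun t => G (t + PI))).
  - rewrite RInt_shift by auto. rewrite Rplus_0_l, (Rplus_comm (2 * PI)). apply RInt_period; auto.
    intros y. unfold G. now rewrite wave_period, Pk.
  - intros t. unfold G. rewrite <- Rmult_assoc, <- wave_antipode. apply (f_equal2 Rmult); auto.
    unfold wave. apply (f_equal cos). ring.
Qed.

Lemma sign_even m : (-1) ^ (2 * m) = 1.
Proof. apply pow_1_even. Qed.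

Lemma sign_odd m : (-1) ^ (2 * m + 1) = -1.
Proof. rewrite pow_add, sign_even. ring. Qed.

Lemma parity n : exists m, n = (2 * m)%nat \/ n = (2 * m + 1)%nat.
Proof. destruct (Nat.Even_or_Odd n) as [[m E]|[m E]]; exists m; auto. Qed.

Lemma INR_even m : INR (2 * m) = 2 * INR m.
Proof. rewrite mult_INR. reflexivity. Qed.

Lemma INR_odd m : INR (2 * m + 1) = 2 * INR m + 1.
Proof. rewrite plus_INR, INR_even. reflexivity. Qed.

Section Structure.
Variables (h1 h2 : R -> R) (R0 : R).
Hypothesis C1 : cont h1.
Hypothesis C2 : cont h2.
Hypothesis P1 : period h1.
Hypothesis P2 : period h2.
Hypothesis Hpos : forall t, 0 < h1 t.
Hypothesis Hlt : forall t, h1 t < h2 t.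
Hypothesis HR0 : 0 < R0.
Hypothesis Hbd : forall t, h2 t <= R0.
Hypothesis Hrad : forall Rad, R0 < Rad -> exists f1 f2, cont f1 /\ cont f2 /\
  (forall t, Rad * cos (f1 t) = h1 t) /\ (forall t, Rad * cos (f2 t) = h2 t) /\
  forall n c, RInt (fun t => wave n c t * cos (INR n * f1 t)) 0 (2 * PI) = RInt (fun t => wave n c t * cos (INR n * f2 t)) 0 (2 * PI).

Definition moment_gap (j n : nat) (c : R) := RInt (fun t => wave n c t * (h1 t ^ j - h2 t ^ j)) 0 (2 * PI).

Lemma bounds1 t : 0 <= h1 t <= R0.
Proof. specialize (Hpos t). specialize (Hlt t). specialize (Hbd t). lra. Qed.
Lemma bounds2 t : 0 <= h2 t <= R0.
Proof. specialize (Hpos t). specialize (Hlt t). specialize (Hbd t). lra. Qed.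

(** The Chebyshev coefficients [2 * M ^ 2] and [2 / 3 * M ^ 2 * (M ^ 2 - 1)] vanish for [M = 0], the
    second also for [M = 1]; these are the frequencies left out. *)
Lemma even_gaps m c : ((1 <= m)%nat -> moment_gap 2 (2 * m) c = 0) /\ ((2 <= m)%nat -> moment_gap 4 (2 * m) c = 0).
Proof.
  destruct (chebyshev_expansion m) as (C & HC & Hch).
  set (M := INR m) in *. set (s := (-1) ^ m) in *.
  assert (Hs : s <> 0) by (apply pow_nonzero; lra).
  destruct (moment_match (wave (2 * m) c) h1 h2 (2 * M) s (- (s * (2 * M ^ 2))) (s * (2 / 3 * M ^ 2 * (M ^ 2 - 1))) C R0 R0 2) as [A B]; auto.
  - apply wave_cont.
  - apply wave_abs.
  - apply bounds1.
  - apply bounds2.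
  - intros t. destruct (Hch t) as [E _].
    replace (s + - (s * (2 * M ^ 2)) * cos t ^ 2 + s * (2 / 3 * M ^ 2 * (M ^ 2 - 1)) * cos t ^ (2 + 2))
      with (s * (1 - 2 * M ^ 2 * cos t ^ 2 + 2 / 3 * M ^ 2 * (M ^ 2 - 1) * cos t ^ 4)) by (change (2 + 2)%nat with 4%nat; ring). exact E.
  - intros Rad HRad. destruct (Hrad Rad HRad) as (f1 & f2 & F1 & F2 & E1 & E2 & E). exists f1, f2. repeat split; auto.
    specialize (E (2 * m)%nat c). rewrite INR_even in E. exact E.
  - change (2 + 2)%nat with 4%nat in B. fold (moment_gap 2 (2 * m) c) in A. fold (moment_gap 4 (2 * m) c) in B. split; intros Hm.
    + assert (HM : 1 <= M) by (unfold M; apply (le_INR 1); auto).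
      apply Rmult_integral in A. destruct A as [A|A]; auto. exfalso. assert (s * (2 * M ^ 2) <> 0) by (apply Rmult_integral_contrapositive_currified; [auto | assert (0 < M ^ 2) by (apply pow_lt; lra); lra]). lra.
    + assert (HM : 2 <= M) by (unfold M; apply (le_INR 2); auto).
      apply Rmult_integral in B. destruct B as [B|B]; auto. exfalso. revert B. apply Rmult_integral_contrapositive_currified; auto.
      assert (0 < M ^ 2) by (apply pow_lt; lra). assert (1 < M ^ 2) by nra. assert (0 < M ^ 2 * (M ^ 2 - 1)) by (apply Rmult_lt_0_compat; lra). lra.
Qed.

(** The linear Chebyshev coefficient never vanishes; the cubic one vanishes only at frequency
    one. *)
Lemma odd_gaps m c : moment_gap 1 (2 * m + 1) c = 0 /\ ((1 <= m)%nat -> moment_gap 3 (2 * m + 1) c = 0).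
Proof.
  destruct (chebyshev_expansion m) as (C & HC & Hch).
  set (M := INR m) in *. set (s := (-1) ^ m) in *.
  assert (Hs : s <> 0) by (apply pow_nonzero; lra). assert (HM0 : 0 <= M) by apply pos_INR.
  destruct (moment_match (wave (2 * m + 1) c) h1 h2 (2 * M + 1) 0 (s * (2 * M + 1)) (s * - ((2 * M + 1) * ((2 * M + 1) ^ 2 - 1) / 6)) C R0 R0 1) as [A B]; auto.
  - apply wave_cont.
  - apply wave_abs.
  - apply bounds1.
  - apply bounds2.
  - intros t. destruct (Hch t) as [_ E].
    replace (0 + s * (2 * M + 1) * cos t ^ 1 + s * - ((2 * M + 1) * ((2 * M + 1) ^ 2 - 1) / 6) * cos t ^ (1 + 2))
      with (s * ((2 * M + 1) * cos t - (2 * M + 1) * ((2 * M + 1) ^ 2 - 1) / 6 * cos t ^ 3)) by (change (1 + 2)%nat with 3%nat; field). exact E.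
  - intros Rad HRad. destruct (Hrad Rad HRad) as (f1 & f2 & F1 & F2 & E1 & E2 & E). exists f1, f2. repeat split; auto.
    specialize (E (2 * m + 1)%nat c). rewrite INR_odd in E. exact E.
  - change (1 + 2)%nat with 3%nat in B. fold (moment_gap 1 (2 * m + 1) c) in A. fold (moment_gap 3 (2 * m + 1) c) in B. split.
    + apply Rmult_integral in A. destruct A as [A|A]; auto. exfalso. revert A. apply Rmult_integral_contrapositive_currified; auto. lra.
    + intros Hm. assert (HM : 1 <= M) by (unfold M; apply (le_INR 1); auto).
      apply Rmult_integral in B. destruct B as [B|B]; auto. exfalso. revert B. apply Rmult_integral_contrapositive_currified; auto.
      assert (0 < (2 * M + 1) * ((2 * M + 1) ^ 2 - 1)) by (apply Rmult_lt_0_compat; nra). lra.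
Qed.

Definition gap (j : nat) (t : R) := h1 t ^ j - h2 t ^ j.

Lemma gap_cont j : cont (gap j).
Proof. unfold gap. ct. Qed.

Lemma gap_period j : period (gap j).
Proof. intros t. unfold gap. now rewrite P1, P2. Qed.

Lemma shifted_cont j : cont (fun t => gap j (t + PI)).
Proof. apply (cont_comp (fun t => t + PI) (gap j)); [ct | apply gap_cont]. Qed.

Lemma gap_sum_moment j sg n c : RInt (fun t => wave n c t * (gap j t + sg * gap j (t + PI))) 0 (2 * PI) = (1 + sg * (-1) ^ n) * moment_gap j n c.
Proof.
  assert (Cw := wave_cont n c). assert (Cg := gap_cont j). assert (Cs := shifted_cont j).
  assert (K1 : cont (fun t => wave n c t * gap j t)) by now apply cont_mult.
  assert (K2 : cont (fun t => wave n c t * gap j (t + PI))) by now apply (cont_mult (wave n c) (fun t => gap j (t + PI))).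
  rewrite (RInt_ext_c _ (fun t => wave n c t * gap j t + sg * (wave n c t * gap j (t + PI)))) by (intros; ring).
  rewrite (RInt_plus_c (fun t => wave n c t * gap j t) (fun t => sg * (wave n c t * gap j (t + PI)))); auto.
  - rewrite (RInt_scal_c sg _ _ _ K2), RInt_antipode by (auto; apply gap_period). change (RInt (fun t => wave n c t * gap j t) 0 (2 * PI)) with (moment_gap j n c). real_eq. ring.
  - apply cont_mult; [apply cont_const | auto].
Qed.

Lemma gap_sum_cont j sg : cont (fun t => gap j t + sg * gap j (t + PI)).
Proof. apply cont_plus; [apply gap_cont|]. apply cont_mult; [apply cont_const | apply shifted_cont]. Qed.

Lemma gap_sum_period j sg : period (fun t => gap j t + sg * gap j (t + PI)).
Proof. intros t. replace (t + 2 * PI + PI) with (t + PI + 2 * PI) by ring. now rewrite !gap_period. Qed.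

Lemma gap_back j t : gap j (t + PI + PI) = gap j t.
Proof. replace (t + PI + PI) with (t + 2 * PI) by ring. apply gap_period. Qed.

Lemma gap1 t : gap 1 t = gap 1 (t + PI).
Proof.
  assert (A := fourier_zero _ (gap_sum_cont 1 (-1)) (gap_sum_period 1 (-1))). cbn beta in A.
  enough (gap 1 t + -1 * gap 1 (t + PI) = 0) by lra. apply A. intros n c. rewrite gap_sum_moment.
  destruct (parity n) as (m & [->| ->]).
  - rewrite sign_even. real_eq. ring.
  - rewrite (proj1 (odd_gaps m c)). real_eq. ring.
Qed.

Lemma gap2 : exists e, forall t, gap 2 t + gap 2 (t + PI) = e.
Proof.
  (* [trig_form] asks for a nonzero [N]; frequency 1 is taken, and its terms disappear on comparing
     [t] with [t + PI]. *)
  destruct (trig_form _ 1 (gap_sum_cont 2 1) (gap_sum_period 2 1)) as (e & p & q & E); [lia| |].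
  - intros n c Hn0 Hn1. rewrite gap_sum_moment. destruct (parity n) as (m & [->| ->]).
    + rewrite (proj1 (even_gaps m c)) by lia. real_eq. ring.
    + rewrite sign_odd. real_eq. ring.
  - exists e. intros t. assert (A := E t). assert (B := E (t + PI)). rewrite gap_back in B. cbn [INR] in A, B.
    rewrite !Rmult_1_l in A, B. rewrite neg_cos, neg_sin in B. lra.
Qed.

Lemma gap3 : exists p q, forall t, gap 3 t - gap 3 (t + PI) = p * cos t + q * sin t.
Proof.
  destruct (trig_form _ 1 (gap_sum_cont 3 (-1)) (gap_sum_period 3 (-1))) as (e & p & q & E); [lia| |].
  - intros n c Hn0 Hn1. rewrite gap_sum_moment. destruct (parity n) as (m & [->| ->]).
    + rewrite sign_even. real_eq. ring.
    + rewrite (proj2 (odd_gaps m c)) by lia. real_eq. ring.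
  - exists p, q. intros t. assert (A := E t). assert (B := E (t + PI)). rewrite gap_back in B. cbn [INR] in A, B.
    rewrite !Rmult_1_l in A, B. rewrite neg_cos, neg_sin in B. lra.
Qed.

Lemma gap4 : exists e p q, forall t, gap 4 t + gap 4 (t + PI) = e + p * cos (2 * t) + q * sin (2 * t).
Proof.
  destruct (trig_form _ 2 (gap_sum_cont 4 1) (gap_sum_period 4 1)) as (e & p & q & E); [lia| |].
  - intros n c Hn0 Hn1. rewrite gap_sum_moment. destruct (parity n) as (m & [->| ->]).
    + rewrite (proj2 (even_gaps m c)) by lia. real_eq. ring.
    + rewrite sign_odd. real_eq. ring.
  - exists e, p, q. intros t. assert (A := E t). cbn [INR] in A. replace (1 + 1) with 2 in A by ring. lra.
Qed.

(** Write [h1 = o + ea] and [h2 = o + eb], with [o] odd and [ea], [eb] even under the half turn. The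
    combined gaps of orders two, three and four are [2 * (ea ^ 2 - eb ^ 2) = e2], then [3 * e2 * o],
    then [e2 * (ea ^ 2 + eb ^ 2) + 6 * e2 * o ^ 2]. As [h1 < h2], [e2] is negative and can be
    divided by. *)
Lemma support_structure : exists P Q K1 K2 k l, forall t,
  (0 < K1 + k * cos (2 * t) + l * sin (2 * t) /\ h1 t = P * cos t + Q * sin t + sqrt (K1 + k * cos (2 * t) + l * sin (2 * t))) /\
  (0 < K2 + k * cos (2 * t) + l * sin (2 * t) /\ h2 t = P * cos t + Q * sin t + sqrt (K2 + k * cos (2 * t) + l * sin (2 * t))).
Proof.
  destruct gap2 as (e2 & G2). destruct gap3 as (p & q & G3). destruct gap4 as (e4 & p4 & q4 & G4).
  assert (He : e2 < 0).
  { rewrite <- (G2 0). unfold gap. assert (A := Hlt 0). assert (B := Hlt (0 + PI)). assert (C := Hpos 0). assert (D := Hpos (0 + PI)). nra. }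
  set (P := p / (3 * e2)). set (Q := q / (3 * e2)).
  set (E := e4 / e2 - 3 * (P ^ 2 + Q ^ 2)). set (k := (p4 / e2 - 3 * (P ^ 2 - Q ^ 2)) / 2). set (l := (q4 / e2 - 6 * P * Q) / 2).
  exists P, Q, (E / 2 + e2 / 4), (E / 2 - e2 / 4), k, l. intros t.
  specialize (G2 t). specialize (G3 t). specialize (G4 t). assert (G1 := gap1 t). unfold gap in *.
  assert (A1 := Hpos t). assert (A2 := Hlt t). assert (A3 := Hpos (t + PI)).
  set (a := h1 t) in *. set (a' := h1 (t + PI)) in *. set (b := h2 t) in *. set (b' := h2 (t + PI)) in *.
  set (o := (a - a') / 2). set (ea := (a + a') / 2). set (eb := (b + b') / 2).
  assert (Ea : a = o + ea) by (unfold o, ea; field). assert (Ea' : a' = ea - o) by (unfold o, ea; field).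
  assert (Eb : b = o + eb) by (unfold o, eb; lra). assert (Eb' : b' = eb - o) by (unfold o, eb; lra).
  clearbody o ea eb. rewrite Ea, Ea', Eb, Eb' in G2, G3, G4.
  assert (D : ea ^ 2 - eb ^ 2 = e2 / 2) by lra.
  assert (O : 3 * e2 * o = p * cos t + q * sin t).
  { rewrite <- G3. replace e2 with (2 * (ea ^ 2 - eb ^ 2)) by lra. ring. }
  assert (O' : o = P * cos t + Q * sin t).
  { apply (Rmult_eq_reg_l (3 * e2)); [|lra]. rewrite O. unfold P, Q. field. lra. }
  assert (S4 : e2 * (ea ^ 2 + eb ^ 2) + 6 * e2 * o ^ 2 = e4 + p4 * cos (2 * t) + q4 * sin (2 * t)).
  { rewrite <- G4. replace e2 with (2 * (ea ^ 2 - eb ^ 2)) by lra. ring. }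
  assert (Osq : o ^ 2 = (P ^ 2 + Q ^ 2) / 2 + (P ^ 2 - Q ^ 2) / 2 * cos (2 * t) + P * Q * sin (2 * t)).
  { rewrite O', cos_2a, sin_2a. assert (T := sin2_cos2 t). unfold Rsqr in T.
    replace ((P ^ 2 + Q ^ 2) / 2) with ((P ^ 2 + Q ^ 2) / 2 * (sin t * sin t + cos t * cos t)) by (rewrite T; ring). field. }
  assert (Sum : ea ^ 2 + eb ^ 2 = E + 2 * k * cos (2 * t) + 2 * l * sin (2 * t)).
  { apply (Rmult_eq_reg_l e2); [|lra]. unfold E, k, l.
    transitivity (e4 + p4 * cos (2 * t) + q4 * sin (2 * t) - 6 * e2 * o ^ 2); [lra|]. rewrite Osq. field. lra. }
  assert (Pa : 0 < ea) by lra. assert (Pb : 0 < eb) by lra.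
  assert (Sa : E / 2 + e2 / 4 + k * cos (2 * t) + l * sin (2 * t) = ea ^ 2) by lra.
  assert (Sb : E / 2 - e2 / 4 + k * cos (2 * t) + l * sin (2 * t) = eb ^ 2) by lra.
  rewrite Sa, Sb, <- O', !sqrt_pow2 by lra. repeat split; auto; apply pow_lt; auto.
Qed.

End Structure.

(** * Fourier moments of the tangent angles *)

Section Averages.
Variables O1 O2 : pt -> Prop.
Hypothesis HS : commuting_pair O1 O2.
Variables (p0 : pt) (h1 h2 : R -> R) (Rad : R).
Hypothesis Hp0 : interior O1 p0.
Hypothesis Hh1 : support_fun O1 p0 h1.
Hypothesis Hh2 : support_fun O2 p0 h2.
Hypothesis HR : forall t, h2 t < Rad.

Lemma foot_inverse O h sg : convex_compact_domain O -> interior O p0 -> support_fun O p0 h -> (forall t, h t < Rad) -> sg * sg = 1 ->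
  exists g, (forall w, foot h Rad sg (g w) = w) /\ forall n c,
    RInt (fun t => wave n c (foot h Rad sg t)) 0 (2 * PI) =
    RInt (wave n c) 0 (2 * PI) - RInt (fun w => - INR n * sin (INR n * w - c) * (g w - w)) 0 (2 * PI) /\ cont g.
Proof.
  intros HO Hp Hh HRad Hsg.
  destruct (choice_fun (fun w t => foot h Rad sg t = w)) as [g Hg].
  { intros w. now apply (foot_surj O p0 h Rad HO Hp Hh HRad). }
  assert (Inc : forall x y, x < y -> foot h Rad sg x < foot h Rad sg y) by (intros x y; now apply (foot_incr O p0 h Rad Hp Hh HRad)).
  assert (Cg : cont g) by now apply (inverse_cont (foot h Rad sg)).
  exists g. split; auto. intros n c. split; auto. apply two_angle_identity; auto.
  - intros t. now apply (foot_cont O p0 h Rad HO Hp Hh HRad).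
  - intros x. apply (foot_inj O p0 h Rad Hp Hh HRad sg); auto.
  - intros x. now apply (foot_period O p0 h Rad Hh).
Qed.

(** The waves at the two feet add up to [2 * (wave n c t * cos (INR n * phi h Rad t))].
    [foot_inverse] expresses each integral through the inverse of a foot map, and by
    [concentric_tangents] the two inverses have the same sum for both domains. *)
Lemma chord_moments n c : RInt (fun t => wave n c t * cos (INR n * phi h1 Rad t)) 0 (2 * PI) = RInt (fun t => wave n c t * cos (INR n * phi h2 Rad t)) 0 (2 * PI).
Proof.
  assert (HR1 : forall t, h1 t < Rad) by (intros t; assert (A := support_lt O1 O2 HS p0 h1 h2 Hh1 Hh2 t); specialize (HR t); lra).
  assert (Hp2 : interior O2 p0) by (apply (inner_interior O1 O2 HS); now apply interior_in).
  assert (cv1' := cv1 O1 O2 HS). assert (cv2' := cv2 O1 O2 HS).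
  destruct (foot_inverse O1 h1 1 cv1' Hp0 Hh1 HR1 ltac:(lra)) as (al & Hal & Ial). destruct (foot_inverse O1 h1 (-1) cv1' Hp0 Hh1 HR1 ltac:(lra)) as (de & Hde & Ide).
  destruct (foot_inverse O2 h2 1 cv2' Hp2 Hh2 HR ltac:(lra)) as (be & Hbe & Ibe). destruct (foot_inverse O2 h2 (-1) cv2' Hp2 Hh2 HR ltac:(lra)) as (ga & Hga & Iga).
  destruct (Ial n c) as [Jal Cal]. destruct (Ide n c) as [Jde Cde]. destruct (Ibe n c) as [Jbe Cbe]. destruct (Iga n c) as [Jga Cga].
  assert (Half : forall O h, convex_compact_domain O -> interior O p0 -> support_fun O p0 h -> (forall t, h t < Rad) ->
    2 * RInt (fun t => wave n c t * cos (INR n * phi h Rad t)) 0 (2 * PI) =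
    RInt (fun t => wave n c (foot h Rad 1 t)) 0 (2 * PI) + RInt (fun t => wave n c (foot h Rad (-1) t)) 0 (2 * PI)).
  { intros O h HO Hp Hh HRad.
    assert (Cphi : cont (phi h Rad)) by (intros t; now apply (phi_cont O p0 h Rad HO Hp Hh HRad)).
    assert (Cw := wave_cont n c).
    assert (Cf : forall sg, cont (fun t => wave n c (foot h Rad sg t))).
    { intros sg. apply (cont_comp (foot h Rad sg) (wave n c)); auto. intros t. now apply (foot_cont O p0 h Rad HO Hp Hh HRad). }
    rewrite <- (RInt_plus_c _ _ _ _ (Cf 1) (Cf (-1))), <- RInt_scal_c.
    - apply RInt_ext_c. intros t. unfold foot. symmetry. apply wave_two_sided.
    - apply (cont_mult (wave n c)); auto. ct. }
  assert (A := Half O1 h1 cv1' Hp0 Hh1 HR1). assert (B := Half O2 h2 cv2' Hp2 Hh2 HR).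
  set (d := fun w => - INR n * sin (INR n * w - c)) in *.
  assert (Cd : cont d) by (unfold d; ct).
  assert (Sum : RInt (fun w => d w * (al w - w)) 0 (2 * PI) + RInt (fun w => d w * (de w - w)) 0 (2 * PI)
     = RInt (fun w => d w * (be w - w)) 0 (2 * PI) + RInt (fun w => d w * (ga w - w)) 0 (2 * PI)).
  { rewrite <- !RInt_plus_c by ct. apply RInt_ext_c. intros w.
    assert (E := concentric_tangents O1 O2 HS p0 h1 h2 Rad Hp0 Hh1 Hh2 HR w (al w) (be w) (ga w) (de w) (Hal w) (Hbe w) (Hga w) (Hde w)).
    transitivity (d w * (al w + de w - 2 * w)); [ring|]. rewrite E. ring. }
  unfold d in Sum. lra.
Qed.

End Averages.

(** * Ellipses *)

Lemma polar a b : exists r u, 0 <= r /\ a = r * cos u /\ b = r * sin u.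
Proof.
  destruct (classic ((a, b) = (0, 0))) as [E|E].
  - injection E as -> ->. exists 0, 0. repeat split; lra.
  - destruct (normalize _ E) as (m & Hm & Em). destruct (unit_angle 0 m Hm) as (u & _ & ->).
    exists (norm2 (a, b)), (0 + u). split; [apply norm2_ge0|].
    assert (F := f_equal fst Em). assert (G := f_equal snd Em). now cbn in F, G.
Qed.

(** A point satisfying all support bounds cannot be strictly separated from [O], hence belongs to
    it; a bound that is attained provides a normal there. *)
Lemma boundary_support O p0 h X : convex_compact_domain O -> support_fun O p0 h ->
  (boundary O X <-> (forall t, dot (nv t) (psub X p0) <= h t) /\ exists t, dot (nv t) (psub X p0) = h t).
Proof.
  intros HO Hh.
  assert (Split : forall t Y, dot (nv t) (psub Y X) = dot (nv t) (psub Y p0) - dot (nv t) (psub X p0)).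
  { intros t Y. pt_eq. }
  split.
  - intros HX. destruct (boundary_nrm O HO X HX) as (n & HOX & Hn & Hs).
    destruct (unit_angle 0 n Hn) as (t & _ & ->). split; [intros s; now apply (Hh s)|]. exists (0 + t).
    destruct (Hh (0 + t)) as [(Y & HY & EY) Hle]. apply Rle_antisym; [now apply Hle|].
    specialize (Hs Y HY). rewrite Split in Hs. lra.
  - intros [Hle (t & Et)]. assert (HOX : O X).
    { apply NNPP. intros HX. destruct (sep_strict O HO X HX) as (m & Hm & Hs).
      destruct (unit_angle 0 m Hm) as (s & _ & ->). destruct (Hh (0 + s)) as [(Y & HY & EY) _].
      specialize (Hs Y HY). specialize (Hle (0 + s)). rewrite Split in Hs. lra. }
    apply (nrm_boundary O X (nv t)). split; auto. split; [apply nv_unit|].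
    intros Y HY. rewrite Split, Et. apply Rle_minus. now apply (Hh t).
Qed.

(** Cauchy-Schwarz with the remainder [(x * B * sin u - y * A * cos u) ^ 2 / (A * B)], which
    vanishes when [u] is the direction of [(x / A, y / B)], the normal of the ellipse; hence the
    polar form of that vector. *)
Lemma ellipse_support A B x y : 0 < A -> 0 < B ->
  let S u := A * cos u ^ 2 + B * sin u ^ 2 in
  ((forall u, x * cos u + y * sin u <= sqrt (S u)) /\ (exists u, x * cos u + y * sin u = sqrt (S u)) <-> x ^ 2 / A + y ^ 2 / B = 1).
Proof.
  intros HA HB S.
  assert (PS : forall u, 0 < S u).
  { intros u. unfold S. assert (T := sin2_cos2 u). unfold Rsqr in T. destruct (Rlt_le_dec A B); nra. }
  assert (CS : forall u, (x * cos u + y * sin u) ^ 2 <= (x ^ 2 / A + y ^ 2 / B) * S u).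
  { intros u. enough (0 <= (x * B * sin u - y * A * cos u) ^ 2 / (A * B)).
    - unfold S. replace ((x ^ 2 / A + y ^ 2 / B) * (A * cos u ^ 2 + B * sin u ^ 2))
        with ((x * cos u + y * sin u) ^ 2 + (x * B * sin u - y * A * cos u) ^ 2 / (A * B)) by (field; lra). lra.
    - apply Rmult_le_pos; [apply pow2_ge_0 | apply Rlt_le, Rinv_0_lt_compat; nra]. }
  destruct (polar (x / A) (y / B)) as (r & u & Hr & Ex & Ey).
  assert (Ex' : x = r * cos u * A) by (rewrite <- Ex; field; lra).
  assert (Ey' : y = r * sin u * B) by (rewrite <- Ey; field; lra).
  assert (Eu : x * cos u + y * sin u = r * S u) by (rewrite Ex', Ey'; unfold S; ring).
  assert (Eq : x ^ 2 / A + y ^ 2 / B = r ^ 2 * S u) by (rewrite Ex', Ey'; unfold S; field; lra).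
  assert (Sq : forall v, sqrt (S v) ^ 2 = S v) by (intros v; apply pow2_sqrt; specialize (PS v); lra).
  split.
  - intros [Hle (v & Ev)]. apply Rle_antisym.
    + specialize (Hle u). rewrite Eu in Hle. specialize (PS u).
      assert (0 <= r * S u) by (apply Rmult_le_pos; lra).
      assert (K := pow_incr _ _ 2 (conj H Hle)). rewrite Sq in K. rewrite Eq.
      apply (Rmult_le_reg_r (S u)); auto. lra.
    + specialize (CS v). rewrite Ev, Sq in CS. apply (Rmult_le_reg_r (S v)); auto. lra.
  - intros E. split.
    + intros v. specialize (CS v). rewrite E, Rmult_1_l in CS. apply Rsqr_incr_0_var; [|apply sqrt_pos].
      rewrite Rsqr_sqrt by (specialize (PS v); lra). unfold Rsqr. lra.
    + exists u. symmetry. rewrite Eu. apply sqrt_lem_1.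
      * specialize (PS u). lra.
      * specialize (PS u). apply Rmult_le_pos; lra.
      * rewrite Eq in E. transitivity (r ^ 2 * S u * S u); [ring | rewrite E; ring].
Qed.

(** On the ellipse the focal radii are affine in [x], namely [a - f * x / a] and [a + f * x / a];
    [Key] and [Key'] measure how far their squares are from the true ones. *)
Lemma focal_sum a B f x y : 0 < a -> 0 < B -> 0 <= f -> a ^ 2 = B + f ^ 2 ->
  (sqrt ((x - f) ^ 2 + y ^ 2) + sqrt ((x + f) ^ 2 + y ^ 2) = 2 * a <-> x ^ 2 / a ^ 2 + y ^ 2 / B = 1).
Proof.
  intros Ha HB Hf E.
  assert (N : forall z, 0 <= z ^ 2 + y ^ 2) by (intros z; assert (A := pow2_ge_0 z); assert (C := pow2_ge_0 y); lra).
  assert (Key : (x - f) ^ 2 + y ^ 2 - (a - f * x / a) ^ 2 = B * (x ^ 2 / a ^ 2 + y ^ 2 / B - 1)).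
  { replace (B * (x ^ 2 / a ^ 2 + y ^ 2 / B - 1)) with (B / a ^ 2 * x ^ 2 + y ^ 2 - B) by (field; lra).
    replace B with (a ^ 2 - f ^ 2) by lra. field; lra. }
  assert (Key' : (x + f) ^ 2 + y ^ 2 - (a + f * x / a) ^ 2 = B * (x ^ 2 / a ^ 2 + y ^ 2 / B - 1)).
  { rewrite <- Key. field. lra. }
  split; intros H.
  - set (d1 := sqrt ((x - f) ^ 2 + y ^ 2)) in *. set (d2 := sqrt ((x + f) ^ 2 + y ^ 2)) in *.
    assert (S1 : d1 ^ 2 = (x - f) ^ 2 + y ^ 2) by (apply pow2_sqrt, N).
    assert (S2 : d2 ^ 2 = (x + f) ^ 2 + y ^ 2) by (apply pow2_sqrt, N).
    assert (D : d1 = a - f * x / a).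
    { apply (Rmult_eq_reg_l (4 * a)); [|lra]. replace (4 * a * (a - f * x / a)) with (4 * a ^ 2 - 4 * f * x) by (field; lra).
      replace d2 with (2 * a - d1) in S2 by lra. lra. }
    rewrite <- S1, D, Rminus_diag in Key. symmetry in Key. apply Rmult_integral in Key. destruct Key; lra.
  - assert (Hx : (f * x / a) ^ 2 <= a ^ 2).
    { assert (0 <= y ^ 2 / B) by (apply Rmult_le_pos; [apply pow2_ge_0 | apply Rlt_le, Rinv_0_lt_compat; lra]).
      replace ((f * x / a) ^ 2) with (f ^ 2 * (x ^ 2 / a ^ 2)) by (field; lra).
      assert (0 <= f ^ 2) by apply pow2_ge_0. nra. }
    assert (-a <= f * x / a <= a) by (split; nra).
    rewrite H in Key, Key'.
    replace ((x - f) ^ 2 + y ^ 2) with ((a - f * x / a) ^ 2) by lra.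
    replace ((x + f) ^ 2 + y ^ 2) with ((a + f * x / a) ^ 2) by lra.
    rewrite !sqrt_pow2 by lra. ring.
Qed.

(** [K + rho * cos (2 * u)] equals [(K + rho) * cos u ^ 2 + (K - rho) * sin u ^ 2], so the squared
    semi-axes are [K + rho] and [K - rho]. The squared distance from centre to focus is [2 * rho],
    independent of [K], which is the source of confocality. *)
Lemma ellipse_of_support O p0 h P Q K rho ph : convex_compact_domain O -> support_fun O p0 h -> 0 <= rho ->
  (forall t, 0 < K + rho * cos (2 * (t - ph)) /\ h t = P * cos t + Q * sin t + sqrt (K + rho * cos (2 * (t - ph)))) ->
  let c := padd p0 (P, Q) in let f := sqrt (2 * rho) in
  let f1 := padd c (pscale f (nv ph)) in let f2 := padd c (pscale (- f) (nv ph)) in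
  dist2 f1 f2 < 2 * sqrt (K + rho) /\ forall X, boundary O X <-> ellipse f1 f2 (sqrt (K + rho)) X.
Proof.
  intros HO Hh Hrho H c f f1 f2.
  assert (Hf : 0 <= f) by apply sqrt_pos. assert (Ef : f ^ 2 = 2 * rho) by (apply pow2_sqrt; lra).
  (* The hypothesis is read in the direction orthogonal to the focal axis. *)
  assert (HB : 0 < K - rho).
  { destruct (H (ph + PI / 2)) as [A _]. replace (2 * (ph + PI / 2 - ph)) with PI in A by field. rewrite cos_PI in A. lra. }
  set (a := sqrt (K + rho)).
  assert (Ha : 0 < a) by (apply sqrt_lt_R0; lra). assert (Ea : a ^ 2 = K + rho) by (apply pow2_sqrt; lra).
  assert (Un := nv_unit ph).
  split.
  - unfold dist2. replace (psub f1 f2) with (pscale (2 * f) (nv ph)) by (unfold f1, f2; pt_eq).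
    rewrite norm2_scale, (norm2_unit _ Un), Rabs_pos_eq by lra. nra.
  - intros X. rewrite (boundary_support O p0 h X HO Hh).
    set (x := dot (nv ph) (psub X c)). set (y := cross (nv ph) (psub X c)).
    assert (D : psub X c = padd (pscale x (nv ph)) (pscale y (perp (nv ph)))) by now apply decomp.
    assert (Dist : forall g, dist2 X (padd c (pscale g (nv ph))) = sqrt ((x - g) ^ 2 + y ^ 2)).
    { intros g. unfold dist2, norm2. apply f_equal.
      replace (psub X (padd c (pscale g (nv ph)))) with (padd (psub X c) (pscale (- g) (nv ph))) by pt_eq.
      rewrite D. transitivity (((x - g) ^ 2 + y ^ 2) * dot (nv ph) (nv ph)); [pt_eq | rewrite Un; ring]. }
    unfold ellipse, f1, f2. rewrite !Dist. replace (x - - f) with (x + f) by ring.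
    rewrite (focal_sum a (K - rho)) by lra. rewrite <- (ellipse_support (a ^ 2) (K - rho)) by nra.
    assert (L : forall t, dot (nv t) (psub X p0) = P * cos t + Q * sin t + (x * cos (t - ph) + y * sin (t - ph))).
    { intros t. replace (psub X p0) with (padd (P, Q) (psub X c)) by (unfold c; pt_eq).
      rewrite D. unfold nv. rewrite cos_minus, sin_minus. pt_eq. }
    assert (S : forall u, a ^ 2 * cos u ^ 2 + (K - rho) * sin u ^ 2 = K + rho * cos (2 * u)).
    { intros u. rewrite Ea, cos_2a. assert (T := sin2_cos2 u). unfold Rsqr in T. replace K with (K * (sin u * sin u + cos u * cos u)) at 3 by (rewrite T; ring). ring. }
    split; intros [Hle (t & Et)]; split.
    + intros u. rewrite S. specialize (Hle (u + ph)). rewrite L, (proj2 (H (u + ph))) in Hle. replace (u + ph - ph) with u in Hle by ring. lra.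
    + exists (t - ph). rewrite S. rewrite L, (proj2 (H t)) in Et. lra.
    + intros u. rewrite L, (proj2 (H u)). specialize (Hle (u - ph)). rewrite S in Hle. lra.
    + exists (t + ph). rewrite L, (proj2 (H (t + ph))). replace (t + ph - ph) with t by ring. rewrite S in Et. lra.
Qed.

Theorem theorem5p21 (O1 O2 : pt -> Prop) :
  convex_compact_domain O1 ->
  convex_compact_domain O2 ->
  compactly_contained O1 O2 ->
  pw_C4_jordan_curve (boundary O1) ->
  pw_C4_jordan_curve (boundary O2) ->
  billiards_commute O1 O2 ->
  confocal_ellipses (boundary O1) (boundary O2).
Proof.
  intros HO1 HO2 Hin J1 J2 Hcom.
  assert (HS : commuting_pair O1 O2) by (split; [|split; [|split; [|split; [|split]]]]; auto; now apply nonsmooth_finite).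
  destruct (dom_int O1 HO1) as [p0 Hp1].
  assert (Hp2 : interior O2 p0) by (apply (inner_interior O1 O2 HS); now apply interior_in).
  destruct (support_fun_exists O1 p0 HO1) as [h1 Hh1]. destruct (support_fun_exists O2 p0 HO2) as [h2 Hh2].
  assert (Hlt := support_lt O1 O2 HS p0 h1 h2 Hh1 Hh2).
  destruct (dom_bound O2 HO2) as (M & HM & HMb).
  assert (Hbd : forall t, h2 t <= M + norm2 p0).
  { intros t. destruct (Hh2 t) as [(X & HX & EX) _]. rewrite <- EX. eapply Rle_trans; [apply dot_le|].
    rewrite (norm2_unit _ (nv_unit t)), Rmult_1_l. eapply Rle_trans; [apply norm2_sub|]. specialize (HMb X HX). lra. }
  assert (Np := norm2_ge0 p0).
  destruct (support_structure h1 h2 (M + norm2 p0)) as (P & Q & K1 & K2 & k & l & H); auto.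
  - intros t. now apply (support_cont O1 p0).
  - intros t. now apply (support_cont O2 p0).
  - intros t. now apply (support_period O1 p0).
  - intros t. now apply (support_period O2 p0).
  - intros t. now apply (support_pos O1 p0).
  - lra.
  - intros Rad HRad. assert (HR2 : forall t, h2 t < Rad) by (intros t; specialize (Hbd t); lra).
    assert (HR1 : forall t, h1 t < Rad) by (intros t; specialize (Hlt t); specialize (HR2 t); lra).
    exists (phi h1 Rad), (phi h2 Rad). split; [|split; [|split; [|split]]].
    + intros t. now apply (phi_cont O1 p0).
    + intros t. now apply (phi_cont O2 p0).
    + intros t. now apply (phi_cos O1 p0).
    + intros t. now apply (phi_cos O2 p0).
    + intros n c. now apply (chord_moments O1 O2 HS p0).
  (* The pair [(k, l)] common to both support functions becomes one amplitude [rho] and one axis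
     direction [psi / 2]; the foci depend only on these and on [p0], [P], [Q], so the same ones
     serve both boundaries. *)
  - destruct (polar k l) as (rho & psi & Hrho & -> & ->).
    assert (E : forall t, rho * cos (2 * (t - psi / 2)) = rho * cos psi * cos (2 * t) + rho * sin psi * sin (2 * t)).
    { intros t. replace (2 * (t - psi / 2)) with (2 * t - psi) by field. rewrite cos_minus. ring. }
    destruct (ellipse_of_support O1 p0 h1 P Q K1 rho (psi / 2)) as [D1 B1]; auto.
    { intros t. rewrite E, <- Rplus_assoc. apply H. }
    destruct (ellipse_of_support O2 p0 h2 P Q K2 rho (psi / 2)) as [D2 B2]; auto.
    { intros t. rewrite E, <- Rplus_assoc. apply H. }
    do 4 eexists. split; [exact D1 | split; [exact D2 | split; [exact B1 | exact B2]]].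
Qed.
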